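(* Let $Q>0$, let $(Z,d,\mu)$ be a $Q$-Ahlfors regular metric measure space, let $\lambda\in(0,Q]$, and let $F\subset Z$ be a closed $\lambda$-Ahlfors regular subset, equipped with the metric $d_{|F}$ and the Hausdorff $\lambda$-measure $\nu$. (A) Suppose that $0<s<1$, $\max\big(Q/(\lambda+s),(Q-\lambda)/s\big)<p<\infty$ and $0<q\le\infty$. Then there exist bounded linear operators $\mathcal R\colon \mathcal B^{s}_{p,q}(Z)\to \mathcal B^{s-\frac{Q-\lambda}{p}}_{p,q}(F)$ and $\mathcal E\colon \mathcal B^{s-\frac{Q-\lambda}{p}}_{p,q}(F)\to\mathcal B^{s}_{p,q}(Z)$ such that $\mathcal R f=f_{|F}$ for all continuous $f\in\mathcal B^{s}_{p,q}(Z)$ and $\mathcal R(\mathcal E f)=f$ for all $f\in\mathcal B^{s-\frac{Q-\lambda}{p}}_{p,q}(F)$. (B) Suppose that $F$ is in addition porous, $0<s<1$, $\max\big(Q/(\lambda+s),(Q-\lambda)/s\big)<p<\infty$ and $Q/(Q+s)<q\le\infty$. Then there exist bounded linear operators $\mathcal R\colon \mathcal F^{s}_{p,q}(Z)\to \mathcal B^{s-\frac{Q-\lambda}{p}}_{p,p}(F)$ and $\mathcal E\colon \mathcal B^{s-\frac{Q-\lambda}{p}}_{p,p}(F)\to\mathcal F^{s}_{p,q}(Z)$ such that $\mathcal R f=f_{|F}$ for all continuous $f\in\mathcal F^{s}_{p,q}(Z)$ and $\mathcal R(\mathcal E f)=f$ for all $f\in\mathcal B^{s-\frac{Q-\lambda}{p}}_{p,p}(F)$.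 (C) Suppose that $F$ is in addition porous and $\max\big(Q/(\lambda+1),Q-\lambda\big)<p<\infty$. Then there exist bounded linear operators $\mathcal R\colon M^{1,p}(Z)\to \mathcal B^{1-\frac{Q-\lambda}{p}}_{p,p}(F)$ and $\mathcal E\colon \mathcal B^{1-\frac{Q-\lambda}{p}}_{p,p}(F)\to M^{1,p}(Z)$ such that $\mathcal R f=f_{|F}$ for all continuous $f\in M^{1,p}(Z)$ and $\mathcal R(\mathcal E f)=f$ for all $f\in\mathcal B^{1-\frac{Q-\lambda}{p}}_{p,p}(F)$. (All identities on $F$ are understood $\nu$-almost everywhere.)
   Context: **Metric measure spaces.** All metric measure spaces $(Z,d,\mu)$ are such that $\mu$ is Borel regular and every ball $B(\xi,r)=\{\eta: d(\eta,\xi)<r\}$ has positive and finite measure. $(Z,d,\mu)$ is $Q$-Ahlfors regular if $\mu(B(\xi,r))\approx r^Q$ uniformly in $\xi\in Z$ and $0<r<\operatorname{diam}Z$. A closed subset $F\subset Z$ (of Hausdorff dimension $\lambda$) is $\lambda$-Ahlfors regular if the metric measure space $(F,d_{|F},\nu)$, with $\nu$ the Hausdorff $\lambda$-measure on $F$, is $\lambda$-Ahlfors regular. A closed set $F\subset Z$ is porous if there exists $c\in(0,1)$ such that for all balls $B\subset Z$ with radius $r<\operatorname{diam}Z$ and $B\cap F\ne\emptyset$ there exists $\xi\in Z$ with $B(\xi,cr)\subset B\setminus F$. $L^1_{\rm loc}(Z)$ denotes the complex-valued $\mu$-measurable functions on $Z$ that are integrable on every ball. **Hyperbolic filling.** For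 each $n\in\mathbb Z$ let $(\xi_x)_{x\in X_n}$ be a maximal set of points of $Z$ with $d(\xi_x,\xi_{x'})\ge 2^{-n-1}$ for distinct $x,x'\in X_n$ ($X_n$ an index set). Put $B(x):=B(\xi_x,2^{-n})$ and $|x|:=n$ for $x\in X_n$, and $X:=\bigsqcup_{n\in\mathbb Z}X_n$. The graph $(X,E)$ has an edge joining $x$ and $x'$ (written $x\sim x'$) iff $x\ne x'$, $||x|-|x'||\le1$ and $B(x)\cap B(x')\neq\emptyset$. Each edge is given one orientation, with starting point $e_-$ and endpoint $e_+$, such that $e_+$ is the vertex of higher level when the levels differ. Put $|e|:=\min(|e_-|,|e_+|)$ and $B(e):=B(e_-)\cup B(e_+)$. For $u\colon X\to\mathbb C$ let $du(e):=u(e_+)-u(e_-)$, $e\in E$. For $f\in L^1_{\rm loc}(Z)$ let $Pf(x):=\frac1{\mu(B(x))}\int_{B(x)}f\,d\mu$, $x\in X$. Fix Lipschitz functions $\psi_x\colon Z\to[0,1]$, $x\in X$, such that $\psi_x$ is supported on $B(x)$, $\operatorname{Lip}\psi_x\lesssim2^{|x|}$, and $(\psi_x)_{x\in X_n}$ is a partition of unity of $Z$ for every $n$; put $T_0^Z u:=\sum_{x\in X_0}u(x)\psi_x$ for $u\colon X\to\mathbb C$. **Non-homogeneous spaces.** Let $Z$ be $Q$-Ahlfors regular. For $0<s\le1$, $Q/(Q+s)<p\le\infty$ and $0<q\le\infty$, $\mathcal B^s_{p,q}(Z)$ is the space of $f\in L^1_{\rm loc}(Z)$ with $$\|f\|_{\mathcal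 B^s_{p,q}(Z)}:=\|T^Z_0(Pf)\|_{L^p(Z)}+\Big(\sum_{k\ge0}2^{ksq}\Big\|\sum_{|e|=k}|d(Pf)(e)|\chi_{B(e)}\Big\|_{L^p(Z)}^q\Big)^{1/q}<\infty.$$ For $0<s\le1$, $Q/(Q+s)<p<\infty$ and $Q/(Q+s)<q\le\infty$, $\mathcal F^s_{p,q}(Z)$ is the space of $f\in L^1_{\rm loc}(Z)$ with $$\|f\|_{\mathcal F^s_{p,q}(Z)}:=\|T^Z_0(Pf)\|_{L^p(Z)}+\Big(\int_Z\Big(\sum_{|e|\ge0}\big[2^{|e|s}|d(Pf)(e)|\big]^q\chi_{B(e)}(\xi)\Big)^{p/q}d\mu(\xi)\Big)^{1/p}<\infty$$ (with suprema in place of $\ell^q$ sums if $q=\infty$). Functions are identified when equal $\mu$-almost everywhere. Different choices of the filling give equivalent quasi-norms. The spaces on $F$ are defined in the same way with $(F,d_{|F},\nu)$ and $\lambda$ in place of $(Z,d,\mu)$ and $Q$. $M^{1,p}(Z)$ is the space of $f\in L^p(Z)$ for which there exists $g\colon Z\to[0,\infty]$ in $L^p(Z)$ with $|f(\xi)-f(\eta)|\le d(\xi,\eta)(g(\xi)+g(\eta))$ for all $\xi,\eta\in Z$, with quasi-norm $\|f\|_{L^p(Z)}+\inf_g\|g\|_{L^p(Z)}$, the infimum being over all such $g$. *)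

(* Defs.v *)
From HB Require Import structures.
From mathcomp Require Import all_boot all_order all_algebra.
From mathcomp Require Import all_classical all_reals all_analysis.
From mathcomp Require Import measurable_realfun complex.

Set Implicit Arguments.
Unset Strict Implicit.
Unset Printing Implicit Defensive.
Import Order.TTheory GRing.Theory Num.Theory.
Import numFieldNormedType.Exports.

Local Open Scope classical_set_scope.
Local Open Scope ring_scope.
Local Open Scope complex_scope.

(* Library measurable types are pointed, hence the point: metric spaces here
   are nonempty. *)
#[short(type="pmetricType")]
HB.structure Definition PointedMetric (R : numDomainType) :=
  {M of Metric R M & isPointed M}.

Definition subsp {R : realType} {Z : pmetricType R} (F : set Z)
  (F0 : F !=set0) : Type := set_type F.

Section subspace.
Context {R : realType} {Z : pmetricType R} (F : set Z) (F0 : F !=set0).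

HB.instance Definition _ := PseudoMetric.copy (subsp F0) (set_type F).

Definition subsp_val (x : subsp F0) : Z := set_val x.

Let sdist (x y : subsp F0) : R := mdist (subsp_val x) (subsp_val y).

Let sdist_ge0 x y : 0 <= sdist x y.
Proof. exact: mdist_ge0. Qed.

Let sdist_pos x y : sdist x y = 0 -> x = y.
Proof. by move=> /mdist_positivity xy; apply: val_inj. Qed.

Let sdist_ball x d : ball x d = [set y | sdist x y < d].
Proof.
rewrite -(initial_ballE (f := @set_val Z F)).
by rewrite ballEmdist.
Qed.

HB.instance Definition _ :=
  @PseudoMetric_isMetric.Build R (subsp F0) sdist sdist_ge0 sdist_pos sdist_ball.

Let subsp_point : subsp F0 :=
  exist _ (projT1 (cid F0)) (mem_set (projT2 (cid F0))).

HB.instance Definition _ := isPointed.Build (subsp F0) subsp_point.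

End subspace.

Section metric_measure.
Context {R : realType} {T : pmetricType R}.
Implicit Types (mu : {outer_measure set T -> \bar R}) (A : set T).

Definition borel : set (set T) := <<s [set U | open U] >>.

(* As usual in metric measure theory a measure is an outer measure defined on
   all subsets; the measurable sets are the Caratheodory measurable ones. *)
Definition borel_regular mu : Prop :=
  (forall U : set T, open U -> mu.-caratheodory U) /\
  (forall A, exists B, [/\ borel B, A `<=` B & mu B = mu A]).

Definition metric_measure_space mu : Prop :=
  borel_regular mu /\
  (forall (x : T) (r : R), 0 < r -> (0 < mu (ball x r) < +oo)%E).

Definition diam A : \bar R :=
  ereal_sup [set (mdist xy.1 xy.2)%:E | xy in A `*` A].

Definition ahlfors_regular (Q : R) mu : Prop :=
  exists C : R, 0 < C /\ forall (x : T) (r : R),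
    0 < r -> (r%:E < diam [set: T])%E ->
    ((C^-1 * r `^ Q)%:E <= mu (ball x r) <= (C * r `^ Q)%:E)%E.

Definition porous A : Prop :=
  exists c : R, 0 < c < 1 /\ forall (x : T) (r : R),
    0 < r -> (r%:E < diam [set: T])%E -> ball x r `&` A !=set0 ->
    exists y : T, ball y (c * r) `<=` ball x r `\` A.

Definition cmeasure mu : {measure set (caratheodory_type mu) -> \bar R} :=
  (mu : set (caratheodory_type mu) -> \bar R).

End metric_measure.

Section hausdorff.
Context {R : realType} {T : pmetricType R}.
Implicit Types (A : set T).
Local Open Scope ereal_scope.

(* The case distinction makes the 0-dimensional gauge of the empty set 0. *)
Definition hausdorff_gauge (s : R) A : \bar R :=
  if A == set0 then 0 else diam A `^ s.

(* No normalizing constant; it would not affect the function spaces. *)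
Definition hausdorff_content (s delta : R) A : \bar R :=
  ereal_inf [set \sum_(k <oo) hausdorff_gauge s (U k) |
    U in [set U : (set T)^nat |
      (forall k, diam (U k) <= delta%:E) /\ A `<=` \bigcup_k U k]].

Definition hausdorff_measure (s : R) A : \bar R :=
  ereal_sup [set hausdorff_content s delta A |
    delta in [set delta : R | (0 < delta)%R]].

Lemma hausdorff_gauge_ge0 s A : 0 <= hausdorff_gauge s A.
Proof. by rewrite /hausdorff_gauge; case: ifPn => // _; exact: poweR_ge0. Qed.

Let D : semiRingOfSetsType _ := g_sigma_algebraType [set: set T].

Let gauge s (delta : R) (A : set D) : \bar R :=
  if `[< diam (A : set T) <= delta%:E >] then hausdorff_gauge s A else +oo.

Let gauge_ge0 s delta A : 0 <= gauge s delta A.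
Proof. by rewrite /gauge; case: ifPn => // _; exact: hausdorff_gauge_ge0. Qed.

Let diam0 : diam (set0 : set T) = -oo.
Proof. by rewrite /diam set0X image_set0 ereal_sup0. Qed.

Let gauge0 s delta : gauge s delta set0 = 0.
Proof.
rewrite /gauge diam0 asboolT ?leNye//.
by rewrite /hausdorff_gauge eqxx.
Qed.

Let hausdorff_contentE s delta A :
  hausdorff_content s delta A = @mu_ext _ D R (gauge s delta) A.
Proof.
apply/eqP; rewrite eq_le; apply/andP; split; last first.
  apply: le_ereal_inf_tmp => _ [U [Ud AU] <-]; apply: ereal_inf_lbound.
  exists U; first by split => // i; exact: sub_gen_smallest.
  by apply: eq_eseriesr => k _; rewrite /gauge asboolT.
apply: le_ereal_inf_tmp => _ [U [_ AU] <-].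
have [Ud|/existsNP[k Uk]] := pselect (forall k, diam (U k : set T) <= delta%:E).
  apply: ereal_inf_lbound; exists U => //.
  by apply: eq_eseriesr => k _; rewrite /gauge asboolT.
rewrite (@eseries_pinfty _ _ xpredT k) ?leey//.
- by move=> n _; rewrite -ltNye (lt_le_trans _ (gauge_ge0 _ _ _)).
- by rewrite /gauge asboolF.
Qed.

Let hausdorff_content_ge0 s delta A : 0 <= hausdorff_content s delta A.
Proof.
rewrite hausdorff_contentE; exact (@mu_ext_ge0 _ D R _ (gauge_ge0 s delta) A).
Qed.

Let le_hausdorff_measure s delta A : (0 < delta)%R ->
  hausdorff_content s delta A <= hausdorff_measure s A.
Proof. by move=> d0; apply: ereal_sup_ubound; exists delta. Qed.

Let hausdorff_measure0 s : hausdorff_measure s set0 = 0.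
Proof.
apply/eqP; rewrite eq_le; apply/andP; split.
  apply: ge_ereal_sup => _ [delta _ <-].
  rewrite hausdorff_contentE.
  by rewrite (@mu_ext0 _ D R _ (gauge0 s delta) (gauge_ge0 s delta)).
exact: le_trans (hausdorff_content_ge0 _ 1 _) (le_hausdorff_measure _ _ ltr01).
Qed.

Let hausdorff_measure_ge0 s A : 0 <= hausdorff_measure s A.
Proof.
exact: le_trans (hausdorff_content_ge0 _ 1 _) (le_hausdorff_measure _ _ ltr01).
Qed.

Let hausdorff_measure_le s :
  {homo hausdorff_measure s : A B / A `<=` B >-> A <= B}.
Proof.
move=> A B AB; apply: ge_ereal_sup => _ [delta d0 <-].
apply: le_trans (le_hausdorff_measure _ _ d0).
by rewrite !hausdorff_contentE; exact (@le_mu_ext _ D R (gauge s delta) A B AB).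
Qed.

Let hausdorff_measure_subadd s : sigma_subadditive (hausdorff_measure s).
Proof.
move=> A; apply: ge_ereal_sup => _ [delta d0 <-].
rewrite hausdorff_contentE.
apply: (@le_trans _ _ (\sum_(i <oo) @mu_ext _ D R (gauge s delta) (A i))).
  exact (@mu_ext_sigma_subadditive _ D R _ (gauge_ge0 s delta) A).
apply: lee_nneseries => [i _ _|i _].
  exact (@mu_ext_ge0 _ D R _ (gauge_ge0 s delta) (A i)).
by rewrite -hausdorff_contentE; exact: le_hausdorff_measure.
Qed.

HB.instance Definition _ (s : R) := isOuterMeasure.Build R T
  (hausdorff_measure s) (hausdorff_measure0 s) (hausdorff_measure_ge0 s)
  (@hausdorff_measure_le s) (@hausdorff_measure_subadd s).

End hausdorff.

Section complex_functions.
Context {R : realType} {T : pmetricType R}.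
Variable mu : {outer_measure set T -> \bar R}.
Implicit Types (f : T -> R[i]) (D : set T).

Definition cabs f : T -> \bar R := fun x => (Normc.normc (f x))%:E.

Definition cmeasurable f : Prop :=
  measurable_fun [set: caratheodory_type mu] (fun x => complex.Re (f x)) /\
  measurable_fun [set: caratheodory_type mu] (fun x => complex.Im (f x)).

Definition cintegrable D f : Prop :=
  (cmeasure mu).-integrable D (fun x => (complex.Re (f x))%:E) /\
  (cmeasure mu).-integrable D (fun x => (complex.Im (f x))%:E).

Definition cintegral D f : R[i] :=
  (\int[cmeasure mu]_(x in D) complex.Re (f x)) +i*
  (\int[cmeasure mu]_(x in D) complex.Im (f x)).

Definition L1loc f : Prop :=
  cmeasurable f /\ forall (x : T) (r : R), 0 < r -> cintegrable (ball x r) f.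

Definition Lp_norm (p : \bar R) (h : T -> \bar R) : \bar R :=
  Lnorm (cmeasure mu) p h.

Definition cae_eq f g : Prop :=
  {ae cmeasure mu, forall x, f x = g x}.

End complex_functions.

Section filling.
Context {R : realType}.

Definition separated (T : pmetricType R) (r : R) (A : set T) : Prop :=
  forall x y, A x -> A y -> x <> y -> r <= mdist x y.

(* [vertex] is the disjoint union of the index sets of all levels; an edge is
   the pair (starting point, endpoint) given by its orientation. "Supported on
   the ball" is read as vanishing outside of it. *)
Record filling (T : pmetricType R) := Filling {
  vertex : choiceType;
  level : vertex -> int;
  center : vertex -> T;
  center_dist : forall x y, level x = level y -> x <> y ->
    2 ^ (- level x - 1) <= mdist (center x) (center y);
  center_max : forall (n : int) (S : set T),
    separated (2 ^ (- n - 1)) S ->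
    center @` [set x | level x = n] `<=` S ->
    S = center @` [set x | level x = n];
  vball : vertex -> set T := fun x => ball (center x) (2 ^ (- level x));
  adjacent : vertex -> vertex -> Prop := fun x y =>
    [/\ x <> y, `|level x - level y| <= 1 & vball x `&` vball y !=set0];
  edge : set (vertex * vertex);
  edge_adjacent : forall e, edge e -> adjacent e.1 e.2;
  edge_total : forall x y, adjacent x y -> edge (x, y) \/ edge (y, x);
  edge_oriented : forall x y, edge (x, y) -> ~ edge (y, x);
  edge_level : forall e, edge e -> level e.1 <> level e.2 ->
    level e.1 < level e.2;
  pou : vertex -> T -> R;
  pou_range : forall x xi, 0 <= pou x xi <= 1;
  pou_supp : forall x xi, pou x xi != 0 -> vball x xi;
  pou_lip : exists L : R, forall x xi eta,
    `|pou x xi - pou x eta| <= L * 2 ^ level x * mdist xi eta;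
  pou_sum : forall (n : int) (xi : T),
    (\esum_(x in [set x | level x = n]) (pou x xi)%:E = 1)%E
}.

Context {T : pmetricType R} (X : filling T).
Variable mu : {outer_measure set T -> \bar R}.

Definition elevel (e : vertex X * vertex X) : int :=
  Num.min (level e.1) (level e.2).

Definition eball (e : vertex X * vertex X) : set T :=
  vball e.1 `|` vball e.2.

Definition du (u : vertex X -> R[i]) (e : vertex X * vertex X) : R[i] :=
  u e.2 - u e.1.

Definition Pavg (f : T -> R[i]) (x : vertex X) : R[i] :=
  (fine (mu (vball x)))^-1%:C * cintegral mu (vball x) f.

(* On an Ahlfors regular space only finitely many terms are nonzero at each
   point; otherwise the library's sum is 0. *)
Definition T0 (u : vertex X -> R[i]) (xi : T) : R[i] :=
  \sum_(x \in [set x : vertex X | level x = 0]) u x * (pou x xi)%:C.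

End filling.

Arguments Pavg {R T} X mu f x.

(* The element 0 only matters for the supremum of an empty family. *)
Definition lq_norm {R : realType} {I : choiceType} (q : \bar R) (A : set I)
    (a : I -> \bar R) : \bar R :=
  match q with
  | r%:E => ((\esum_(i in A) a i `^ r) `^ r^-1)%E
  | _ => ereal_sup (0%E |` (a @` A))
  end.

(* Functions are not quotiented: identification almost everywhere is built
   into [bounded_linear_op] below. *)
Record fspace (R : realType) (T : pmetricType R) := FSpace {
  fmem : set (T -> R[i]);
  fnorm : (T -> R[i]) -> \bar R
}.

Section spaces.
Context {R : realType} {T : pmetricType R}.
Variables (mu : {outer_measure set T -> \bar R}) (X : filling T).
Local Open Scope ereal_scope.

(* 2^(ksq) N^q is written (2^(ks) N)^q. *)
Definition besov_norm (s : R) (p q : \bar R) (f : T -> R[i]) : \bar R :=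
  Lp_norm mu p (cabs (T0 (Pavg X mu f))) +
  lq_norm q [set: nat] (fun k => (2 `^ (k%:R * s))%:E *
    Lp_norm mu p (fun xi =>
      \esum_(e in [set e | edge e /\ elevel e = k%:Z])
        (Normc.normc (du (Pavg X mu f) e) * \1_(eball e) xi)%:E)).

Definition besov (s : R) (p q : \bar R) : fspace T := {|
  fmem := [set f | L1loc mu f /\ besov_norm s p q f < +oo];
  fnorm := besov_norm s p q |}.

Definition triebel_norm (s p : R) (q : \bar R) (f : T -> R[i]) : \bar R :=
  Lp_norm mu p%:E (cabs (T0 (Pavg X mu f))) +
  Lp_norm mu p%:E (fun xi =>
    lq_norm q [set e : vertex X * vertex X | edge e /\ (0 <= elevel e)%R]
      (fun e => (2 `^ ((elevel e)%:~R * s) *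
        Normc.normc (du (Pavg X mu f) e) * \1_(eball e) xi)%:E)).

Definition triebel (s p : R) (q : \bar R) : fspace T := {|
  fmem := [set f | L1loc mu f /\ triebel_norm s p q f < +oo];
  fnorm := triebel_norm s p q |}.

Definition hajlasz_gradient (p : R) (f : T -> R[i]) (g : T -> \bar R) : Prop :=
  [/\ (forall xi, 0 <= g xi),
      measurable_fun [set: caratheodory_type mu] g,
      Lp_norm mu p%:E g < +oo &
      forall xi eta, (Normc.normc (f xi - f eta))%:E <=
        (mdist xi eta)%:E * (g xi + g eta)].

Definition hajlasz (p : R) : fspace T := {|
  fmem := [set f | [/\ cmeasurable mu f, Lp_norm mu p%:E (cabs f) < +oo &
                      exists g, hajlasz_gradient p f g]];
  fnorm := fun f => Lp_norm mu p%:E (cabs f) +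
    ereal_inf [set Lp_norm mu p%:E g | g in hajlasz_gradient p f] |}.

End spaces.

Section operators.
Context {R : realType}.

Definition bounded_linear_op (T U : pmetricType R)
    (mu : {outer_measure set T -> \bar R})
    (nu : {outer_measure set U -> \bar R}) (A : fspace T) (B : fspace U)
    (L : (T -> R[i]) -> (U -> R[i])) : Prop :=
  [/\ (forall f, fmem A f -> fmem B (L f)),
      (forall f g, fmem A f -> fmem A g -> cae_eq mu f g ->
        cae_eq nu (L f) (L g)),
      (forall (a : R[i]) f g, fmem A f -> fmem A g ->
        cae_eq nu (L (fun x => a * f x + g x)) (fun y => a * L f y + L g y)) &
      exists C : R, forall f, fmem A f ->
        (fnorm B (L f) <= C%:E * fnorm A f)%E].

Context {Z : pmetricType R} (F : set Z) (F0 : F !=set0).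

Definition trace_and_extension (mu : {outer_measure set Z -> \bar R})
    (nu : {outer_measure set (subsp F0) -> \bar R})
    (A : fspace Z) (B : fspace (subsp F0)) : Prop :=
  exists (Tr : (Z -> R[i]) -> (subsp F0 -> R[i]))
         (Ext : (subsp F0 -> R[i]) -> (Z -> R[i])),
    [/\ bounded_linear_op mu nu A B Tr,
        bounded_linear_op nu mu B A Ext,
        (forall f, fmem A f -> continuous (f : Z -> R[i]^o) ->
          cae_eq nu (Tr f) (f \o @subsp_val R Z F F0)) &
        (forall f, fmem B f -> cae_eq nu (Tr (Ext f)) f)].

End operators.

(* Main.v *)
(* Everything is reduced to functions on the vertices of the fillings. A vertex
   function u has the smoothings T_n u = sum u(x) psi_x over level n; the series
   with terms T_(n+1) u - T_n u restricted to F defines the trace. Its terms are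
   bounded and Lipschitz at scale 2^(-n) with constants given by the differences
   of u along the edges near F, and such a series is synthesised into a Besov
   function by Schur's test with a geometric kernel. The extension transports a
   vertex function of F to the vertices near F and sums the same jumps, each cut
   off to a neighbourhood of F of width comparable with 2^(-n). That the trace of
   the extension is the given function f follows from the convergence of the
   smoothed means of f to f along a subsequence almost everywhere (Lipschitz
   functions are dense, then Fatou).

   If F is porous, every vertex ball contains a ball of comparable size, its hole,
   at comparable distance from F; holes of vertices near F overlap boundedly over
   all levels together. Hence lambda < Q, neighbourhoods of F have small measure,
   and integrals of a single function over all the holes are controlled by its
   integral: this replaces the summation over levels by an integral for the
   Triebel-Lizorkin and Hajlasz spaces. In the Hajlasz case f need not be known to
   be locally integrable, so u(x) is a value of f at a point of the hole of x where
   the gradient is at most twice its mean; two such selections give the same trace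
   almost everywhere, since they can be used alternately on even and odd levels. *)
From HB Require Import structures.
From mathcomp Require Import all_boot all_order all_algebra.
From mathcomp Require Import finmap.
From mathcomp Require Import all_classical all_reals all_analysis.
From mathcomp Require Import measurable_realfun complex ring lra zify.
Require Import Defs.

Set Implicit Arguments.
Unset Strict Implicit.
Unset Printing Implicit Defensive.
Import Order.TTheory GRing.Theory Num.Theory.
Import numFieldNormedType.Exports.

Local Open Scope classical_set_scope.
Local Open Scope ring_scope.

(** The two lower bounds on p come from a sum over finer scales. A mean over a ball of level k sees
    every level n beyond k; there are about 2^((n - k) D) balls to count and, for p < 1, a power of
    a sum to pay for, and the contributions decay exactly when [tail_exp] is positive. On F, with
    smoothness s - (Q - lambda) / p, this reads p > Q / (lambda + s) for p < 1 and positivity of the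
    smoothness for p >= 1. Coarser levels n decay like 2^(n - k) because the terms are Lipschitz;
    this beats the weight 2^(k s) since s < 1. For s = 1 on Z this second sum is avoided: a gradient
    is summed directly. Passing between Z and F loses nothing because (s - (Q - lambda) / p) p -
    lambda = s p - Q, so that one level carries the same weight on both sides. As p may be below 1,
    neither duality nor maximal functions are used; powers of sums are split with geometric weights.
    F may be null for [mu], so convergence almost everywhere on F is never read off from Z:
    coefficients are moved to F and summed there. *)

Local Notation nc := Normc.normc.

(** * Powers with real exponents, in particular powers of 2 *)

Section powers.
Context {R : realType}.
Implicit Types (p r s : R) (x y : \bar R).
Local Open Scope ereal_scope.

Lemma poweR_le r x y : (0 <= r)%R -> 0 <= x -> x <= y -> x `^ r <= y `^ r.
Proof.
move=> r0 x0 xy; apply: gt0_ler_poweR => //; rewrite in_itv/= leey andbT//.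
exact: le_trans xy.
Qed.

Lemma poweRVK r x : (0 < r)%R -> 0 <= x -> (x `^ r) `^ r^-1 = x.
Proof. by move=> r0 x0; rewrite -poweRrM mulfV ?gt_eqF// poweRe1. Qed.

Lemma poweRKV r x : (0 < r)%R -> 0 <= x -> (x `^ r^-1) `^ r = x.
Proof. by move=> r0 x0; rewrite -poweRrM mulVf ?gt_eqF// poweRe1. Qed.

Lemma poweR_le_inv r x y : (0 < r)%R -> 0 <= x -> 0 <= y ->
  x `^ r <= y `^ r -> x <= y.
Proof.
move=> r0 x0 y0 h; rewrite -(poweRVK r0 x0) -(poweRVK r0 y0).
by apply: poweR_le => //; [rewrite invr_ge0 ltW|exact: poweR_ge0].
Qed.

Lemma powRDpos (t r s : R) : (0 < t)%R -> (t `^ (r + s) = t `^ r * t `^ s)%R.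
Proof. by move=> t0; rewrite powRD// (gt_eqF t0) implybT. Qed.

Lemma powRVl (t r : R) : (0 <= t)%R -> (t^-1 `^ r = (t `^ r)^-1)%R.
Proof. by move=> t0; rewrite -[in LHS]powR_inv1// -powRrM mulN1r powRN. Qed.

Lemma e2_gt0 r : (0 < 2 `^ r :> R)%R. Proof. by rewrite powR_gt0. Qed.

Lemma e2_ge0 r : (0 <= 2 `^ r :> R)%R. Proof. by rewrite powR_ge0. Qed.

Lemma e2D r s : (2 `^ (r + s) = 2 `^ r * 2 `^ s :> R)%R.
Proof. by rewrite powRD// pnatr_eq0 implybT. Qed.

Lemma e2B r s : (2 `^ (r - s) = 2 `^ r / 2 `^ s :> R)%R.
Proof. by rewrite powRB// pnatr_eq0 implybT. Qed.

Lemma e2_le r s : (r <= s -> 2 `^ r <= 2 `^ s :> R)%R.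
Proof. by move=> rs; rewrite ler_powR// ler1n. Qed.

Lemma e2_lt1 r : (r < 0 -> 2 `^ r < 1 :> R)%R.
Proof.
move=> r0; rewrite -[ltRHS](powRr0 2) /powR pnatr_eq0/= ltr_expR.
by rewrite mul0r nmulr_rlt0// ln_gt0// ltr1n.
Qed.

Lemma e2_nat (n : nat) : (2 `^ n%:R = 2 ^+ n :> R)%R.
Proof. by rewrite powR_mulrn. Qed.

Lemma e2_oppnat (n : nat) : (2 `^ (- n%:R) = 2 ^- n :> R)%R.
Proof. by rewrite powR_invn. Qed.

End powers.

(** * Unordered sums: powers of sums, geometric kernels, l^q quasi-norms *)

Section esums.
Context {R : realType}.
Local Open Scope ereal_scope.

Section one_index.
Context {I : choiceType}.
Implicit Types (A B : set I) (a b : I -> \bar R).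

Lemma esum_le_subset A B a : A `<=` B -> (forall i, B i -> 0 <= a i) ->
  \esum_(i in A) a i <= \esum_(i in B) a i.
Proof.
move=> AB a0; rewrite (esumID A B a)//.
rewrite (_ : B `&` A = A) ?leeDl//; last by apply/setIidr.
by apply: esum_ge0 => i [/a0].
Qed.

Lemma esum_ge_term A a i : A i -> (forall j, A j -> 0 <= a j) ->
  a i <= \esum_(j in A) a j.
Proof.
move=> Ai a0; rewrite -[leLHS](esum_set1 (t := i) (a := a)) ?a0//.
by apply: esum_le_subset => // j ->.
Qed.

Lemma esumZl A a (c : R) : (0 <= c)%R -> (forall i, A i -> 0 <= a i) ->
  \esum_(i in A) (c%:E * a i) = c%:E * \esum_(i in A) a i.
Proof.
move=> c0 a0; wlog {c0} c0 : c / (0 < c)%R.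
  move=> h; move: c0; rewrite le_eqVlt => /predU1P[<-|/h//].
  by rewrite mul0e esum1// => i _; rewrite mul0e.
have key (d : R) (b : I -> \bar R) : (0 < d)%R -> (forall i, A i -> 0 <= b i) ->
    \esum_(i in A) (d%:E * b i) <= d%:E * \esum_(i in A) b i.
  move=> d0 b0; apply: ge_ereal_sup => _ [X [finX XA] <-].
  rewrite fsbig_finite//= big_seq -ge0_sume_distrr; last first.
    by move=> i; rewrite in_fset_set// inE => /XA/b0.
  rewrite -big_seq lee_pmul2l// -fsbig_finite//.
  by apply: ereal_sup_ubound; exists X.
apply/eqP; rewrite eq_le key//= -lee_pdivlMl//.
apply: le_trans (key _ _ _ _) => //; last 2 first.
- by rewrite invr_gt0.
- by move=> i Ai; rewrite mule_ge0 ?lee_fin ?a0// ltW.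
by apply: le_esum => i _; rewrite muleA -EFinM mulVf ?gt_eqF// mul1e.
Qed.

End one_index.
Lemma esum_exchange {I J : choiceType} (A : set I) (B : set J)
    (Rl : I -> J -> Prop) (a : I -> J -> \bar R) :
  (forall i j, A i -> B j -> Rl i j -> 0 <= a i j) ->
  \esum_(i in A) \esum_(j in [set j | B j /\ Rl i j]) a i j =
  \esum_(j in B) \esum_(i in [set i | A i /\ Rl i j]) a i j.
Proof.
move=> a0; rewrite esum_esum//; last by move=> i j Ai [Bj Rij]; exact: a0.
rewrite esum_esum//; last by move=> j i Bj [Ai Rij]; exact: a0.
rewrite (reindex_esum (B `*`` (fun j => [set i | A i /\ Rl i j])) _
  (fun x => (x.2, x.1)))//; split=> //=.
- by move=> [j i] /= [Bj [Ai Rij]].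
- by move=> [j1 i1] [j2 i2] /= _ _ [] -> ->.
- by move=> [i j] /= [Ai [Bj Rij]]; exists (j, i).
Qed.

Lemma esum_exchangeT {I J : choiceType} (A : set I) (B : set J)
    (a : I -> J -> \bar R) :
  (forall i j, A i -> B j -> 0 <= a i j) ->
  \esum_(i in A) \esum_(j in B) a i j = \esum_(j in B) \esum_(i in A) a i j.
Proof.
move=> a0; have := @esum_exchange _ _ A B (fun _ _ => True) a.
rewrite (_ : [set j | B j /\ True] = B); last by apply/seteqP; split=> // x [].
rewrite (_ : [set j | A j /\ True] = A); last by apply/seteqP; split=> // x [].
by apply => i j Ai Bj _; exact: a0.
Qed.

Lemma esumU_le {I : choiceType} (A B : set I) (a : I -> \bar R) :
  (forall i, (A `|` B) i -> 0 <= a i) ->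
  \esum_(i in A `|` B) a i <= \esum_(i in A) a i + \esum_(i in B) a i.
Proof.
move=> a0; rewrite (esumID A (A `|` B))//; apply: leeD.
  by apply: esum_le_subset => [i []//|i Ai]; apply: a0; left.
by apply: esum_le_subset => [i [[]]//|i Ai]; apply: a0; right.
Qed.

(** A substitute for Hoelder's inequality that works for every p > 0: with S the weighted sum on the
    right, each [a i] is at most [w i] times S^(1/p), and the weights add up to at most K. Geometric
    weights then cost an arbitrarily small part of an exponential decay. *)
Lemma esum_pow_weight {I : choiceType} (A : set I) (a : I -> \bar R)
    (w : I -> R) (K p : R) : (0 < p)%R -> (0 <= K)%R ->
  (forall i, A i -> 0 <= a i) -> (forall i, A i -> (0 < w i)%R) ->
  \esum_(i in A) (w i)%:E <= K%:E ->
  (\esum_(i in A) a i) `^ p <=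
  (K `^ p)%:E * \esum_(i in A) ((w i `^ (- p))%:E * a i `^ p).
Proof.
move=> p0 K0 a0 w0 wK; set S := \esum_(i in A) (_ * _).
have S0 : 0 <= S.
  by apply: esum_ge0 => i _; rewrite mule_ge0 ?poweR_ge0// lee_fin powR_ge0.
have aS i : A i -> a i <= (w i)%:E * S `^ p^-1.
  move=> Ai; have wi := w0 _ Ai; have ai := a0 _ Ai.
  apply: (poweR_le_inv p0) => //.
    by rewrite mule_ge0 ?poweR_ge0// lee_fin ltW.
  rewrite poweRM ?poweR_ge0//; last by rewrite lee_fin ltW.
  rewrite poweRKV// poweR_EFin -lee_pdivrMl ?powR_gt0// -powRN.
  apply: (esum_ge_term (a := fun i => (w i `^ (- p))%:E * a i `^ p) Ai) => //.
  by move=> j _; rewrite mule_ge0 ?poweR_ge0// lee_fin powR_ge0.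
have [Soo|Sfin] := eqVneq S +oo.
  have [K00|Kn0] := eqVneq K 0%R.
    have -> : \esum_(i in A) a i = 0.
      apply: esum1 => i Ai; exfalso; have := w0 _ Ai.
      rewrite -lte_fin ltNge => /negP; apply.
      rewrite -K00; apply: le_trans wK.
      apply: (esum_ge_term (a := fun i => (w i)%:E) Ai) => //.
      by move=> j /w0 /ltW; rewrite lee_fin.
    by rewrite poweR0r ?gt_eqF// mule_ge0// lee_fin powR_ge0.
  rewrite Soo muleC gt0_mulye ?leey// lte_fin powR_gt0//.
  by rewrite lt_neqAle eq_sym Kn0.
have Sf : S `^ p^-1 \is a fin_num.
  by rewrite fin_num_poweR// ge0_fin_numE// ltey.
have : \esum_(i in A) a i <= K%:E * S `^ p^-1.
  apply: (le_trans (le_esum aS)).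
  under eq_esum do rewrite muleC.
  rewrite -(fineK Sf) esumZl; last 2 first.
  - by rewrite fine_ge0// poweR_ge0.
  - by move=> i /w0/ltW; rewrite lee_fin.
  rewrite muleC lee_pmul//.
    by apply: esum_ge0 => i /w0/ltW; rewrite lee_fin.
  by rewrite lee_fin fine_ge0// poweR_ge0.
move=> /(poweR_le (ltW p0) (esum_ge0 a0)) /le_trans; apply.
by rewrite poweRM ?poweR_ge0 ?lee_fin// poweRKV.
Qed.

Lemma esum_pow_count {I : choiceType} (A : set I) (a : I -> \bar R) (N p : R) :
  (0 < p)%R -> (0 <= N)%R -> (forall i, A i -> 0 <= a i) ->
  \esum_(i in A) 1 <= N%:E ->
  (\esum_(i in A) a i) `^ p <= (N `^ p)%:E * \esum_(i in A) a i `^ p.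
Proof.
move=> p0 N0 a0 AN.
apply: le_trans (esum_pow_weight (w := fun=> 1%R) p0 N0 a0 _ AN) _ => //.
rewrite le_eqVlt; apply/orP; left; apply/eqP; congr (_ * _).
by apply: eq_esum => i _; rewrite powR1 mul1e.
Qed.

(** Here N enters with the optimal exponent max(p - 1, 0), against p in [esum_pow_count]. This
    matters where N counts the balls of level n inside a ball of level k and grows exponentially in
    n - k. *)
Lemma esum_pow_sharp {I : choiceType} (A : set I) (a : I -> \bar R) (N p : R) :
  (0 < p)%R -> (0 < N)%R -> (forall i, A i -> 0 <= a i) ->
  \esum_(i in A) 1 <= N%:E ->
  (\esum_(i in A) a i) `^ p <=
  (2 `^ p * N `^ (Num.max (p - 1) 0))%:E * \esum_(i in A) a i `^ p.
Proof.
move=> p0 N0 a0 AN; set S := \esum_(i in A) a i `^ p.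
have S0 : 0 <= S by apply: esum_ge0 => i _; exact: poweR_ge0.
have aS i : A i -> a i `^ p <= S.
  move=> Ai.
  by apply: (esum_ge_term (a := fun i => a i `^ p) Ai) => // j _; exact: poweR_ge0.
have C0 : (0 < 2 `^ p * N `^ (Num.max (p - 1) 0))%R by rewrite mulr_gt0// powR_gt0.
have [Soo|Sfin] := eqVneq S +oo.
  by rewrite Soo muleC gt0_mulye ?leey// lte_fin.
have [Sz|Snz] := eqVneq S 0.
  rewrite esum1 ?poweR0r ?gt_eqF// => [|i Ai].
    by rewrite mule_ge0// lee_fin ltW.
  apply/(poweR_eq0_eq0 (r := p)) => //; first exact: a0.
  by apply/eqP; rewrite eq_le poweR_ge0 andbT -Sz aS.
have Sf : S \is a fin_num by rewrite ge0_fin_numE// ltey.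
pose sg := fine S; have sgE : S = sg%:E by rewrite fineK.
have sg0 : (0 < sg)%R by rewrite -lte_fin -sgE lt_neqAle eq_sym Snz.
have afin i : A i -> exists2 b : R, a i = b%:E & (0 <= b)%R.
  move=> Ai; have := aS _ Ai; have := a0 _ Ai.
  case: (a i) => [b|_|]//; first by rewrite lee_fin; exists b.
  by rewrite poweRyr ?gt_eqF// sgE leye_eq.
suff : \esum_(i in A) a i <= (2 * N `^ (Num.max (p - 1) 0 / p) * sg `^ p^-1)%:E.
  move=> /(poweR_le (ltW p0) (esum_ge0 a0)) /le_trans; apply.
  rewrite poweR_EFin sgE -EFinM lee_fin !powRM ?powR_ge0 ?mulr_ge0 ?powR_ge0//.
  by rewrite -!powRrM mulVf ?gt_eqF// powRr1 ?(ltW sg0)// divfK ?gt_eqF.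
have [p1|p1] := leP p 1%R.
  rewrite max_r ?subr_le0// mul0r powRr0 mulr1.
  (* No term exceeds t, so for p <= 1 each is at most t^(1 - p) times its p-th power. *)
  set t : R := (sg `^ p^-1)%R; have t0 : (0 < t)%R by rewrite powR_gt0.
  apply: (@le_trans _ _ (\esum_(i in A) ((t `^ (1 - p))%:E * a i `^ p))).
    apply: le_esum => i Ai; have [b ab b0] := afin _ Ai.
    have bt : (b <= t)%R.
      rewrite -lee_fin; apply: (poweR_le_inv p0); rewrite ?lee_fin ?(ltW t0)//.
      rewrite -powRrM mulVf ?gt_eqF// powRr1 ?(ltW sg0)//.
      by rewrite -lee_fin -poweR_EFin -ab -sgE aS.
    rewrite ab poweR_EFin -EFinM lee_fin.
    have [->|bn0] := eqVneq b 0%R; first by rewrite mulr_ge0 ?powR_ge0.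
    have {}b0 : (0 < b)%R by rewrite lt_neqAle eq_sym bn0.
    rewrite -[leLHS](powRr1 (ltW b0)) -[1%R](subrK p) powRDpos//.
    rewrite addrK.
    by rewrite ler_wpM2r ?powR_ge0// ge0_ler_powR ?nnegrE ?subr_ge0 ?(ltW b0) ?(ltW t0).
  rewrite esumZl ?powR_ge0//; last by move=> *; exact: poweR_ge0.
  rewrite -/S sgE -EFinM lee_fin.
  have -> : sg = (t `^ p)%R by rewrite -powRrM mulVf ?gt_eqF// powRr1// ltW.
  rewrite -powRDpos// subrK powRr1 ?(ltW t0)// ler_peMl ?(ltW t0)//.
  by rewrite ler1n.
rewrite max_l ?subr_ge0 ?(ltW p1)//.
(* The p-mean as threshold: the terms below t contribute at most N t, those above it at most t^(1 -
   p) [sg], which is again N t. *)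
set t : R := ((sg / N) `^ p^-1)%R; have t0 : (0 < t)%R by rewrite powR_gt0// divr_gt0.
apply: (@le_trans _ _ (\esum_(i in A) (t%:E * 1 + (t `^ (1 - p))%:E * a i `^ p))).
  apply: le_esum => i Ai; have [b ab b0] := afin _ Ai.
  rewrite ab mule1 poweR_EFin -EFinM -EFinD lee_fin.
  have [bt|tb] := leP b t; first by rewrite ler_wpDr// mulr_ge0 ?powR_ge0.
  have {}b0 : (0 < b)%R by apply: lt_trans tb.
  apply: ler_wpDl; first exact: ltW.
  rewrite -[leLHS](powRr1 (ltW b0)) -[in leLHS](subrK p 1%R) powRDpos//.
  rewrite ler_wpM2r ?powR_ge0// -[in leLHS]opprB -[in leRHS]opprB !powRN.
  rewrite lef_pV2 ?posrE; [|exact: powR_gt0|exact: powR_gt0].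
  by apply: ge0_ler_powR; rewrite ?nnegrE ?subr_ge0; apply: ltW.
rewrite esumD; last 2 first.
- by move=> i _; rewrite mule1 lee_fin ltW.
- by move=> i _; rewrite mule_ge0 ?poweR_ge0// lee_fin powR_ge0.
rewrite esumZl ?(ltW t0)// esumZl ?powR_ge0//; last by move=> *; exact: poweR_ge0.
rewrite -/S sgE -EFinM.
apply: (@le_trans _ _ (t%:E * N%:E + (t `^ (1 - p) * sg)%:E)).
  by rewrite leeD2r// lee_pmul2l.
rewrite -EFinM -EFinD lee_fin.
have sgt : sg = (N * t `^ p)%R.
  rewrite -powRrM mulVf ?gt_eqF// powRr1 ?divr_ge0 ?ltW//.
  by rewrite mulrC divfK ?gt_eqF.
clearbody t.
have -> : (t `^ (1 - p) * sg = t * N)%R.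
  rewrite sgt mulrCA -powRDpos// subrK powRr1 ?(ltW t0)//.
  by rewrite mulrC.
have -> : (sg `^ p^-1 = N `^ p^-1 * t)%R.
  rewrite [in LHS]sgt powRM ?powR_ge0 ?(ltW N0)// -powRrM mulfV ?gt_eqF//.
  by rewrite powRr1// ltW.
have NE : (N `^ ((p - 1) / p) * N `^ p^-1 = N)%R.
  by rewrite -powRDpos// mulrBl mul1r mulfV ?gt_eqF// subrK powRr1// ltW.
by rewrite -[in leLHS]NE le_eqVlt; apply/orP; left; apply/eqP; ring.
Qed.

Lemma esum_geo (x : R) : (0 <= x < 1)%R ->
  \esum_(n in [set: nat]) (x ^+ n)%:E <= ((1 - x)^-1)%:E.
Proof.
move=> /andP[x0 x1]; rewrite -nneseries_esumT; last first.
  by move=> n; rewrite lee_fin exprn_ge0.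
apply: lime_le; first by apply: is_cvg_nneseries => n _ _; rewrite lee_fin exprn_ge0.
apply: nearW => n; rewrite sumEFin lee_fin -[leRHS]mul1r ler_pdivlMr ?subr_gt0//.
rewrite big_mkord mulrC -opprB mulNr -subrX1 opprB lerBlDr lerDl.
exact: exprn_ge0.
Qed.

Definition geo_kernel (d : R) (k n : nat) : R := (2 `^ (- (d * `|k%:R - n%:R|)))%R.

Lemma geo_kernel_gt0 d k n : (0 < geo_kernel d k n)%R.
Proof. exact: e2_gt0. Qed.

Lemma geo_kernelC d k n : geo_kernel d k n = geo_kernel d n k.
Proof. by rewrite /geo_kernel distrC. Qed.

Lemma geo_kernel_pow d r k n : (geo_kernel d k n `^ r)%R = geo_kernel (d * r) k n.
Proof. by rewrite /geo_kernel -powRrM mulNr mulrAC. Qed.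

Lemma geo_kernel_sum (d : R) : (0 < d)%R -> exists2 K : R, (0 < K)%R &
  forall k, \esum_(n in [set: nat]) (geo_kernel d k n)%:E <= K%:E.
Proof.
move=> d0; set x : R := (2 `^ (- d))%R.
have x0 : (0 <= x)%R by exact: e2_ge0.
have x1 : (x < 1)%R by rewrite e2_lt1// oppr_lt0.
have K0 : (0 < (1 - x)^-1)%R by rewrite invr_gt0 subr_gt0.
exists ((1 - x)^-1 + (1 - x)^-1)%R; first by rewrite addr_gt0.
have xE j : (x ^+ j = 2 `^ (- (d * j%:R)))%R.
  by rewrite -powR_mulrn ?e2_ge0// -powRrM mulNr.
have geo0 n : [set: nat] n -> 0 <= (x ^+ n)%:E by rewrite lee_fin exprn_ge0.
move=> k; rewrite (esumID [set n | (n <= k)%N] setT); last first.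
  by move=> *; rewrite lee_fin ltW// geo_kernel_gt0.
rewrite EFinD; apply: leeD; apply: le_trans (esum_geo _); rewrite ?x0//.
- rewrite (reindex_esum [set n | (n <= k)%N] _ (fun n => k - n)%N); last first.
    split=> [n _|n m|n]/=.
    + by split => //; rewrite leq_subr.
    + by rewrite !inE/= => nk mk e; rewrite -(subKn nk) -(subKn mk) e.
    + by case=> _ nk; exists (k - n)%N; rewrite /= ?leq_subr// subKn.
  apply: le_trans (esum_le_subset (@subsetT _ _) geo0).
  apply: le_esum => n /= nk.
  by rewrite /geo_kernel natrB// opprB addrC subrK normr_nat xE.
- rewrite setTI.
  rewrite (reindex_esum [set n | (0 < n)%N] _ (fun n => k + n)%N); last first.
    split=> [n /=|n m _ _|n]/=.
    + by move=> n0; apply/negP; rewrite -ltnNge -[X in (X < _)%N]addn0 ltn_add2l.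
    + exact: addnI.
    + move=> /negP; rewrite -ltnNge => nk; exists (n - k)%N; rewrite /= ?subn_gt0//.
      by rewrite subnKC// ltnW.
  apply: le_trans (esum_le_subset (@subsetT _ _) geo0).
  apply: le_esum => n /= nk.
  by rewrite /geo_kernel natrD opprD addrA subrr add0r normrN normr_nat xE.
Qed.

Lemma lq_norm_ge0 {I : choiceType} q (A : set I) (a : I -> \bar R) :
  0 <= lq_norm q A a.
Proof.
case: q => [r||] /=; first exact: poweR_ge0.
  by apply: ereal_sup_ubound; left.
by apply: ereal_sup_ubound; left.
Qed.

Lemma lq_norm_fin {I : choiceType} (r : R) (A : set I) (a : I -> \bar R) (x : \bar R) :
  (0 < r)%R -> 0 <= x -> (lq_norm r%:E A a <= x) =
  (\esum_(i in A) a i `^ r <= x `^ r).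
Proof.
move=> r0 x0; have s0 : 0 <= \esum_(i in A) a i `^ r.
  by apply: esum_ge0 => i _; exact: poweR_ge0.
apply/idP/idP => /= [h|h].
  by rewrite -(poweRKV r0 s0); apply: poweR_le => //; [exact: ltW|exact: poweR_ge0].
by rewrite -(poweRVK r0 x0); apply: poweR_le => //; rewrite invr_ge0 ltW.
Qed.

Lemma lq_normy {I : choiceType} (A : set I) (a : I -> \bar R) (x : \bar R) :
  0 <= x -> (forall i, A i -> a i <= x) -> lq_norm +oo A a <= x.
Proof. by move=> x0 ax; apply: ge_ereal_sup => _ [->//|[i /ax ? <-]]. Qed.

Lemma lq_norm_term {I : choiceType} q (A : set I) (a : I -> \bar R) i :
  0 < q -> (forall i, A i -> 0 <= a i) -> A i -> a i <= lq_norm q A a.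
Proof.
move=> q0 a0 Ai; case: q q0 => [r|_|//].
  rewrite lte_fin => r0; apply: (poweR_le_inv r0); rewrite ?a0//.
    exact: poweR_ge0.
  rewrite /= poweRKV//; last by apply: esum_ge0 => *; exact: poweR_ge0.
  by apply: (esum_ge_term (a := fun i => a i `^ r) Ai) => *; exact: poweR_ge0.
by apply: ereal_sup_ubound; right; exists i.
Qed.

(* All parameters but [rho] and [tau] may be fixed before the constant. *)
Lemma lq_norm_geo q (p d C : R) : 0 < q -> (0 < p)%R -> (0 < d)%R -> (0 <= C)%R ->
  exists2 K : R, (0 <= K)%R & forall rho tau : nat -> \bar R,
    (forall k, 0 <= rho k) -> (forall k, 0 <= tau k) ->
    (forall k, rho k `^ p <=
      C%:E * \esum_(n in [set: nat]) ((geo_kernel d k n)%:E * tau n `^ p)) ->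
    lq_norm q setT rho <= K%:E * lq_norm q setT tau.
Proof.
move=> q0 p0 d0 C0.
have d20 : (0 < d / 2)%R by rewrite divr_gt0.
have [K1 K10 HK1] := geo_kernel_sum d0.
have [K2 K20 HK2] := geo_kernel_sum d20.
case: q q0 => [r|_|//].
  rewrite lte_fin => r0.
  have rp0 : (0 < r / p)%R by rewrite divr_gt0.
  have d30 : (0 < d / 2 * (r / p))%R by rewrite mulr_gt0.
  have [K3 K30 HK3] := geo_kernel_sum d30.
  pose K := ((C `^ (r / p) * K2 `^ (r / p) * K3) `^ r^-1)%R.
  exists K; first exact: powR_ge0.
  move=> rho tau rho0 tau0 h.
  rewrite lq_norm_fin//; last by rewrite mule_ge0 ?lq_norm_ge0// lee_fin powR_ge0.
  rewrite poweRM ?lq_norm_ge0//; last by rewrite lee_fin powR_ge0.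
  rewrite poweR_EFin -powRrM mulVf ?gt_eqF// powRr1 ?mulr_ge0 ?powR_ge0 ?(ltW K30)//.
  rewrite /lq_norm poweRKV//; last by apply: esum_ge0 => *; exact: poweR_ge0.
  apply: (@le_trans _ _ (\esum_(k in [set: nat]) ((C `^ (r / p) * K2 `^ (r / p))%:E *
      \esum_(n in [set: nat]) ((geo_kernel (d / 2 * (r / p)) k n)%:E * tau n `^ r)))).
    apply: le_esum => k _.
    have -> : rho k `^ r = (rho k `^ p) `^ (r / p).
      by rewrite -poweRrM mulrC divfK ?gt_eqF.
    apply: le_trans (poweR_le _ _ (h k)) _; rewrite ?(ltW rp0) ?poweR_ge0//.
    rewrite poweRM ?lee_fin//; last first.
      by apply: esum_ge0 => *; rewrite mule_ge0 ?poweR_ge0// lee_fin ltW// geo_kernel_gt0.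
    rewrite poweR_EFin EFinM -muleA lee_wpmul2l ?lee_fin ?powR_ge0//.
    (* Half of the decay pays for the power r / p of the sum; the other half is left for the
       summation over k after the exchange. *)
    apply: le_trans (esum_pow_weight (w := geo_kernel (d / 2) k) rp0 (ltW K20) _ _ (HK2 k)) _.
    - by move=> *; rewrite mule_ge0 ?poweR_ge0// lee_fin ltW// geo_kernel_gt0.
    - by move=> *; exact: geo_kernel_gt0.
    rewrite lee_wpmul2l ?lee_fin ?powR_ge0//; apply: le_esum => n _.
    rewrite poweRM ?poweR_ge0//; last by rewrite lee_fin ltW// geo_kernel_gt0.
    rewrite -poweRrM (mulrC p) divfK ?gt_eqF// muleA lee_wpmul2r ?poweR_ge0//.
    rewrite poweR_EFin -EFinM lee_fin !geo_kernel_pow /geo_kernel -e2D.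
    by apply: e2_le; rewrite le_eqVlt; apply/orP; left; apply/eqP; field; rewrite gt_eqF.
  rewrite esumZl ?mulr_ge0 ?powR_ge0//; last first.
    move=> k _; apply: esum_ge0 => *.
    by rewrite mule_ge0 ?poweR_ge0// lee_fin ltW// geo_kernel_gt0.
  rewrite [in leRHS]EFinM -[leRHS]muleA lee_wpmul2l ?lee_fin ?mulr_ge0 ?powR_ge0//.
  rewrite esum_exchangeT; last first.
    by move=> *; rewrite mule_ge0 ?poweR_ge0// lee_fin ltW// geo_kernel_gt0.
  rewrite -esumZl ?(ltW K30)//; last by move=> *; exact: poweR_ge0.
  apply: le_esum => n _.
  have [->|toy] := eqVneq (tau n) +oo.
    by rewrite poweRyr ?gt_eqF// gt0_muley ?leey// lte_fin.
  have tf : tau n `^ r \is a fin_num.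
    by rewrite fin_num_poweR// ge0_fin_numE// ltey.
  rewrite -(fineK tf); under eq_esum do rewrite muleC.
  rewrite esumZl ?fine_ge0 ?poweR_ge0//; last first.
    by move=> *; rewrite lee_fin ltW// geo_kernel_gt0.
  rewrite muleC lee_wpmul2r ?lee_fin ?fine_ge0 ?poweR_ge0//.
  by under eq_esum do rewrite geo_kernelC.
exists ((C * K1) `^ p^-1)%R; first exact: powR_ge0.
move=> rho tau rho0 tau0 h.
set x := lq_norm _ _ tau; have x0 : 0 <= x by exact: lq_norm_ge0.
apply: lq_normy => [|k _]; first by rewrite mule_ge0// lee_fin powR_ge0.
apply: (poweR_le_inv p0) => //; first by rewrite mule_ge0// lee_fin powR_ge0.
apply: le_trans (h k) _; rewrite poweRM ?lee_fin ?powR_ge0//.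
rewrite poweR_EFin -powRrM mulVf ?gt_eqF// powRr1 ?mulr_ge0 ?(ltW K10)//.
rewrite EFinM -muleA lee_wpmul2l ?lee_fin//.
have [xoo|xoo] := eqVneq x +oo.
  by rewrite xoo poweRyr ?gt_eqF// gt0_muley ?leey// lte_fin.
have xf : x `^ p \is a fin_num by rewrite fin_num_poweR// ge0_fin_numE// ltey.
apply: (@le_trans _ _ (\esum_(n in [set: nat]) ((fine (x `^ p))%:E * (geo_kernel d k n)%:E))).
  apply: le_esum => n _; rewrite muleC lee_wpmul2r ?lee_fin ?(ltW (geo_kernel_gt0 _ _ _))//.
  rewrite fineK//; apply: poweR_le => //; first exact: ltW.
  by apply: lq_norm_term => //; rewrite ltry.
rewrite esumZl ?fine_ge0 ?poweR_ge0//; last first.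
  by move=> *; rewrite lee_fin ltW// geo_kernel_gt0.
by rewrite fineK// muleC lee_wpmul2r ?poweR_ge0.
Qed.

End esums.

(** * The modulus of complex numbers *)

Section modulus.
Context {R : realType}.
Local Notation C := (R[i]).
Implicit Types z w : C.

Lemma normc_ge0 z : 0 <= nc z.
Proof. by case: z => a b; rewrite /= sqrtr_ge0. Qed.

Lemma normcD z w : nc (z + w) <= nc z + nc w.
Proof. exact: le_normcD. Qed.

Lemma normcN z : nc (- z) = nc z.
Proof. exact: (@complex.normcN R z). Qed.

Lemma normcB z w : nc (z - w) <= nc z + nc w.
Proof. by rewrite -(normcN w); exact: normcD. Qed.

Lemma normcBC z w : nc (z - w) = nc (w - z).
Proof. by rewrite -normcN opprB. Qed.

Lemma normc_tri z w v : nc (z - v) <= nc (z - w) + nc (w - v).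
Proof. by apply: le_trans (normcD _ _); rewrite addrA subrK. Qed.

Lemma normcC (a : R) : nc (a%:C)%C = `|a|.
Proof. by rewrite /= expr0n/= addr0 sqrtr_sqr. Qed.

Lemma normc0 : nc (0 : C) = 0. Proof. exact: Normc.normc0. Qed.

Lemma normc_sum (I : Type) (s : seq I) (P : pred I) (F : I -> C) :
  nc (\sum_(i <- s | P i) F i) <= \sum_(i <- s | P i) nc (F i).
Proof.
elim/big_rec2: _ => [|i x y _ h]; first by rewrite normc0.
by apply: le_trans (normcD _ _) _; rewrite lerD2l.
Qed.

Lemma normRe_le z : `|complex.Re z| <= nc z.
Proof.
case: z => a b /=; rewrite -(sqrtr_sqr a) ler_wsqrtr// lerDl; exact: sqr_ge0.
Qed.

Lemma normIm_le z : `|complex.Im z| <= nc z.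
Proof.
case: z => a b /=; rewrite -(sqrtr_sqr b) ler_wsqrtr// lerDr; exact: sqr_ge0.
Qed.

Lemma normc_le_ReIm z : nc z <= `|complex.Re z| + `|complex.Im z|.
Proof.
case: z => a b /=.
rewrite -(ler_pXn2r (n := 2)) ?nnegrE ?sqrtr_ge0 ?addr_ge0//.
rewrite sqr_sqrtr ?addr_ge0 ?sqr_ge0// sqrrD !real_normK ?num_real//.
by rewrite -addrA lerD2l lerDr mulrn_wge0// mulr_ge0.
Qed.

End modulus.

(** * Measurability and integrals of unordered sums *)

Section measure_aux.
Context d (T : measurableType d) (R : realType) (mu : {measure set T -> \bar R}).
Local Open Scope ereal_scope.

(** An injection of the index set into the natural numbers turns the unordered sum into a series
    whose terms are sums over fibres, each empty or a single point. The same device gives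
    [integral_esum]. *)
Lemma measurable_esum (I : choiceType) (A : set I) (D : set T) (f : I -> T -> \bar R) :
  countable A -> (forall i x, 0 <= f i x) -> (forall i, A i -> measurable_fun D (f i)) ->
  measurable_fun D (fun x => \esum_(i in A) f i x).
Proof.
move=> /countable_injP[g ginj] f0 mf.
have [g0 E] : (trivIset setT (fun n => [set i | A i /\ g i = n])) /\
    A = \bigcup_n [set i | A i /\ g i = n].
  split; last by apply/seteqP; split => [i Ai|i [n _ []]//]; exists (g i).
  by move=> m n _ _ [i [[_ <-] [_ <-]]].
rewrite (_ : (fun x => _) = (fun x => \sum_(0 <= n <oo | n \in xpredT) (\esum_(i in [set i | A i /\ g i = n]) f i x))); last first.
  apply/funext => x; rewrite {1}E nneseries_sum_bigcup//.
apply: ge0_emeasurable_sum => [k x _ _|k _]; first exact: esum_ge0.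
have [[i [Ai gi]]|/forallNP h] := pselect (exists i, A i /\ g i = k).
  rewrite (_ : [set i | _] = [set i]); last first.
    apply/seteqP; split => [j [Aj gj]|j -> //]/=.
    by apply: ginj; rewrite ?inE// gi gj.
  by under eq_fun do rewrite esum_set1//; exact: mf.
rewrite (_ : [set i | _] = set0); last by apply/seteqP; split => [j /h|].
by under eq_fun do rewrite esum_set0; exact: measurable_cst.
Qed.

Lemma integral_esum (I : choiceType) (A : set I) (D : set T) (f : I -> T -> \bar R) :
  measurable D ->
  countable A -> (forall i x, 0 <= f i x) -> (forall i, A i -> measurable_fun D (f i)) ->
  \int[mu]_(x in D) (\esum_(i in A) f i x) = \esum_(i in A) \int[mu]_(x in D) f i x.
Proof.
move=> mD /countable_injP[g ginj] f0 mf.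
have [g0 E] : (trivIset setT (fun n => [set i | A i /\ g i = n])) /\
    A = \bigcup_n [set i | A i /\ g i = n].
  split; last by apply/seteqP; split => [i Ai|i [n _ []]//]; exists (g i).
  by move=> m n _ _ [i [[_ <-] [_ <-]]].
rewrite [in RHS]E nneseries_sum_bigcup//; last by move=> i; exact: integral_ge0.
under eq_integral do rewrite {1}E nneseries_sum_bigcup//.
have key k : ((exists2 i, A i & [set i | A i /\ g i = k] = [set i]) \/
    [set i | A i /\ g i = k] = set0).
  have [[i [Ai gi]]|/forallNP h] := pselect (exists i, A i /\ g i = k).
    left; exists i => //; apply/seteqP; split => [j [Aj gj]|j -> //]/=.
    by apply: ginj; rewrite ?inE// gi gj.
  by right; apply/seteqP; split => [j /h|].
rewrite integral_nneseries//; last 2 first.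
- move=> k; have [[i Ai ->]| ->] := key k.
    by under eq_fun do rewrite esum_set1//; exact: mf.
  by under eq_fun do rewrite esum_set0; exact: measurable_cst.
- by move=> k x _; exact: esum_ge0.
apply: eq_eseriesr => k _; have [[i Ai ->]| ->] := key k.
  by under eq_integral do rewrite esum_set1//; rewrite esum_set1// integral_ge0.
by under eq_integral do rewrite esum_set0; rewrite esum_set0 integral0.
Qed.

Lemma measurable_overlap (I : choiceType) (A : set I) (B : I -> set T)
    (t : I -> \bar R) : countable A -> (forall i, A i -> measurable (B i)) ->
  (forall i, 0 <= t i) ->
  measurable_fun setT (fun x => \esum_(i in [set i | A i /\ B i x]) t i).
Proof.
move=> cA mB t0.
rewrite (_ : (fun x => _) =
    (fun x => \esum_(i in A) ((cst (t i)) \_ (B i)) x)); last first.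
  apply/funext => x; rewrite (_ : [set i | A i /\ B i x] = A `&` [set i | B i x])//.
  rewrite esum_mkcondr; apply: eq_esum => i Ai.
  by rewrite patchE /=; congr (if _ then _ else _); apply/idP/idP; rewrite !inE.
apply: measurable_esum => // [i x|i Ai].
  by rewrite patchE; case: ifP => //= _; exact: t0.
by apply/(measurable_restrictT _ (mB _ Ai)); exact: measurable_cst.
Qed.

Lemma integral_overlap (I : choiceType) (A : set I) (B : I -> set T)
    (t : I -> \bar R) : countable A -> (forall i, A i -> measurable (B i)) ->
  (forall i, 0 <= t i) ->
  \int[mu]_x (\esum_(i in [set i | A i /\ B i x]) t i) =
  \esum_(i in A) (t i * mu (B i)).
Proof.
move=> cA mB t0.
have E x : \esum_(i in [set i | A i /\ B i x]) t i = \esum_(i in A) ((cst (t i)) \_ (B i)) x.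
  rewrite (_ : [set i | A i /\ B i x] = A `&` [set i | B i x])//.
  rewrite esum_mkcondr; apply: eq_esum => i Ai.
  by rewrite patchE /=; congr (if _ then _ else _); apply/idP/idP; rewrite !inE.
under eq_integral do rewrite E.
rewrite integral_esum//; last 2 first.
- by move=> i x; rewrite patchE; case: ifP => //= _; exact: t0.
- move=> i Ai.
  by apply/(measurable_restrictT _ (mB _ Ai)); exact: measurable_cst.
by apply: eq_esum => i Ai; rewrite -integral_mkcond integral_cst//; exact: mB.
Qed.

(** At most N sets meet at a point, so the power of the sum is replaced pointwise by the sum of the
    powers, to which [integral_overlap] applies. *)
Lemma integral_overlap_pow (I : choiceType) (A : set I) (B : I -> set T)
    (t : I -> \bar R) (N b p : R) :
  (0 < p)%R -> (0 <= N)%R -> (0 <= b)%R ->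
  countable A -> (forall i, A i -> measurable (B i)) ->
  (forall i, 0 <= t i) -> (forall i, A i -> mu (B i) <= b%:E) ->
  (forall x, \esum_(i in [set i | A i /\ B i x]) 1 <= N%:E) ->
  \int[mu]_x ((\esum_(i in [set i | A i /\ B i x]) t i) `^ p) <=
  (N `^ p * b)%:E * \esum_(i in A) t i `^ p.
Proof.
move=> p0 N0 b0 cA mB t0 Bb BN.
apply: (@le_trans _ _ (\int[mu]_x ((N `^ p)%:E * \esum_(i in [set i | A i /\ B i x]) t i `^ p))).
  apply: ge0_le_integral => //.
  - by move=> x _; exact: poweR_ge0.
  - apply: (measurableT_comp (measurable_poweR p)).
    exact: measurable_overlap.
  - apply: measurable_funeM; apply: measurable_overlap => // i.
    exact: poweR_ge0.
  - by move=> x _; exact: esum_pow_count.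
rewrite ge0_integralZl ?lee_fin ?powR_ge0//; last 2 first.
- by apply: measurable_overlap => // i; exact: poweR_ge0.
- by move=> x _; apply: esum_ge0 => i _; exact: poweR_ge0.
rewrite integral_overlap//; last by move=> i; exact: poweR_ge0.
rewrite EFinM -muleA lee_wpmul2l ?lee_fin ?powR_ge0//.
rewrite -esumZl//; last by move=> i _; exact: poweR_ge0.
apply: le_esum => i Ai; rewrite muleC lee_wpmul2r ?poweR_ge0//.
exact: Bb.
Qed.

Lemma esum_measure_le (I : choiceType) (A : set I) (B : I -> set T) (E : set T) :
  measurable E ->
  (forall i, A i -> measurable (B i)) -> (forall i, A i -> B i `<=` E) ->
  trivIset A B -> \esum_(i in A) mu (B i) <= mu E.
Proof.
move=> mE mB BE tB; apply: ge_ereal_sup => _ [X [finX XA] <-].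
rewrite fsbig_finite//= -measure_fbigsetU; last 2 first.
- by move=> i; rewrite in_fset_set// inE => /XA/mB.
- by rewrite fset_setK//; apply: sub_trivIset XA tB.
apply: le_measure; rewrite ?inE//.
  by rewrite -bigcup_fset; apply: fin_bigcup_measurable => // i;
    rewrite /= in_fset_set// inE => /XA/mB.
rewrite -bigcup_fset => x [j].
by rewrite /= in_fset_set// inE => /XA/BE h /h.
Qed.

End measure_aux.

Lemma esum1_finite (R : realType) (I : choiceType) (A : set I) (N : R) :
  (\esum_(i in A) (1%:E : \bar R) <= N%:E)%E -> finite_set A.
Proof.
move=> AN; apply: contrapT => infA.
have card_le (n : nat) : exists2 B : set I, fsets A B & (n%:R%:E <= \sum_(i \in B) (1%:E : \bar R))%E.
  have [B BA nB] := infinite_set_fset n infA.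
  exists [set` B]; first by split.
  rewrite fsbig_finite//= set_fsetK sumEFin big_const_seq count_predT iter_addr_0.
  by rewrite lee_fin ler_nat.
have [n Nn] : exists n : nat, N < n%:R.
  exists (Num.bound `|N|); rewrite (le_lt_trans (ler_norm _))//.
  exact: archi_boundP.
suff : (N%:E < \esum_(i in A) (1%:E : \bar R))%E by rewrite ltNge AN.
apply: (@lt_le_trans _ _ n%:R%:E); first by rewrite lte_fin.
by apply: esum_ge; exact: card_le.
Qed.

(** * Ahlfors regularity at the scales of the nonnegative levels *)

Section regular.
Context {R : realType} {T : pmetricType R}.
Implicit Types (m : {outer_measure set T -> \bar R}) (D : R).

(** Radii are no longer compared with the diameter. The lower bound is asked for radii at most 1,
    those of the levels from 0 on; the upper bound also serves enlarged balls of any radius, even in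
    a bounded space. *)
Definition regular_space D m : Prop :=
  [/\ 0 < D, metric_measure_space m & exists2 C : R, 0 < C &
    (forall (x : T) (r : R), 0 < r -> (m (ball x r) <= (C * r `^ D)%:E)%E) /\
    (forall (x : T) (r : R), 0 < r <= 1 -> ((r `^ D)%:E <= C%:E * m (ball x r))%E)].

(** Two distinct points make the diameter positive. On a one point space Ahlfors regularity is
    vacuous, while the upper bound would fail at small radii. *)
Lemma ahlfors_regular_space D m : 0 < D -> metric_measure_space m ->
  ahlfors_regular D m -> (exists x y : T, x <> y) -> regular_space D m.
Proof.
move=> D0 mm [C [C0 HC]] [x0 [y0 xy0]]; split => //.
have dxy : ((mdist x0 y0)%:E <= diam [set: T])%E.
  by apply: ereal_sup_ubound; exists (x0, y0).
have d0 : 0 < mdist x0 y0 by rewrite mdist_gt0; apply/eqP.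
have [doo|dfin] := eqVneq (diam [set: T]) +oo%E.
  exists C => //; split => x r.
    by move=> r0; have /andP[] := HC x r r0 (eq_ind_r (fun z => r%:E < z)%E (ltry r) doo).
  move=> /andP[r0 _].
  have /andP[+ _] := HC x r r0 (eq_ind_r (fun z => r%:E < z)%E (ltry r) doo).
  by rewrite EFinM lee_pdivrMl.
pose del := fine (diam [set: T]).
have dE : diam [set: T] = del%:E.
  rewrite /del fineK// fin_numE dfin andbT.
  by apply/negP => /eqP h; move: dxy; rewrite h leeNy_eq.
have del0 : 0 < del by rewrite -lte_fin -dE (lt_le_trans _ dxy)// lte_fin.
have Mfin := mm.2 point _ (mulr_gt0 (ltr0Sn _ 1) del0 : 0 < 2%:R * del).
have le_del (x y : T) : mdist x y <= del.
  by rewrite -lee_fin -dE; apply: ereal_sup_ubound; exists (x, y).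
have ballT : ball (point : T) (2%:R * del) = setT.
  apply/seteqP; split => // y _; rewrite ballEmdist/=.
  by apply: le_lt_trans (le_del _ _) _; rewrite ltr_pMl// ltr1n.
rewrite ballT in Mfin.
have mT : m setT = (fine (m setT))%:E.
  by rewrite fineK// ge0_fin_numE; case/andP: Mfin => // /ltW.
set M := fine (m setT) in mT.
have M0 : 0 < M by rewrite -lte_fin -mT; case/andP: Mfin.
have dD : 0 < del `^ D by exact: powR_gt0.
have hD : 0 < (del / 2) `^ D by rewrite powR_gt0// divr_gt0.
(* For diameter [del], the middle term gives the lower bound at radii from [del] up to 1, through
   the ball of radius [del / 2]; the last one gives the upper bound at radii from [del] on, through
   the total mass M. *)
pose C' := C + C / (del / 2) `^ D + M / del `^ D.
have C1 : C <= C' by rewrite /C' -addrA lerDl addr_ge0 ?divr_ge0 ?ltW.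
have C2 : C / (del / 2) `^ D <= C'.
  by rewrite /C' addrAC lerDr addr_ge0 ?divr_ge0 ?ltW.
have C3 : M / del `^ D <= C' by rewrite /C' lerDr addr_ge0 ?divr_ge0 ?ltW.
exists C'; first exact: lt_le_trans C1.
split => [x r r0|x r /andP[r0 r1]].
  have [rd|dr] := ltP r del.
    have /andP[_] := HC x r r0 (eq_ind_r (fun z => r%:E < z)%E (rd : r%:E < del%:E)%E dE).
    move=> /le_trans; apply; rewrite lee_fin ler_wpM2r// powR_ge0//.
  apply: le_trans (le_outer_measure _ _ _ (@subsetT _ _)) _.
  rewrite mT lee_fin; apply: (@le_trans _ _ (M / del `^ D * r `^ D)).
    rewrite -[leLHS](@divfK _ (del `^ D)) ?gt_eqF// ler_wpM2l ?divr_ge0 ?(ltW M0) ?(ltW dD)//.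
    by apply: ge0_ler_powR; rewrite ?nnegrE// ltW.
  by rewrite ler_wpM2r// powR_ge0.
have [rd|dr] := ltP r del.
  have /andP[+ _] := HC x r r0 (eq_ind_r (fun z => r%:E < z)%E (rd : r%:E < del%:E)%E dE).
  rewrite EFinM lee_pdivrMl// => h; apply: le_trans h _.
  by rewrite lee_wpmul2r.
have h2 : 0 < del / 2 by rewrite divr_gt0.
have hd : del / 2 < del by rewrite ltr_pdivrMr// ltr_pMr// ltr1n.
have /andP[+ _] := HC x (del / 2) h2 (eq_ind_r (fun z => (del / 2)%:E < z)%E (hd : (del / 2)%:E < del%:E)%E dE).
move=> h; apply: (@le_trans _ _ 1%:E).
  rewrite lee_fin [leRHS](_ : _ = 1 `^ D); last by rewrite powR1.
  by apply: ge0_ler_powR; rewrite ?nnegrE// ltW.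
apply: (@le_trans _ _ ((C / (del / 2) `^ D)%:E * m (ball x (del / 2)))%E); last first.
  apply: lee_pmul => //; first by rewrite lee_fin divr_ge0 ?ltW.
  apply: le_outer_measure; apply: le_ball; apply: le_trans dr; exact: ltW.
rewrite -lee_pdivrMl ?divr_gt0// mule1; apply: le_trans h.
by rewrite lee_fin invf_div mulrC.
Qed.

Lemma ball_open_metric (x : T) (r : R) : open (ball x r).
Proof.
rewrite openE => y; rewrite ballEmdist/= => xy; rewrite /interior -nbhs_ballE.
exists (r - mdist x y) => /=; first by rewrite subr_gt0.
move=> z; rewrite !ballEmdist/= => yz.
by apply: le_lt_trans (metric_triangle x y z) _; rewrite -ltrBrDl.
Qed.

Section with_measure.
Context (m : {outer_measure set T -> \bar R}).
Hypothesis mm : metric_measure_space m.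

Lemma measurable_open_c (U : set T) : open U ->
  measurable (U : set (caratheodory_type m)).
Proof. by move=> oU; exact: mm.1.1. Qed.

Lemma measurable_ball_c (x : T) (r : R) :
  measurable (ball x r : set (caratheodory_type m)).
Proof. by apply: measurable_open_c; exact: ball_open_metric. Qed.

End with_measure.
End regular.

(** * Geometry of the filling at nonnegative levels *)

Section filling_geometry.
Context {R : realType} {T : pmetricType R} (W : filling T).
Local Notation V := (vertex W).

Definition rad (n : nat) : R := 2 ^- n.

Lemma rad_gt0 n : 0 < rad n. Proof. by rewrite /rad invr_gt0 exprn_gt0. Qed.
Hint Resolve rad_gt0 : core.

Lemma rad_ge0 n : 0 <= rad n. Proof. exact: ltW. Qed.

Lemma rad_neq0 n : rad n != 0. Proof. by rewrite gt_eqF. Qed.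

Lemma radE n : rad n = 2 `^ (- n%:R). Proof. by rewrite e2_oppnat. Qed.

Lemma radS n : rad n = 2 * rad n.+1.
Proof. by rewrite /rad exprS invfM mulrA mulfV ?mul1r. Qed.

Lemma rad0 : rad 0 = 1. Proof. by rewrite /rad expr0 invr1. Qed.

Lemma radD n k : rad (n + k) = rad n * rad k.
Proof. by rewrite /rad exprD invfM. Qed.

Lemma rad_le n k : (n <= k)%N -> rad k <= rad n.
Proof. by move=> nk; rewrite !radE e2_le// lerN2 ler_nat. Qed.

Lemma rad_le1 n : rad n <= 1. Proof. by rewrite -rad0 rad_le. Qed.

Lemma rad_pow n D : rad n `^ D = 2 `^ (- (n%:R * D)).
Proof. by rewrite radE -powRrM mulNr. Qed.

Definition lev (n : nat) : set V := [set x | level x = n%:Z].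

Lemma lev_rad n x : lev n x -> 2 ^ (- level x) = rad n.
Proof. by move=> ->; rewrite /rad exprnN. Qed.

Lemma vballE n x xi : lev n x -> vball x xi <-> mdist (center x) xi < rad n.
Proof. by move=> xn; rewrite /vball (lev_rad xn) ballEmdist. Qed.

Lemma lev_inj n k x : lev n x -> lev k x -> n = k.
Proof. by rewrite /lev/= => -> []. Qed.

Definition nearv (K : R) (n : nat) (xi : T) : set V :=
  [set x | lev n x /\ mdist (center x) xi < K * rad n].

Lemma lev_sep n x y : lev n x -> lev n y -> x <> y ->
  rad n.+1 <= mdist (center x) (center y).
Proof.
move=> xn yn xy; have := @center_dist _ _ W x y; rewrite xn yn => /(_ erefl xy).
by rewrite -opprD -PoszD addn1 /rad exprnN.
Qed.

(** By maximality: an uncovered point could be added to the separated set of centers. The radius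
    obtained is half that of the vertex balls, so that a whole ball around xi still fits into one
    vertex ball. *)
Lemma lev_cover n xi : exists2 x, lev n x & mdist (center x) xi < rad n.+1.
Proof.
apply: contrapT => h.
have h' x : lev n x -> rad n.+1 <= mdist (center x) xi.
  by move=> xn; rewrite leNgt; apply/negP => hx; apply: h; exists x.
have rE : 2 ^ (- n%:Z - 1) = rad n.+1.
  by rewrite -opprD -PoszD addn1 /rad exprnN.
have := @center_max _ _ W n%:Z (xi |` (@center _ _ W @` [set x | level x = n%:Z])).
rewrite rE => H.
have /seteqP[+ _] : xi |` (@center _ _ W @` [set x | level x = n%:Z]) =
    @center _ _ W @` [set x | level x = n%:Z].
  apply: H; last by move=> y; right.
  move=> y z [->|[x xn <-]] [->|[x' xn' <-]] // yz.
  - by rewrite metric_sym; exact: h'.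
  - exact: h'.
  - by apply: (lev_sep xn xn') => xx'; apply: yz; rewrite xx'.
move=> /(_ xi (or_introl erefl)) [x xn xxi].
by have := h' x xn; rewrite xxi mdistxx leNgt rad_gt0.
Qed.

Lemma lev_cover_vball n xi : exists2 x, lev n x & vball x xi.
Proof.
have [x xn h] := lev_cover n xi; exists x => //; apply/(vballE _ xn).
by apply: lt_le_trans h _; exact: rad_le.
Qed.

Definition elev (n : nat) : set (V * V) := [set e | edge e /\ elevel e = n%:Z].

Lemma elev_levels n e : elev n e ->
  (lev n e.1 /\ (lev n e.2 \/ lev n.+1 e.2)).
Proof.
move=> [eE]; rewrite /elevel/lev/= => en.
have [_ h _] := edge_adjacent eE; have := edge_level eE.
move: h en; case: (eqVneq (level e.1) (level e.2)) => [->|/eqP ne] h en.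
  by move=> _; move: en; rewrite minxx => ->; split => //; left.
move=> /(_ ne) lt; move: en; rewrite min_l ?ltW// => en; split => //; right.
by move: h lt; rewrite en; lia.
Qed.

Lemma vball_diam n x y xi eta : lev n x -> (lev n y \/ lev n.+1 y) ->
  vball x `&` vball y !=set0 -> (vball x `|` vball y) xi ->
  (vball x `|` vball y) eta -> mdist xi eta < 4 * rad n.
Proof.
move=> xn yn [z [/(vballE _ xn) xz yz]].
have yB t : vball y t -> mdist (center y) t < rad n.
  case: yn => yn /(vballE _ yn)// h; apply: lt_le_trans h _; exact: rad_le.
have {}yz := yB _ yz; have r0 := rad_gt0 n.
have T2 := @metric_triangle R T; have S := @metric_sym R T.
move=> [/(vballE _ xn)|/yB] h1 [/(vballE _ xn)|/yB] h2.
- have := T2 xi (center x) eta; rewrite (S xi (center x)); lra.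
- have := T2 xi (center x) eta; have := T2 (center x) z eta.
  have := T2 z (center y) eta; rewrite (S xi (center x)) (S z (center y)); lra.
- have := T2 xi (center y) eta; have := T2 (center y) z eta.
  have := T2 z (center x) eta; rewrite (S xi (center y)) (S z (center x)); lra.
- have := T2 xi (center y) eta; rewrite (S xi (center y)); lra.
Qed.

Lemma elev_near n e xi : elev n e -> eball e xi ->
  mdist (center e.1) xi < 4 * rad n /\ mdist (center e.2) xi < 4 * rad n.
Proof.
move=> en exi; have [e1 e2] := elev_levels en.
have [_ _ I] := edge_adjacent en.1.
have c1 : eball e (center e.1) by left; apply/(vballE _ e1); rewrite mdistxx.
have c2 : eball e (center e.2).
  by right; case: e2 => e2; apply/(vballE _ e2); rewrite mdistxx.
by split; apply: (vball_diam e1 e2 I).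
Qed.

(** Vertices whose balls share a point and whose levels differ by at most one are equal or adjacent;
    taking the modulus removes the dependence on the orientation of the edge. *)
Lemma edge_osc n (u : V -> R[i]) x x' xi : lev n x ->
  (lev n x' \/ lev n.+1 x') -> vball x xi -> vball x' xi ->
  x = x' \/ exists e, [/\ elev n e, eball e xi &
    Normc.normc (u x' - u x) = Normc.normc (du u e)].
Proof.
move=> xn x'n xxi x'xi; have [->|/eqP ne] := eqVneq x x'; [by left|right].
have adj : adjacent x x'.
  split => //; last by exists xi.
  by case: x'n => x'n; rewrite xn x'n; lia.
have [e|e] := edge_total adj.
  exists (x, x'); split => //; last by left.
  split => //; rewrite /elevel/= xn.
  by case: x'n => ->; rewrite ?minxx// min_l// lez_nat.
exists (x', x); split => //.
- split => //; rewrite /elevel/= xn.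
  by case: x'n => ->; rewrite ?minxx// min_r// lez_nat.
- by right.
- by rewrite /du/= normcBC.
Qed.

End filling_geometry.
#[global] Hint Resolve rad_gt0 : core.

(** * Bounded overlap of vertices and edges *)

Section counting.
Context {R : realType} {T : pmetricType R} (m : {outer_measure set T -> \bar R}).
Context (D : R) (W : filling T).
Hypothesis Hm : regular_space D m.
Local Notation V := (vertex W).
Local Open Scope ereal_scope.

Let mm : metric_measure_space m. Proof. by case: Hm. Qed.
Let D0 : (0 < D)%R. Proof. by case: Hm. Qed.

(** Packing by volume. The exact power D of the ratio of scales is kept, since it decides which
    decay survives in [tail_sum_pow]. *)
Lemma lev_count : exists2 C : R, (0 < C)%R & forall n xi rho, (rad n <= rho)%R ->
  \esum_(x in [set x : V | lev n x /\ (mdist (center x) xi < rho)%R]) 1 <=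
    (C * (rho / rad n) `^ D)%:E.
Proof.
case: Hm => _ _ [C C0 [Cu Cl]].
exists (C * C * 8 `^ D)%R; first by rewrite !mulr_gt0// powR_gt0.
move=> n xi rho hrho; set A := [set x | _].
have rn := @rad_gt0 R n.
have rho0 : (0 < rho)%R by exact: lt_le_trans hrho.
(* Centers of level n are at distance at least [rad n / 2], so balls of a quarter of the radius are
   disjoint. *)
set r : R := (rad n / 4)%R.
have r0 : (0 < r)%R by rewrite divr_gt0.
have r1 : (r <= 1)%R by rewrite ler_pdivrMr// mul1r (le_trans (rad_le1 n))// ler1n.
have rD : (0 < r `^ D)%R by exact: powR_gt0.
have H1 : \esum_(x in A) m (ball (center x) r) <= m (ball xi (2 * rho)).
  apply: (@esum_measure_le _ _ _ (cmeasure m)).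
  - exact: measurable_ball_c.
  - by move=> i _; exact: measurable_ball_c.
  - move=> x [xn xd] y; rewrite !ballEmdist/= => h.
    have := metric_triangle xi (center x) y; rewrite (metric_sym xi (center x)).
    have : (r <= rho)%R by apply: le_trans hrho; rewrite ler_pdivrMr// ler_peMr ?(ltW rn)// ler1n.
    lra.
  - move=> x y [xn _] [yn _] [z []]; rewrite !ballEmdist/= => h1 h2.
    apply: contrapT => xy; have := lev_sep xn yn xy.
    have := metric_triangle (center x) z (center y); rewrite (metric_sym z (center y)).
    by have := @radS R n; rewrite /r in h1 h2; lra.
have H2 : \esum_(x in A) 1 <= (C / r `^ D)%:E * \esum_(x in A) m (ball (center x) r).
  rewrite -esumZl ?divr_ge0 ?(ltW C0) ?(ltW rD)//.
  apply: le_esum => x _; rewrite mulrC EFinM -muleA -lee_pdivrMl ?invr_gt0//.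
  by rewrite invrK mule1; apply: Cl; rewrite r0.
apply: le_trans H2 _.
apply: (@le_trans _ _ ((C / r `^ D)%:E * (C * (2 * rho) `^ D)%:E)).
  rewrite lee_wpmul2l ?lee_fin ?divr_ge0 ?(ltW C0) ?(ltW rD)//.
  by apply: le_trans H1 _; apply: Cu; rewrite mulr_gt0.
rewrite -EFinM lee_fin le_eqVlt; apply/orP; left; apply/eqP.
rewrite /r !powRM ?divr_ge0 ?invr_ge0 ?(ltW rho0) ?(ltW rn)//.
rewrite (_ : 8 = 2 * 4 :> R)%R; last by ring.
rewrite powRM// !powRVl ?(ltW rn)//; field.
by rewrite !gt_eqF// powR_gt0.
Qed.

Lemma nearv_count (K : R) : (1 <= K)%R -> exists2 N : R, (1 <= N)%R &
  forall n xi, \esum_(x in @nearv _ _ W K n xi) 1 <= N%:E.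
Proof.
move=> K1; have [C C0 HC] := lev_count.
exists (Num.max 1 (C * K `^ D))%R; first by rewrite le_max lexx.
move=> n xi.
have := HC n xi (K * rad n)%R; rewrite ler_peMl ?rad_ge0// => /(_ isT).
rewrite mulfK ?rad_neq0// => /le_trans; apply.
by rewrite lee_fin le_max lexx orbT.
Qed.

Lemma nearv_finite K n xi : finite_set (@nearv _ _ W K n xi).
Proof.
have K1 : (1 <= Num.max 1 K)%R by rewrite le_max lexx.
have [N _ HN] := nearv_count K1; have := HN n xi.
move=> /esum1_finite; apply: sub_finite_set => x [xn xd]; split => //.
by apply: lt_le_trans xd _; rewrite ler_wpM2r ?rad_ge0// le_max lexx orbT.
Qed.

Lemma lev_countable n : countable (@lev _ _ W n).
Proof.
have -> : @lev _ _ W n = \bigcup_k (@nearv _ _ W k%:R n point).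
  apply/seteqP; split => [x xn|x [k _ []]//].
  pose y := (mdist (center x) point / rad n)%R.
  exists (Num.bound y) => //; split => //.
  rewrite -ltr_pdivrMr ?rad_gt0//; apply: archi_boundP.
  by rewrite divr_ge0 ?rad_ge0// mdist_ge0.
apply: bigcup_countable => // k _; apply: finite_set_countable.
exact: nearv_finite.
Qed.

Lemma elev_countable n : countable (@elev _ _ W n).
Proof.
set A : set V := @lev _ _ W n `|` @lev _ _ W n.+1.
have cA : countable A.
  rewrite (_ : A = \bigcup_(i in [set n; n.+1]) @lev _ _ W i).
    by apply: bigcup_countable => // i _; exact: lev_countable.
  apply/seteqP; split => x; first by move=> [h|h]; [exists n|exists n.+1] => //=; [left|right].
  by move=> [k [->|->]]; [left|right].
have [f fi] := countable_injP _ cA.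
have inA e : @elev _ _ W n e -> A e.1 /\ A e.2.
  by move=> /elev_levels[h [h'|h']]; split; [left|left|left|right].
have : countable (A `*` A).
  apply/countable_injP; exists (fun e => CodeSeq.code [:: f e.1; f e.2]).
  move=> [x1 y1] [x2 y2]; rewrite !inE => -[h1 h2] [h3 h4] /(can_inj CodeSeq.codeK).
  case=> /fi e1 /fi e2; congr pair; first by apply: e1; rewrite inE.
  by apply: e2; rewrite inE.
by apply: sub_countable; apply: subset_card_le => e /inA.
Qed.

Definition neare (K : R) (n : nat) (xi : T) : set (V * V) :=
  [set e | elev n e /\ (mdist (center e.1) xi < K * rad n)%R].

Lemma elev_neare n e xi : elev n e -> eball e xi -> neare 4 n xi e.
Proof. by move=> en h; split => //; have [] := elev_near en h. Qed.

Lemma neare_count (K : R) : (1 <= K)%R -> exists2 N : R, (1 <= N)%R &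
  forall n xi, \esum_(e in neare K n xi) 1 <= N%:E.
Proof.
(* The endpoint [e.2] is within [4 * rad n] of [e.1] and may have level n.+1, where the unit of
   length is halved: hence the double of K + 4. *)
move=> K1; have K41 : (1 <= 2 * (K + 4))%R by lra.
have [N N1 HN] := nearv_count K41.
have N0 : (0 <= N)%R by exact: le_trans N1.
exists ((N + N) * (N + N))%R.
  nra.
move=> n xi; set A := @nearv _ _ W (2 * (K + 4)) n xi `|` @nearv _ _ W (2 * (K + 4)) n.+1 xi.
have HA : \esum_(e in A) 1 <= (N + N)%:E.
  by apply: le_trans (esumU_le _) _ => //; rewrite EFinD leeD.
apply: (@le_trans _ _ (\esum_(e in A `*`` (fun=> A)) 1)).
  apply: esum_le_subset => // e [en d1].
  have rn := @rad_gt0 R n; have r1 := @radS R n.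
  have c1 : eball e (center e.1).
    by left; have [h _] := elev_levels en; apply/(vballE _ h); rewrite mdistxx.
  have [_ d2] := elev_near en c1.
  have := metric_triangle (center e.2) (center e.1) xi => d3.
  have [h1 h2] := elev_levels en; split => /=.
    by left; split => //; nra.
  by case: h2 => h2; [left|right]; split => //; nra.
rewrite -(@esum_esum _ _ _ A (fun=> A) (fun _ _ => 1))//.
apply: (@le_trans _ _ (\esum_(i in A) ((N + N)%:E * 1))).
  by apply: le_esum => i _; rewrite mule1.
rewrite esumZl//; last by rewrite addr_ge0.
by rewrite EFinM lee_wpmul2l ?lee_fin ?addr_ge0.
Qed.

End counting.

Lemma measurable_loclip (R : realType) (T : pmetricType R)
    (m : {outer_measure set T -> \bar R}) (phi : T -> R) :
  metric_measure_space m ->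
  (forall xi, exists r K : R, [/\ 0 < r, 0 <= K & forall eta, mdist xi eta < r ->
    `|phi xi - phi eta| <= K * mdist xi eta]) ->
  measurable_fun [set: caratheodory_type m] (phi : caratheodory_type m -> R).
Proof.
move=> mm H; apply: (measurability _ (RGenOInfty.measurableE R)).
move=> _ [_ [a ->] <-]; rewrite setTI; apply: (measurable_open_c mm).
rewrite openE => xi; rewrite /= in_itv/= andbT => axi.
rewrite /interior -nbhs_ballE.
have [r [K [r0 K0 HK]]] := H xi.
have e0 : 0 < (phi xi - a) / (K + 1) by rewrite divr_gt0 ?subr_gt0// ltr_wpDl.
exists (Num.min r ((phi xi - a) / (K + 1))) => /=; first by rewrite lt_min r0.
move=> eta; rewrite ballEmdist/= lt_min => /andP[h1 h2]; rewrite /= in_itv/= andbT.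
have K1 : 0 < K + 1 by rewrite ltr_wpDl.
move: h2; rewrite (ltr_pdivlMr _ _ K1) => h2.
have := HK eta h1; rewrite ler_norml => /andP[_ h3].
have := mdist_ge0 xi eta => h4; nra.
Qed.

Lemma esum_le_count (R : realType) (I : choiceType) (A : set I) (a : I -> \bar R)
    (x : \bar R) (N : R) : (0 < N) -> (0 <= x)%E -> (forall i, A i -> a i <= x)%E ->
  (\esum_(i in A) (1%:E : \bar R) <= N%:E)%E -> (\esum_(i in A) a i <= N%:E * x)%E.
Proof.
move=> N0 x0 ax AN; case: x x0 ax => [x|_ _|//].
  rewrite lee_fin => x0 ax; apply: le_trans (le_esum ax) _.
  under eq_esum do rewrite -[x%:E]mule1.
  by rewrite esumZl// muleC lee_wpmul2r ?lee_fin.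
by rewrite gt0_muley ?leey// lte_fin.
Qed.

Lemma poweRD_le (R : realType) (x y : \bar R) (p : R) : 0 < p ->
  (0 <= x -> 0 <= y -> (x + y) `^ p <= (2 `^ p)%:E * (x `^ p + y `^ p))%E.
Proof.
move=> p0 x0 y0; wlog xy : x y x0 y0 / (x <= y)%E.
  move=> h; have [/h|/ltW/h] := leP x y; first by apply.
  by rewrite addeC [X in (_ * X)%E]addeC; apply.
apply: (@le_trans _ _ ((2%:E * y) `^ p)%E).
  apply: poweR_le; rewrite ?(ltW p0) ?adde_ge0//.
  rewrite (_ : 2%:E = 1%:E + 1%:E)%E; last by rewrite -EFinD.
  by rewrite ge0_muleDl ?lee_fin// mul1e leeD2r.
rewrite poweRM ?lee_fin// poweR_EFin lee_wpmul2l ?lee_fin ?powR_ge0//.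
by rewrite leeDr// poweR_ge0.
Qed.

(** * The smoothings of a vertex function *)

Section averaging_operator.
Context {R : realType} {T : pmetricType R} (m : {outer_measure set T -> \bar R}).
Context (D : R) (W : filling T).
Hypothesis Hm : regular_space D m.
Local Notation V := (vertex W).
Implicit Types (u : V -> R[i]) (n : nat) (xi eta : T).

Definition Tn n u xi : R[i] := \sum_(x \in lev n) u x * (pou x xi)%:C%C.

Definition fnear (K : R) n xi : {fset V} := fset_set (@nearv _ _ W K n xi).

Lemma in_fnear K n xi x : x \in fnear K n xi -> lev n x /\ mdist (center x) xi < K * rad n.
Proof.
by rewrite /fnear in_fset_set ?inE//; exact: (nearv_finite _ Hm).
Qed.

Lemma pou_far K n xi eta (x : V) : mdist xi eta <= (K - 1) * rad n -> lev n x ->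
  ~ nearv K n xi x -> pou x eta = 0.
Proof.
move=> d xn xf; apply/eqP; apply: contra_notT xf => /pou_supp /(vballE _ xn) h.
split => //; have := metric_triangle (center x) eta xi.
by rewrite (metric_sym eta xi); lra.
Qed.

Lemma Tn_fset K n u xi eta : mdist xi eta <= (K - 1) * rad n ->
  Tn n u eta = \sum_(x <- fnear K n xi) u x * (pou x eta)%:C%C.
Proof.
move=> d; rewrite /Tn -(@fsbig_widen _ _ _ _ (nearv K n xi)).
- by rewrite fsbig_finite//; exact: (nearv_finite _ Hm).
- by move=> x [].
- by move=> x [/= xn xf]; rewrite (pou_far d xn xf) mulr0.
Qed.

Lemma pou_sum_fset K n xi eta : mdist xi eta <= (K - 1) * rad n ->
  \sum_(x <- fnear K n xi) pou x eta = 1.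
Proof.
move=> d; have := @pou_sum _ _ W n%:Z eta.
rewrite (esumID (nearv K n xi)); last first.
  by move=> x _; rewrite lee_fin; have /andP[] := pou_range x eta.
rewrite [X in (_ + X)%E]esum1 ?adde0; last first.
  by move=> x [xn xf]; rewrite (pou_far d xn xf).
rewrite (_ : _ `&` _ = nearv K n xi); last first.
  by apply/seteqP; split => [x []//|x h]; split => //; case: h.
rewrite esum_fset; last 2 first.
- exact: (nearv_finite _ Hm).
- by move=> x _; rewrite lee_fin; have /andP[] := pou_range x eta.
rewrite fsbig_finite/=; last exact: (nearv_finite _ Hm).
by rewrite sumEFin => -[].
Qed.

Lemma Tn_sub K n u xi eta c : mdist xi eta <= (K - 1) * rad n ->
  Tn n u eta - c = \sum_(x <- fnear K n xi) (u x - c) * (pou x eta)%:C%C.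
Proof.
move=> d; rewrite (Tn_fset u d).
under [RHS]eq_bigr do rewrite mulrBl.
rewrite big_split/= sumrN -mulr_sumr; congr (_ - _).
rewrite -[in LHS](mulr1 c); congr (_ * _).
by rewrite -(rmorph_sum (real_complex R)) (pou_sum_fset d).
Qed.

(** The smoothing at xi is a convex combination of the values at the vertices whose balls contain
    xi, so it is as close to c as these values are. Most later pointwise estimates apply this with c
    a value of u, a partial sum or 0. *)
Lemma Tn_osc n u c (M : R) xi :
  (forall x, lev n x -> vball x xi -> nc (u x - c) <= M) -> nc (Tn n u xi - c) <= M.
Proof.
move=> h; have d : mdist xi xi <= (1 - 1) * rad n by rewrite subrr mul0r mdistxx.
rewrite (Tn_sub u c d); apply: le_trans (normc_sum _ _ _) _.
rewrite -[leRHS]mulr1 -[X in _ <= M * X](pou_sum_fset d) mulr_sumr.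
rewrite big_seq [leRHS]big_seq; apply: ler_sum => x /in_fnear[xn xd].
rewrite Normc.normcM normcC; have /andP[p0 _] := pou_range x xi.
rewrite ger0_norm// ler_wpM2r// h//; apply/(vballE _ xn).
by rewrite mul1r in xd.
Qed.

(** Since the partition functions add up to 1 at both points, c may be subtracted from all values.
    Only a bounded number of vertices whose balls contain one of the points then contribute, each
    with a Lipschitz constant of order 2^n. *)
Lemma Tn_lip : exists2 C : R, 0 <= C & forall n u c (M : R) xi eta,
  mdist xi eta <= rad n ->
  (forall x, lev n x -> (vball x xi \/ vball x eta) -> nc (u x - c) <= M) ->
  nc (Tn n u xi - Tn n u eta) <= C * (2 ^+ n * mdist xi eta) * M.
Proof.
have [L HL] := pou_lip W; have [N N1 HN] := nearv_count W Hm (ler1n _ 2).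
exists (`|L| * N); first by rewrite mulr_ge0// (le_trans _ N1).
move=> n u c M xi eta d h.
have M0 : 0 <= M.
  have [x xn xxi] := lev_cover_vball W n xi.
  by apply: le_trans (h x xn (or_introl xxi)); exact: normc_ge0.
have d1 : mdist xi eta <= (2 - 1) * rad n by lra.
have d0 : mdist xi xi <= (2 - 1) * rad n by rewrite mdistxx; have := @rad_ge0 R n; lra.
have dd := mdist_ge0 xi eta.
rewrite (_ : Tn n u xi - Tn n u eta = (Tn n u xi - c) - (Tn n u eta - c)); last first.
  by rewrite opprB addrA subrK.
rewrite (Tn_sub u c d0) (Tn_sub u c d1).
rewrite -sumrB; apply: le_trans (normc_sum _ _ _) _.
apply: (@le_trans _ _ (\sum_(x <- fnear 2 n xi) `|L| * (2 ^+ n * mdist xi eta) * M)).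
  rewrite big_seq [leRHS]big_seq; apply: ler_sum => x /in_fnear[xn xd].
  rewrite -mulrBr -rmorphB/= Normc.normcM normcC.
  have [z|nz] := pselect (vball x xi \/ vball x eta); last first.
    have -> : pou x xi = 0.
      by apply/eqP; apply: contra_notT nz => /pou_supp; left.
    have -> : pou x eta = 0.
      by apply/eqP; apply: contra_notT nz => /pou_supp; right.
    by rewrite subrr normr0 mulr0 !mulr_ge0// exprn_ge0.
  rewrite mulrC ler_pM ?normc_ge0 ?h//.
  apply: le_trans (HL x xi eta) _; rewrite mulrA ler_wpM2r//.
  by rewrite xn -exprnP ler_wpM2r ?exprn_ge0// ler_norm.
rewrite big_const_seq count_predT iter_addr_0.
set c0 := `|L| * _ * M; have c00 : 0 <= c0 by rewrite !mulr_ge0// exprn_ge0.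
rewrite (_ : `|L| * N * _ * M = c0 * N); last by rewrite /c0; ring.
rewrite -[_ *+ _]mulr_natr ler_wpM2l//.
rewrite -lee_fin; apply: le_trans (HN n xi).
rewrite esum_fset//; last exact: (nearv_finite _ Hm).
rewrite fsbig_finite/=; last exact: (nearv_finite _ Hm).
by rewrite sumEFin big_const_seq count_predT iter_addr_0.
Qed.

(** The constant depends on the finitely many values near xi; nothing is assumed on u. This is
    enough for the measurability of every smoothing. *)
Lemma Tn_loclip n u xi : exists r K : R, [/\ 0 < r, 0 <= K & forall eta, mdist xi eta < r ->
  nc (Tn n u xi - Tn n u eta) <= K * mdist xi eta].
Proof.
have [C C0 HC] := Tn_lip; pose M := \sum_(x <- fnear 2 n xi) nc (u x).
have M0 : 0 <= M by apply: sumr_ge0 => x _; exact: normc_ge0.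
exists (rad n), (C * 2 ^+ n * M); split => //.
  by rewrite !mulr_ge0 ?exprn_ge0.
move=> eta d; apply: le_trans (HC n u 0 M xi eta (ltW d) _) _; last first.
  by rewrite le_eqVlt; apply/orP; left; apply/eqP; ring.
move=> x xn xB; rewrite subr0.
have xs : x \in fnear 2 n xi.
  rewrite /fnear in_fset_set ?inE; last exact: (nearv_finite _ Hm).
  split => //; have rn := @rad_gt0 R n.
  case: xB => /(vballE _ xn) h; first by lra.
  have := metric_triangle (center x) eta xi; rewrite (metric_sym eta xi); lra.
rewrite /M (big_fsetD1 x)//= lerDl; apply: sumr_ge0 => y _; exact: normc_ge0.
Qed.

Lemma measurable_Tn n u : cmeasurable m (Tn n u).
Proof.
case: Hm => _ mm _.
split; apply: measurable_loclip => // xi; have [r [K [r0 K0 HK]]] := Tn_loclip n u xi;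
  exists r, K; split => // eta d; apply: le_trans (HK _ d).
- by rewrite -raddfB; exact: normRe_le.
- by rewrite -raddfB; exact: normIm_le.
Qed.

End averaging_operator.

(** * From the Besov quasi-norm to coefficients *)

Section analysis_bounds.
Context {R : realType} {T : pmetricType R} (m : {outer_measure set T -> \bar R}).
Context (D : R) (W : filling T).
Hypothesis Hm : regular_space D m.
Local Notation V := (vertex W).
Implicit Types (u : V -> R[i]) (n k : nat) (xi eta : T) (p s : R).
Local Open Scope ereal_scope.

Let mm : metric_measure_space m. Proof. by case: Hm. Qed.

Definition edge_sum (k : nat) u (xi : T) : \bar R :=
  \esum_(e in [set e : V * V | elev k e /\ eball e xi]) (nc (du u e))%:E.

Definition edge_pow (k : nat) (p : R) u : \bar R :=
  \esum_(e in @elev _ _ W k) (nc (du u e))%:E `^ p.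

Definition base_pow (p : R) u : \bar R :=
  \esum_(x in @lev _ _ W 0) (nc (u x))%:E `^ p.

Lemma edge_sum_ge0 k u xi : 0 <= edge_sum k u xi.
Proof. by apply: esum_ge0 => e _; rewrite lee_fin normc_ge0. Qed.

Lemma edge_pow_ge0 k p u : 0 <= edge_pow k p u.
Proof. by apply: esum_ge0 => e _; exact: poweR_ge0. Qed.

Lemma base_pow_ge0 p u : 0 <= base_pow p u.
Proof. by apply: esum_ge0 => e _; exact: poweR_ge0. Qed.

Lemma edge_sumE k u :
  (fun xi => \esum_(e in [set e : V * V | edge e /\ elevel e = k%:Z])
        (Normc.normc (du u e) * \1_(eball e) xi)%:E) = edge_sum k u.
Proof.
apply/funext => xi; rewrite /edge_sum.
rewrite (_ : [set e | elev k e /\ eball e xi] = elev k `&` [set e | eball e xi])//.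
rewrite [RHS]esum_mkcondr; apply: eq_esum => e _.
rewrite indicE (_ : (xi \in eball e) = (e \in [set e | eball e xi])).
  by case: ifP => _; rewrite ?mulr1 ?mulr0.
by apply/idP/idP; rewrite !inE.
Qed.

Lemma measurable_vball (x : V) : measurable (vball x : set (caratheodory_type m)).
Proof. exact: measurable_ball_c. Qed.

Lemma measurable_eball (e : V * V) : measurable (eball e : set (caratheodory_type m)).
Proof. by apply: measurableU; exact: measurable_vball. Qed.

Lemma measurable_edge_sum k u :
  measurable_fun [set: caratheodory_type m] (edge_sum k u).
Proof.
apply: (@measurable_overlap _ (caratheodory_type m)) => [|e _|e].
- exact: (elev_countable W Hm).
- exact: measurable_eball.
- by rewrite lee_fin normc_ge0.
Qed.

Lemma edge_sum_term k u xi e : elev k e -> eball e xi -> (nc (du u e))%:E <= edge_sum k u xi.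
Proof.
move=> ek exi; apply: (esum_ge_term (a := fun e => (nc (du u e))%:E)) => //.
by move=> *; rewrite lee_fin normc_ge0.
Qed.

Lemma eball_count : exists2 N : R, (1 <= N)%R & forall k xi,
  \esum_(e in [set e : V * V | elev k e /\ eball e xi]) 1 <= N%:E.
Proof.
have [N N1 HN] := neare_count W Hm (ler1n _ 4); exists N => // k xi.
apply: le_trans (HN k xi); apply: esum_le_subset => // e [ek h].
exact: elev_neare.
Qed.

Lemma vball_count : exists2 N : R, (1 <= N)%R & forall k xi,
  \esum_(x in [set x : V | lev k x /\ vball x xi]) 1 <= N%:E.
Proof.
have [N N1 HN] := nearv_count W Hm (lexx 1); exists N => // k xi.
apply: le_trans (HN k xi); apply: esum_le_subset => // x [xk h].
by split => //; rewrite mul1r; exact/(vballE _ xk).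
Qed.

Lemma vball_lower : exists2 C : R, (0 < C)%R & forall k x, @lev _ _ W k x ->
  (2 `^ (- (k%:R * D)))%:E <= C%:E * m (vball x).
Proof.
case: Hm => D0 _ [C C0 [_ HC]]; exists C => // k x xk.
rewrite -rad_pow /vball (lev_rad xk); apply: HC.
by rewrite rad_gt0 rad_le1.
Qed.

(** The lower bound on the measure of a vertex ball turns each coefficient into an integral over
    [eball e]. At a point at most N of these integrands are nonzero, and each is at most the power
    of the edge sum. *)
Lemma edge_pow_le p : (0 < p)%R -> exists2 C : R, (0 <= C)%R & forall k u,
  (2 `^ (- (k%:R * D)))%:E * edge_pow k p u <=
  C%:E * \int[cmeasure m]_xi (edge_sum k u xi `^ p).
Proof.
move=> p0; have [C C0 HC] := vball_lower; have [N N1 HN] := eball_count.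
have N0 : (0 < N)%R by exact: lt_le_trans N1.
exists (C * N)%R; first by rewrite mulr_ge0// ltW.
move=> k u; rewrite /edge_pow -esumZl ?e2_ge0//; last by move=> *; exact: poweR_ge0.
apply: (@le_trans _ _ (\esum_(e in @elev _ _ W k) (C%:E * ((nc (du u e))%:E `^ p * m (eball e))))).
  apply: le_esum => e ek; rewrite [leRHS]muleCA [leLHS]muleC lee_wpmul2l ?poweR_ge0//.
  have [h _] := elev_levels ek; apply: le_trans (HC _ _ h) _.
  by rewrite lee_wpmul2l ?lee_fin ?(ltW C0)// le_outer_measure// => z; left.
rewrite esumZl ?(ltW C0)//; last by move=> *; rewrite mule_ge0 ?poweR_ge0.
rewrite EFinM -muleA lee_wpmul2l ?lee_fin ?(ltW C0)//.
rewrite -(@integral_overlap _ _ _ (cmeasure m) _ (@elev _ _ W k) (fun e => eball e)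
  (fun e => (nc (du u e))%:E `^ p)); last 3 first.
- exact: (elev_countable W Hm).
- by move=> e _; exact: measurable_eball.
- by move=> e; exact: poweR_ge0.
rewrite -ge0_integralZl//; last 3 first.
- apply: (measurableT_comp (measurable_poweR p)); exact: measurable_edge_sum.
- by move=> x _; exact: poweR_ge0.
- by rewrite lee_fin ltW.
apply: ge0_le_integral => //.
- by move=> x _; apply: esum_ge0 => e _; exact: poweR_ge0.
- apply: measurable_overlap => [|e _|e].
  + exact: (elev_countable W Hm).
  + exact: measurable_eball.
  + exact: poweR_ge0.
- apply: measurable_funeM; apply: (measurableT_comp (measurable_poweR p)).
  exact: measurable_edge_sum.
move=> x _; apply: esum_le_count => //; first exact: poweR_ge0.
move=> e [ek ex]; apply: poweR_le; rewrite ?(ltW p0) ?lee_fin ?normc_ge0//.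
exact: edge_sum_term.
Qed.

(** The smoothing alone does not control the values, since they may cancel; but all vertices of
    level k over xi are equal or joined to x by edges of level k, which measure their deviation from
    [u x]. *)
Lemma vertex_le_Tn_edge k u xi (x : V) : lev k x -> vball x xi ->
  (nc (u x))%:E <= (nc (Tn k u xi))%:E + edge_sum k u xi.
Proof.
move=> xk xB; have g0 := edge_sum_ge0 k u xi.
case E : (edge_sum k u xi) => [g| |]; last 2 first.
- by rewrite addey ?leey.
- by move: g0; rewrite E.
rewrite -EFinD lee_fin.
have h : (nc (Tn k u xi - u x) <= g)%R.
  apply: (Tn_osc (W := W) Hm) => x' x'k x'B.
  have [->|[e [ek ex ->]]] := edge_osc u xk (or_introl x'k) xB x'B.
    by rewrite subrr normc0 -lee_fin -E.
  by rewrite -lee_fin -E; exact: edge_sum_term.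
have := normcD (u x - Tn k u xi)%R (Tn k u xi); rewrite subrK => /le_trans; apply.
by rewrite normcBC addrC lerD2l.
Qed.

Lemma measurable_cabs (f : T -> R[i]) : cmeasurable m f ->
  measurable_fun [set: caratheodory_type m] (cabs f).
Proof.
move=> [mre mim]; apply/measurable_EFinP.
rewrite (_ : (fun x => nc (f x)) = (fun x => (complex.Re (f x) ^+ 2 + complex.Im (f x) ^+ 2) `^ 2^-1)%R); last first.
  by apply/funext => x; rewrite powR12_sqrt ?addr_ge0 ?sqr_ge0//; case: (f x).
apply: (measurableT_comp (@measurable_powR R _)).
by apply: measurable_funD; apply: measurable_funX.
Qed.

Lemma base_pow_le p : (0 < p)%R -> exists2 C : R, (0 <= C)%R & forall u,
  base_pow p u <= C%:E * (\int[cmeasure m]_xi (cabs (Tn 0 u) xi `^ p) +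
    \int[cmeasure m]_xi (edge_sum 0 u xi `^ p)).
Proof.
move=> p0; have [C C0 HC] := vball_lower; have [N N1 HN] := vball_count.
have N0 : (0 < N)%R by exact: lt_le_trans N1.
exists (C * (N * 2 `^ p))%R; first by rewrite !mulr_ge0 ?powR_ge0// ltW.
move=> u.
have mT : measurable_fun [set: caratheodory_type m] (fun xi => cabs (Tn 0 u) xi `^ p).
  apply: (measurableT_comp (measurable_poweR p)); apply: measurable_cabs.
  exact: (measurable_Tn Hm).
have mE : measurable_fun [set: caratheodory_type m] (fun xi => edge_sum 0 u xi `^ p).
  apply: (measurableT_comp (measurable_poweR p)); exact: measurable_edge_sum.
apply: (@le_trans _ _ (\esum_(x in @lev _ _ W 0) (C%:E * ((nc (u x))%:E `^ p * m (vball x))))).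
  apply: le_esum => x xk; rewrite [leRHS]muleCA -[leLHS]mule1 lee_wpmul2l ?poweR_ge0//.
  by have := HC _ _ xk; rewrite mul0r oppr0 powRr0.
rewrite esumZl ?(ltW C0)//; last by move=> *; rewrite mule_ge0 ?poweR_ge0.
rewrite EFinM -muleA lee_wpmul2l ?lee_fin ?(ltW C0)//.
rewrite -(@integral_overlap _ _ _ (cmeasure m) _ (@lev _ _ W 0) (fun e => vball e)
  (fun x => (nc (u x))%:E `^ p)); last 3 first.
- exact: (lev_countable W Hm).
- by move=> e _; exact: measurable_vball.
- by move=> e; exact: poweR_ge0.
rewrite -ge0_integralD//; last 2 first.
- by move=> x _; exact: poweR_ge0.
- by move=> x _; exact: poweR_ge0.
rewrite -ge0_integralZl//; last 3 first.
- exact: emeasurable_funD.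
- by move=> x _; rewrite adde_ge0 ?poweR_ge0.
- by rewrite lee_fin mulr_ge0 ?powR_ge0// ltW.
apply: ge0_le_integral => //.
- by move=> x _; apply: esum_ge0 => e _; exact: poweR_ge0.
- apply: measurable_overlap => [|e _|e].
  + exact: (lev_countable W Hm).
  + exact: measurable_vball.
  + exact: poweR_ge0.
- by apply: measurable_funeM; exact: emeasurable_funD.
move=> x _; rewrite EFinM -muleA; apply: esum_le_count => //.
  by rewrite mule_ge0 ?lee_fin ?powR_ge0// adde_ge0 ?poweR_ge0.
move=> y [yk yx]; apply: le_trans (poweRD_le _ _ _); rewrite ?lee_fin ?normc_ge0 ?edge_sum_ge0//.
by apply: poweR_le; rewrite ?(ltW p0) ?lee_fin ?normc_ge0//; exact: vertex_le_Tn_edge.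
Qed.

(** The Besov quasi-norm with functions replaced by coefficients: 2^(- k dim) stands for the measure
    of a ball of level k, and [b k] for the sum of the p-th powers of the coefficients of that
    level. *)
Definition seq_norm s p (q : \bar R) (dim : R) (b0 : \bar R) (b : nat -> \bar R) : \bar R :=
  b0 `^ p^-1 + lq_norm q [set: nat]
    (fun k => (2 `^ (k%:R * s))%:E * ((2 `^ (- (k%:R * dim)))%:E * b k) `^ p^-1).

Lemma lq_norm_scale (I : choiceType) q (A : set I) (a b : I -> \bar R) (C : R) : 0 < q ->
  (0 <= C)%R -> (forall i, A i -> 0 <= a i) -> (forall i, A i -> 0 <= b i) ->
  (forall i, A i -> a i <= C%:E * b i) -> lq_norm q A a <= C%:E * lq_norm q A b.
Proof.
move=> q0 C0 a0 b0 ab.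
have h0 : 0 <= C%:E * lq_norm q A b by rewrite mule_ge0 ?lq_norm_ge0.
case: q q0 h0 => [r|_|//].
  rewrite lte_fin => r0 h0; rewrite lq_norm_fin// poweRM ?lq_norm_ge0//.
  rewrite /= poweRKV//; last by apply: esum_ge0 => *; exact: poweR_ge0.
  rewrite -esumZl ?powR_ge0//; last by move=> *; exact: poweR_ge0.
  apply: le_esum => i Ai; rewrite -poweR_EFin -poweRM ?lee_fin ?b0//.
  by apply: poweR_le; rewrite ?a0 ?(ltW r0) ?ab.
move=> h0; apply: lq_normy => // i Ai; apply: le_trans (ab _ Ai) _.
by rewrite lee_wpmul2l// lq_norm_term.
Qed.

Lemma seq_norm_le_besov s p q : (0 < p)%R -> 0 < q -> exists2 C : R, (0 <= C)%R &
  forall f : T -> R[i],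
  seq_norm s p q D (base_pow p (Pavg W m f)) (fun k => edge_pow k p (Pavg W m f)) <=
  C%:E * besov_norm m W s p%:E q f.
Proof.
move=> p0 q0; have [C1 C10 HC1] := edge_pow_le p0.
have [C2 C20 HC2] := base_pow_le p0.
have pV : (0 < p^-1)%R by rewrite invr_gt0.
pose K := (2 `^ p^-1)%R; have K0 : (0 <= K)%R by exact: powR_ge0.
exists (C2 `^ p^-1 * K + C2 `^ p^-1 * K + C1 `^ p^-1)%R.
  by rewrite !addr_ge0 ?mulr_ge0 ?powR_ge0.
move=> f; set u := Pavg W m f; rewrite /besov_norm.
set L := lq_norm q _ (fun k => _ * Lp_norm _ _ _).
set B := Lp_norm _ _ _.
have B0 : 0 <= B by exact: Lnorm_ge0.
have L0 : 0 <= L by exact: lq_norm_ge0.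
have LpE h : (forall x, 0 <= h x) -> \int[cmeasure m]_xi (h xi `^ p) = Lp_norm m p%:E h `^ p.
  move=> h0; rewrite poweR_Lnorm ?gt_eqF//.
  by apply: eq_integral => x _; rewrite gee0_abs.
rewrite /seq_norm.
have H1 : lq_norm q [set: nat] (fun k => (2 `^ (k%:R * s))%:E *
    ((2 `^ (- (k%:R * D)))%:E * edge_pow k p u) `^ p^-1) <= (C1 `^ p^-1)%:E * L.
  apply: lq_norm_scale => //; first exact: powR_ge0.
  - by move=> k _; rewrite mule_ge0 ?poweR_ge0// lee_fin e2_ge0.
  - by move=> k _; rewrite mule_ge0 ?Lnorm_ge0// lee_fin e2_ge0.
  move=> k _; rewrite muleCA lee_wpmul2l ?lee_fin ?e2_ge0//.
  have h := HC1 k u; rewrite LpE in h; last exact: edge_sum_ge0.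
  apply: le_trans (poweR_le _ _ h) _; rewrite ?(ltW pV)//.
    by rewrite mule_ge0 ?edge_pow_ge0// lee_fin e2_ge0.
  rewrite poweRM ?lee_fin ?poweR_ge0// poweR_EFin poweRVK ?Lnorm_ge0//.
  by rewrite edge_sumE.
have H2 : base_pow p u `^ p^-1 <= (C2 `^ p^-1 * K)%:E * B + (C2 `^ p^-1 * K)%:E * L.
  have h := HC2 u; rewrite !LpE in h; last 2 first.
  - exact: edge_sum_ge0.
  - by move=> x; rewrite lee_fin normc_ge0.
  apply: le_trans (poweR_le _ _ h) _; rewrite ?(ltW pV) ?base_pow_ge0//.
  rewrite poweRM ?lee_fin ?adde_ge0 ?poweR_ge0// poweR_EFin EFinM -!muleA -ge0_muleDr; last 2 first.
  - by rewrite mule_ge0// lee_fin.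
  - by rewrite mule_ge0// lee_fin.
  rewrite lee_wpmul2l ?lee_fin ?powR_ge0//.
  apply: le_trans (poweRD_le pV _ _) _; rewrite ?poweR_ge0//.
  rewrite !poweRVK ?Lnorm_ge0// -ge0_muleDr// lee_wpmul2l ?lee_fin// leeD2l//.
  (* The edges of level 0 that the base values require are the entry k = 0 of the l^q norm. *)
  have := @lq_norm_term R nat q setT (fun k => (2 `^ (k%:R * s))%:E * Lp_norm m p%:E (edge_sum k u)) 0%N.
  rewrite mul0r powRr0 mul1e => h0; apply: le_trans (h0 q0 _ Logic.I) _.
    by move=> k _; rewrite mule_ge0 ?Lnorm_ge0// lee_fin e2_ge0.
  by rewrite le_eqVlt; apply/orP; left; apply/eqP; congr (lq_norm _ _ _);
    apply/funext => k; rewrite edge_sumE.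
apply: le_trans (leeD H2 H1) _.
have c0 : 0 <= (C2 `^ p^-1 * K)%:E by rewrite lee_fin mulr_ge0 ?powR_ge0.
have c1 : 0 <= (C1 `^ p^-1)%:E by rewrite lee_fin powR_ge0.
rewrite 2!EFinD ge0_muleDl ?adde_ge0// ge0_muleDl//.
by apply: leeD; [apply: leeD|]; rewrite lee_wpmul2l// ?leeDl ?leeDr.
Qed.

End analysis_bounds.

Lemma geo_kernel_le (R : realType) (d : R) k n : (k <= n)%N ->
  geo_kernel d k n = 2 `^ (- (d * (n%:R - k%:R))).
Proof. by move=> kn; rewrite /geo_kernel distrC ger0_norm// subr_ge0 ler_nat. Qed.

(** * Contribution of all finer levels to a ball *)

Section tail_sums.
Context {R : realType} {T : pmetricType R} (m : {outer_measure set T -> \bar R}).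
Context (D : R) (W : filling T).
Hypothesis Hm : regular_space D m.
Local Notation V := (vertex W).
Implicit Types (c t : V -> \bar R) (n k : nat) (xi eta : T) (x y : V) (p s : R).
Local Open Scope ereal_scope.

Let mm : metric_measure_space m. Proof. by case: Hm. Qed.
Let D0 : (0 < D)%R. Proof. by case: Hm. Qed.

Definition bsum c n xi : \bar R :=
  \esum_(x in [set x : V | lev n x /\ vball x xi]) c x.

Definition psum_lev c p n : \bar R := \esum_(x in @lev _ _ W n) c x `^ p.

Definition near_pair n k y x : Prop :=
  lev n y /\ (mdist (center y) (center x) < 2 * rad k)%R.

(* [tail_sum c k x] dominates the mean over [vball x], with [x] of level [k],
   of the functions [bsum c n] of all levels [n >= k]. *)
Definition tail_sum c k x : \bar R := \esum_(n in [set n | (k <= n)%N])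
  ((2 `^ ((k%:R - n%:R) * D))%:E * \esum_(y in [set y | near_pair n k y x]) c y).

Definition near_tail c n xi : \bar R := \esum_(x in nearv 8 n xi) tail_sum c n x.

(** Taking means costs no decay for p >= 1 and D (1 - p) for p < 1. With D and s positive, this is
    positive exactly when p > D / (D + s). *)
Definition tail_exp p s : R := (s * p - D * Num.max (1 - p) 0)%R.

Lemma tail_sum_ge0 c k x : (forall y, 0 <= c y) -> 0 <= tail_sum c k x.
Proof.
move=> c0; apply: esum_ge0 => n _; rewrite mule_ge0 ?lee_fin ?e2_ge0//.
exact: esum_ge0.
Qed.

Lemma near_tail_ge0 c n xi : (forall y, 0 <= c y) -> 0 <= near_tail c n xi.
Proof. by move=> c0; apply: esum_ge0 => x _; exact: tail_sum_ge0. Qed.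

Lemma bsum_ge0 c n xi : (forall y, 0 <= c y) -> 0 <= bsum c n xi.
Proof. by move=> c0; apply: esum_ge0 => x _. Qed.

Lemma psum_lev_ge0 c p n : 0 <= psum_lev c p n.
Proof. by apply: esum_ge0 => x _; exact: poweR_ge0. Qed.

Lemma le_tail_sum c k x : (forall y, 0 <= c y) -> lev k x -> c x <= tail_sum c k x.
Proof.
move=> c0 kx; apply: (@le_trans _ _ ((2 `^ ((k%:R - k%:R) * D))%:E * \esum_(y in [set y | near_pair k k y x]) c y)).
  rewrite subrr mul0r powRr0 mul1e; apply: esum_ge_term => //.
  by split => //; rewrite mdistxx mulr_gt0 ?rad_gt0.
apply: (esum_ge_term (a := fun n => (2 `^ ((k%:R - n%:R) * D))%:E * \esum_(y in [set y | near_pair n k y x]) c y)); first exact: leqnn.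
by move=> j _; rewrite mule_ge0 ?lee_fin ?e2_ge0//; exact: esum_ge0.
Qed.

Lemma near_pow_integral p K : (0 < p)%R -> (1 <= K)%R -> exists2 C : R, (0 <= C)%R &
  forall n t, (forall x, 0 <= t x) ->
  \int[cmeasure m]_xi ((\esum_(x in nearv K n xi) t x) `^ p) <=
  (C * 2 `^ (- (n%:R * D)))%:E * psum_lev t p n.
Proof.
move=> p0 K1; have [N N1 HN] := nearv_count W Hm K1.
have K0 : (0 < K)%R by exact: lt_le_trans K1.
case: Hm => _ _ [C C0 [HC _]].
exists (N `^ p * (C * K `^ D))%R; first by rewrite !mulr_ge0 ?powR_ge0// ltW.
move=> n t t0.
have E xi : nearv K n xi = [set x : V | lev n x /\ ball (center x) (K * rad n) xi].
  by apply/seteqP; split => x; rewrite /nearv/= ballEmdist.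
under eq_integral do rewrite E.
rewrite -mulrA -(mulrA C); apply: (@integral_overlap_pow _ _ _ (cmeasure m)) => //.
- by rewrite (le_trans _ N1).
- by rewrite !mulr_ge0 ?powR_ge0// ltW.
- exact: (lev_countable W Hm).
- by move=> x _; exact: measurable_ball_c.
- move=> x _; apply: le_trans (HC _ _ _) _; first by rewrite mulr_gt0 ?rad_gt0.
  by rewrite lee_fin powRM ?rad_ge0 ?(ltW K0)// rad_pow.
- by move=> xi; rewrite -E.
Qed.

Lemma measurable_near_sum K n t : (forall x, 0 <= t x) ->
  measurable_fun [set: caratheodory_type m] (fun xi => \esum_(x in nearv K n xi) t x).
Proof.
move=> t0.
have E xi : nearv K n xi = [set x : V | lev n x /\ ball (center x) (K * rad n) xi].
  by apply/seteqP; split => x; rewrite /nearv/= ballEmdist.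
under eq_fun do rewrite E.
apply: (@measurable_overlap _ (caratheodory_type m)) => //.
- exact: (lev_countable W Hm).
- by move=> x _; exact: measurable_ball_c.
Qed.

Lemma measurable_bsum c n : (forall x, 0 <= c x) ->
  measurable_fun [set: caratheodory_type m] (bsum c n).
Proof.
move=> c0; apply: (@measurable_overlap _ (caratheodory_type m)) => //.
- exact: (lev_countable W Hm).
- by move=> x _; exact: (measurable_vball Hm).
Qed.

(** Two sums are raised to the power p: that over n, by geometric weights, and that over the
    vertices of level n near x, about 2^((n - k) D) in number, by [esum_pow_sharp]. Exchanging the
    sums over x and y then costs only the bounded number of x near a given y. The remaining decay in
    n - k is [tail_exp / 2]. *)
Lemma tail_sum_pow p s : (0 < p)%R -> (0 < tail_exp p s)%R ->
  exists2 C : R, (0 <= C)%R & forall c k, (forall x, 0 <= c x) ->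
  (2 `^ (k%:R * (s * p - D)))%:E * psum_lev (tail_sum c k) p k <=
  C%:E * \esum_(n in [set: nat]) ((geo_kernel (tail_exp p s / 2) k n)%:E *
    ((2 `^ (n%:R * (s * p - D)))%:E * psum_lev c p n)).
Proof.
move=> p0 ex0; set ex := tail_exp p s in ex0 *.
(* With this [eps] the weights cost [eps * p], half of the available decay. The name [mu] denotes
   the exponent of [esum_pow_sharp], not a measure. *)
set mu := Num.max (p - 1)%R 0%R; set eps := (ex / 2 / p)%R.
have eps0 : (0 < eps)%R by rewrite !divr_gt0.
have [C1 C10 HC1] := lev_count W Hm.
have [N N1 HN] := nearv_count W Hm (ler1n _ 2).
have N0 : (0 < N)%R by exact: lt_le_trans N1.
have [K K0 HK] := geo_kernel_sum eps0.
have mu0 : (0 <= mu)%R by rewrite le_max lexx orbT.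
(* One formula for p on both sides of 1, from max(1 - p, 0) = max(p - 1, 0) + 1 - p. *)
have exE : (ex = s * p + D * p - D - D * mu)%R.
  rewrite /ex /tail_exp /mu; case: (leP p 1%R) => h.
    rewrite (_ : Num.max (1 - p) 0 = 1 - p)%R; last by apply: max_l; rewrite subr_ge0.
    rewrite (_ : Num.max (p - 1) 0 = 0)%R; last by apply: max_r; rewrite subr_le0.
    by ring.
  rewrite (_ : Num.max (1 - p) 0 = 0)%R; last by apply: max_r; rewrite subr_le0 ltW.
  rewrite (_ : Num.max (p - 1) 0 = p - 1)%R; last by apply: max_l; rewrite subr_ge0 ltW.
  by ring.
pose C2 := (2 `^ p * (C1 * 2 `^ D) `^ mu)%R.
have C20 : (0 <= C2)%R by rewrite mulr_ge0 ?powR_ge0.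
exists (K `^ p * (C2 * N))%R; first by rewrite !mulr_ge0 ?powR_ge0// ltW.
move=> c k c0.
pose Y n x := \esum_(y in [set y | near_pair n k y x]) c y.
have Y0 n x : 0 <= Y n x by exact: esum_ge0.
have Ypow n x : (k <= n)%N -> Y n x `^ p <=
    (C2 * 2 `^ ((n%:R - k%:R) * (D * mu)))%:E * \esum_(y in [set y | near_pair n k y x]) c y `^ p.
  move=> kn; have := HC1 n (center x) (2 * rad k)%R.
  rewrite (le_trans (@rad_le R _ _ kn)) ?ler_peMl ?rad_ge0 ?ler1n// => /(_ isT) h.
  have h' : (0 < C1 * (2 * rad k / rad n) `^ D)%R.
    by rewrite mulr_gt0// powR_gt0// divr_gt0// ?mulr_gt0 ?rad_gt0.
  apply: le_trans (esum_pow_sharp p0 h' _ h) _ => //.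
  rewrite lee_wpmul2r//; first by apply: esum_ge0 => *; exact: poweR_ge0.
  rewrite lee_fin /C2 -/mu -[leRHS]mulrA ler_wpM2l ?powR_ge0//.
  rewrite le_eqVlt; apply/orP; left; apply/eqP.
  have r0 := @rad_gt0 R k; have r1 := @rad_gt0 R n.
  rewrite -mulrA (powRM D) ?divr_ge0 ?rad_ge0//.
  rewrite mulrA powRM ?mulr_ge0 ?powR_ge0 ?(ltW C10)//.
  congr (_ * _)%R; rewrite -powRrM !radE -e2B -powRrM; congr (2 `^ _)%R; ring.
clearbody C2.
have tpow x : tail_sum c k x `^ p <= (K `^ p)%:E * \esum_(n in [set n | (k <= n)%N])
    ((2 `^ ((n%:R - k%:R) * (ex / 2 - D * p)))%:E * Y n x `^ p).
  apply: le_trans (esum_pow_weight (w := geo_kernel eps k) p0 (ltW K0) _ _ _) _.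
  - by move=> n _; rewrite mule_ge0 ?Y0// lee_fin e2_ge0.
  - by move=> n _; exact: geo_kernel_gt0.
  - apply: le_trans (HK k); apply: esum_le_subset => // n _.
    by rewrite lee_fin ltW// geo_kernel_gt0.
  rewrite lee_wpmul2l ?lee_fin ?powR_ge0//; apply: le_esum => n /= kn.
  rewrite poweRM ?Y0 ?lee_fin ?e2_ge0// muleA lee_wpmul2r ?poweR_ge0//.
  rewrite poweR_EFin -EFinM lee_fin geo_kernel_pow geo_kernel_le// -powRrM -e2D; apply: e2_le.
  rewrite le_eqVlt; apply/orP; left; apply/eqP; rewrite /eps; field.
  by rewrite gt_eqF.
have step n : (k <= n)%N -> \esum_(x in @lev _ _ W k) Y n x `^ p <=
    (C2 * N * 2 `^ ((n%:R - k%:R) * (D * mu)))%:E * psum_lev c p n.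
  move=> kn; apply: le_trans (le_esum (fun x _ => Ypow n x kn)) _.
  rewrite esumZl ?mulr_ge0 ?e2_ge0//; last first.
    by move=> x _; apply: esum_ge0 => *; exact: poweR_ge0.
  rewrite (mulrAC C2) [in leRHS]EFinM -[leRHS]muleA lee_wpmul2l ?lee_fin ?mulr_ge0 ?e2_ge0//.
  rewrite (esum_exchange (Rl := fun x y => (mdist (center y) (center x) < 2 * rad k)%R)
    (a := fun x y => c y `^ p)); last by move=> *; exact: poweR_ge0.
  rewrite -esumZl ?(ltW N0)//; last by move=> *; exact: poweR_ge0.
  apply: le_esum => y yn; apply: esum_le_count => //; first exact: poweR_ge0.
  apply: le_trans (HN k (center y)); apply: esum_le_subset => // x [xk h].
  by split => //; rewrite metric_sym.
have E0 n : 0 <= (2 `^ ((n%:R - k%:R) * (ex / 2 - D * p)))%:E by rewrite lee_fin e2_ge0.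
apply: (@le_trans _ _ ((2 `^ (k%:R * (s * p - D)))%:E * ((K `^ p)%:E *
    \esum_(n in [set n | (k <= n)%N]) ((2 `^ ((n%:R - k%:R) * (ex / 2 - D * p)))%:E *
    ((C2 * N * 2 `^ ((n%:R - k%:R) * (D * mu)))%:E * psum_lev c p n))))).
  rewrite lee_wpmul2l ?lee_fin ?e2_ge0//.
  apply: le_trans (le_esum (fun x _ => tpow x)) _.
  rewrite esumZl ?powR_ge0//; last first.
    by move=> x _; apply: esum_ge0 => n _; rewrite mule_ge0 ?poweR_ge0.
  rewrite lee_wpmul2l ?lee_fin ?powR_ge0// esum_exchangeT; last first.
    by move=> x n _ _; rewrite mule_ge0 ?poweR_ge0.
  apply: le_esum => n /= kn; rewrite esumZl ?e2_ge0//; last by move=> *; exact: poweR_ge0.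
  by rewrite lee_wpmul2l//; exact: step.
rewrite muleCA EFinM -muleA lee_wpmul2l ?lee_fin ?powR_ge0//.
rewrite -!esumZl ?mulr_ge0 ?e2_ge0 ?(ltW N0)//;
  try by move=> n _; rewrite !mule_ge0 ?psum_lev_ge0// ?lee_fin ?mulr_ge0 ?e2_ge0 ?(ltW N0).
apply: le_trans (esum_le_subset (@subsetT _ _) _); last first.
  by move=> n _; rewrite !mule_ge0 ?psum_lev_ge0// ?lee_fin ?mulr_ge0 ?e2_ge0 ?(ltW N0).
apply: le_esum => n /= kn; rewrite !muleA lee_wpmul2r ?psum_lev_ge0//.
rewrite -!EFinM lee_fin [leLHS]mulrCA -[leRHS]mulrA.
rewrite ler_wpM2l ?mulr_ge0 ?(ltW N0)// geo_kernel_le//.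
rewrite -!e2D; apply: e2_le.
by rewrite le_eqVlt; apply/orP; left; apply/eqP; rewrite exE; field.
Qed.

(** This explains the weights of [tail_sum]: a ball of level n has measure about 2^((k - n) D) times
    that of [vball x], and only balls with centers within [2 * rad k] of the center of x meet it. *)
Lemma tail_mean : exists2 C : R, (0 <= C)%R & forall c k x,
  (forall x, 0 <= c x) -> lev k x ->
  \int[cmeasure m]_(xi in vball x) (\esum_(n in [set n | (k <= n)%N]) bsum c n xi) <=
  (C%:E * m (vball x)) * tail_sum c k x.
Proof.
have [C1 C10 HC1] := vball_lower W Hm; case: (Hm) => _ _ [C C0 [HC _]].
exists (C * C1)%R; first by rewrite mulr_ge0 ?ltW.
move=> c k x c0 xk.
rewrite integral_esum; last 4 first.
- exact: (measurable_vball Hm).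
- exact: countableP.
- by move=> *; exact: bsum_ge0.
- by move=> n _; apply: measurable_funTS; exact: measurable_bsum.
have mx : m (vball x) = (fine (m (vball x)))%:E.
  rewrite fineK// ge0_fin_numE//.
  have := mm.2 (center x) (2 ^ (- level x))%R.
  by rewrite exprz_gt0// => /(_ isT) /andP[].
rewrite mx -EFinM -esumZl ?mulr_ge0 ?fine_ge0 ?(ltW C0) ?(ltW C10)//; last first.
  by move=> n _; rewrite mule_ge0 ?lee_fin ?e2_ge0//; exact: esum_ge0.
rewrite EFinM -mx.
apply: le_esum => n /= kn.
apply: (@le_trans _ _ (\int[cmeasure m]_xi
    (\esum_(y in [set y | near_pair n k y x /\ vball y xi]) c y))).
  rewrite integral_mkcond; apply: ge0_le_integral => //.
  - by move=> xi _; rewrite patchE; case: ifP => // _; exact: bsum_ge0.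
  - apply/(measurable_restrictT _ (measurable_vball Hm x)).
    by apply: measurable_funTS; exact: measurable_bsum.
  - apply: (@measurable_overlap _ (caratheodory_type m)) => //.
    + by apply: sub_countable (lev_countable W Hm n); apply: subset_card_le => y [].
    + by move=> y _; exact: (measurable_vball Hm).
  move=> xi _; rewrite patchE; case: ifPn => [|_]; last exact: esum_ge0.
  rewrite inE => xiB; apply: esum_le_subset => // y [yn yB]; split => //; split => //.
  have h1 := (vballE _ xk).1 xiB; have h2 := (vballE _ yn).1 yB.
  have := metric_triangle (center y) xi (center x); rewrite (metric_sym xi (center x)).
  have := @rad_le R _ _ kn; lra.
rewrite integral_overlap//; last 2 first.
- by apply: sub_countable (lev_countable W Hm n); apply: subset_card_le => y [].
- by move=> y _; exact: (measurable_vball Hm).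
rewrite muleA.
apply: (@le_trans _ _ (\esum_(y in [set y | near_pair n k y x]) ((C * 2 `^ (- (n%:R * D)))%:E * c y))).
  apply: le_esum => y [yn _]; rewrite muleC lee_wpmul2r//.
  by rewrite /vball (lev_rad yn) -rad_pow; apply: HC; exact: rad_gt0.
rewrite esumZl ?mulr_ge0 ?e2_ge0 ?(ltW C0)// lee_wpmul2r//; first exact: esum_ge0.
rewrite !EFinM -!muleA lee_wpmul2l ?lee_fin ?(ltW C0)//.
rewrite muleA; apply: le_trans (_ : (2 `^ (- (k%:R * D)))%:E * (2 `^ ((k%:R - n%:R) * D))%:E <= _).
  rewrite -EFinM lee_fin -e2D; apply: e2_le.
  by rewrite le_eqVlt; apply/orP; left; apply/eqP; ring.
by rewrite lee_wpmul2r ?lee_fin ?e2_ge0// HC1.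
Qed.

End tail_sums.

(** * Series of complex functions and their limits *)

Section complex_limits.
Context {R : realType} {T : pmetricType R}.
Implicit Types (F f : nat -> T -> R[i]) (xi : T).

(* The upper limits make this measurable without any convergence. *)
Definition clim F : T -> R[i] := fun xi =>
  (fine (limn_esup (fun n => (complex.Re (F n xi))%:E)) +i*
   fine (limn_esup (fun n => (complex.Im (F n xi))%:E)))%C.

Lemma eps_cvg (u : nat -> R) (l : R) :
  (forall e : R, 0 < e -> exists N, forall n, (N <= n)%N -> `|u n - l| <= e) ->
  fine (limn_esup (fun n => (u n)%:E)) = l.
Proof.
move=> h; have cu : (u n)%:E @[n --> \oo] --> l%:E.
  apply: cvg_EFin; first by apply: nearW.
  apply/cvgrPdist_le => e e0; have [N HN] := h e e0.
  by exists N => // n /= Nn; rewrite distrC; exact: HN.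
by have [_ ->] := cvg_limn_einf_sup cu.
Qed.

Lemma clim_cvg F xi z :
  (forall e : R, 0 < e -> exists N, forall n, (N <= n)%N -> nc (F n xi - z) <= e) ->
  clim F xi = z.
Proof.
move=> h; rewrite /clim (@eps_cvg _ (complex.Re z)) ?(@eps_cvg _ (complex.Im z)); first by case: z h.
- move=> e e0; have [N HN] := h e e0; exists N => n /HN; apply: le_trans.
  by rewrite -raddfB; exact: normIm_le.
- move=> e e0; have [N HN] := h e e0; exists N => n /HN; apply: le_trans.
  by rewrite -raddfB; exact: normRe_le.
Qed.

Lemma measurable_clim (m : {outer_measure set T -> \bar R}) F :
  (forall n, cmeasurable m (F n)) -> cmeasurable m (clim F).
Proof.
move=> mF; split; rewrite /clim/=.
- apply: (measurableT_comp (fine_measurable measurableT)).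
  by apply: measurable_fun_limn_esup => n; apply/measurable_EFinP; have [] := mF n.
- apply: (measurableT_comp (fine_measurable measurableT)).
  by apply: measurable_fun_limn_esup => n; apply/measurable_EFinP; have [] := mF n.
Qed.

Definition csum f (n : nat) : T -> R[i] := fun xi => \sum_(i < n.+1) f i xi.

Lemma csumS f n xi : csum f n.+1 xi = csum f n xi + f n.+1 xi.
Proof. by rewrite /csum big_ord_recr. Qed.

Lemma measurable_csum (m : {outer_measure set T -> \bar R}) f n :
  (forall n, cmeasurable m (f n)) -> cmeasurable m (csum f n).
Proof.
move=> mf; elim: n => [|n [IH1 IH2]].
  by rewrite (_ : csum f 0 = f 0%N)//; apply/funext => x; rewrite /csum big_ord1.
have [m1 m2] := mf n.+1.
rewrite (_ : csum f n.+1 = fun x => csum f n x + f n.+1 x); last by apply/funext => x; rewrite csumS.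
split.
- under eq_fun do rewrite raddfD; exact: measurable_funD.
- under eq_fun do rewrite raddfD; exact: measurable_funD.
Qed.

Local Open Scope ereal_scope.

Lemma esum_tail_seg (b : nat -> \bar R) k j : (forall n, 0 <= b n) ->
  \sum_(i < j) b (k + i.+1)%N <= \esum_(i in [set i | (k < i)%N]) b i.
Proof.
move=> b0; rewrite (reindex_esum setT _ (fun i => k + i.+1)%N); last first.
  split => [i _ /=|i i' _ _ /addnI[]//|i /= ki].
    by rewrite -addSnnS leq_addr.
  by exists (i - k.+1)%N => //; rewrite -addSnnS subnKC.
rewrite -nneseries_esumT// -(big_mkord xpredT (fun i => b (k + i.+1)%N)).
exact: nneseries_lim_ge.
Qed.

Lemma csum_sub_le f (b : nat -> \bar R) xi k n :
  (forall n, (nc (f n xi))%:E <= b n) -> (k <= n)%N ->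
  (nc (csum f n xi - csum f k xi)%R)%:E <= \esum_(i in [set i | (k < i)%N]) b i.
Proof.
move=> fb kn; have b0 j : 0 <= b j by apply: le_trans (fb j); rewrite lee_fin normc_ge0.
apply: le_trans (@esum_tail_seg b k (n - k) b0).
rewrite -(subnKC kn) addKn; elim: (n - k)%N => [|j IH].
  by rewrite addn0 subrr normc0 big_ord0.
rewrite big_ord_recr/= addnS csumS addrAC.
apply: (@le_trans _ _ ((nc (csum f (k + j) xi - csum f k xi)%R)%:E + (nc (f (k + j).+1 xi))%:E)).
  by rewrite -EFinD lee_fin normcD.
by rewrite leeD// -addnS fb.
Qed.

Lemma esum_tail_small (b : nat -> \bar R) (e : R) : (forall n, 0 <= b n) ->
  \esum_(n in [set: nat]) b n < +oo -> (0 < e)%R ->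
  exists N, \esum_(i in [set i | (N < i)%N]) b i <= e%:E.
Proof.
move=> b0 bf e0.
have /fine_cvgP[_] : \sum_(k <= i <oo) b i @[k --> \oo] --> 0.
  by apply: nneseries_tail_cvg => //; rewrite nneseries_esumT.
move=> /cvgrPdist_le /(_ e e0) [N _ HN]; exists N.
have := HN N.+1 (leqnSn N); rewrite sub0r normrN /= => {}HN.
have E : \esum_(i in [set i | (N < i)%N]) b i = \sum_(N.+1 <= i <oo) b i.
  rewrite -nneseries_addn; last by move=> *; exact: b0.
  rewrite nneseries_esumT//.
  rewrite (reindex_esum setT _ (fun i => i + N.+1)%N)//.
  split => [i _ /=|i i' _ _ /addIn//|i /= ki]; first by rewrite leq_addl.
  by exists (i - N.+1)%N => //; rewrite subnK.
have fin : \sum_(N.+1 <= i <oo) b i \is a fin_num.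
  rewrite -E ge0_fin_numE; last exact: esum_ge0.
  by apply: le_lt_trans bf; apply: esum_le_subset.
rewrite E -(fineK fin) lee_fin; apply: le_trans HN; exact: ler_norm.
Qed.

Lemma cauchy_re (u : nat -> R) (b : nat -> \bar R) : (forall n, 0 <= b n) ->
  \esum_(n in [set: nat]) b n < +oo ->
  (forall k n, (k <= n)%N -> (`|u n - u k|)%:E <= \esum_(i in [set i | (k < i)%N]) b i) ->
  exists l : R, forall e : R, (0 < e)%R -> exists N, forall n, (N <= n)%N -> (`|u n - l| <= e)%R.
Proof.
move=> b0 bf h.
have cu : cvgn (u : nat -> R^o).
  apply/cauchy_cvgP/cauchy_exP => e e0.
  have [N HN] := esum_tail_small b0 bf (divr_gt0 e0 (ltr0Sn _ 1)); exists (u N).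
  exists N => // n /= Nn; rewrite /ball/= distrC.
  have := le_trans (h N n Nn) HN; rewrite lee_fin => /le_lt_trans; apply.
  by rewrite ltr_pdivrMr// ltr_pMr// ltr1n.
exists (limn (u : nat -> R^o)) => e e0.
move: cu => /cvgrPdist_le /(_ e e0)[N _ HN]; exists N => n Nn.
by rewrite distrC; exact: HN.
Qed.

(** The tails of b bound the increments of the partial sums, so real and imaginary parts are Cauchy
    and the upper limits in [clim] are limits. *)
Lemma csum_cvg f (b : nat -> \bar R) xi : (forall n, (nc (f n xi))%:E <= b n) ->
  \esum_(n in [set: nat]) b n < +oo ->
  (forall e : R, (0 < e)%R -> exists N, forall n, (N <= n)%N ->
    (nc (csum f n xi - clim (csum f) xi) <= e)%R) /\
  forall k, (nc (clim (csum f) xi - csum f k xi))%:E <= \esum_(i in [set i | (k < i)%N]) b i.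
Proof.
move=> fb bf; have b0 j : 0 <= b j by apply: le_trans (fb j); rewrite lee_fin normc_ge0.
have [l1 H1] := @cauchy_re (fun n => complex.Re (csum f n xi)) b b0 bf
  (fun k n kn => le_trans (eq_ind_r (fun z => `|z|%:E <= (nc (csum f n xi - csum f k xi)%R)%:E)
     (normRe_le (csum f n xi - csum f k xi)%R) (esym (raddfB _ _ _)))
     (csum_sub_le fb kn)).
have [l2 H2] := @cauchy_re (fun n => complex.Im (csum f n xi)) b b0 bf
  (fun k n kn => le_trans (eq_ind_r (fun z => `|z|%:E <= (nc (csum f n xi - csum f k xi)%R)%:E)
     (normIm_le (csum f n xi - csum f k xi)%R) (esym (raddfB _ _ _)))
     (csum_sub_le fb kn)).
have cv (e : R) : (0 < e)%R -> exists N, forall n, (N <= n)%N ->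
    (nc (csum f n xi - (l1 +i* l2)%C) <= e)%R.
  move=> e0; have e20 : (0 < e / 2)%R by rewrite divr_gt0.
  have [N1 HN1] := H1 _ e20; have [N2 HN2] := H2 _ e20.
  exists (maxn N1 N2) => n; rewrite geq_max => /andP[/HN1 h1 /HN2 h2].
  apply: le_trans (normc_le_ReIm _) _.
  by rewrite !raddfB/= (splitr e) lerD.
have E : clim (csum f) xi = (l1 +i* l2)%C by exact: clim_cvg.
split=> [e e0|k]; first by rewrite E; exact: cv.
rewrite E; apply/lee_addgt0Pr => e e0; have [N HN] := cv e e0.
pose n := maxn N k.
apply: (@le_trans _ _ ((nc (csum f n xi - csum f k xi)%R)%:E + (nc (csum f n xi - (l1 +i* l2)%C)%R)%:E)).
  rewrite -EFinD lee_fin [leRHS]addrC (normcBC (csum f n xi) (l1 +i* l2)%C).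
  exact: normc_tri.
rewrite leeD//; first by apply: csum_sub_le => //; rewrite leq_maxr.
by rewrite lee_fin HN// leq_maxl.
Qed.

End complex_limits.

(** * Statements holding almost everywhere *)

Section ae_tools.
Context d (T : measurableType d) (R : realType) (mu : {measure set T -> \bar R}).
Local Open Scope ereal_scope.

Lemma ae_imp (P Q : T -> Prop) : (forall x, P x -> Q x) ->
  {ae mu, forall x, P x} -> {ae mu, forall x, Q x}.
Proof. by move=> PQ; apply: filterS. Qed.

Lemma ae_imp2 (P Q S : T -> Prop) : (forall x, P x -> Q x -> S x) ->
  {ae mu, forall x, P x} -> {ae mu, forall x, Q x} -> {ae mu, forall x, S x}.
Proof. by move=> PQ; apply: filterS2. Qed.

Lemma ae_countable (I : choiceType) (A : set I) (P : I -> T -> Prop) :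
  countable A -> (forall i, A i -> {ae mu, forall x, P i x}) ->
  {ae mu, forall x, forall i, A i -> P i x}.
Proof.
move=> /countable_injP[g ginj] H.
have : {ae mu, forall x, forall n, (fun n x => forall i, A i -> g i = n -> P i x) n x}.
  apply: ae_foralln => n.
  have [[i [Ai gi]]|/forallNP h] := pselect (exists i, A i /\ g i = n).
    apply: filterS (H i Ai) => x Px j Aj gj.
    by rewrite (_ : j = i)//; apply: ginj; rewrite ?inE// gi gj.
  by apply: nearW => x i Ai gi; exfalso; apply: (h i).
by apply: filterS => x h i Ai; apply: (h (g i)).
Qed.

Lemma integral_ae_lty (D : set T) (g : T -> \bar R) : measurable D ->
  measurable_fun D g -> (forall x, 0 <= g x) -> \int[mu]_(x in D) g x < +oo ->
  {ae mu, forall x, D x -> g x < +oo}.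
Proof.
move=> mD mg g0 h.
have : mu.-integrable D g.
  apply/integrableP; split => //; rewrite (eq_integral g)// => x _.
  by rewrite gee0_abs.
by move=> /(integrable_ae mD); apply: filterS => x hx /hx; rewrite ge0_fin_numE.
Qed.

End ae_tools.

(** * Means over vertex balls *)

Section means.
Context {R : realType} {T : pmetricType R} (m : {outer_measure set T -> \bar R}).
Context (W : filling T).
Hypothesis mm : metric_measure_space m.
Local Open Scope ereal_scope.
Implicit Types (f : T -> R[i]) (x : vertex W).

Lemma vball_meas_gt0_lty x : 0 < m (vball x) < +oo.
Proof. by apply: mm.2; rewrite exprz_gt0. Qed.

Lemma vball_measE x : m (vball x) = (fine (m (vball x)))%:E.
Proof. by rewrite fineK// ge0_fin_numE//; case/andP: (vball_meas_gt0_lty x). Qed.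

Lemma fine_vball_gt0 x : (0 < fine (m (vball x)))%R.
Proof. by rewrite -lte_fin -vball_measE; case/andP: (vball_meas_gt0_lty x). Qed.

Lemma integrable_cst_vball x (a : R) :
  (cmeasure m).-integrable (vball x) (fun=> a%:E).
Proof.
apply/integrableP; split; first exact: measurable_cst.
have mB : measurable (vball x : set (caratheodory_type m)) by exact: measurable_ball_c.
rewrite [X in X < _](_ : _ = \int[cmeasure m]_(y in vball x) cst `|a%:E| y)//.
by rewrite integral_cst// [cmeasure m _]vball_measE abse_EFin -EFinM ltry.
Qed.

Lemma measurable_subC f (z : R[i]) : cmeasurable m f -> cmeasurable m (fun y => f y - z)%R.
Proof.
move=> [m1 m2]; split.
- by under eq_fun do rewrite raddfB; exact: measurable_funB.
- by under eq_fun do rewrite raddfB; exact: measurable_funB.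
Qed.

Lemma measurable_nc f : cmeasurable m f ->
  measurable_fun [set: caratheodory_type m] (fun y => (nc (f y))%:E).
Proof.
move=> [mre mim]; apply/measurable_EFinP.
rewrite (_ : (fun y => nc (f y)) = (fun y => (complex.Re (f y) ^+ 2 + complex.Im (f y) ^+ 2) `^ 2^-1)%R); last first.
  by apply/funext => y; rewrite powR12_sqrt ?addr_ge0 ?sqr_ge0//; case: (f y).
apply: (measurableT_comp (@measurable_powR R _)).
by apply: measurable_funD; apply: measurable_funX.
Qed.

(** The factor 2 comes from treating real and imaginary parts separately. Multiplying by the measure
    of the ball keeps the estimate free of divisions in the extended reals. *)
Lemma Pavg_sub_le f x (z : R[i]) : cmeasurable m f -> cintegrable m (vball x) f ->
  (nc (Pavg W m f x - z)%R)%:E * m (vball x) <=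
  2%:E * \int[cmeasure m]_(xi in vball x) (nc (f xi - z)%R)%:E.
Proof.
move=> mf [i1 i2]; have B0 := fine_vball_gt0 x.
have mB : measurable (vball x : set (caratheodory_type m)) by exact: measurable_ball_c.
set b := fine (m (vball x)) in B0.
have part (g : T -> R) (a : R) : (cmeasure m).-integrable (vball x) (fun y => (g y)%:E) ->
    (forall xi, (`|g xi - a| <= nc (f xi - z))%R) ->
    (`|b^-1 * (\int[cmeasure m]_(xi in vball x) g xi)%R - a|%R)%:E * m (vball x) <=
    \int[cmeasure m]_(xi in vball x) (nc (f xi - z)%R)%:E.
  move=> ig ga.
  have E : (b^-1 * (\int[cmeasure m]_(xi in vball x) g xi)%R - a = b^-1 * (\int[cmeasure m]_(xi in vball x) (g xi - a))%R)%R.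
    rewrite RintegralB//; last exact: (integrable_cst_vball x a).
    rewrite mulrBr; congr (_ - _)%R.
    rewrite /Rintegral (_ : (fun _ => _) = cst a%:E)// integral_cst//.
    rewrite [cmeasure m _]vball_measE -/b -EFinM/= mulrCA mulVf ?mulr1//.
    by rewrite gt_eqF.
  rewrite E normrM ger0_norm ?invr_ge0 ?(ltW B0)// vball_measE -/b -EFinM.
  rewrite mulrAC mulVf ?gt_eqF// mul1r.
  have ib : (cmeasure m).-integrable (vball x) (fun xi => (g xi - a)%:E).
    by under eq_fun do rewrite EFinB; apply: integrableB => //; exact: integrable_cst_vball.
  rewrite /Rintegral -abse_EFin fineK; last exact: integrable_fin_num.
  apply: le_trans (le_abse_integral _ mB _) _; first by case/integrableP: ib.
  apply: ge0_le_integral => //.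
  - by apply: measurableT_comp => //; case/integrableP: ib.
  - by apply: measurable_funTS; apply: measurable_nc; exact: measurable_subC.
  - by move=> xi _; rewrite abse_EFin lee_fin.
have p1 := part (fun xi => complex.Re (f xi)) (complex.Re z) i1.
have p2 := part (fun xi => complex.Im (f xi)) (complex.Im z) i2.
have {}p1 := p1 (fun xi => eq_ind _ (fun w => `|w| <= nc (f xi - z))%R (normRe_le (f xi - z)%R) _ (raddfB _ _ _)).
have {}p2 := p2 (fun xi => eq_ind _ (fun w => `|w| <= nc (f xi - z))%R (normIm_le (f xi - z)%R) _ (raddfB _ _ _)).
rewrite (_ : 2%:E = 1%:E + 1%:E)%E; last by rewrite -EFinD.
rewrite ge0_muleDl ?lee_fin// mul1e; apply: le_trans (leeD p1 p2).
rewrite -ge0_muleDl ?lee_fin// lee_wpmul2r// -EFinD lee_fin.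
apply: le_trans (normc_le_ReIm _) _; rewrite !raddfB/= /Pavg /cintegral -/b.
by rewrite /= !mul0r subr0 addr0 lexx.
Qed.

Lemma Pavg_ae_eq f g x : cmeasurable m f -> cmeasurable m g -> cae_eq m f g ->
  Pavg W m f x = Pavg W m g x.
Proof.
move=> [f1 f2] [g1 g2] fg; congr (_ * _)%R; rewrite /cintegral /Rintegral.
have mB : measurable (vball x : set (caratheodory_type m)) by exact: measurable_ball_c.
congr (fine _ +i* fine _)%C; apply: ae_eq_integral => //.
- by apply/measurable_EFinP; apply: measurable_funTS.
- by apply/measurable_EFinP; apply: measurable_funTS.
- by apply: (ae_imp (mu := cmeasure m) _ fg) => y -> .
- by apply/measurable_EFinP; apply: measurable_funTS.
- by apply/measurable_EFinP; apply: measurable_funTS.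
- by apply: (ae_imp (mu := cmeasure m) _ fg) => y -> .
Qed.

End means.

(** * Synthesis of Besov functions from Lipschitz terms *)

Section synthesis.
Context {R : realType} {T : pmetricType R} (m : {outer_measure set T -> \bar R}).
Context (D : R) (W : filling T).
Hypothesis Hm : regular_space D m.
Local Notation V := (vertex W).
Implicit Types (c : V -> \bar R) (f : nat -> T -> R[i]) (n k j : nat) (xi eta zeta : T)
  (x y : V) (p s : R) (q : \bar R).
Local Open Scope ereal_scope.

Let mm : metric_measure_space m. Proof. by case: Hm. Qed.
Let D0 : (0 < D)%R. Proof. by case: Hm. Qed.

(** The common interface of the trace series on F and the extension series on Z. The Lipschitz bound
    is asked for all pairs of points; for distant ones it follows from the size bound. *)
Definition synth_data c f : Prop :=
  [/\ (forall x, 0 <= c x), (forall n, cmeasurable m (f n)),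
      (forall n xi, (nc (f n xi))%:E <= bsum c n xi) &
      (forall n xi eta, (nc (f n xi - f n eta)%R)%:E <=
        (2 ^+ n * mdist xi eta)%:E * (bsum c n xi + bsum c n eta))].

(** Level 0 is enough: its tails contain all levels, so [tail_mean] makes the sum of all majorants
    integrable on every ball of level 0. *)
Definition fine_tails c : Prop := forall x, lev 0 x -> tail_sum D c 0 x < +oo.

Definition total_bsum c xi : \bar R := \esum_(n in [set: nat]) bsum c n xi.

(** Levels n up to k enter with the factor 2^(n - k) that the Lipschitz bound gains at distance
    [rad k]; finer ones enter through the tails at k or k.+1. All n are included so that the kernel
    is symmetric, as Schur's test requires. *)
Definition level_sum c k xi : \bar R :=
  \esum_(n in [set: nat]) ((geo_kernel 1 k n)%:E * near_tail D c n xi).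

Lemma measurable_total_bsum c : (forall x, 0 <= c x) ->
  measurable_fun [set: caratheodory_type m] (total_bsum c).
Proof.
move=> c0; apply: measurable_esum => [|n xi|n _].
- exact: countableP.
- exact: bsum_ge0.
- exact: (measurable_bsum Hm).
Qed.

Lemma total_bsum_mean c x : (forall x, 0 <= c x) -> fine_tails c -> lev 0 x ->
  \int[cmeasure m]_(xi in vball x) total_bsum c xi < +oo.
Proof.
move=> c0 ft x0; have [C C0 HC] := tail_mean W Hm.
have := HC c 0%N x c0 x0.
rewrite (_ : [set n | (0 <= n)%N] = setT); last by apply/seteqP; split.
move=> /le_lt_trans; apply; rewrite (vball_measE mm) -EFinM.
have := ft x x0; have := tail_sum_ge0 D 0 x c0.
by case: (tail_sum _ _ _ _) => [r||]//= _ _; rewrite -EFinM ltry.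
Qed.

Lemma total_bsum_ae c : (forall x, 0 <= c x) -> fine_tails c ->
  {ae cmeasure m, forall xi, total_bsum c xi < +oo}.
Proof.
move=> c0 ft.
have H x : lev 0 x -> {ae cmeasure m, forall xi, vball x xi -> total_bsum c xi < +oo}.
  move=> x0; apply: integral_ae_lty.
  - exact: measurable_ball_c.
  - by apply: measurable_funTS; exact: measurable_total_bsum.
  - by move=> xi; apply: esum_ge0 => n _; exact: bsum_ge0.
  - exact: total_bsum_mean.
apply: (ae_imp (mu := cmeasure m) _ (ae_countable (lev_countable W Hm 0) H)) => xi h.
by have [x x0 xB] := lev_cover_vball W 0 xi; exact: (h x).
Qed.

Lemma total_bsum_ball c xi r : (forall x, 0 <= c x) -> fine_tails c ->
  \int[cmeasure m]_(eta in ball xi r) total_bsum c eta < +oo.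
Proof.
move=> c0 ft; set K := (r + 1)%R; set A := @nearv _ _ W K 0 xi.
have fA : finite_set A by exact: (nearv_finite _ Hm).
have t0 eta : 0 <= total_bsum c eta by apply: esum_ge0 => n _; exact: bsum_ge0.
have mt := measurable_total_bsum c0.
have mB x : measurable (vball x : set (caratheodory_type m)) by exact: measurable_ball_c.
apply: (@le_lt_trans _ _ (\esum_(x in A) \int[cmeasure m]_(eta in vball x) total_bsum c eta)); last first.
  rewrite esum_fset//; last by move=> x _; exact: integral_ge0.
  rewrite fsbig_finite//= big_seq; apply: lte_sum_pinfty => x.
  rewrite in_fset_set// inE => -[x0 _].
  exact: total_bsum_mean.
under eq_esum do rewrite integral_mkcond.
rewrite -integral_esum//; last 3 first.
- exact: finite_set_countable.
- by move=> x eta; rewrite patchE; case: ifP.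
- move=> x _; apply/(measurable_restrictT _ (mB x)); exact: measurable_funTS.
rewrite [leLHS]integral_mkcond; apply: ge0_le_integral => //.
- by move=> eta _; rewrite patchE; case: ifP.
- apply/(measurable_restrictT _ (measurable_ball_c mm xi r)); exact: measurable_funTS.
- apply: measurable_esum; first exact: finite_set_countable.
  + by move=> x eta; rewrite patchE; case: ifP.
  + by move=> x _; apply/(measurable_restrictT _ (mB x)); exact: measurable_funTS.
move=> eta _; rewrite patchE; case: ifPn => [|_]; last first.
  by apply: esum_ge0 => x _; rewrite patchE; case: ifP.
rewrite inE ballEmdist/= => hr.
have [x x0 xB] := lev_cover_vball W 0 eta.
apply: (@le_trans _ _ ((total_bsum c \_ (vball x)) eta)).
  by rewrite patchE mem_set.
apply: (esum_ge_term (a := fun x => (total_bsum c \_ (vball x)) eta)); last first.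
  by move=> y _; rewrite patchE; case: ifP.
split => //; rewrite rad0 mulr1.
have := metric_triangle (center x) eta xi; rewrite (metric_sym eta xi).
by have := (vballE _ x0).1 xB; rewrite rad0 /K; lra.
Qed.

Lemma synth_cvg c f xi : synth_data c f -> total_bsum c xi < +oo ->
  forall k, (nc (clim (csum f) xi - csum f k xi)%R)%:E <=
    \esum_(n in [set n | (k < n)%N]) bsum c n xi.
Proof. by move=> [_ _ h _] ft; have [] := csum_cvg (fun n => h n xi) ft. Qed.

Lemma synth_le_total c f xi : synth_data c f -> total_bsum c xi < +oo ->
  (nc (clim (csum f) xi))%:E <= total_bsum c xi.
Proof.
move=> [c0 _ h d4] ft; have [_ /(_ 0%N)] := csum_cvg (fun n => h n xi) ft.
rewrite {2}/csum big_ord1 => h1.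
apply: (@le_trans _ _ (\esum_(n in [set n | (0 < n)%N]) bsum c n xi + bsum c 0 xi)).
  apply: le_trans (leeD h1 (h 0%N xi)); rewrite -EFinD lee_fin.
  by have := normcD (clim (csum f) xi - f 0%N xi)%R (f 0%N xi); rewrite subrK.
rewrite addeC /total_bsum (esumID [set 0%N] setT); last by move=> n _; exact: bsum_ge0.
rewrite setTI esum_set1 ?bsum_ge0// leeD2l// setTI.
apply: esum_le_subset => [n /= n0 n00|n _]; last exact: bsum_ge0.
by rewrite n00 in n0.
Qed.

Lemma synth_L1loc c f : synth_data c f -> fine_tails c -> L1loc m (clim (csum f)).
Proof.
move=> sd ft; have [c0 mf _ _] := sd.
have mH : cmeasurable m (clim (csum f)).
  by apply: measurable_clim => n; exact: measurable_csum.
split => // xi r r0.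
have mB := measurable_ball_c mm xi r.
have ae : {ae cmeasure m, forall eta, ball xi r eta -> (nc (clim (csum f) eta))%:E <= total_bsum c eta}.
  apply: (ae_imp (mu := cmeasure m) _ (total_bsum_ae c0 ft)) => eta h _.
  exact: synth_le_total.
have fin : \int[cmeasure m]_(eta in ball xi r) (nc (clim (csum f) eta))%:E < +oo.
  apply: le_lt_trans (total_bsum_ball xi r c0 ft).
  apply: ae_ge0_le_integral => //.
  - by move=> eta _; rewrite lee_fin normc_ge0.
  - by apply: measurable_funTS; exact: measurable_nc.
  - by move=> eta _; apply: esum_ge0 => n _; exact: bsum_ge0.
  - by apply: measurable_funTS; exact: measurable_total_bsum.
have inc : (cmeasure m).-integrable (ball xi r) (fun eta => (nc (clim (csum f) eta))%:E).
  apply/integrableP; split; first by apply: measurable_funTS; exact: measurable_nc.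
  by under eq_integral do rewrite abse_EFin (ger0_norm (normc_ge0 _)).
split; apply: (le_integrable mB _ _ inc).
- by apply/measurable_EFinP; apply: measurable_funTS; case: mH.
- by move=> eta _; rewrite !abse_EFin lee_fin (ger0_norm (normc_ge0 _)) normRe_le.
- by apply/measurable_EFinP; apply: measurable_funTS; case: mH.
- by move=> eta _; rewrite !abse_EFin lee_fin (ger0_norm (normc_ge0 _)) normIm_le.
Qed.

Lemma level_sum_ge0 c k xi : (forall x, 0 <= c x) -> 0 <= level_sum c k xi.
Proof.
move=> c0; apply: esum_ge0 => n _.
by rewrite mule_ge0 ?near_tail_ge0// lee_fin ltW// geo_kernel_gt0.
Qed.

Lemma bsum_le_near_tail c n xi zeta : (forall x, 0 <= c x) ->
  (mdist zeta xi <= 4 * rad n)%R -> bsum c n zeta <= near_tail D c n xi.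
Proof.
move=> c0 d; apply: (@le_trans _ _ (\esum_(x in nearv 8 n xi) c x)); last first.
  by apply: le_esum => x [xn _]; exact: le_tail_sum.
apply: esum_le_subset => // x [xn xB]; split => //.
have := metric_triangle (center x) zeta xi; have := (vballE _ xn).1 xB.
have := @rad_gt0 R n; lra.
Qed.

Lemma tail_le_level c k j x xi : (forall x, 0 <= c x) -> lev j x ->
  (j = k \/ j = k.+1) -> (mdist (center x) xi < 4 * rad k)%R ->
  tail_sum D c j x <= 2%:E * level_sum c k xi.
Proof.
move=> c0 xj jk d.
apply: (@le_trans _ _ (near_tail D c j xi)).
  apply: (esum_ge_term (a := tail_sum D c j)); last by move=> *; exact: tail_sum_ge0.
  split => //; apply: lt_le_trans d _; have := @rad_gt0 R k.
  by case: jk => ->; rewrite ?(@radS R k); have := @rad_gt0 R k.+1; lra.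
have h : (geo_kernel 1 k j)%:E * near_tail D c j xi <= level_sum c k xi.
  apply: (esum_ge_term (a := fun n => (geo_kernel 1 k n)%:E * near_tail D c n xi)) => //.
  by move=> n _; rewrite mule_ge0 ?near_tail_ge0// lee_fin ltW// geo_kernel_gt0.
(* The kernel is 1 for j = k and 1/2 for j = k.+1, hence the factor 2. *)
apply: le_trans (_ : 2%:E * ((geo_kernel 1 k j)%:E * near_tail D c j xi) <= _).
  rewrite muleA -EFinM -[leLHS]mul1e lee_wpmul2r ?near_tail_ge0// lee_fin.
  have kj : (k <= j)%N by case: jk => ->.
  rewrite geo_kernel_le//; case: jk => ->.
    by rewrite subrr mulr0 oppr0 powRr0 mulr1 ler1n.
  rewrite -natrB// subSnn mulr1 powRN powRr1// mulfV//.
by rewrite lee_wpmul2l.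
Qed.

(** Over the distance [4 * rad k] the term of index i varies by at most 4 * 2^(i - k) times the sum
    of two majorants, each below [near_tail] at xi; this gives the 8. *)
Lemma csum_near c f k xi zeta : synth_data c f -> (mdist zeta xi < 4 * rad k)%R ->
  (nc (csum f k zeta - csum f k xi)%R)%:E <= 8%:E * level_sum c k xi.
Proof.
move=> [c0 _ _ h] d; rewrite /csum -sumrB.
apply: (@le_trans _ _ (\sum_(i < k.+1) (nc (f i zeta - f i xi)%R)%:E)).
  by rewrite sumEFin lee_fin; exact: normc_sum.
apply: (@le_trans _ _ (\sum_(i < k.+1) (8%:E * ((geo_kernel 1 k i)%:E * near_tail D c i xi)))).
  apply: lee_sum => i _; have ik : (i <= k)%N by rewrite -ltnS.
  apply: le_trans (h i zeta xi) _; have ri := @rad_le R _ _ ik.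
  have ntp := near_tail_ge0 D i xi c0.
  apply: (@le_trans _ _ ((4 * geo_kernel 1 k i)%:E * (near_tail D c i xi + near_tail D c i xi))).
    apply: lee_pmul.
    - by rewrite lee_fin mulr_ge0 ?exprn_ge0// mdist_ge0.
    - by rewrite adde_ge0// bsum_ge0.
    - rewrite lee_fin geo_kernelC geo_kernel_le// mul1r opprB e2D e2_nat -radE.
      by rewrite mulrCA ler_wpM2l ?exprn_ge0// ltW.
    - have r0 := @rad_gt0 R i.
      apply: leeD; apply: bsum_le_near_tail => //; first by lra.
      by rewrite mdistxx; lra.
  have -> : near_tail D c i xi + near_tail D c i xi = 2%:E * near_tail D c i xi.
    by rewrite (_ : 2%:E = 1%:E + 1%:E)%E ?ge0_muleDl ?lee_fin// ?mul1e// -EFinD.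
  rewrite !muleA -!EFinM lee_wpmul2r// lee_fin le_eqVlt.
  by apply/orP; left; apply/eqP; ring.
rewrite -ge0_sume_distrr; last first.
  by move=> i _; rewrite mule_ge0 ?near_tail_ge0// lee_fin ltW// geo_kernel_gt0.
rewrite lee_wpmul2l// /level_sum -nneseries_esumT; last first.
  by move=> i; rewrite mule_ge0 ?near_tail_ge0// lee_fin ltW// geo_kernel_gt0.
rewrite -(big_mkord xpredT (fun i => (geo_kernel 1 k i)%:E * near_tail D c i xi)).
apply: nneseries_lim_ge => i _ _.
by rewrite mule_ge0 ?near_tail_ge0// lee_fin ltW// geo_kernel_gt0.
Qed.

Lemma synth_cintegrable c f x : synth_data c f -> fine_tails c ->
  cintegrable m (vball x) (clim (csum f)).
Proof.
by move=> sd ft; have [_ h] := synth_L1loc sd ft; apply: h; rewrite exprz_gt0.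
Qed.

Lemma mean_le (a b B : \bar R) (x : V) : 0 <= b -> 0 <= B ->
  a * m (vball x) <= 2%:E * B -> B <= b * m (vball x) -> a <= 2%:E * b.
Proof.
move=> b0 B0; rewrite (vball_measE mm) => h1 h2.
have e0 := fine_vball_gt0 mm x.
rewrite -(@lee_pmul2r _ (fine (m (vball x)))%:E)//.
by apply: le_trans h1 _; rewrite -muleA lee_wpmul2l.
Qed.

(* Comparison of the mean over a vertex ball with the partial sum at a nearby
   point: levels up to [k] through the Lipschitz bound, the others through
   [tail_mean]. *)
Lemma Pavg_near : exists2 C : R, (0 <= C)%R & forall c f k j x xi,
  synth_data c f -> fine_tails c -> lev j x -> (j = k \/ j = k.+1) ->
  (mdist (center x) xi < 4 * rad k)%R ->
  (forall zeta, vball x zeta -> (mdist zeta xi < 4 * rad k)%R) ->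
  (nc (Pavg W m (clim (csum f)) x - csum f k xi)%R)%:E <= C%:E * level_sum c k xi.
Proof.
have [C C0 HC] := tail_mean W Hm.
(* The outer 2 comes from [Pavg_sub_le], the 8 from [csum_near], and C with its 2 from [tail_mean]
   followed by [tail_le_level]. *)
exists (2 * (8 + C * 2))%R; first by rewrite mulr_ge0// addr_ge0// mulr_ge0.
move=> c f k j x xi sd ft xj jk dc dB; have [c0 mf h3 h4] := sd.
have S0 := level_sum_ge0 k xi c0.
have kj : (k <= j)%N by case: jk => ->.
have mH : cmeasurable m (clim (csum f)).
  by apply: measurable_clim => n; exact: measurable_csum.
have mB : measurable (vball x : set (caratheodory_type m)) by exact: measurable_ball_c.
pose tl zeta := \esum_(n in [set n | (j <= n)%N]) bsum c n zeta.
have tl0 zeta : 0 <= tl zeta by apply: esum_ge0 => n _; exact: bsum_ge0.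
have mtl : measurable_fun [set: caratheodory_type m] tl.
  apply: measurable_esum => [|n zeta|n _]; first exact: countableP.
    exact: bsum_ge0.
  exact: (measurable_bsum Hm).
have pt : {ae cmeasure m, forall zeta, vball x zeta ->
    (nc (clim (csum f) zeta - csum f k xi)%R)%:E <= 8%:E * level_sum c k xi + tl zeta}.
  apply: (ae_imp (mu := cmeasure m) _ (total_bsum_ae c0 ft)) => zeta fz zB.
  apply: (@le_trans _ _ ((nc (csum f k zeta - csum f k xi)%R)%:E + (nc (clim (csum f) zeta - csum f k zeta)%R)%:E)).
    by rewrite -EFinD lee_fin [leRHS]addrC; exact: normc_tri.
  apply: leeD; first exact: (csum_near sd (dB _ zB)).
  apply: le_trans (synth_cvg sd fz k) _; apply: esum_le_subset => [n /= kn|n _].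
    by case: jk => -> //; exact: ltnW.
  exact: bsum_ge0.
have i1 := Pavg_sub_le (x := x) mm (csum f k xi) mH (synth_cintegrable x sd ft).
apply: le_trans (_ : 2%:E * (8%:E * level_sum c k xi + C%:E * tail_sum D c j x) <= _).
  apply: (mean_le _ _ i1).
  - by rewrite adde_ge0 ?mule_ge0 ?tail_sum_ge0.
  - by apply: integral_ge0 => *; rewrite lee_fin normc_ge0.
  apply: (@le_trans _ _ (\int[cmeasure m]_(zeta in vball x) (8%:E * level_sum c k xi + tl zeta))).
    apply: ae_ge0_le_integral => //.
    - by move=> *; rewrite lee_fin normc_ge0.
    - by apply: measurable_funTS; apply: measurable_nc; exact: measurable_subC.
    - by move=> *; rewrite adde_ge0 ?mule_ge0.
    - by apply: emeasurable_funD => //; apply: measurable_funTS.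
  rewrite ge0_integralD//; last 2 first.
  - by move=> *; rewrite mule_ge0.
  - exact: measurable_funTS.
  rewrite ge0_muleDl ?mule_ge0 ?tail_sum_ge0//; apply: leeD.
    by rewrite (_ : (fun _ => _) = cst (8%:E * level_sum c k xi))// integral_cst.
  by rewrite muleAC; exact: HC.
rewrite [in leRHS]EFinM -muleA lee_wpmul2l// (EFinD 8 (C * 2)%R) ge0_muleDl ?lee_fin ?mulr_ge0//.
rewrite leeD2l// [in leRHS]EFinM -muleA lee_wpmul2l ?lee_fin//.
exact: tail_le_level.
Qed.

(** The means at both endpoints are compared with the same number [csum f k xi]; for this
    [Pavg_near] admits vertices of level k.+1. *)
Lemma edge_sum_synth : exists2 C : R, (0 <= C)%R & forall c f k xi,
  synth_data c f -> fine_tails c ->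
  edge_sum k (Pavg W m (clim (csum f))) xi <= C%:E * level_sum c k xi.
Proof.
have [C C0 HC] := Pavg_near; have [N N1 HN] := eball_count W Hm.
have N0 : (0 < N)%R by exact: lt_le_trans N1.
exists (N * (C + C))%R; first by rewrite mulr_ge0 ?addr_ge0// ltW.
move=> c f k xi sd ft; have c0 : forall x, 0 <= c x by case: sd.
have S0 := level_sum_ge0 k xi c0.
rewrite EFinM -muleA; apply: esum_le_count => //.
  by rewrite mule_ge0// lee_fin addr_ge0.
move=> e [ek exi]; have [e1 e2] := elev_levels ek; have [n1 n2] := elev_near ek exi.
have [_ _ I] := edge_adjacent ek.1.
set H := clim _; set z := csum f k xi.
have h1 : (nc (Pavg W m H e.1 - z)%R)%:E <= C%:E * level_sum c k xi.
  apply: (HC c f k k e.1) => //; first by left.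
  by move=> zeta zB; apply: (vball_diam e1 e2 I) => //; left.
have h2 : (nc (Pavg W m H e.2 - z)%R)%:E <= C%:E * level_sum c k xi.
  have zd zeta : vball e.2 zeta -> (mdist zeta xi < 4 * rad k)%R.
    by move=> zB; apply: (vball_diam e1 e2 I) => //; right.
  by case: e2 => e2; [apply: (HC c f k k e.2)|apply: (HC c f k k.+1 e.2)] => //; [left|right].
rewrite EFinD ge0_muleDl//; apply: le_trans (leeD h2 h1); rewrite -EFinD lee_fin.
by rewrite /du (normcBC (Pavg W m H e.1)); exact: normc_tri.
Qed.

Lemma T0_synth : exists2 C : R, (0 <= C)%R & forall c f xi,
  synth_data c f -> fine_tails c ->
  cabs (T0 (Pavg W m (clim (csum f)))) xi <= C%:E * near_tail D c 0 xi.
Proof.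
have [C C0 HC] := tail_mean W Hm.
exists (2 * C)%R; first by rewrite mulr_ge0.
move=> c f xi sd ft; have c0 : forall x, 0 <= c x by case: sd.
have [_ mf _ _] := sd; have A0 := near_tail_ge0 D 0 xi c0.
have mH : cmeasurable m (clim (csum f)).
  by apply: measurable_clim => n; exact: measurable_csum.
have H x : lev 0 x -> vball x xi ->
    (nc (Pavg W m (clim (csum f)) x - (0 : R[i]))%R)%:E <= (2 * C)%:E * near_tail D c 0 xi.
  move=> x0 xB.
  have mB : measurable (vball x : set (caratheodory_type m)) by exact: measurable_ball_c.
  have i1 := Pavg_sub_le (x := x) mm (0 : R[i])%R mH (synth_cintegrable x sd ft).
  apply: (@le_trans _ _ (2%:E * (C%:E * tail_sum D c 0 x))).
    apply: (mean_le _ _ i1).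
    - by rewrite mule_ge0 ?tail_sum_ge0.
    - by apply: integral_ge0 => *; rewrite lee_fin normc_ge0.
    apply: (@le_trans _ _ (\int[cmeasure m]_(zeta in vball x) total_bsum c zeta)).
      apply: ae_ge0_le_integral => //.
      - by move=> *; rewrite lee_fin normc_ge0.
      - by apply: measurable_funTS; apply: measurable_nc; exact: measurable_subC.
      - by move=> *; apply: esum_ge0 => n _; exact: bsum_ge0.
      - by apply: measurable_funTS; exact: measurable_total_bsum.
      apply: (ae_imp (mu := cmeasure m) _ (total_bsum_ae c0 ft)) => zeta h _.
      by rewrite subr0; exact: synth_le_total.
    have := HC c 0%N x c0 x0.
    rewrite (_ : [set n | (0 <= n)%N] = setT); last by apply/seteqP; split.
    by rewrite muleAC.
  rewrite EFinM -muleA lee_wpmul2l// lee_wpmul2l ?lee_fin//.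
  apply: (esum_ge_term (a := tail_sum D c 0)); last by move=> *; exact: tail_sum_ge0.
  split => //; have := (vballE _ x0).1 xB; rewrite rad0; lra.
rewrite /cabs; set B := (_ * _) in H *.
have B0 : 0 <= B by rewrite mule_ge0// lee_fin mulr_ge0.
case: B B0 H => [b|_ _|//]; last by rewrite leey.
rewrite !lee_fin => b0 H.
rewrite -[T0 _ xi]subr0; apply: (Tn_osc Hm) => x x0 xB.
by have := H x x0 xB; rewrite lee_fin.
Qed.

Lemma measurable_near_tail c n : (forall x, 0 <= c x) ->
  measurable_fun [set: caratheodory_type m] (near_tail D c n).
Proof. by move=> c0; apply: (measurable_near_sum Hm) => x; exact: tail_sum_ge0. Qed.

Lemma measurable_level_sum c k : (forall x, 0 <= c x) ->
  measurable_fun [set: caratheodory_type m] (level_sum c k).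
Proof.
move=> c0; apply: measurable_esum => [|n zeta|n _]; first exact: countableP.
  by rewrite mule_ge0 ?near_tail_ge0// lee_fin ltW// geo_kernel_gt0.
by apply: measurable_funeM; exact: measurable_near_tail.
Qed.

(** The kernel decays with rate 1 and the weight 2^(k s) takes s of it. Half of the remaining 1 - s
    is spent on the power of the sum, the other half survives in the kernel on the right. *)
Lemma level_sum_pow p s : (0 < p)%R -> (0 < s < 1)%R -> exists2 C : R, (0 <= C)%R &
  forall c k, (forall x, 0 <= c x) ->
  (2 `^ (k%:R * (s * p)))%:E * \int[cmeasure m]_xi (level_sum c k xi `^ p) <=
  C%:E * \esum_(n in [set: nat]) ((geo_kernel (p * (1 - s) / 2) k n)%:E *
    ((2 `^ (n%:R * (s * p - D)))%:E * psum_lev (tail_sum D c n) p n)).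
Proof.
move=> p0 /andP[s0 s1].
have d0 : (0 < (1 - s) / 2)%R by rewrite divr_gt0// subr_gt0.
have [K K0 HK] := geo_kernel_sum d0.
have [C C0 HC] := near_pow_integral W Hm p0 (ler1n R 8).
exists (K `^ p * C)%R; first by rewrite mulr_ge0 ?powR_ge0.
move=> c k c0.
have gk0 d n : 0 <= (geo_kernel d k n)%:E :> \bar R by rewrite lee_fin ltW// geo_kernel_gt0.
have mp n : measurable_fun [set: caratheodory_type m] (fun xi => near_tail D c n xi `^ p).
  by apply: (measurableT_comp (measurable_poweR p)); exact: measurable_near_tail.
apply: (@le_trans _ _ ((2 `^ (k%:R * (s * p)))%:E * \int[cmeasure m]_xi
    ((K `^ p)%:E * \esum_(n in [set: nat]) ((geo_kernel (p - (1 - s) / 2 * p) k n)%:E * near_tail D c n xi `^ p)))).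
  rewrite lee_wpmul2l ?lee_fin ?e2_ge0//; apply: ge0_le_integral => //.
  - by move=> *; exact: poweR_ge0.
  - by apply: (measurableT_comp (measurable_poweR p)); exact: measurable_level_sum.
  - apply: measurable_funeM; apply: measurable_esum => [|n zeta|n _]; first exact: countableP.
      by rewrite mule_ge0 ?poweR_ge0.
    exact: measurable_funeM.
  move=> xi _; apply: le_trans (esum_pow_weight p0 (ltW K0) _ _ (HK k)) _.
  - by move=> n _; rewrite mule_ge0 ?near_tail_ge0.
  - by move=> *; exact: geo_kernel_gt0.
  rewrite lee_wpmul2l ?lee_fin ?powR_ge0//; apply: le_esum => n _.
  rewrite poweRM ?near_tail_ge0// muleA lee_wpmul2r ?poweR_ge0//.
  rewrite poweR_EFin -EFinM lee_fin !geo_kernel_pow /geo_kernel -e2D; apply: e2_le.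
  by rewrite le_eqVlt; apply/orP; left; apply/eqP; ring.
rewrite ge0_integralZl//; last 3 first.
- apply: measurable_esum => [|n zeta|n _]; first exact: countableP.
    by rewrite mule_ge0 ?poweR_ge0.
  exact: measurable_funeM.
- by move=> xi _; apply: esum_ge0 => n _; rewrite mule_ge0 ?poweR_ge0.
- by rewrite lee_fin powR_ge0.
rewrite muleCA EFinM -muleA lee_wpmul2l ?lee_fin ?powR_ge0//.
rewrite integral_esum//; last 3 first.
- exact: countableP.
- by move=> *; rewrite mule_ge0 ?poweR_ge0.
- by move=> n _; exact: measurable_funeM.
rewrite -!esumZl ?e2_ge0//; last 2 first.
- by move=> n _; rewrite !mule_ge0 ?psum_lev_ge0// lee_fin e2_ge0.
- by move=> n _; apply: integral_ge0 => *; rewrite mule_ge0 ?poweR_ge0.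
apply: le_esum => n _; rewrite ge0_integralZl//; last by move=> *; exact: poweR_ge0.
apply: (@le_trans _ _ ((2 `^ (k%:R * (s * p)))%:E * ((geo_kernel (p - (1 - s) / 2 * p) k n)%:E *
    ((C * 2 `^ (- (n%:R * D)))%:E * psum_lev (tail_sum D c n) p n)))).
  rewrite lee_wpmul2l ?lee_fin ?e2_ge0// lee_wpmul2l//.
  by apply: HC => x; exact: tail_sum_ge0.
rewrite !muleA lee_wpmul2r ?psum_lev_ge0// -!EFinM lee_fin mulrCA -!mulrA ler_wpM2l//.
rewrite /geo_kernel -!e2D; apply: e2_le.
have h : (k%:R - n%:R <= `|k%:R - n%:R| :> R)%R by exact: ler_norm.
have sp0 : (0 <= s * p)%R by rewrite mulr_ge0 ?ltW.
have := ler_wpM2l sp0 h; lra.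
Qed.

(** The weight depends on the dimension and the smoothness only through s p - D, which is the same
    for Q and s on Z as for lambda and s - (Q - lambda) / p on F. Every passage between the two
    fillings uses this. *)
Definition level_norm p s c k : \bar R :=
  ((2 `^ (k%:R * (s * p - D)))%:E * psum_lev c p k) `^ p^-1.

Lemma level_norm_ge0 p s c k : 0 <= level_norm p s c k.
Proof. exact: poweR_ge0. Qed.

Lemma level_normK p s c k : (0 < p)%R ->
  level_norm p s c k `^ p = (2 `^ (k%:R * (s * p - D)))%:E * psum_lev c p k.
Proof.
by move=> p0; rewrite poweRKV// mule_ge0 ?psum_lev_ge0// lee_fin e2_ge0.
Qed.

Lemma level_norm_tail p s q : (0 < p)%R -> 0 < q -> (0 < tail_exp D p s)%R ->
  exists2 C : R, (0 <= C)%R & forall c, (forall x, 0 <= c x) ->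
  lq_norm q setT (fun k => level_norm p s (tail_sum D c k) k) <=
  C%:E * lq_norm q setT (level_norm p s c).
Proof.
move=> p0 q0 te; have [C C0 HC] := tail_sum_pow W Hm p0 te.
have te2 : (0 < tail_exp D p s / 2)%R by rewrite divr_gt0.
have [K K0 HK] := lq_norm_geo q0 p0 te2 C0; exists K => // c c0.
apply: HK => [k|k|k]; [exact: level_norm_ge0|exact: level_norm_ge0|].
rewrite level_normK//; apply: le_trans (HC c k c0) _.
rewrite lee_wpmul2l ?lee_fin//; apply: le_esum => n _.
by rewrite level_normK.
Qed.

Lemma fine_tails_lq p s q c : (0 < p)%R -> 0 < q -> (0 < tail_exp D p s)%R ->
  (forall x, 0 <= c x) -> lq_norm q setT (level_norm p s c) < +oo -> fine_tails c.
Proof.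
move=> p0 q0 te c0 fin x x0; have [C C0 HC] := level_norm_tail p0 q0 te.
have h : level_norm p s (tail_sum D c 0) 0 < +oo.
  apply: le_lt_trans (_ : C%:E * lq_norm q setT (level_norm p s c) < +oo).
    apply: le_trans (HC c c0).
    apply: (lq_norm_term (a := fun k => level_norm p s (tail_sum D c k) k)) => //.
    by move=> *; exact: level_norm_ge0.
  have := lq_norm_ge0 q setT (level_norm p s c).
  by case: (lq_norm _ _ _) fin => [r||]//= _ _; rewrite -EFinM ltry.
have p1 : (p^-1 != 0)%R by rewrite invr_neq0// gt_eqF.
move: h; rewrite /level_norm mul0r powRr0 mul1e => /(lty_poweRy p1) h.
have pn : p != 0%R by rewrite gt_eqF.
apply: (lty_poweRy pn); apply: le_lt_trans h.
by apply: (esum_ge_term (a := fun x => tail_sum D c 0 x `^ p)) => // *; exact: poweR_ge0.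
Qed.

Lemma Lp_norm_pow p (h : T -> \bar R) : (0 < p)%R -> (forall xi, 0 <= h xi) ->
  Lp_norm m p%:E h `^ p = \int[cmeasure m]_xi (h xi `^ p).
Proof.
move=> p0 h0; rewrite poweR_Lnorm ?gt_eqF//.
by apply: eq_integral => x _; rewrite gee0_abs.
Qed.

(** Two applications of Schur's test: from the coefficients to their tails, where a positive
    [tail_exp] handles finer levels, and from the tails to the edge sums, where s < 1 handles
    coarser ones. *)
Lemma besov_synth p s q : (0 < p)%R -> 0 < q -> (0 < s < 1)%R -> (0 < tail_exp D p s)%R ->
  exists2 C : R, (0 <= C)%R & forall c f, synth_data c f -> fine_tails c ->
  besov_norm m W s p%:E q (clim (csum f)) <= C%:E * lq_norm q setT (level_norm p s c).
Proof.
move=> p0 q0 s01 te; have [s0 s1] := andP s01.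
have [C1 C10 HC1] := level_norm_tail p0 q0 te.
have [C2 C20 HC2] := level_sum_pow p0 s01.
have [C3 C30 HC3] := edge_sum_synth; have [C4 C40 HC4] := T0_synth.
have [C5 C50 HC5] := near_pow_integral W Hm p0 (ler1n R 8).
have C32 : (0 <= C3 `^ p * C2)%R by rewrite mulr_ge0 ?powR_ge0.
have d0 : (0 < p * (1 - s) / 2)%R by rewrite divr_gt0// mulr_gt0// subr_gt0.
have [K K0 HK] := lq_norm_geo q0 p0 d0 C32.
exists (C4 * C5 `^ p^-1 * C1 + K * C1)%R.
  by rewrite addr_ge0 ?mulr_ge0 ?powR_ge0.
move=> c f sd ft; have c0 : forall x, 0 <= c x by case: sd.
set u := Pavg W m (clim (csum f)); set L := lq_norm q setT (level_norm p s c).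
have L0 : 0 <= L by exact: lq_norm_ge0.
set B := lq_norm q setT (fun k => level_norm p s (tail_sum D c k) k).
have B0 : 0 <= B by exact: lq_norm_ge0.
have hB : B <= C1%:E * L by exact: HC1.
have pn : p != 0%R by rewrite gt_eqF.
rewrite EFinD ge0_muleDl ?lee_fin ?mulr_ge0 ?powR_ge0//; apply: leeD.
  apply: (@le_trans _ _ ((C4 * C5 `^ p^-1)%:E * B)); last first.
    by rewrite [in leRHS]EFinM -muleA lee_wpmul2l// lee_fin mulr_ge0 ?powR_ge0.
  apply: (poweR_le_inv p0); first exact: Lnorm_ge0.
    by rewrite mule_ge0// lee_fin mulr_ge0 ?powR_ge0.
  rewrite Lp_norm_pow//; last by move=> x; rewrite lee_fin normc_ge0.
  apply: (@le_trans _ _ (\int[cmeasure m]_xi ((C4 `^ p)%:E * near_tail D c 0 xi `^ p))).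
    apply: ge0_le_integral => //.
    - by move=> *; exact: poweR_ge0.
    - apply: (measurableT_comp (measurable_poweR p)); apply: measurable_nc.
      exact: (measurable_Tn Hm).
    - apply: measurable_funeM; apply: (measurableT_comp (measurable_poweR p)).
      exact: measurable_near_tail.
    - move=> xi _; rewrite -poweR_EFin -poweRM ?near_tail_ge0//.
      apply: poweR_le; rewrite ?(ltW p0)// ?lee_fin ?normc_ge0//.
      exact: HC4.
  rewrite ge0_integralZl//; last 3 first.
  - by apply: (measurableT_comp (measurable_poweR p)); exact: measurable_near_tail.
  - by move=> *; exact: poweR_ge0.
  - by rewrite lee_fin powR_ge0.
  rewrite poweRM// ?lee_fin ?mulr_ge0 ?powR_ge0// poweR_EFin powRM ?powR_ge0//.
  rewrite -powRrM mulVf// powRr1// EFinM -muleA lee_wpmul2l ?lee_fin ?powR_ge0//.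
  have h := HC5 0%N (tail_sum D c 0) (fun x => tail_sum_ge0 D 0 x c0).
  apply: le_trans h _; rewrite mul0r oppr0 powRr0 mulr1 lee_wpmul2l ?lee_fin//.
  have : level_norm p s (tail_sum D c 0) 0 <= B.
    apply: (lq_norm_term (a := fun k => level_norm p s (tail_sum D c k) k)) => //.
    by move=> *; exact: level_norm_ge0.
  move=> /(poweR_le (ltW p0) (level_norm_ge0 _ _ _ _)).
  by rewrite level_normK// mul0r powRr0 mul1e.
apply: (@le_trans _ _ (K%:E * B)); last first.
  by rewrite [in leRHS]EFinM -muleA lee_wpmul2l.
apply: HK => [k|k|k].
- by rewrite mule_ge0 ?Lnorm_ge0// lee_fin e2_ge0.
- exact: level_norm_ge0.
rewrite edge_sumE poweRM ?Lnorm_ge0 ?lee_fin ?e2_ge0// poweR_EFin -powRrM.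
rewrite Lp_norm_pow//; last by move=> xi; exact: edge_sum_ge0.
have -> : (k%:R * s * p = k%:R * (s * p))%R by rewrite mulrA.
apply: (@le_trans _ _ ((C3 `^ p)%:E * ((2 `^ (k%:R * (s * p)))%:E *
    \int[cmeasure m]_xi (level_sum c k xi `^ p)))).
  rewrite muleCA lee_wpmul2l ?lee_fin ?e2_ge0//.
  rewrite -ge0_integralZl//; last 3 first.
  - by apply: (measurableT_comp (measurable_poweR p)); exact: measurable_level_sum.
  - by move=> *; exact: poweR_ge0.
  - by rewrite lee_fin powR_ge0.
  apply: ge0_le_integral => //.
  - by move=> *; exact: poweR_ge0.
  - apply: (measurableT_comp (measurable_poweR p)); exact: (measurable_edge_sum Hm).
  - apply: measurable_funeM; apply: (measurableT_comp (measurable_poweR p)).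
    exact: measurable_level_sum.
  move=> xi _; rewrite -poweR_EFin -poweRM ?level_sum_ge0//.
  by apply: poweR_le; rewrite ?(ltW p0) ?edge_sum_ge0//; exact: HC3.
rewrite EFinM -muleA lee_wpmul2l ?lee_fin ?powR_ge0//.
apply: le_trans (HC2 c k c0) _; rewrite lee_wpmul2l ?lee_fin//.
by apply: le_esum => n _; rewrite level_normK.
Qed.

End synthesis.

(** * Coefficient sums along an incidence relation, and a shift of levels *)

Section sequence_tools.
Context {R : realType}.
Local Open Scope ereal_scope.

(** Double counting with at most N partners on either side. Only the indices j that have a partner
    remain on the right; this is what restricts the trace estimate to edges near F. *)
Lemma esum_pow_incidence {I J : choiceType} (A : set I) (B : set J)
    (Rl : I -> J -> Prop) (t : J -> \bar R) (N p : R) :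
  (0 < p)%R -> (0 < N)%R -> (forall j, 0 <= t j) ->
  (forall i, A i -> \esum_(j in [set j | B j /\ Rl i j]) 1 <= N%:E) ->
  (forall j, B j -> \esum_(i in [set i | A i /\ Rl i j]) 1 <= N%:E) ->
  \esum_(i in A) (\esum_(j in [set j | B j /\ Rl i j]) t j) `^ p <=
  (N `^ p * N)%:E * \esum_(j in [set j | B j /\ exists2 i, A i & Rl i j]) t j `^ p.
Proof.
move=> p0 N0 t0 hI hJ; set B' := [set j | B j /\ exists2 i, A i & Rl i j].
have E i : A i -> [set j | B j /\ Rl i j] = [set j | B' j /\ Rl i j].
  by move=> Ai; apply/seteqP; split => j [] => [Bj r|[Bj _] r]; repeat split => //; exists i.
apply: (@le_trans _ _ (\esum_(i in A) ((N `^ p)%:E * \esum_(j in [set j | B' j /\ Rl i j]) t j `^ p))).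
  apply: le_esum => i Ai; rewrite -(E i Ai).
  by apply: esum_pow_count; rewrite ?(ltW N0)//; exact: hI.
rewrite esumZl ?powR_ge0//; last by move=> i _; apply: esum_ge0 => *; exact: poweR_ge0.
rewrite EFinM -muleA lee_wpmul2l ?lee_fin ?powR_ge0//.
rewrite esum_exchange; last by move=> *; exact: poweR_ge0.
rewrite -esumZl ?(ltW N0)//; last by move=> *; exact: poweR_ge0.
apply: le_esum => j [Bj _]; apply: esum_le_count => //; [exact: poweR_ge0|exact: hJ].
Qed.

(** Terms of level n.+1 come from edges of level n, and the term of level 0 from the base values;
    the shift is absorbed here for finite and infinite q. *)
Lemma lq_norm_shift q (C : R) : 0 < q -> (0 <= C)%R -> exists2 K : R, (0 <= K)%R &
  forall (a b : nat -> \bar R) al, (forall n, 0 <= a n) -> (forall n, 0 <= b n) -> 0 <= al ->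
  a 0%N <= C%:E * al -> (forall n, a n.+1 <= C%:E * b n) ->
  lq_norm q setT a <= K%:E * (al + lq_norm q setT b).
Proof.
move=> q0 C0; case: q q0 => [r||//] q0; last first.
  exists C => // a b al a0 b0 al0 h0 hS; apply: lq_normy => [|[|n] _].
  - by rewrite mule_ge0 ?adde_ge0 ?lq_norm_ge0.
  - by apply: le_trans h0 _; rewrite lee_wpmul2l// leeDl// lq_norm_ge0.
  - apply: le_trans (hS n) _; rewrite lee_wpmul2l//.
    apply: le_trans (lq_norm_term (a := b) (A := setT) (i := n) (ltry 0) _ _) _ => //.
    by rewrite leeDr.
have r0 : (0 < r)%R by rewrite -lte_fin.
exists (C * 2 `^ r^-1)%R; first by rewrite mulr_ge0 ?powR_ge0.
move=> a b al a0 b0 al0 h0 hS.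
set L := lq_norm r%:E setT b; have L0 : 0 <= L by exact: lq_norm_ge0.
rewrite lq_norm_fin//; last by rewrite mule_ge0 ?adde_ge0// lee_fin mulr_ge0 ?powR_ge0.
rewrite poweRM ?adde_ge0// ?lee_fin ?mulr_ge0 ?powR_ge0//.
rewrite poweR_EFin powRM ?powR_ge0// -powRrM mulVf ?gt_eqF// powRr1//.
have -> : [set: nat] = [set 0%N] `|` [set n | (0 < n)%N].
  by apply/seteqP; split => // -[|n] _; [left|right].
apply: (le_trans (esumU_le _)); first by move=> *; exact: poweR_ge0.
rewrite esum_set1 ?poweR_ge0//.
rewrite (reindex_esum setT [set n | (0 < n)%N] S); last first.
  by split => [n _ //|n n' _ _ []//|[//|n] _]; exists n.
have CE : (C `^ r * 2)%:E = (C `^ r)%:E + (C `^ r)%:E by rewrite -EFinD mulrDr mulr1.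
rewrite CE ge0_muleDl ?lee_fin ?powR_ge0//; apply: leeD.
  apply: (@le_trans _ _ ((C%:E * al) `^ r)); first exact: poweR_le (ltW r0) _ _.
  rewrite poweRM// poweR_EFin lee_wpmul2l ?lee_fin ?powR_ge0//.
  by apply: poweR_le; rewrite ?(ltW r0)// leeDl.
apply: (@le_trans _ _ ((C `^ r)%:E * \esum_(n in [set: nat]) b n `^ r)).
  rewrite -esumZl ?powR_ge0//; last by move=> *; exact: poweR_ge0.
  apply: le_esum => n _; rewrite -poweR_EFin -poweRM//.
  exact: poweR_le (ltW r0) _ _.
rewrite lee_wpmul2l ?lee_fin ?powR_ge0//.
apply: (@le_trans _ _ (L `^ r)).
  by rewrite -lq_norm_fin.
by apply: poweR_le; rewrite ?(ltW r0)// leeDr.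
Qed.

End sequence_tools.

(** * Jumps between consecutive smoothings *)

Section level_jumps.
Context {R : realType} {T : pmetricType R} (m : {outer_measure set T -> \bar R}).
Context (D : R) (W : filling T).
Hypothesis Hm : regular_space D m.
Local Notation V := (vertex W).
Implicit Types (u : V -> R[i]) (n : nat) (xi eta : T).
Local Open Scope ereal_scope.

Definition jump n u xi : R[i] := (Tn n.+1 u xi - Tn n u xi)%R.

Lemma edge_sum_osc n u x x' xi : lev n x -> (lev n x' \/ lev n.+1 x') ->
  vball x xi -> vball x' xi -> (nc (u x' - u x)%R)%:E <= edge_sum n u xi.
Proof.
move=> xn xn' xB xB'; case: (edge_osc u xn xn' xB xB') => [->|[e [en eB ->]]].
  by rewrite subrr normc0 edge_sum_ge0.
exact: edge_sum_term.
Qed.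

Lemma jump_le n u xi : (nc (jump n u xi))%:E <= 2%:E * edge_sum n u xi.
Proof.
have [x xn xB] := lev_cover_vball W n xi.
have h x' : (lev n x' \/ lev n.+1 x') -> vball x' xi ->
    (nc (u x' - u x)%R)%:E <= edge_sum n u xi by move=> *; exact: edge_sum_osc.
case: (edge_sum n u xi) h (edge_sum_ge0 n u xi) => [r||] h r0; last by [].
- rewrite -EFinM lee_fin mulr_natl mulr2n.
  apply: (le_trans (normc_tri _ (u x) _)); apply: lerD.
  + by apply: (Tn_osc Hm) => y yn yB; have := h y (or_intror yn) yB; rewrite lee_fin.
  + rewrite normcBC; apply: (Tn_osc Hm) => y yn yB.
    by have := h y (or_introl yn) yB; rewrite lee_fin.
- by rewrite gt0_muley ?leey// lte_fin.
Qed.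

Lemma jump_lip : exists2 C : R, (0 <= C)%R & forall n u xi eta,
  (mdist xi eta <= rad n.+1)%R ->
  (nc (jump n u xi - jump n u eta)%R)%:E <=
  (C * (2 ^+ n.+1 * mdist xi eta))%:E * (edge_sum n u xi + edge_sum n u eta).
Proof.
have [C C0 HC] := Tn_lip W Hm; exists (C + C + 1)%R; first by rewrite !addr_ge0.
(* The covering by balls of half the radius provides a single vertex whose ball contains both
   points, and [u x] serves as the constant for both smoothings. *)
move=> n u xi eta d; have [x xn xB1] := lev_cover W n xi.
have d0 : (0 <= mdist xi eta)%R by exact: mdist_ge0.
have xB : vball x xi by apply/(vballE _ xn); apply: lt_trans xB1 _; rewrite [ltRHS]radS; have := @rad_gt0 R n.+1; lra.
have xB' : vball x eta.
  apply/(vballE _ xn); have := metric_triangle (center x) xi eta.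
  by rewrite [X in (_ < X)%R]radS; lra.
(* Distance 0 is separated because the edge sums are extended reals here: an infinite sum makes the
   right side infinite only if the factor before it is positive. *)
have [d00|d1] := eqVneq (mdist xi eta) 0%R.
  have -> : xi = eta by exact: mdist_positivity.
  by rewrite subrr normc0 mule_ge0 ?adde_ge0 ?edge_sum_ge0// lee_fin !mulr_ge0 ?addr_ge0 ?mdist_ge0 ?exprn_ge0.
have dgt : (0 < mdist xi eta)%R by rewrite lt_def d1.
have h x' : (lev n x' \/ lev n.+1 x') -> (vball x' xi \/ vball x' eta) ->
    (nc (u x' - u x)%R)%:E <= edge_sum n u xi + edge_sum n u eta.
  move=> xn' [B|B].
    by apply: le_trans (edge_sum_osc u xn xn' xB B) _; rewrite leeDl// edge_sum_ge0.
  by apply: le_trans (edge_sum_osc u xn xn' xB' B) _; rewrite leeDr// edge_sum_ge0.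
have M0 : 0 <= edge_sum n u xi + edge_sum n u eta by rewrite adde_ge0 ?edge_sum_ge0.
have e0 : (0 < (C + C + 1) * (2 ^+ n.+1 * mdist xi eta))%R.
  by rewrite !mulr_gt0 ?exprn_gt0// ltr_wpDl// addr_ge0.
case: (edge_sum n u xi + edge_sum n u eta) h M0 => [r||] h r0; last by [].
- have h2 := HC n u (u x) r xi eta (le_trans d (rad_le (leqnSn n))).
  have {}h1 := HC n.+1 u (u x) r xi eta d (fun y yn yB => h y (or_intror yn) yB).
  have {}h2 := h2 (fun y yn yB => h y (or_introl yn) yB).
  rewrite -EFinM lee_fin.
  have -> : (jump n u xi - jump n u eta =
    (Tn n.+1 u xi - Tn n.+1 u eta) - (Tn n u xi - Tn n u eta))%R by rewrite /jump; ring.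
  apply: (le_trans (normcB _ _)); rewrite lee_fin in r0.
  have g0 : (0 <= C * (2 ^+ n * mdist xi eta) * r)%R by rewrite !mulr_ge0 ?exprn_ge0.
  have g1 : (0 <= 2 ^+ n * mdist xi eta * r)%R by rewrite !mulr_ge0 ?exprn_ge0.
  rewrite exprS in h1 *; lra.
- by rewrite gt0_muley ?leey// lte_fin.
Qed.

End level_jumps.

(** * The trace of a vertex function *)

Section trace_of_sequences.
Context {R : realType} {Z : pmetricType R} (mu : {outer_measure set Z -> \bar R}).
Context (Q : R) (X : filling Z) (F : set Z) (F0 : F !=set0).
Context (nu : {outer_measure set (subsp F0) -> \bar R}) (lambda : R).
Context (Y : filling (subsp F0)).
Hypothesis HX : regular_space Q mu.
Hypothesis HY : regular_space lambda nu.
Local Notation V := (vertex X).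
Local Notation val := (@subsp_val R Z F F0).
Implicit Types (u : V -> R[i]) (n k : nat) (xi eta : subsp F0) (y : vertex Y) (p s : R).
Local Open Scope ereal_scope.

(** The point z need not lie in F. If some center of F is near z, the count is moved to that center,
    at the price of doubling K. *)
Lemma subsp_count (K : R) : (1 <= K)%R -> exists2 N : R, (1 <= N)%R &
  forall n (z : Z), \esum_(y in [set y : vertex Y | lev n y /\
    (mdist (val (center y)) z < K * rad n)%R]) 1 <= N%:E.
Proof.
move=> K1; have K2 : (1 <= 2 * K)%R by lra.
have [N N1 HN] := nearv_count Y HY K2; exists N => // n z.
set A := [set y | _].
have [->|/set0P[y0 [y0n y0z]]] := eqVneq A set0.
  by rewrite esum_set0 lee_fin; lra.
apply: le_trans (HN n (center y0)); apply: esum_le_subset => // y [yn yz]; split => //.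
have := metric_triangle (val (center y)) z (val (center y0)).
rewrite (metric_sym z (val (center y0))) -mulrA => h; apply: le_lt_trans h _; lra.
Qed.

(** The 5 is that of [trace_coef]. Only such edges enter the trace, and only for them do the holes
    overlap boundedly over all levels. *)
Definition near_elev n : set (V * V) :=
  [set e | elev n e /\ exists xi, (mdist (center e.1) (val xi) < 5 * rad n)%R].

Definition near_edge_pow n p u : \bar R := \esum_(e in near_elev n) (nc (du u e))%:E `^ p.

Lemma near_edge_pow_le n p u : near_edge_pow n p u <= edge_pow n p u.
Proof. by apply: esum_le_subset => [e []//|e _]; exact: poweR_ge0. Qed.

Lemma near_edge_pow_ge0 n p u : 0 <= near_edge_pow n p u.
Proof. by apply: esum_ge0 => *; exact: poweR_ge0. Qed.

(** The term of index n.+1 is [jump n], so a vertex of level n.+1 collects edges of level n. An edge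
    whose ball contains a point is within [4 * rad n] of it, and the ball of y adds at most [rad n]:
    hence 5. Negative levels carry the default 0. *)
Definition trace_coef (K : R) u y : \bar R :=
  match level y with
  | Posz 0 => K%:E * \esum_(x in [set x : V | lev 0 x /\
      (mdist (center x) (val (center y)) < 5 * rad 0)%R]) (nc (u x))%:E
  | Posz n.+1 => K%:E * \esum_(e in neare 5 n (val (center y))) (nc (du u e))%:E
  | Negz _ => 0
  end.

Definition trace_seq u n xi : R[i] :=
  if n is n'.+1 then jump n' u (val xi) else Tn 0 u (val xi).

Lemma csum_trace u n xi : csum (trace_seq u) n xi = Tn n u (val xi).
Proof.
elim: n => [|n IH]; first by rewrite /csum big_ord1.
by rewrite csumS IH /= /jump addrC subrK.
Qed.

Lemma trace_coef_ge0 (K : R) u y : (0 <= K)%R -> 0 <= trace_coef K u y.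
Proof.
move=> K0; rewrite /trace_coef; case: (level y) => // -[|n];
  by rewrite mule_ge0 ?lee_fin//; apply: esum_ge0 => *; rewrite lee_fin normc_ge0.
Qed.

Lemma trace_coef0 K u y : lev 0 y -> trace_coef K u y =
  K%:E * \esum_(x in nearv 5 0 (val (center y))) (nc (u x))%:E.
Proof. by rewrite /trace_coef => ->. Qed.

Lemma trace_coefS K n u y : lev n.+1 y -> trace_coef K u y =
  K%:E * \esum_(e in neare 5 n (val (center y))) (nc (du u e))%:E.
Proof. by rewrite /trace_coef => ->. Qed.

Definition vertex_sum u (z : Z) : \bar R :=
  \esum_(x in [set x : V | lev 0 x /\ vball x z]) (nc (u x))%:E.

Lemma vertex_sum_fin u z : exists2 r : R, (0 <= r)%R & vertex_sum u z = r%:E.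
Proof.
have fA : finite_set [set x : V | lev 0 x /\ vball x z].
  apply: (sub_finite_set _ (nearv_finite X HX 1 0 z)) => x [x0 xB]; split => //.
  by rewrite mul1r; exact: (vballE _ x0).1 xB.
exists (\sum_(x \in [set x : V | lev 0 x /\ vball x z]) nc (u x))%R.
  by rewrite fsbig_finite//; apply: sumr_ge0 => *; exact: normc_ge0.
rewrite /vertex_sum esum_fset//; last by move=> *; rewrite lee_fin normc_ge0.
exact: fsumEFin.
Qed.

Lemma vertex_sum_term u z x : lev 0 x -> vball x z -> (nc (u x))%:E <= vertex_sum u z.
Proof.
move=> x0 xB; apply: (esum_ge_term (a := fun x => (nc (u x))%:E)) => // *.
by rewrite lee_fin normc_ge0.
Qed.

Lemma bsum_coef0 (K : R) u xi : (0 <= K)%R ->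
  K%:E * vertex_sum u (val xi) <=
  bsum (trace_coef K u) 0 xi.
Proof.
move=> K0; have [y y0 yB] := lev_cover_vball Y 0 xi.
apply: (@le_trans _ _ (trace_coef K u y)).
  rewrite trace_coef0// lee_wpmul2l//; apply: esum_le_subset => [x [x0 xB]|x _]; last first.
    by rewrite lee_fin normc_ge0.
  split => //; have := (vballE _ x0).1 xB; have := (vballE _ y0).1 yB.
  have := metric_triangle (center x) (val xi) (val (center y)).
  rewrite (metric_sym (val xi)) rad0 => h1 h2 h3.
  have {h2}h2 : (mdist (val (center y)) (val xi) < 1)%R by [].
  by apply: le_lt_trans h1 _; lra.
by apply: (esum_ge_term (a := trace_coef K u)) => // *; exact: trace_coef_ge0.
Qed.

Lemma bsum_coefS (K : R) n u xi : (0 <= K)%R ->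
  K%:E * edge_sum n u (val xi) <= bsum (trace_coef K u) n.+1 xi.
Proof.
move=> K0; have [y yn yB] := lev_cover_vball Y n.+1 xi.
apply: (@le_trans _ _ (trace_coef K u y)).
  rewrite (trace_coefS K u yn) lee_wpmul2l//; apply: esum_le_subset => [e [en eB]|e _]; last first.
    by rewrite lee_fin normc_ge0.
  split => //; have [h1 _] := elev_near en eB.
  have h2 : (mdist (val (center y)) (val xi) < rad n.+1)%R by exact: (vballE _ yn).1 yB.
  have := metric_triangle (center e.1) (val xi) (val (center y)).
  rewrite (metric_sym (val xi)) => h; apply: le_lt_trans h _.
  have := @radS R n; have := @rad_gt0 R n.+1; lra.
by apply: (esum_ge_term (a := trace_coef K u)) => // *; exact: trace_coef_ge0.
Qed.

Lemma cmeasurable_loclip (f : subsp F0 -> R[i]) :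
  (forall xi, exists r K : R, [/\ 0 < r, 0 <= K & forall eta, mdist xi eta < r ->
    nc (f xi - f eta) <= K * mdist xi eta])%R -> cmeasurable nu f.
Proof.
case: HY => _ mm _ H.
split; apply: measurable_loclip => // xi; have [r [K [r0 K0 HK]]] := H xi;
  exists r, K; split => // eta d; apply: le_trans (HK _ d).
- by rewrite -raddfB; exact: normRe_le.
- by rewrite -raddfB; exact: normIm_le.
Qed.

Lemma measurable_Tn_val n u : cmeasurable nu (fun xi => Tn n u (val xi)).
Proof.
apply: cmeasurable_loclip => xi; have [r [K [r0 K0 HK]]] := Tn_loclip HX n u (val xi).
by exists r, K; split => // eta; exact: HK.
Qed.

Lemma trace_synth : exists2 K : R, (0 <= K)%R & forall u,
  synth_data nu (trace_coef K u) (trace_seq u).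
Proof.
have [C1 C10 HC1] := jump_lip X HX; have [C2 C20 HC2] := Tn_lip X HX.
(* The 2 comes from [jump_le], C1 from [jump_lip], and C2 from the Lipschitz bound of the smoothing
   of level 0. *)
pose K := (2 + C1 + C2)%R; have K0 : (0 <= K)%R by rewrite /K; lra.
exists K => // u.
have B0 n xi : 0 <= bsum (trace_coef K u) n xi.
  by apply: bsum_ge0 => y; exact: trace_coef_ge0.
have b0 xi : (nc (Tn 0 u (val xi)))%:E <= bsum (trace_coef K u) 0 xi.
  apply: le_trans (bsum_coef0 u xi K0).
  have [r r0 Er] := vertex_sum_fin u (val xi); rewrite Er -EFinM lee_fin.
  apply: (@le_trans _ _ r); last by rewrite -[leLHS]mul1r ler_wpM2r// /K; lra.
  rewrite -[Tn _ _ _]subr0; apply: (Tn_osc HX) => x x0 xB; rewrite subr0.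
  by have := vertex_sum_term u x0 xB; rewrite Er lee_fin.
have bS n xi : (nc (jump n u (val xi)))%:E <= bsum (trace_coef K u) n.+1 xi.
  apply: le_trans (bsum_coefS n u xi K0); apply: le_trans (jump_le HX n u (val xi)) _.
  by rewrite lee_wpmul2r ?edge_sum_ge0// lee_fin /K; lra.
have bn n xi : (nc (trace_seq u n xi))%:E <= bsum (trace_coef K u) n xi by case: n => [|n]; [exact: b0|exact: bS].
split => //.
- by move=> y; exact: trace_coef_ge0.
- case=> [|n]; first exact: measurable_Tn_val.
  have [h1 h2] := measurable_Tn_val n.+1 u; have [h3 h4] := measurable_Tn_val n u.
  split.
  + by under eq_fun do rewrite /trace_seq /jump raddfB; exact: measurable_funB.
  + by under eq_fun do rewrite /trace_seq /jump raddfB; exact: measurable_funB.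
- move=> n xi eta; have S0 := adde_ge0 (B0 n xi) (B0 n eta).
  (* Beyond the distance [rad n] the size bound suffices, since [2 ^+ n * mdist xi eta] exceeds 1
     there. *)
  have [d|d] := leP (mdist xi eta) (rad n); last first.
    apply: (@le_trans _ _ (bsum (trace_coef K u) n xi + bsum (trace_coef K u) n eta)).
      by apply: le_trans (leeD (bn n xi) (bn n eta)); rewrite -EFinD lee_fin normcB.
    rewrite -[leLHS]mul1e lee_wpmul2r// lee_fin.
    have e0 : (0 < 2 ^+ n :> R)%R by rewrite exprn_gt0.
    by rewrite -(@ler_pM2l _ (rad n))// ?rad_gt0// mulr1 mulrA mulVf ?gt_eqF// mul1r ltW.
  have e0 : (0 <= 2 ^+ n * mdist xi eta)%R by rewrite mulr_ge0 ?exprn_ge0 ?mdist_ge0.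
  case: n d S0 e0 => [|n] d S0 e0.
    have [r r0 Er] := vertex_sum_fin u (val xi); have [t t0 Et] := vertex_sum_fin u (val eta).
    apply: (@le_trans _ _ ((2 ^+ 0 * mdist xi eta)%:E * (K * (r + t))%:E)); last first.
      by rewrite lee_wpmul2l// mulrDr EFinD !EFinM -Er -Et leeD// bsum_coef0.
    rewrite -EFinM lee_fin.
    apply: (@le_trans _ _ (C2 * (2 ^+ 0 * mdist xi eta) * (r + t))%R).
      apply: (HC2 0%N u 0%R) => // x x0 [xB|xB]; rewrite subr0.
        by have := vertex_sum_term u x0 xB; rewrite Er lee_fin; lra.
      by have := vertex_sum_term u x0 xB; rewrite Et lee_fin; lra.
    rewrite (mulrC C2) -[leLHS]mulrA ler_wpM2l// ler_wpM2r ?addr_ge0// /K; lra.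
  apply: le_trans (HC1 n u (val xi) (val eta) d) _.
  rewrite (mulrC C1) [in leLHS]EFinM -muleA lee_wpmul2l//.
  apply: le_trans (leeD (bsum_coefS n u xi K0) (bsum_coefS n u eta K0)).
  rewrite -ge0_muleDr ?edge_sum_ge0// lee_wpmul2r ?adde_ge0 ?edge_sum_ge0//.
  by rewrite lee_fin /K; lra.
Qed.

Lemma trace_coef_pow (K : R) p : (0 < p)%R -> (0 <= K)%R -> exists2 C : R, (0 <= C)%R &
  forall u, psum_lev (trace_coef K u) p 0 <= C%:E * base_pow p u /\
    forall n, psum_lev (trace_coef K u) p n.+1 <= C%:E * near_edge_pow n p u.
Proof.
move=> p0 K0.
have h5 : (1 <= 5 :> R)%R by lra.
have [N1 N11 HN1] := subsp_count h5; have [N2 N21 HN2] := nearv_count X HX h5.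
have [N3 N31 HN3] := neare_count X HX h5.
have h10 : (1 <= 10 :> R)%R by lra.
have [N4 N41 HN4] := subsp_count h10.
pose N := (N1 + N2 + N3 + N4)%R; have N0 : (0 < N)%R by rewrite /N; lra.
exists (K `^ p * (N `^ p * N))%R.
  by rewrite !mulr_ge0 ?powR_ge0// ltW.
move=> u; split=> [|n].
  rewrite EFinM -muleA.
  apply: (@le_trans _ _ (\esum_(y in @lev _ _ Y 0) ((K `^ p)%:E * (\esum_(x in [set x : V | lev 0 x /\ (mdist (center x) (val (center y)) < 5 * rad 0)%R]) (nc (u x))%:E) `^ p))).
    apply: le_esum => y y0; rewrite trace_coef0// poweRM ?lee_fin//.
    by apply: esum_ge0 => *; rewrite lee_fin normc_ge0.
  rewrite esumZl ?powR_ge0//; last by move=> *; exact: poweR_ge0.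
  rewrite lee_wpmul2l ?lee_fin ?powR_ge0//.
  apply: (le_trans (esum_pow_incidence (N := N) p0 N0 _ _ _)).
  - by move=> x; rewrite lee_fin normc_ge0.
  - move=> y y0; apply: le_trans (HN2 0%N (val (center y))) _.
    by rewrite lee_fin /N; lra.
  - move=> x x0.
    apply: (@le_trans _ _ (\esum_(y in [set y : vertex Y | lev 0 y /\ (mdist (val (center y)) (center x) < 5 * rad 0)%R]) 1)).
      by apply: esum_le_subset => // y [y0]; rewrite metric_sym => h; split.
    by apply: le_trans (HN1 0%N (center x)) _; rewrite lee_fin /N; lra.
  rewrite lee_wpmul2l ?lee_fin ?mulr_ge0 ?powR_ge0 ?(ltW N0)//.
  by apply: esum_le_subset => [x []//|*]; exact: poweR_ge0.
rewrite EFinM -muleA.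
apply: (@le_trans _ _ (\esum_(y in @lev _ _ Y n.+1) ((K `^ p)%:E * (\esum_(e in [set e : V * V | elev n e /\ (mdist (center e.1) (val (center y)) < 5 * rad n)%R]) (nc (du u e))%:E) `^ p))).
  apply: le_esum => y y0; rewrite (trace_coefS K u y0) poweRM ?lee_fin//.
  by apply: esum_ge0 => *; rewrite lee_fin normc_ge0.
rewrite esumZl ?powR_ge0//; last by move=> *; exact: poweR_ge0.
rewrite lee_wpmul2l ?lee_fin ?powR_ge0//.
apply: (le_trans (esum_pow_incidence (N := N) p0 N0 _ _ _)).
- by move=> e; rewrite lee_fin normc_ge0.
- move=> y y0; apply: le_trans (HN3 n (val (center y))) _.
  by rewrite lee_fin /N; lra.
- move=> e en.
  apply: (@le_trans _ _ (\esum_(y in [set y : vertex Y | lev n.+1 y /\ (mdist (val (center y)) (center e.1) < 10 * rad n.+1)%R]) 1)).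
    apply: esum_le_subset => // y [y0]; rewrite metric_sym => h; split => //.
    by apply: lt_le_trans h _; rewrite (@radS R n); lra.
  by apply: le_trans (HN4 n.+1 (center e.1)) _; rewrite lee_fin /N; lra.
rewrite lee_wpmul2l ?lee_fin ?mulr_ge0 ?powR_ge0 ?(ltW N0)//.
apply: esum_le_subset => [e [en [y _ h]]|*]; last exact: poweR_ge0.
by split => //; exists (center y).
Qed.

Definition trace u : subsp F0 -> R[i] := clim (csum (trace_seq u)).

Definition trace_cvg u xi : Prop := forall e : R, (0 < e)%R -> exists N, forall n, (N <= n)%N ->
  (nc (Tn n u (val xi) - trace u xi) <= e)%R.

Definition trace_norm s p q u : \bar R :=
  seq_norm s p q Q (base_pow p u) (fun k => near_edge_pow k p u).

Lemma trace_besov s p q : (0 < p)%R -> 0 < q ->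
  (0 < s - (Q - lambda) / p < 1)%R -> (0 < tail_exp lambda p (s - (Q - lambda) / p))%R ->
  exists2 C : R, (0 <= C)%R & forall u, trace_norm s p q u < +oo ->
  [/\ L1loc nu (trace u),
      besov_norm nu Y (s - (Q - lambda) / p) p%:E q (trace u) <= C%:E * trace_norm s p q u &
      {ae cmeasure nu, forall xi, trace_cvg u xi}].
Proof.
move=> p0 q0; set s' := (s - _)%R => s'01 te.
have pn : p != 0%R by rewrite gt_eqF.
have Es : (s' * p - lambda = s * p - Q)%R by rewrite /s' mulrBl divfK//; ring.
have [K K0 HK] := trace_synth.
have [C1 C10 HC1] := trace_coef_pow p0 K0.
(* The first summand pays for the shift from edges of level n to coefficients of level n.+1; the
   second serves level 0. *)
pose C2 := ((C1 * 2 `^ (s * p - Q)) `^ p^-1 + C1 `^ p^-1)%R.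
have C20 : (0 <= C2)%R by rewrite addr_ge0 ?powR_ge0.
have [C3 C30 HC3] := lq_norm_shift q0 C20.
have [C4 C40 HC4] := besov_synth Y HY p0 q0 s'01 te.
have ip : (0 <= p^-1)%R by rewrite invr_ge0 ltW.
exists (C4 * C3)%R; first by rewrite mulr_ge0.
move=> u fin; have [c0 _ cb _] := HK u.
have H : lq_norm q setT (level_norm lambda p s' (trace_coef K u)) <= C3%:E * trace_norm s p q u.
  apply: HC3.
  - by move=> n; exact: level_norm_ge0.
  - by move=> n; rewrite mule_ge0 ?poweR_ge0// lee_fin e2_ge0.
  - exact: poweR_ge0.
  - rewrite /level_norm mul0r powRr0 mul1e.
    apply: le_trans (poweR_le ip (psum_lev_ge0 _ _ _) (HC1 u).1) _.
    rewrite poweRM ?base_pow_ge0// poweR_EFin lee_wpmul2r ?poweR_ge0//.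
    by rewrite lee_fin /C2 lerDr powR_ge0.
  - move=> n; rewrite /level_norm Es.
    apply: (@le_trans _ _ (((C1 * 2 `^ (s * p - Q))%:E * ((2 `^ (n%:R * (s * p - Q)))%:E * near_edge_pow n p u)) `^ p^-1)).
      apply: poweR_le => //; first by rewrite mule_ge0 ?psum_lev_ge0// lee_fin e2_ge0.
      apply: (@le_trans _ _ ((2 `^ (n.+1%:R * (s * p - Q)))%:E * (C1%:E * near_edge_pow n p u))).
        by rewrite lee_wpmul2l ?lee_fin ?e2_ge0//; exact: (HC1 u).2.
      rewrite !muleA -!EFinM le_eqVlt; apply/orP; left; apply/eqP; congr (_%:E * _).
      by rewrite -mulrA -e2D [RHS]mulrC; congr (2 `^ _ * _)%R; rewrite -natr1; ring.
    rewrite poweRM ?mule_ge0 ?near_edge_pow_ge0 ?lee_fin ?e2_ge0 ?mulr_ge0 ?e2_ge0//.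
    rewrite poweR_EFin; apply: lee_pmul; rewrite ?lee_fin ?powR_ge0 ?poweR_ge0//.
      by rewrite /C2 lerDl powR_ge0.
    have -> : (2 `^ (n%:R * s))%:E = (2 `^ (n%:R * (s * p)))%:E `^ p^-1 :> \bar R.
      by rewrite poweR_EFin -powRrM; congr (_ `^ _)%:E; rewrite -!mulrA mulfV// mulr1.
    rewrite -poweRM ?mule_ge0 ?near_edge_pow_ge0 ?lee_fin ?e2_ge0//.
    by rewrite muleA -EFinM -e2D mulrBr.
have lqf : lq_norm q setT (level_norm lambda p s' (trace_coef K u)) < +oo.
  apply: le_lt_trans H _.
  have : 0 <= trace_norm s p q u by rewrite adde_ge0 ?poweR_ge0 ?lq_norm_ge0.
  by case: (trace_norm _ _ _ _) fin => [r||]// _ _; rewrite -EFinM ltry.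
have ft := fine_tails_lq HY p0 q0 te c0 lqf.
split.
- exact: (synth_L1loc HY (HK u)).
- apply: le_trans (HC4 _ _ (HK u) ft) _.
  by rewrite [in leRHS]EFinM -muleA lee_wpmul2l.
- apply: (ae_imp (mu := cmeasure nu) _ (total_bsum_ae HY c0 ft)) => xi h e e0.
  have [+ _] := csum_cvg (fun n => cb n xi) h; move=> /(_ e e0)[N HN]; exists N => n Nn.
  by have := HN n Nn; rewrite csum_trace.
Qed.

Lemma trace_unique u xi z :
  (forall e : R, (0 < e)%R -> exists N, forall n, (N <= n)%N -> (nc (Tn n u (val xi) - z) <= e)%R) ->
  trace u xi = z.
Proof.
move=> h; rewrite /trace (_ : csum _ = fun n xi => Tn n u (val xi)); last first.
  by apply/funext => n; apply/funext => eta; rewrite csum_trace.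
exact: clim_cvg.
Qed.

Lemma TnZD n (a : R[i]) u v z : (Tn n (fun x => a * u x + v x) z = a * Tn n u z + Tn n v z)%R.
Proof.
have d : (mdist z z <= (1 - 1) * rad n)%R by rewrite mdistxx subrr mul0r.
rewrite !(Tn_fset HX _ d).
rewrite mulr_sumr -big_split/=; apply: eq_bigr => x _; rewrite mulrDl mulrA//.
Qed.

(** Upper limits are not additive, so linearity is claimed only at points where both sequences
    converge. *)
Lemma trace_linear (a : R[i]) u v xi : trace_cvg u xi -> trace_cvg v xi ->
  trace (fun x => a * u x + v x)%R xi = (a * trace u xi + trace v xi)%R.
Proof.
move=> cu cv; apply: trace_unique => e e0.
have n0 := normc_ge0 a; have a1 : (0 < nc a + 1)%R by lra.
have [N1 H1] := cu (e / 2 / (nc a + 1))%R (divr_gt0 (divr_gt0 e0 (ltr0Sn _ 1)) a1).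
have [N2 H2] := cv (e / 2)%R (divr_gt0 e0 (ltr0Sn _ 1)).
exists (maxn N1 N2) => n; rewrite geq_max => /andP[/H1 h1 /H2 h2].
rewrite TnZD (_ : (_ - _) = a * (Tn n u (val xi) - trace u xi) + (Tn n v (val xi) - trace v xi))%R; last by ring.
apply: (le_trans (normcD _ _)); rewrite (splitr e) lerD// Normc.normcM.
apply: le_trans (_ : (nc a + 1) * (e / 2 / (nc a + 1)) <= _)%R.
  by apply: ler_pM; rewrite ?normc_ge0//; lra.
by rewrite mulrC divfK// gt_eqF.
Qed.

End trace_of_sequences.

(** * The extension of a vertex function of F *)

Section extension_of_sequences.
Context {R : realType} {Z : pmetricType R} (mu : {outer_measure set Z -> \bar R}).
Context (Q : R) (X : filling Z) (F : set Z) (F0 : F !=set0).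
Context (nu : {outer_measure set (subsp F0) -> \bar R}) (lambda : R).
Context (Y : filling (subsp F0)).
Hypothesis HX : regular_space Q mu.
Hypothesis HY : regular_space lambda nu.
Local Notation V := (vertex X).
Local Notation val := (@subsp_val R Z F F0).
Implicit Types (v : vertex Y -> R[i]) (n k : nat) (xi eta : subsp F0) (z t : Z) (p s : R).
Local Open Scope ereal_scope.

(** The shift by five levels makes [rad k = 32 * rad (k + 5)]. In units of [rad (k + 5)], a point of
    F within 6 of x is less than 16 + 8 + 6 = 30 away from the center of y, hence inside the ball of
    y; this is [ext_pair_vball]. *)
Definition ext_pair k (x : V) (y : vertex Y) : Prop :=
  [/\ lev (k + 5) x, lev k y & exists xi,
    (mdist (center x) (val xi) < 8 * rad (k + 5))%R /\ (mdist (center y) xi < rad k.+1)%R].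

(** The partner is chosen from x alone, so the transported function depends linearly on v; vertices
    away from F get 0. *)
Definition ext_vertex v (x : V) : R[i] :=
  if pselect (exists y, exists k, ext_pair k x y) is left h then v (projT1 (cid h)) else 0%R.

(** Smoothing this indicator produces the cut-off, whose Lipschitz bound is then an instance of
    [Tn_lip]. The cut-off is 1 on F and 0 beyond [3 * rad (k + 5)], within the range 4 of
    [ext_step_local]. *)
Definition cut_vertex (x : V) : R[i] :=
  if `[< exists xi, (mdist (center x) (val xi) < 2 * 2 ^ (- level x))%R >] then 1%R else 0%R.

Definition cut k z : R[i] := Tn (k + 5) cut_vertex z.

Definition ext_seq v n z : R[i] :=
  (cut n z * (if n is n'.+1 then jump (n' + 5) (ext_vertex v) z
              else Tn 5 (ext_vertex v) z))%R.

Lemma rad5 k : (rad k = 32 * rad (k + 5) :> R)%R.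
Proof. by rewrite !addnS addn0 5!(@radS R) !mulrA -!natrM. Qed.

Lemma ext_vertexP v k x xi : lev (k + 5) x -> (mdist (center x) (val xi) < 8 * rad (k + 5))%R ->
  exists y, ext_vertex v x = v y /\ ext_pair k x y.
Proof.
move=> xk d; have [y0 y0k y0d] := lev_cover Y k xi.
rewrite /ext_vertex; case: pselect => [h|]; last first.
  by case; exists y0, k; split => //; exists xi.
case: (cid h) => y [k' yk'] /=; exists y; split => //.
have [xk' _ _] := yk'; have /eqP := lev_inj xk xk'.
by rewrite eqn_add2r => /eqP ->.
Qed.

Lemma ext_pair_vball k x y xi : ext_pair k x y ->
  (mdist (center x) (val xi) < 6 * rad (k + 5))%R -> vball y xi.
Proof.
move=> [xk yk [zeta [d1 d2]]] d; apply/(vballE _ yk).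
have h1 : (mdist (center y) xi <= mdist (center y) zeta + mdist zeta xi)%R by exact: metric_triangle.
have h2 : (mdist zeta xi <= mdist (val zeta) (center x) + mdist (center x) (val xi))%R.
  exact: (metric_triangle (val zeta) (center x) (val xi)).
rewrite (metric_sym (val zeta)) in h2.
have := rad5 k; have := @radS R k; have := @rad_gt0 R k; lra.
Qed.

Lemma ext_vertex_near v n x xi : (lev (n + 5) x \/ lev (n.+1 + 5) x) ->
  (mdist (center x) (val xi) < 6 * rad (n.+1 + 5))%R ->
  exists y, [/\ ext_vertex v x = v y, lev n y \/ lev n.+1 y & vball y xi].
Proof.
have E : (rad (n + 5) = 2 * rad (n.+1 + 5) :> R)%R by exact: radS.
have r0 := @rad_gt0 R (n.+1 + 5).
move=> [xn|xn] d.
- have [|y [-> yp]] := @ext_vertexP v n x xi xn; first by rewrite E; lra.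
  exists y; split => //; first by left; case: yp.
  by apply: (ext_pair_vball yp); rewrite E; lra.
- have [|y [-> yp]] := @ext_vertexP v n.+1 x xi xn; first by lra.
  exists y; split => //; first by right; case: yp.
  by apply: (ext_pair_vball yp).
Qed.

(** The center of x is within 2 + 4 = 6 radii [rad (n.+1 + 5)] of xi, so the ball of its partner
    contains xi; the partner and y are then compared through the edges over xi. The point z itself
    may lie off F. *)
Lemma ext_vertex_osc v n x xi y z : (lev (n + 5) x \/ lev (n.+1 + 5) x) -> vball x z ->
  (mdist z (val xi) < 4 * rad (n.+1 + 5))%R -> lev n y -> vball y xi ->
  (nc (ext_vertex v x - v y)%R)%:E <= edge_sum n v xi.
Proof.
move=> xn xz d yn yxi.
have [|y' [-> yn' yB']] := @ext_vertex_near v n x xi xn; last exact: edge_sum_osc.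
have h : (mdist (center x) z < 2 * rad (n.+1 + 5))%R.
  case: xn => xn; have := (vballE _ xn).1 xz; first by rewrite (@radS R (n + 5)).
  by have := @rad_gt0 R (n.+1 + 5); lra.
have := metric_triangle (center x) z (val xi); lra.
Qed.

Lemma ext_vertex_base v x xi z : lev 5 x -> vball x z ->
  (mdist z (val xi) < 4 * rad 5)%R -> (nc (ext_vertex v x))%:E <= vertex_sum v xi.
Proof.
move=> xn xz d; have h := (vballE _ xn).1 xz.
have h2 := metric_triangle (center x) z (val xi).
have r0 := @rad_gt0 R 5.
have [|y [-> yp]] := @ext_vertexP v 0 x xi xn; first by rewrite add0n; lra.
apply: vertex_sum_term; first by case: yp.
by apply: (ext_pair_vball yp); rewrite add0n; lra.
Qed.

Lemma cut_vertex_le1 x : (nc (cut_vertex x) <= 1)%R.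
Proof. by rewrite /cut_vertex; case: ifP; rewrite ?normc0// Normc.normc1. Qed.

Lemma cut_le1 k z : (nc (cut k z) <= 1)%R.
Proof.
by rewrite -[cut k z]subr0; apply: (Tn_osc HX) => x _ _; rewrite subr0 cut_vertex_le1.
Qed.

Lemma cut_neq0 k z : cut k z != 0%R -> exists xi, (mdist z (val xi) < 3 * rad (k + 5))%R.
Proof.
apply: contra_neqP => /forallNP h.
suff : (nc (cut k z - 0) <= 0)%R.
  rewrite subr0 => c0; apply: Normc.eq0_normc; apply/eqP.
  by rewrite eq_le c0 normc_ge0.
apply: (Tn_osc HX) => x xk xz; rewrite subr0 /cut_vertex; case: ifPn => [/asboolP[xi]|_].
  rewrite (lev_rad xk) => d; exfalso; apply: (h xi).
  have := (vballE _ xk).1 xz; rewrite (metric_sym (center x)) => h1.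
  have := metric_triangle z (center x) (val xi); lra.
by rewrite normc0.
Qed.

Lemma cut_on k xi : cut k (val xi) = 1%R.
Proof.
apply/eqP; rewrite -subr_eq0; apply/eqP; apply: Normc.eq0_normc; apply/eqP.
rewrite eq_le normc_ge0 andbT; apply: (Tn_osc HX) => x xk xz.
rewrite /cut_vertex asboolT ?subrr ?normc0//.
exists xi; rewrite (lev_rad xk); have := (vballE _ xk).1 xz.
have := @rad_gt0 R (k + 5); lra.
Qed.

(** On F all cut-offs are 1 and the series telescopes. *)
Lemma csum_ext v n xi : csum (ext_seq v) n (val xi) = Tn (n + 5) (ext_vertex v) (val xi).
Proof.
elim: n => [|n IH]; first by rewrite /csum big_ord1 /ext_seq cut_on mul1r.
by rewrite csumS IH /ext_seq cut_on mul1r /jump addrC subrK.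
Qed.

Definition ext_coef (K : R) v (x : V) : \bar R :=
  match level x with
  | Posz 0 => K%:E * \esum_(y in [set y : vertex Y | lev 0 y /\
      (mdist (val (center y)) (center x) < 5 * rad 0)%R]) (nc (v y))%:E
  | Posz n.+1 => K%:E * \esum_(e in [set e : vertex Y * vertex Y | elev n e /\
      (mdist (val (center e.1)) (center x) < 5 * rad n)%R]) (nc (du v e))%:E
  | Negz _ => 0
  end.

Lemma ext_coef_ge0 (K : R) v x : (0 <= K)%R -> 0 <= ext_coef K v x.
Proof.
move=> K0; rewrite /ext_coef; case: (level x) => // -[|n];
  by rewrite mule_ge0 ?lee_fin//; apply: esum_ge0 => *; rewrite lee_fin normc_ge0.
Qed.

Lemma ext_coef0 K v x : lev 0 x -> ext_coef K v x =
  K%:E * \esum_(y in [set y : vertex Y | lev 0 y /\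
      (mdist (val (center y)) (center x) < 5 * rad 0)%R]) (nc (v y))%:E.
Proof. by rewrite /ext_coef => ->. Qed.

Lemma ext_coefS K n v x : lev n.+1 x -> ext_coef K v x =
  K%:E * \esum_(e in [set e : vertex Y * vertex Y | elev n e /\
      (mdist (val (center e.1)) (center x) < 5 * rad n)%R]) (nc (du v e))%:E.
Proof. by rewrite /ext_coef => ->. Qed.

Lemma bsum_ext0 (K : R) v xi z : (0 <= K)%R -> (mdist z (val xi) < 4 * rad 5)%R ->
  K%:E * vertex_sum v xi <= bsum (ext_coef K v) 0 z.
Proof.
move=> K0 d; have [x x0 xB] := lev_cover_vball X 0 z.
apply: (@le_trans _ _ (ext_coef K v x)).
  rewrite ext_coef0// lee_wpmul2l//; apply: esum_le_subset => [y [y0 yB]|y _]; last first.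
    by rewrite lee_fin normc_ge0.
  split => //; have h1 := (vballE _ x0).1 xB.
  have h2 : (mdist (val (center y)) (val xi) < rad 0)%R := (vballE _ y0).1 yB.
  have h3 := metric_triangle (val (center y)) (val xi) (center x).
  have h4 := metric_triangle (val xi) z (center x).
  rewrite (metric_sym z (center x)) (metric_sym (val xi) z) in h4.
  have := rad5 0; have := @rad_gt0 R 0; rewrite add0n; lra.
by apply: (esum_ge_term (a := ext_coef K v)) => // *; exact: ext_coef_ge0.
Qed.

Lemma bsum_extS (K : R) n v xi z : (0 <= K)%R -> (mdist z (val xi) < 4 * rad (n.+1 + 5))%R ->
  K%:E * edge_sum n v xi <= bsum (ext_coef K v) n.+1 z.
Proof.
move=> K0 d; have [x xn xB] := lev_cover_vball X n.+1 z.
apply: (@le_trans _ _ (ext_coef K v x)).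
  rewrite (ext_coefS K v xn) lee_wpmul2l//; apply: esum_le_subset => [e [en eB]|e _]; last first.
    by rewrite lee_fin normc_ge0.
  split => //; have [h1 _] := elev_near en eB.
  have {}h1 : (mdist (val (center e.1)) (val xi) < 4 * rad n)%R := h1.
  have h2 := (vballE _ xn).1 xB.
  have h3 := metric_triangle (val (center e.1)) (val xi) (center x).
  have h4 := metric_triangle (val xi) z (center x).
  rewrite (metric_sym z (center x)) (metric_sym (val xi) z) in h4.
  have := rad5 n.+1; have := @radS R n; have := @rad_gt0 R n; lra.
by apply: (esum_ge_term (a := ext_coef K v)) => // *; exact: ext_coef_ge0.
Qed.

Lemma measurable_cmul (f g : Z -> R[i]) : cmeasurable mu f -> cmeasurable mu g ->
  cmeasurable mu (fun z => f z * g z)%R.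
Proof.
move=> [f1 f2] [g1 g2]; split.
- rewrite (_ : (fun _ => _) = fun z => complex.Re (f z) * complex.Re (g z) - complex.Im (f z) * complex.Im (g z))%R; last first.
    by apply/funext => z; case: (f z); case: (g z).
  by apply: measurable_funB; apply: measurable_funM.
- rewrite (_ : (fun _ => _) = fun z => complex.Re (f z) * complex.Im (g z) + complex.Im (f z) * complex.Re (g z))%R; last first.
    by apply/funext => z; case: (f z); case: (g z).
  by apply: measurable_funD; apply: measurable_funM.
Qed.

Lemma measurable_ext_seq v n : cmeasurable mu (ext_seq v n).
Proof.
apply: measurable_cmul; first exact: (measurable_Tn HX).
case: n => [|n]; first exact: (measurable_Tn HX).
have [h1 h2] := measurable_Tn HX (n + 5).+1 (ext_vertex v).
have [h3 h4] := measurable_Tn HX (n + 5) (ext_vertex v).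
by split; under eq_fun do rewrite /jump raddfB; exact: measurable_funB.
Qed.

Definition ext_step v n z : R[i] :=
  if n is n'.+1 then jump (n' + 5) (ext_vertex v) z else Tn 5 (ext_vertex v) z.

Lemma edge_sum_fin n v xi : exists2 r : R, (0 <= r)%R & edge_sum n v xi = r%:E.
Proof.
have [N _ HN] := eball_count Y HY; have fA := esum1_finite (HN n xi).
exists (\sum_(e \in [set e : vertex Y * vertex Y | elev n e /\ eball e xi]) nc (du v e))%R.
  by rewrite fsbig_finite//; apply: sumr_ge0 => *; exact: normc_ge0.
rewrite /edge_sum esum_fset//; last by move=> *; rewrite lee_fin normc_ge0.
exact: fsumEFin.
Qed.

(** Around a point xi of F every bound holds with the same finite r, the vertex sum or edge sum of v
    at xi. The factor 64 absorbs the shift of the levels by five. *)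
Lemma ext_step_local : exists2 C : R, (0 <= C)%R & forall (K : R) v n xi, (0 <= K)%R ->
  exists r : R, [/\ (0 <= r)%R,
    (forall z, (mdist z (val xi) < 4 * rad (n + 5))%R -> (K * r)%:E <= bsum (ext_coef K v) n z),
    (forall z, (mdist z (val xi) < 4 * rad (n + 5))%R -> (nc (ext_step v n z) <= 2 * r)%R) &
    (forall z t, (mdist z (val xi) < 4 * rad (n + 5))%R -> (mdist t (val xi) < 4 * rad (n + 5))%R ->
      (mdist z t <= rad (n + 5))%R ->
      (nc (ext_step v n z - ext_step v n t) <= C * (2 ^+ n * mdist z t) * r)%R)].
Proof.
have [C C0 HC] := Tn_lip X HX; exists (64 * C)%R; first by rewrite mulr_ge0.
move=> K v n xi K0; case: n => [|n].
  have [r r0 Er] := vertex_sum_fin HY v xi; exists r; split => // [z d|z d|z t dz dt d].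
  - by rewrite EFinM -Er; exact: bsum_ext0.
  - apply: (@le_trans _ _ r); last by lra.
    rewrite -[ext_step _ _ _]subr0; apply: (Tn_osc HX) => x x5 xz; rewrite subr0.
    by have := ext_vertex_base v x5 xz d; rewrite Er lee_fin.
  - apply: (@le_trans _ _ (C * (2 ^+ 5 * mdist z t) * r)%R).
      apply: (HC 5%N (ext_vertex v) 0%R) => // x x5 xz; rewrite subr0 -lee_fin -Er.
      by case: xz => xz; exact: ext_vertex_base xz _.
    have := mulr_ge0 (mulr_ge0 C0 (mdist_ge0 z t)) r0; lra.
have [r r0 Er] := edge_sum_fin n v xi; exists r.
have [y yn yB] := lev_cover_vball Y n xi.
have H x z : (lev (n + 5) x \/ lev (n.+1 + 5) x) -> vball x z ->
    (mdist z (val xi) < 4 * rad (n.+1 + 5))%R -> (nc (ext_vertex v x - v y) <= r)%R.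
  by move=> xn xz d; rewrite -lee_fin -Er; exact: ext_vertex_osc xz d yn yB.
split => // [z d|z d|z t dz dt d].
- by rewrite EFinM -Er; exact: bsum_extS.
- rewrite mulr_natl mulr2n; apply: (le_trans (normc_tri _ (v y) _)); apply: lerD.
    by apply: (Tn_osc HX) => x xn xz; apply: H xz d; right.
  by rewrite normcBC; apply: (Tn_osc HX) => x xn xz; apply: H xz d; left.
- have h1 := HC (n.+1 + 5)%N (ext_vertex v) (v y) r z t d.
  have h2 := HC (n + 5)%N (ext_vertex v) (v y) r z t (le_trans d (rad_le (leqnSn (n + 5)))).
  have {}h1 := h1 (fun x xn (xz : _ \/ _) => match xz with or_introl a => H x z (or_intror xn) a dz | or_intror a => H x t (or_intror xn) a dt end).
  have {}h2 := h2 (fun x xn (xz : _ \/ _) => match xz with or_introl a => H x z (or_introl xn) a dz | or_intror a => H x t (or_introl xn) a dt end).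
  rewrite /ext_step /jump.
  set a := Tn (n + 5).+1 _ _; set a' := Tn (n + 5) _ _.
  set b := Tn (n + 5).+1 _ _; set b' := Tn (n + 5) _ _.
  have -> : (a - a' - (b - b') = (a - b) - (a' - b'))%R by ring.
  apply: (le_trans (normcB _ _)); apply: le_trans (lerD h1 h2) _.
  rewrite !exprD [in leRHS]exprS exprS.
  have g0 : (0 <= C * (2 ^+ n * mdist z t) * r)%R by rewrite !mulr_ge0 ?exprn_ge0 ?mdist_ge0.
  lra.
Qed.

Lemma ext_synth : exists2 K : R, (0 < K)%R & forall v,
  synth_data mu (ext_coef K v) (ext_seq v).
Proof.
have [C1 C10 H1] := ext_step_local; have [C2 C20 H2] := Tn_lip X HX.
(* The three terms serve the size bound with its factor 64, the variation of the step, and the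
   variation of the cut-off. *)
pose K := (128 + C1 + 64 * C2)%R; have K1 : (0 < K)%R by rewrite /K; lra.
exists K => // v; have K0 := ltW K1.
have B0 n z : 0 <= bsum (ext_coef K v) n z.
  by apply: bsum_ge0 => x; exact: ext_coef_ge0.
have fE n z : (ext_seq v n z = cut n z * ext_step v n z)%R by case: n.
(* The 64 is a reserve: for points farther apart than [rad (n + 5)] the product [2 ^+ n * mdist z t]
   is only known to exceed 1/32. *)
have A n z : (64 * nc (ext_seq v n z))%:E <= bsum (ext_coef K v) n z.
  rewrite fE; have [->|/cut_neq0[xi d]] := eqVneq (cut n z) 0%R.
    by rewrite mul0r normc0 mulr0.
  have [r [r0 h1 h2 _]] := H1 K v n xi K0.
  have d4 : (mdist z (val xi) < 4 * rad (n + 5))%R by have := @rad_gt0 R (n + 5); lra.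
  apply: le_trans (h1 z d4); rewrite lee_fin Normc.normcM.
  have := ler_pM (normc_ge0 _) (normc_ge0 _) (cut_le1 n z) (h2 z d4); rewrite mul1r => h.
  have {}h : (64 * (nc (cut n z) * nc (ext_step v n z)) <= 64 * (2 * r))%R by rewrite ler_pM2l.
  have : (0 <= (C1 + 64 * C2) * r)%R by rewrite mulr_ge0// addr_ge0// mulr_ge0.
  rewrite /K; lra.
have L n z t : cut n z != 0%R -> (mdist z t <= rad (n + 5))%R ->
    (nc (ext_seq v n z - ext_seq v n t))%:E <= (2 ^+ n * mdist z t)%:E * bsum (ext_coef K v) n z.
  move=> /cut_neq0[xi d] dzt; have [r [r0 h1 h2 h3]] := H1 K v n xi K0.
  have p0 := @rad_gt0 R (n + 5).
  have d4 : (mdist z (val xi) < 4 * rad (n + 5))%R by lra.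
  have e4 : (mdist t (val xi) < 4 * rad (n + 5))%R.
    by have := metric_triangle t z (val xi); rewrite (metric_sym t z); lra.
  have q0 : (0 <= 2 ^+ n * mdist z t)%R by rewrite mulr_ge0 ?exprn_ge0 ?mdist_ge0.
  apply: (@le_trans _ _ ((2 ^+ n * mdist z t)%:E * (K * r)%:E)); last first.
    by rewrite lee_wpmul2l ?lee_fin// h1.
  rewrite -EFinM lee_fin !fE.
  rewrite (_ : (_ - _) = (cut n z - cut n t) * ext_step v n z + cut n t * (ext_step v n z - ext_step v n t))%R; last by ring.
  apply: (le_trans (normcD _ _)); rewrite !Normc.normcM.
  have k1 : (nc (cut n z - cut n t) <= C2 * (2 ^+ (n + 5) * mdist z t) * 1)%R.
    by apply: (H2 _ _ 0%R) => // x _ _; rewrite subr0 cut_vertex_le1.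
  have := ler_pM (normc_ge0 _) (normc_ge0 _) k1 (h2 z d4).
  have := ler_pM (normc_ge0 _) (normc_ge0 _) (cut_le1 n t) (h3 z t d4 e4 dzt).
  rewrite exprD mul1r => g1 g2; apply: le_trans (lerD g2 g1) _.
  rewrite (_ : (2 ^+ n * mdist z t * (K * r))%R = (128 * (2 ^+ n * mdist z t * r) +
    (C2 * (2 ^+ n * 2 ^+ 5 * mdist z t) * 1 * (2 * r) + C1 * (2 ^+ n * mdist z t) * r))%R); last first.
    by rewrite /K; ring.
  by rewrite lerDr !mulr_ge0 ?exprn_ge0 ?mdist_ge0.
split.
- by move=> x; exact: ext_coef_ge0.
- exact: measurable_ext_seq.
- move=> n z; apply: le_trans (A n z); rewrite lee_fin; have := normc_ge0 (ext_seq v n z); lra.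
- move=> n z t; have [d|d] := leP (mdist z t) (rad (n + 5)); last first.
    have p0 := @rad_gt0 R (n + 5).
    apply: (@le_trans _ _ ((2 ^+ n * mdist z t)%:E * (64 * nc (ext_seq v n z) + 64 * nc (ext_seq v n t))%:E)); last first.
      rewrite lee_wpmul2l ?lee_fin ?mulr_ge0 ?exprn_ge0 ?mdist_ge0// EFinD; exact: leeD.
    rewrite -EFinM lee_fin; apply: (le_trans (normcB _ _)).
    have h : (1 <= 64 * (2 ^+ n * mdist z t))%R.
      have e0 : (0 < 2 ^+ n :> R)%R by rewrite exprn_gt0.
      have : (2 ^+ n * rad (n + 5) <= 2 ^+ n * mdist z t)%R by rewrite ler_pM2l// ltW.
      have -> : (2 ^+ n * rad (n + 5) = 32^-1 :> R)%R.
        by rewrite radD mulrA mulfV ?gt_eqF// mul1r /rad -natrX.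
      lra.
    rewrite -mulrDr mulrCA mulrA -[leLHS]mul1r ler_wpM2r ?addr_ge0 ?normc_ge0//; lra.
  have q0 : 0 <= (2 ^+ n * mdist z t)%:E by rewrite lee_fin mulr_ge0 ?exprn_ge0 ?mdist_ge0.
  (* [L] needs a nonzero cut-off at its first point, which places that point near F. If both
     cut-offs vanish, so do both terms. *)
  have [cz|cz] := eqVneq (cut n z) 0%R; last first.
    by apply: le_trans (L n z t cz d) _; rewrite lee_wpmul2l// leeDl.
  have [ct|ct] := eqVneq (cut n t) 0%R; last first.
    rewrite normcBC metric_sym; rewrite metric_sym in d.
    apply: le_trans (L n t z ct d) _; rewrite lee_wpmul2l// ?leeDr//.
    by rewrite metric_sym.
  by rewrite !fE cz ct !mul0r subrr normc0 mule_ge0// adde_ge0.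
Qed.

Lemma subsp_edge_count (K : R) : (1 <= K)%R -> exists2 N : R, (1 <= N)%R &
  forall n (z : Z), \esum_(e in [set e : vertex Y * vertex Y | elev n e /\
    (mdist (val (center e.1)) z < K * rad n)%R]) 1 <= N%:E.
Proof.
move=> K1; have K2 : (1 <= 2 * K)%R by lra.
have [N N1 HN] := neare_count Y HY K2; exists N => // n z.
set A := [set e | _].
have [->|/set0P[e0 [e0n e0z]]] := eqVneq A set0.
  by rewrite esum_set0 lee_fin; lra.
apply: le_trans (HN n (center e0.1)); apply: esum_le_subset => // e [en ez]; split => //.
have := metric_triangle (val (center e.1)) z (val (center e0.1)).
rewrite (metric_sym z (val (center e0.1))) -mulrA => h; apply: le_lt_trans h _; lra.
Qed.

Lemma ext_coef_pow (K : R) p : (0 < p)%R -> (0 <= K)%R -> exists2 C : R, (0 <= C)%R &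
  forall v, psum_lev (ext_coef K v) p 0 <= C%:E * base_pow p v /\
    forall n, psum_lev (ext_coef K v) p n.+1 <= C%:E * edge_pow n p v.
Proof.
move=> p0 K0.
have h5 : (1 <= 5 :> R)%R by lra.
have h10 : (1 <= 10 :> R)%R by lra.
have [N1 N11 HN1] := subsp_count Y HY h5; have [N2 N21 HN2] := nearv_count X HX h5.
have [N3 N31 HN3] := subsp_edge_count h5.
have [N4 N41 HN4] := nearv_count X HX h10.
pose N := (N1 + N2 + N3 + N4)%R; have N0 : (0 < N)%R by rewrite /N; lra.
exists (K `^ p * (N `^ p * N))%R.
  by rewrite !mulr_ge0 ?powR_ge0// ltW.
move=> v; split=> [|n].
  rewrite EFinM -muleA.
  apply: (@le_trans _ _ (\esum_(x in @lev _ _ X 0) ((K `^ p)%:E * (\esum_(y in [set y : vertex Y | lev 0 y /\ (mdist (val (center y)) (center x) < 5 * rad 0)%R]) (nc (v y))%:E) `^ p))).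
    apply: le_esum => x x0; rewrite ext_coef0// poweRM ?lee_fin//.
    by apply: esum_ge0 => *; rewrite lee_fin normc_ge0.
  rewrite esumZl ?powR_ge0//; last by move=> *; exact: poweR_ge0.
  rewrite lee_wpmul2l ?lee_fin ?powR_ge0//.
  apply: (le_trans (esum_pow_incidence (N := N) p0 N0 _ _ _)).
  - by move=> y; rewrite lee_fin normc_ge0.
  - move=> x x0; apply: le_trans (HN1 0%N (center x)) _.
    by rewrite lee_fin /N; lra.
  - move=> y y0.
    apply: (@le_trans _ _ (\esum_(x in @nearv _ _ X 5 0 (val (center y))) 1)).
      by apply: esum_le_subset => // x [x0]; rewrite metric_sym => h; split.
    by apply: le_trans (HN2 0%N (val (center y))) _; rewrite lee_fin /N; lra.
  rewrite lee_wpmul2l ?lee_fin ?mulr_ge0 ?powR_ge0 ?(ltW N0)//.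
  by apply: esum_le_subset => [y []//|*]; exact: poweR_ge0.
rewrite EFinM -muleA.
apply: (@le_trans _ _ (\esum_(x in @lev _ _ X n.+1) ((K `^ p)%:E * (\esum_(e in [set e : vertex Y * vertex Y | elev n e /\ (mdist (val (center e.1)) (center x) < 5 * rad n)%R]) (nc (du v e))%:E) `^ p))).
  apply: le_esum => x x0; rewrite (ext_coefS K v x0) poweRM ?lee_fin//.
  by apply: esum_ge0 => *; rewrite lee_fin normc_ge0.
rewrite esumZl ?powR_ge0//; last by move=> *; exact: poweR_ge0.
rewrite lee_wpmul2l ?lee_fin ?powR_ge0//.
apply: (le_trans (esum_pow_incidence (N := N) p0 N0 _ _ _)).
- by move=> e; rewrite lee_fin normc_ge0.
- move=> x x0; apply: le_trans (HN3 n (center x)) _.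
  by rewrite lee_fin /N; lra.
- move=> e en.
  apply: (@le_trans _ _ (\esum_(x in @nearv _ _ X 10 n.+1 (val (center e.1))) 1)).
    apply: esum_le_subset => // x [x0]; rewrite metric_sym => h; split => //.
    by apply: lt_le_trans h _; rewrite (@radS R n); lra.
  by apply: le_trans (HN4 n.+1 (val (center e.1))) _; rewrite lee_fin /N; lra.
rewrite lee_wpmul2l ?lee_fin ?mulr_ge0 ?powR_ge0 ?(ltW N0)//.
by apply: esum_le_subset => [e []//|*]; exact: poweR_ge0.
Qed.

Definition ext v : Z -> R[i] := clim (csum (ext_seq v)).

Definition ext_cvg v z : Prop := forall e : R, (0 < e)%R -> exists N, forall n, (N <= n)%N ->
  (nc (csum (ext_seq v) n z - ext v z) <= e)%R.

Definition ext_norm s p q v : \bar R :=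
  seq_norm s p q lambda (base_pow p v) (fun k => edge_pow k p v).

(* The tails [tail_sum Q c] are kept: they also control the means of [ext v]. *)
Lemma ext_level_norm (K : R) s p q : (0 <= K)%R -> (0 < p)%R -> 0 < q ->
  exists2 C : R, (0 <= C)%R & forall v,
  lq_norm q setT (level_norm Q p s (ext_coef K v)) <=
  C%:E * ext_norm (s - (Q - lambda) / p) p q v.
Proof.
move=> K0 p0 q0; set s' := (s - _)%R.
have pn : p != 0%R by rewrite gt_eqF.
have Es : (s' * p - lambda = s * p - Q)%R by rewrite /s' mulrBl divfK//; ring.
have [C1 C10 HC1] := ext_coef_pow p0 K0.
pose C2 := ((C1 * 2 `^ (s * p - Q)) `^ p^-1 + C1 `^ p^-1)%R.
have C20 : (0 <= C2)%R by rewrite addr_ge0 ?powR_ge0.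
have [C3 C30 HC3] := lq_norm_shift q0 C20.
have ip : (0 <= p^-1)%R by rewrite invr_ge0 ltW.
exists C3 => // v; have c0 x := ext_coef_ge0 v x K0.
apply: HC3.
- by move=> n; exact: level_norm_ge0.
- by move=> n; rewrite mule_ge0 ?poweR_ge0// lee_fin e2_ge0.
- exact: poweR_ge0.
- rewrite /level_norm mul0r powRr0 mul1e.
  apply: le_trans (poweR_le ip (psum_lev_ge0 _ _ _) (HC1 v).1) _.
  rewrite poweRM ?base_pow_ge0// poweR_EFin lee_wpmul2r ?poweR_ge0//.
  by rewrite lee_fin /C2 lerDr powR_ge0.
- move=> n; rewrite /level_norm.
  apply: (@le_trans _ _ (((C1 * 2 `^ (s * p - Q))%:E * ((2 `^ (n%:R * (s * p - Q)))%:E * edge_pow n p v)) `^ p^-1)).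
    apply: poweR_le => //; first by rewrite mule_ge0 ?psum_lev_ge0// lee_fin e2_ge0.
    apply: (@le_trans _ _ ((2 `^ (n.+1%:R * (s * p - Q)))%:E * (C1%:E * edge_pow n p v))).
      by rewrite lee_wpmul2l ?lee_fin ?e2_ge0//; exact: (HC1 v).2.
    rewrite !muleA -!EFinM le_eqVlt; apply/orP; left; apply/eqP; congr (_%:E * _).
    by rewrite -mulrA -e2D [RHS]mulrC; congr (2 `^ _ * _)%R; rewrite -natr1; ring.
  rewrite poweRM ?mule_ge0 ?edge_pow_ge0 ?lee_fin ?e2_ge0 ?mulr_ge0 ?e2_ge0//.
  rewrite poweR_EFin; apply: lee_pmul; rewrite ?lee_fin ?powR_ge0 ?poweR_ge0//.
    by rewrite /C2 lerDl powR_ge0.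
  have -> : (2 `^ (n%:R * s'))%:E = (2 `^ (n%:R * (s' * p)))%:E `^ p^-1 :> \bar R.
    by rewrite poweR_EFin -powRrM; congr (_ `^ _)%:E; rewrite -!mulrA mulfV// mulr1.
  rewrite -poweRM ?mule_ge0 ?edge_pow_ge0 ?lee_fin ?e2_ge0//.
  by rewrite muleA -EFinM -e2D -Es mulrBr.
Qed.

Lemma tail_exp_gt0 (D p s : R) : (0 < p)%R -> (0 < s)%R -> (0 < D)%R ->
  (D / (D + s) < p)%R -> (0 < tail_exp D p s)%R.
Proof.
move=> p0 s0 D0; have Ds : (0 < D + s)%R by lra.
rewrite ltr_pdivrMr// => h; rewrite /tail_exp subr_gt0.
by case: (leP (1 - p)%R 0%R) => h1; rewrite ?mulr0 ?mulr_gt0//; lra.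
Qed.

Lemma ext_L1loc s p q v : (0 < p)%R -> 0 < q -> (0 < tail_exp Q p s)%R ->
  ext_norm (s - (Q - lambda) / p) p q v < +oo ->
  L1loc mu (ext v) /\ {ae cmeasure mu, forall z, ext_cvg v z}.
Proof.
move=> p0 q0 te fin; have [K K1 HK] := ext_synth; have K0 := ltW K1.
have [C3 C30 HC3] := ext_level_norm s K0 p0 q0.
have [c0 _ cb _] := HK v.
have lqf : lq_norm q setT (level_norm Q p s (ext_coef K v)) < +oo.
  apply: le_lt_trans (HC3 v) _.
  have : 0 <= ext_norm (s - (Q - lambda) / p) p q v by rewrite adde_ge0 ?poweR_ge0 ?lq_norm_ge0.
  by case: (ext_norm _ _ _ _) fin => [r||]// _ _; rewrite -EFinM ltry.
have ft := fine_tails_lq HX p0 q0 te c0 lqf.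
split; first exact: (synth_L1loc HX (HK v)).
apply: (ae_imp (mu := cmeasure mu) _ (total_bsum_ae HX c0 ft)) => z h e e0.
by have [+ _] := csum_cvg (fun n => cb n z) h; move=> /(_ e e0).
Qed.

Lemma ext_besov s p q : (0 < p)%R -> 0 < q -> (0 < s < 1)%R -> (0 < tail_exp Q p s)%R ->
  exists2 C : R, (0 <= C)%R & forall v, ext_norm (s - (Q - lambda) / p) p q v < +oo ->
  besov_norm mu X s p%:E q (ext v) <= C%:E * ext_norm (s - (Q - lambda) / p) p q v.
Proof.
move=> p0 q0 s01 te; have [K K1 HK] := ext_synth; have K0 := ltW K1.
have [C3 C30 HC3] := ext_level_norm s K0 p0 q0.
have [C4 C40 HC4] := besov_synth X HX p0 q0 s01 te.
exists (C4 * C3)%R; first by rewrite mulr_ge0.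
move=> v fin; have [c0 _ cb _] := HK v.
have lqf : lq_norm q setT (level_norm Q p s (ext_coef K v)) < +oo.
  apply: le_lt_trans (HC3 v) _.
  have : 0 <= ext_norm (s - (Q - lambda) / p) p q v by rewrite adde_ge0 ?poweR_ge0 ?lq_norm_ge0.
  by case: (ext_norm _ _ _ _) fin => [r||]// _ _; rewrite -EFinM ltry.
have ft := fine_tails_lq HX p0 q0 te c0 lqf.
apply: le_trans (HC4 _ _ (HK v) ft) _.
by rewrite [in leRHS]EFinM -muleA lee_wpmul2l.
Qed.

Lemma ext_unique v z w :
  (forall e : R, (0 < e)%R -> exists N, forall n, (N <= n)%N ->
    (nc (csum (ext_seq v) n z - w) <= e)%R) -> ext v z = w.
Proof. exact: clim_cvg. Qed.

Lemma ext_vertexZD (a : R[i]) v v' x :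
  (ext_vertex (fun y => a * v y + v' y) x = a * ext_vertex v x + ext_vertex v' x)%R.
Proof. by rewrite /ext_vertex; case: pselect => // _; rewrite mulr0 addr0. Qed.

Lemma ext_seqZD (a : R[i]) v v' n z :
  (ext_seq (fun y => a * v y + v' y) n z = a * ext_seq v n z + ext_seq v' n z)%R.
Proof.
have E : ext_vertex (fun y => a * v y + v' y)%R = (fun x => a * ext_vertex v x + ext_vertex v' x)%R.
  by apply/funext => x; exact: ext_vertexZD.
rewrite /ext_seq E; case: n => [|n]; rewrite /jump !(TnZD HX); ring.
Qed.

Lemma csum_extZD (a : R[i]) v v' n z : (csum (ext_seq (fun y => a * v y + v' y)) n z =
  a * csum (ext_seq v) n z + csum (ext_seq v') n z)%R.
Proof.
by elim: n => [|n IH]; [rewrite /csum !big_ord1 ext_seqZD|rewrite !csumS IH ext_seqZD; ring].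
Qed.

Lemma ext_linear (a : R[i]) v v' z : ext_cvg v z -> ext_cvg v' z ->
  ext (fun y => a * v y + v' y)%R z = (a * ext v z + ext v' z)%R.
Proof.
move=> cv cv'; apply: ext_unique => e e0.
have n0 := normc_ge0 a; have a1 : (0 < nc a + 1)%R by lra.
have [N1 H1] := cv (e / 2 / (nc a + 1))%R (divr_gt0 (divr_gt0 e0 (ltr0Sn _ 1)) a1).
have [N2 H2] := cv' (e / 2)%R (divr_gt0 e0 (ltr0Sn _ 1)).
exists (maxn N1 N2) => n; rewrite geq_max => /andP[/H1 h1 /H2 h2].
rewrite csum_extZD (_ : (_ - _) = a * (csum (ext_seq v) n z - ext v z) + (csum (ext_seq v') n z - ext v' z))%R; last by ring.
apply: (le_trans (normcD _ _)); rewrite (splitr e) lerD// Normc.normcM.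
apply: le_trans (_ : (nc a + 1) * (e / 2 / (nc a + 1)) <= _)%R.
  by apply: ler_pM; rewrite ?normc_ge0//; lra.
by rewrite mulrC divfK// gt_eqF.
Qed.

End extension_of_sequences.

(** * Density of Lipschitz functions; smoothed means converge to the function *)

Section differentiation.
Import HBSimple.
Context {R : realType} {T : pmetricType R} (m : {outer_measure set T -> \bar R}).
Context (D : R) (W : filling T).
Hypothesis Hm : regular_space D m.
Implicit Types (g phi : T -> R) (A B : set T) (xi eta : T).
Local Open Scope ereal_scope.

Let mm : metric_measure_space m. Proof. by case: Hm. Qed.

Definition lipschitz_fun phi : Prop := exists2 L : R, (0 <= L)%R &
  forall xi eta, (`|phi xi - phi eta| <= L * mdist xi eta)%R.

Definition lip_dense B g : Prop := forall e : R, (0 < e)%R ->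
  exists2 phi, lipschitz_fun phi & \int[cmeasure m]_(xi in B) (`|g xi - phi xi|)%:E <= e%:E.

Let mfun g := measurable_fun [set: caratheodory_type m] g.

Lemma measurable_lipschitz phi : lipschitz_fun phi -> mfun phi.
Proof.
move=> [L L0 HL]; apply: measurable_loclip => // xi.
by exists 1%R, L; split.
Qed.

Lemma measurable_dist g phi : mfun g -> mfun phi ->
  measurable_fun [set: caratheodory_type m] (fun xi => (`|g xi - phi xi|)%:E).
Proof.
move=> mg mp; apply/measurable_EFinP; apply: (measurableT_comp (@normr_measurable R setT)).
exact: measurable_funB.
Qed.

Section on_a_set.
Variable B : set (caratheodory_type m).
Hypothesis mB : measurable B.
Hypothesis fB : m B < +oo.

Lemma int_dist_tri g1 g2 g3 : mfun g1 -> mfun g2 -> mfun g3 ->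
  \int[cmeasure m]_(xi in B) (`|g1 xi - g3 xi|)%:E <=
  \int[cmeasure m]_(xi in B) (`|g1 xi - g2 xi|)%:E + \int[cmeasure m]_(xi in B) (`|g2 xi - g3 xi|)%:E.
Proof.
move=> m1 m2 m3; rewrite -ge0_integralD//; last 2 first.
- by apply: measurable_funTS; exact: measurable_dist.
- by apply: measurable_funTS; exact: measurable_dist.
apply: ge0_le_integral => //.
- by apply: measurable_funTS; exact: measurable_dist.
- by apply: measurable_funTS; apply: emeasurable_funD; exact: measurable_dist.
- by move=> xi _; rewrite -EFinD lee_fin ler_distD.
Qed.

Lemma lip_dense_lim g : mfun g ->
  (forall e : R, (0 < e)%R -> exists g', [/\ mfun g', lip_dense B g' &
    \int[cmeasure m]_(xi in B) (`|g xi - g' xi|)%:E <= e%:E]) -> lip_dense B g.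
Proof.
move=> mg H e e0; have e2 : (0 < e / 2)%R by rewrite divr_gt0.
have [g' [mg' lg' h1]] := H _ e2; have [phi lphi h2] := lg' _ e2.
exists phi => //; apply: le_trans (int_dist_tri mg mg' (measurable_lipschitz lphi)) _.
by rewrite [in leRHS](splitr e) EFinD leeD.
Qed.

Lemma lip_dense_lipschitz phi : lipschitz_fun phi -> lip_dense B phi.
Proof.
move=> lp e e0; exists phi => //; under eq_integral do rewrite subrr normr0.
by rewrite integral0 lee_fin ltW.
Qed.

Lemma lipschitz_cst (a : R) : lipschitz_fun (fun=> a).
Proof. by exists 0%R => // *; rewrite subrr normr0 mul0r. Qed.

Lemma lipschitzD phi psi : lipschitz_fun phi -> lipschitz_fun psi ->
  lipschitz_fun (fun xi => phi xi + psi xi)%R.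
Proof.
move=> [L L0 HL] [M M0 HM]; exists (L + M)%R; first by rewrite addr_ge0.
move=> xi eta; rewrite (_ : (_ - _) = (phi xi - phi eta) + (psi xi - psi eta))%R; last by ring.
by apply: (le_trans (ler_normD _ _)); rewrite mulrDl lerD.
Qed.

Lemma lipschitzZ (a : R) phi : lipschitz_fun phi -> lipschitz_fun (fun xi => a * phi xi)%R.
Proof.
move=> [L L0 HL]; exists (`|a| * L)%R; first by rewrite mulr_ge0.
by move=> xi eta; rewrite -mulrBr normrM -mulrA ler_wpM2l.
Qed.

Lemma lip_denseD g1 g2 : mfun g1 -> mfun g2 -> lip_dense B g1 -> lip_dense B g2 ->
  lip_dense B (fun xi => g1 xi + g2 xi)%R.
Proof.
move=> m1 m2 l1 l2 e e0; have e2 : (0 < e / 2)%R by rewrite divr_gt0.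
have [p1 lp1 h1] := l1 _ e2; have [p2 lp2 h2] := l2 _ e2.
exists (fun xi => p1 xi + p2 xi)%R; first exact: lipschitzD.
have mp1 := measurable_lipschitz lp1; have mp2 := measurable_lipschitz lp2.
apply: (@le_trans _ _ (\int[cmeasure m]_(xi in B) ((`|g1 xi - p1 xi|)%:E + (`|g2 xi - p2 xi|)%:E))).
  apply: ge0_le_integral => //.
  - by apply: measurable_funTS; apply: measurable_dist; exact: measurable_funD.
  - by apply: measurable_funTS; apply: emeasurable_funD; exact: measurable_dist.
  - move=> xi _; rewrite -EFinD lee_fin; apply: le_trans (ler_normD _ _).
    by rewrite le_eqVlt; apply/orP; left; apply/eqP; congr `|_|%R; ring.
rewrite ge0_integralD//; last 2 first.
- by apply: measurable_funTS; exact: measurable_dist.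
- by apply: measurable_funTS; exact: measurable_dist.
by rewrite [in leRHS](splitr e) EFinD leeD.
Qed.

Lemma lip_denseZ (a : R) g : mfun g -> lip_dense B g -> lip_dense B (fun xi => a * g xi)%R.
Proof.
move=> mg lg e e0; have a1 : (0 < `|a| + 1)%R by rewrite ltr_wpDl.
have [p lp h] := lg _ (divr_gt0 e0 a1).
exists (fun xi => a * p xi)%R; first exact: lipschitzZ.
under eq_integral do rewrite -mulrBr normrM EFinM.
rewrite ge0_integralZl//; last first.
  by apply: measurable_funTS; apply: measurable_dist => //; exact: measurable_lipschitz.
apply: (@le_trans _ _ (`|a|%:E * (e / (`|a| + 1))%:E)); first by rewrite lee_wpmul2l// lee_fin.
rewrite -EFinM lee_fin mulrCA ler_piMr ?(ltW e0)// ler_pdivrMr// mul1r; lra.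
Qed.

Lemma lip_dense_eq g g' : {ae cmeasure m, forall xi, B xi -> g xi = g' xi} ->
  mfun g -> mfun g' -> lip_dense B g -> lip_dense B g'.
Proof.
move=> ae mg mg' lg e e0; have [p lp h] := lg _ e0; exists p => //.
have mp := measurable_lipschitz lp; apply: le_trans h.
apply: ae_ge0_le_integral => //.
- by apply: measurable_funTS; exact: measurable_dist.
- by apply: measurable_funTS; exact: measurable_dist.
- by apply: (ae_imp (mu := cmeasure m) _ ae) => xi E xB; rewrite E.
Qed.

Lemma int_cst_set (a : R) : \int[cmeasure m]_(xi in B) a%:E = a%:E * m B.
Proof. by rewrite (_ : (fun _ => _) = cst a%:E)// integral_cst. Qed.

Lemma lip_dense_bounded_cvg (h : nat -> T -> R) g : (forall n, mfun (h n)) -> mfun g ->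
  (forall n xi, (`|h n xi| <= 1)%R) -> (forall xi, h n xi @[n --> \oo] --> (g xi : R^o)) ->
  (forall n, lip_dense B (h n)) -> lip_dense B g.
Proof.
move=> mh mg h1 hg lh; apply: lip_dense_lim => // e e0.
have [|||||_ H _] := @dominated_convergence _ _ _ (cmeasure m) B mB (fun n xi => (h n xi)%:E)
  (fun xi => (g xi)%:E) (cst 1%:E).
- by move=> n; apply/measurable_EFinP; apply: measurable_funTS; exact: mh.
- by apply/measurable_EFinP; apply: measurable_funTS; exact: mg.
- by apply: aeW => xi _; apply: cvg_EFin; [exact: nearW|exact: hg].
- apply/integrableP; split; first exact: measurable_cst.
  rewrite [ltLHS](_ : _ = \int[cmeasure m]_(xi in B) 1%:E); last first.
    by apply: eq_integral => xi _; rewrite /= normr1.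
  by rewrite int_cst_set mul1e.
- by apply: aeW => xi n _; rewrite abse_EFin lee_fin.
move: H => /fine_cvgP[[N1 _ HN1] /cvgrPdist_le /(_ e e0)[N2 _ HN2]].
exists (h (maxn N1 N2)); split => //.
have := HN1 (maxn N1 N2) (leq_maxl _ _); have := HN2 (maxn N1 N2) (leq_maxr _ _).
rewrite /= sub0r normrN => hN hf.
rewrite [leLHS](_ : _ = \int[cmeasure m]_(xi in B) `|(h (maxn N1 N2) xi)%:E - (g xi)%:E|); last first.
  by apply: eq_integral => xi _; rewrite -EFinB abse_EFin distrC.
by rewrite -(fineK hf) lee_fin; apply: le_trans hN; exact: ler_norm.
Qed.

Let ind A : T -> R := fun xi => \1_A xi.

Lemma measurable_ind A : measurable (A : set (caratheodory_type m)) -> mfun (ind A).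
Proof. by move=> mA; exact: measurable_indic. Qed.

Lemma rad_small (e : R) : (0 < e)%R -> exists N, (rad N < e)%R.
Proof.
move=> e0; exists (Num.truncn e^-1).+1.
rewrite /rad -[ltRHS]invrK ltf_pV2 ?posrE ?exprn_gt0 ?invr_gt0//.
apply: lt_trans (truncnS_gt e^-1) _.
by rewrite -natrX ltr_nat ltn_expl.
Qed.

(** Assign 1 to the vertices whose ball lies in A and smooth: the result is Lipschitz at each level,
    vanishes off A, and equals 1 at any given point of A from some level on. *)
Lemma lip_dense_open A : open A -> lip_dense B (ind A).
Proof.
move=> oA; pose u (x : vertex W) : R[i] := if `[< vball x `<=` A >] then 1%R else 0%R.
have u1 x : (nc (u x) <= 1)%R by rewrite /u; case: ifP; rewrite ?normc0 ?Normc.normc1.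
have T1 n xi : (nc (Tn n u xi) <= 1)%R.
  by rewrite -[Tn _ _ _]subr0; apply: (Tn_osc Hm) => x _ _; rewrite subr0.
have lT n : lipschitz_fun (fun xi => complex.Re (Tn n u xi)).
  have [C C0 HC] := Tn_lip W Hm; exists ((C + 2) * 2 ^+ n)%R.
    by rewrite mulr_ge0 ?exprn_ge0// addr_ge0.
  move=> xi eta; rewrite -raddfB; apply: (le_trans (normRe_le _)).
  have q0 : (0 <= 2 ^+ n * mdist xi eta)%R by rewrite mulr_ge0 ?exprn_ge0 ?mdist_ge0.
  rewrite -mulrA; have [d|d] := leP (mdist xi eta) (rad n).
    apply: (@le_trans _ _ (C * (2 ^+ n * mdist xi eta) * 1)%R); last by rewrite mulr1 ler_wpM2r// lerDl.
    by apply: (HC n u 0%R) => // x _ _; rewrite subr0.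
  apply: (le_trans (normcB _ _)); apply: (@le_trans _ _ 2%R).
    by have := T1 n xi; have := T1 n eta; lra.
  have q1 : (1 <= 2 ^+ n * mdist xi eta)%R.
    have e0 : (0 < 2 ^+ n :> R)%R by rewrite exprn_gt0.
    by rewrite -(@ler_pM2l _ (rad n))// ?rad_gt0// mulr1 mulrA mulVf ?gt_eqF// mul1r ltW.
  have := mulr_ge0 C0 q0; lra.
apply: (@lip_dense_bounded_cvg (fun n xi => complex.Re (Tn n u xi))).
- by move=> n; exact: measurable_lipschitz.
- by apply: measurable_ind; exact: measurable_open_c.
- by move=> n xi; apply: le_trans (normRe_le _) (T1 n xi).
- move=> xi; have [hA|hA] := pselect (A xi); rewrite /ind indicE ?(mem_set hA) ?(memNset hA)//; last first.
    apply: cvg_near_cst; apply: nearW => n.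
    have : (nc (Tn n u xi - 0) <= 0)%R.
      apply: (Tn_osc Hm) => x xn xB; rewrite /u asboolF ?subrr ?normc0// => h.
      by apply: hA; exact: h.
    rewrite subr0 => h; have {}h : nc (Tn n u xi) = 0%R by apply/eqP; rewrite eq_le h normc_ge0.
    by rewrite (Normc.eq0_normc h).
  have [e /= e0 he] : exists2 e : R, (0 < e)%R & ball xi e `<=` A.
    by have /nbhs_ballP := open_nbhs_nbhs (conj oA hA).
  have [N HN] := rad_small (divr_gt0 e0 (ltr0Sn _ 1)).
  apply: cvg_near_cst; exists N => // n /= Nn.
  have : (nc (Tn n u xi - 1) <= 0)%R.
    apply: (Tn_osc Hm) => x xn xB; rewrite /u asboolT ?subrr ?normc0// => eta /(vballE _ xn) h.
    apply: he; rewrite ballEmdist/=.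
    have h2 := metric_triangle xi (center x) eta; rewrite (metric_sym xi (center x)) in h2.
    have := (vballE _ xn).1 xB; have := @rad_le R _ _ Nn; lra.
  move=> h; have {}h : nc (Tn n u xi - 1)%R = 0%R by apply/eqP; rewrite eq_le h normc_ge0.
  by have /eqP := Normc.eq0_normc h; rewrite subr_eq0 => /eqP ->.
- by move=> n; exact: lip_dense_lipschitz.
Qed.

Lemma borel_measurable A : borel A -> measurable (A : set (caratheodory_type m)).
Proof.
move: A; apply: smallest_sub; last by move=> U /= oU; exact: measurable_open_c.
split; [exact: measurable0|by move=> A mA; rewrite setTD; exact: measurableC|].
by move=> A mA; exact: bigcupT_measurable.
Qed.

(** Open sets are stable under intersection and generate the Borel sets. In a disjoint union the
    partial sums of indicators are bounded by 1 and converge pointwise. *)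
Lemma lip_dense_borel A : borel A -> lip_dense B (ind A).
Proof.
move: A; apply: (@dynkin_induction _ (g_sigma_algebraType [set U : set T | open U]) [set U | open U]
  (fun A => lip_dense B (ind A))) => //.
- by move=> U V oU oV; exact: openI.
- rewrite /ind; under eq_fun do rewrite indicT; exact: (lip_dense_lipschitz (lipschitz_cst 1)).
- exact: lip_dense_open.
- move=> A mA lA; have mA' := measurable_ind (borel_measurable mA).
  rewrite (_ : ind (~` A) = fun xi => 1 + (-1) * ind A xi)%R; last first.
    by apply/funext => xi; rewrite /ind !indicE in_setC; case: (xi \in A); rewrite /=; lra.
  apply: lip_denseD.
  + exact: measurable_cst.
  + by apply: measurable_funM => //; exact: measurable_cst.
  + exact: (lip_dense_lipschitz (lipschitz_cst 1)).
  + exact: lip_denseZ.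
- move=> A mA tA lA.
  have mA' n := measurable_ind (borel_measurable (mA n)).
  pose h n xi : R := (\sum_(i < n) ind (A i) xi)%R.
  have hE j n xi : A j xi -> h n xi = (j < n)%N%:R.
    move=> Aj; rewrite /h; have [jn|nj] := ltnP j n.
      rewrite (bigD1 (Ordinal jn))//= big1 ?addr0 => [|i ij].
        by rewrite /ind indicE mem_set.
      rewrite /ind indicE memNset// => Ai.
      have /trivIsetP/(_ i j I I) := tA; rewrite -val_eqE/= in ij.
      by move=> /(_ ij) E; have : (A i `&` A j) xi by []; rewrite E.
    rewrite big1// => i _; rewrite /ind indicE memNset// => Ai.
    have ij : (i != j :> nat) by rewrite neq_ltn (leq_trans (ltn_ord i) nj).
    have /trivIsetP/(_ i j I I ij) E := tA.
    by have : (A i `&` A j) xi by []; rewrite E.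
  have h0 n xi : ~ (\bigcup_k A k) xi -> h n xi = 0%R.
    move=> nA; rewrite /h big1// => i _; rewrite /ind indicE memNset// => Ai.
    by apply: nA; exists i.
  have mh n : mfun (h n) by apply: measurable_sum => i; exact: mA'.
  apply: (@lip_dense_bounded_cvg h) => //.
  + by apply: measurable_ind; apply: bigcupT_measurable => k; exact: (borel_measurable (mA k)).
  + move=> n xi; have [[j _ Aj]|nA] := pselect ((\bigcup_k A k) xi).
      by rewrite (hE j n xi Aj); case: (_ < _)%N; rewrite ?normr1 ?normr0.
    by rewrite h0// normr0.
  + move=> xi; have [[j _ Aj]|nA] := pselect ((\bigcup_k A k) xi).
      apply: cvg_near_cst; exists j.+1 => // n /= jn.
      by rewrite (hE j n xi Aj) jn /ind indicE mem_set//; exists j.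
    by apply: cvg_near_cst; apply: nearW => n; rewrite h0// /ind indicE memNset.
  + elim=> [|n IH].
      rewrite (_ : h 0%N = fun=> 0%R); first exact: (lip_dense_lipschitz (lipschitz_cst 0)).
      by apply/funext => xi; rewrite /h big_ord0.
    rewrite (_ : h n.+1 = fun xi => h n xi + ind (A n) xi)%R; first exact: lip_denseD.
    by apply/funext => xi; rewrite /h big_ord_recr.
Qed.

(** Borel regularity is applied to the intersection with B, whose measure is finite; the excess of
    its Borel hull is therefore a null set. *)
Lemma lip_dense_measurable A : measurable (A : set (caratheodory_type m)) -> lip_dense B (ind A).
Proof.
move=> mA; have [[_ breg] _] := mm; have [U [bU AU mU]] := breg (A `&` B).
have mU' := borel_measurable bU.
have mAB : measurable (A `&` B : set (caratheodory_type m)) by exact: measurableI.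
have fin : m (A `&` B) < +oo.
  by apply: le_lt_trans fB; apply: le_outer_measure; exact: subIsetr.
apply: (@lip_dense_eq (ind U)).
- exists (U `\` (A `&` B)); split.
  + exact: measurableD.
  + have E : cmeasure m (U `\` (A `&` B)) = cmeasure m U - cmeasure m (U `&` (A `&` B)).
      apply: measureD => //; have : m U < +oo by rewrite mU.
      by [].
    rewrite E setIidr//; have fn : m (A `&` B) \is a fin_num by rewrite ge0_fin_numE.
    by change (m U - m (A `&` B) = 0); rewrite mU subee.
  + move=> xi /= /not_implyP[Bxi h]; split.
      apply: contrapT => nU; apply: h; rewrite /ind !indicE !memNset// => Axi.
      by apply: nU; exact: AU.
    move=> [Axi _]; apply: h; rewrite /ind !indicE !mem_set//; exact: AU.
- exact: measurable_ind.
- exact: measurable_ind.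
- exact: lip_dense_borel.
Qed.

Lemma lip_dense_integrable g : mfun g -> (cmeasure m).-integrable B (EFin \o g) -> lip_dense B g.
Proof.
move=> mg ig; apply: lip_dense_lim => // e e0.
have [h [_ _ H]] := approximation_sfun_integrable mB ig.
move: H => /fine_cvgP[[N1 _ HN1] /cvgrPdist_le /(_ e e0)[N2 _ HN2]].
pose N := maxn N1 N2; exists (h N).
have := HN1 N (leq_maxl _ _); have := HN2 N (leq_maxr _ _).
rewrite /= sub0r normrN => hN hf; split.
- exact: measurable_funP.
- pose s := fset_set (range (h N)).
  have E : (h N : T -> R) = (fun xi => \sum_(y <- s) y * ind (h N @^-1` [set y]) xi)%R.
    by apply/funext => xi; rewrite fimfunE fsbig_finite.
  rewrite E; elim: (enum_fset s) => [|y r IH].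
    under eq_fun do rewrite big_nil; exact: (lip_dense_lipschitz (lipschitz_cst 0)).
  under eq_fun do rewrite big_cons.
  have mi (z : R) : mfun (ind (h N @^-1` [set z])).
    by apply: measurable_ind; exact: measurable_sfunP.
  apply: lip_denseD => //.
  + by apply: measurable_funM; [exact: measurable_cst|exact: mi].
  + by apply: measurable_sum => z; apply: measurable_funM; [exact: measurable_cst|exact: mi].
  + by apply: lip_denseZ => //; apply: lip_dense_measurable; exact: measurable_sfunP.
- rewrite [leLHS](_ : _ = \int[cmeasure m]_(z in B) `|(EFin \o g) z - (h N z)%:E|); last first.
    by apply: eq_integral => xi _.
  by rewrite -(fineK hf) lee_fin; apply: le_trans hN; exact: ler_norm.
Qed.

End on_a_set.
Lemma lip_dense_complex (B : set T) (f : T -> R[i]) (e : R) :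
  measurable (B : set (caratheodory_type m)) -> m B < +oo -> cmeasurable m f ->
  cintegrable m B f -> (0 < e)%R ->
  exists phi : T -> R[i], exists L : R, [/\ (0 <= L)%R,
    (forall xi eta, (nc (phi xi - phi eta) <= L * mdist xi eta)%R), cmeasurable m phi &
    \int[cmeasure m]_(xi in B) (nc (f xi - phi xi)%R)%:E <= e%:E].
Proof.
move=> mB fB [mf1 mf2] [i1 i2] e0; have e2 : (0 < e / 2)%R by rewrite divr_gt0.
have [p1 lp1 h1] := lip_dense_integrable mB fB mf1 i1 e2.
have [p2 lp2 h2] := lip_dense_integrable mB fB mf2 i2 e2.
have mp1 := measurable_lipschitz lp1; have mp2 := measurable_lipschitz lp2.
have [L1 L10 H1] := lp1; have [L2 L20 H2] := lp2.
have mp : cmeasurable m (fun xi => p1 xi +i* p2 xi)%C by [].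
exists (fun xi => p1 xi +i* p2 xi)%C, (L1 + L2)%R; split => //.
- by rewrite addr_ge0.
- by move=> xi eta; apply: (le_trans (normc_le_ReIm _)); rewrite /= mulrDl lerD.
apply: (@le_trans _ _ (\int[cmeasure m]_(xi in B) ((`|complex.Re (f xi) - p1 xi|)%:E + (`|complex.Im (f xi) - p2 xi|)%:E))).
  apply: ge0_le_integral => //.
  - by move=> *; rewrite lee_fin normc_ge0.
  - apply: measurable_funTS; apply: measurable_nc; split; rewrite /=.
      by under eq_fun do rewrite raddfB; exact: measurable_funB.
    by under eq_fun do rewrite raddfB; exact: measurable_funB.
  - by apply: measurable_funTS; apply: emeasurable_funD; exact: measurable_dist.
  - by move=> xi _; rewrite -EFinD lee_fin; apply: (le_trans (normc_le_ReIm _)); rewrite !raddfB.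
rewrite ge0_integralD//; last 2 first.
- by apply: measurable_funTS; exact: measurable_dist.
- by apply: measurable_funTS; exact: measurable_dist.
by rewrite [in leRHS](splitr e) EFinD leeD.
Qed.

(** Replacing f by the Lipschitz function leaves its variation over a vertex ball, at most
    [2 * L * rad k]; the factor of [Pavg_sub_le] doubles it. *)
Lemma Tn_Pavg_lip k (f phi : T -> R[i]) (L : R) xi : L1loc m f -> cmeasurable m phi -> (0 <= L)%R ->
  (forall xi eta, (nc (phi xi - phi eta) <= L * mdist xi eta)%R) ->
  (nc (Tn k (Pavg W m f) xi - phi xi)%R)%:E <= (4 * L * rad k)%:E +
    \esum_(x in [set x : vertex W | lev k x /\ vball x xi])
      ((2 / fine (m (vball x)))%:E * \int[cmeasure m]_(eta in vball x) (nc (f eta - phi eta)%R)%:E).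
Proof.
move=> [mf lf] mp L0 HL; set S := \esum_(x in _) _.
have t0 (x : vertex W) : 0 <= (2 / fine (m (vball x)))%:E * \int[cmeasure m]_(eta in vball x) (nc (f eta - phi eta)%R)%:E.
  rewrite mule_ge0 ?lee_fin ?divr_ge0 ?(ltW (fine_vball_gt0 mm x))//.
  by apply: integral_ge0 => *; rewrite lee_fin normc_ge0.
have mfp : cmeasurable m (fun eta => f eta - phi eta)%R.
  case: mf mp => [a1 a2] [b1 b2]; split.
    by under eq_fun do rewrite raddfB; exact: measurable_funB.
  by under eq_fun do rewrite raddfB; exact: measurable_funB.
have H x : lev k x -> vball x xi -> (nc (Pavg W m f x - phi xi)%R)%:E <= (4 * L * rad k)%:E + S.
  move=> xk xB; have B0 := fine_vball_gt0 mm x; have BE := vball_measE mm x.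
  have mB : measurable (vball x : set (caratheodory_type m)) by exact: measurable_ball_c.
  have ci : cintegrable m (vball x) f by apply: lf; rewrite exprz_gt0.
  have h := Pavg_sub_le (x := x) mm (phi xi) mf ci.
  have h2 : \int[cmeasure m]_(eta in vball x) (nc (f eta - phi xi)%R)%:E <=
      \int[cmeasure m]_(eta in vball x) (nc (f eta - phi eta)%R)%:E + (2 * L * rad k)%:E * m (vball x).
    rewrite -(int_cst_set (B := vball x) mB) -ge0_integralD//; last 3 first.
    - by move=> *; rewrite lee_fin normc_ge0.
    - by apply: measurable_funTS; exact: measurable_nc.
    - by move=> *; rewrite lee_fin !mulr_ge0 ?rad_ge0.
    apply: ge0_le_integral => //.
    - by move=> *; rewrite lee_fin normc_ge0.
    - by apply: measurable_funTS; apply: measurable_nc; exact: measurable_subC.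
    - apply: measurable_funTS; apply: emeasurable_funD => //; exact: measurable_nc.
    - move=> eta eB; rewrite -EFinD lee_fin; apply: (le_trans (normc_tri _ (phi eta) _)).
      rewrite lerD2l; apply: (le_trans (HL _ _)).
      rewrite (mulrC 2%R) -mulrA ler_wpM2l//.
      have := metric_triangle eta (center x) xi; rewrite (metric_sym eta (center x)).
      have := (vballE _ xk).1 xB; have := (vballE _ xk).1 eB; lra.
  apply: le_trans (_ : (4 * L * rad k)%:E + (2 / fine (m (vball x)))%:E * \int[cmeasure m]_(eta in vball x) (nc (f eta - phi eta)%R)%:E <= _); last first.
    by rewrite leeD2l//; apply: (esum_ge_term (a := fun x => (2 / fine (m (vball x)))%:E * \int[cmeasure m]_(eta in vball x) (nc (f eta - phi eta)%R)%:E)).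
  have : 0 <= \int[cmeasure m]_(eta in vball x) (nc (f eta - phi eta)%R)%:E.
    by apply: integral_ge0 => *; rewrite lee_fin normc_ge0.
  move: h h2.
  rewrite BE; set b := fine _; set J := \int[_]_(_ in _) (nc (_ - phi xi)%R)%:E.
  set I := \int[_]_(_ in _) (nc (_ - phi _)%R)%:E => h h2 I0.
  have two0 : 0 <= 2%:E :> \bar R by rewrite lee_fin.
  have h3 := le_trans h (lee_wpmul2l two0 h2); rewrite [fine _]/=.
  case: I I0 h3 {h h2} => [i||//] I0 h3; last by rewrite gt0_muley ?addey ?leey// lte_fin divr_gt0.
  move: h3; rewrite -(EFinM (2 * L * rad k)) -(EFinD i) -(EFinM 2) -EFinM lee_fin -EFinM -EFinD lee_fin => h3.
  rewrite -(ler_pM2r B0); apply: le_trans h3 _; rewrite le_eqVlt; apply/orP; left; apply/eqP.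
  by rewrite -/b; field; rewrite gt_eqF.
have S0 : 0 <= (4 * L * rad k)%:E + S by rewrite adde_ge0 ?esum_ge0// lee_fin !mulr_ge0 ?rad_ge0.
case: (_ + S) H S0 => [r H r0|_ _|//]; last by rewrite leey.
rewrite lee_fin; apply: (Tn_osc Hm) => x xk xB; have := H x xk xB; by rewrite lee_fin.
Qed.

(** Averaging over vertex balls is bounded in L^1 by bounded overlap. The radius grows by 2 because
    two points of a vertex ball of nonnegative level are less than 2 apart. *)
Lemma int_sum_vball k (h : T -> \bar R) (o : T) (r : R) :
  (forall xi, 0 <= h xi) -> measurable_fun [set: caratheodory_type m] h ->
  forall N : R, (0 < N)%R -> (forall xi, \esum_(x in [set x : vertex W | lev k x /\ vball x xi]) 1 <= N%:E) ->
  \int[cmeasure m]_(xi in ball o r)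
    (\esum_(x in [set x : vertex W | lev k x /\ vball x xi])
      ((2 / fine (m (vball x)))%:E * \int[cmeasure m]_(eta in vball x) h eta)) <=
  (2 * N)%:E * \int[cmeasure m]_(xi in ball o (r + 2)) h xi.
Proof.
move=> h0 mh N N0 HN.
have mB (x : vertex W) : measurable (vball x : set (caratheodory_type m)) by exact: measurable_ball_c.
pose A := [set x : vertex W | lev k x /\ vball x `&` ball o r !=set0].
have cA : countable A by apply: sub_countable (lev_countable W Hm k); apply: subset_card_le => x [].
pose t (x : vertex W) := (2 / fine (m (vball x)))%:E * \int[cmeasure m]_(eta in vball x) h eta.
have t0 x : 0 <= t x.
  by rewrite mule_ge0 ?integral_ge0// lee_fin divr_ge0 ?(ltW (fine_vball_gt0 mm x)).
apply: (@le_trans _ _ (\int[cmeasure m]_xi (\esum_(x in [set x | A x /\ vball x xi]) t x))).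
  rewrite [leLHS]integral_mkcond; apply: ge0_le_integral => //.
  - by move=> xi _; rewrite patchE; case: ifP => // _; apply: esum_ge0 => x _; exact: t0.
  - apply/(measurable_restrictT _ (measurable_ball_c mm o r)); apply: measurable_funTS.
    by apply: measurable_overlap => //; exact: (lev_countable W Hm).
  - by apply: measurable_overlap.
  - move=> xi _; rewrite patchE; case: ifPn => [|_]; last by apply: esum_ge0 => x _; exact: t0.
    rewrite inE => xiB; apply: esum_le_subset => [x [xk xB]|x _]; last exact: t0.
    by split => //; split => //; exists xi.
rewrite integral_overlap//.
apply: (@le_trans _ _ (\esum_(x in A) (2%:E * \int[cmeasure m]_(eta in vball x) h eta))).
  apply: le_esum => x _; have B0 := fine_vball_gt0 mm x.
  have E : cmeasure m (vball x) = (fine (m (vball x)))%:E := vball_measE mm x.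
  by rewrite E /t muleAC -EFinM divfK ?gt_eqF.
rewrite esumZl//; last by move=> x _; exact: integral_ge0.
rewrite EFinM -muleA lee_wpmul2l//.
under eq_esum do rewrite integral_mkcond.
rewrite -integral_esum//; last 2 first.
- by move=> x eta; rewrite patchE; case: ifP.
- move=> x _; apply/(measurable_restrictT _ (mB x)); exact: measurable_funTS.
rewrite -ge0_integralZl ?lee_fin ?(ltW N0)//; last 2 first.
- exact: measurable_ball_c.
- exact: measurable_funTS.
rewrite [leRHS]integral_mkcond; apply: ge0_le_integral => //.
- by move=> xi _; apply: esum_ge0 => x _; rewrite patchE; case: ifP.
- apply: measurable_esum => //.
  + by move=> x eta; rewrite patchE; case: ifP.
  + by move=> x _; apply/(measurable_restrictT _ (mB x)); exact: measurable_funTS.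
- apply/(measurable_restrictT _ (measurable_ball_c mm o (r + 2))); apply: measurable_funTS.
  exact: measurable_funeM.
move=> xi _; rewrite [leRHS]patchE; case: ifPn => [_|/negP nB].
  rewrite [leLHS](_ : _ = \esum_(x in [set x | A x /\ vball x xi]) h xi).
    apply: esum_le_count => //; apply: le_trans (HN xi).
    by apply: esum_le_subset => // x [[]].
  rewrite [RHS](esum_mkcondr A (fun x => vball x xi)); apply: eq_esum => x _.
  by rewrite patchE.
rewrite esum1// => x [xk [eta [eB eo]]]; rewrite patchE; case: ifPn => //.
rewrite inE => xB; exfalso; apply: nB; rewrite inE ballEmdist/=.
move: eo; rewrite ballEmdist/= => eo.
have := metric_triangle xi (center x) eta; have := metric_triangle xi eta o.
rewrite (metric_sym xi (center x)) (metric_sym o xi) (metric_sym eta o).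
have := (vballE _ xk).1 xB; have := (vballE _ xk).1 eB; have := @rad_le1 R k; lra.
Qed.

Lemma int_Tn_Pavg (f : T -> R[i]) (o : T) (r : R) : L1loc m f -> (0 < r)%R ->
  forall e : R, (0 < e)%R -> exists K : nat, forall k, (K <= k)%N ->
  \int[cmeasure m]_(xi in ball o r) (nc (Tn k (Pavg W m f) xi - f xi)%R)%:E <= e%:E.
Proof.
move=> Lf r0 e e0; have [N N1 HN] := vball_count W Hm.
have N0 : (0 < N)%R by exact: lt_le_trans N1.
have [mf lf] := Lf; have r2 : (0 < r + 2)%R by rewrite addr_gt0.
have mB := measurable_ball_c mm o r; have mB2 := measurable_ball_c mm o (r + 2).
have [_ fB2] := andP (mm.2 o (r + 2)%R r2); have [_ fB] := andP (mm.2 o r r0).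
(* The approximation error is counted once directly and 2 N times through the averages, in total
   [e / 2]; the other half is left for the variation of phi. *)
have d0 : (0 < e / 2 / (1 + 2 * N))%R by rewrite !divr_gt0// addr_gt0// mulr_gt0.
have [phi [L [L0 HL mp Hp]]] := lip_dense_complex mB2 fB2 mf (lf o _ r2) d0.
set M := fine (m (ball o r)).
have ME : m (ball o r) = M%:E by rewrite fineK// ge0_fin_numE.
have M0 : (0 <= M)%R by rewrite -lee_fin -ME.
have c0 : (0 < 4 * L * M + 1)%R by rewrite ltr_wpDl// !mulr_ge0.
have [K HK] := rad_small (divr_gt0 (divr_gt0 e0 (ltr0Sn _ 1)) c0).
exists K => k Kk.
have mfp : cmeasurable m (fun eta => f eta - phi eta)%R.
  case: mf mp => [a1 a2] [b1 b2]; split.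
    by under eq_fun do rewrite raddfB; exact: measurable_funB.
  by under eq_fun do rewrite raddfB; exact: measurable_funB.
have mh := measurable_nc mfp.
have h0 eta : 0 <= (nc (f eta - phi eta)%R)%:E by rewrite lee_fin normc_ge0.
pose S xi := \esum_(x in [set x : vertex W | lev k x /\ vball x xi])
  ((2 / fine (m (vball x)))%:E * \int[cmeasure m]_(eta in vball x) (nc (f eta - phi eta)%R)%:E).
have t0 (x : vertex W) : 0 <= (2 / fine (m (vball x)))%:E * \int[cmeasure m]_(eta in vball x) (nc (f eta - phi eta)%R)%:E.
  by rewrite mule_ge0 ?integral_ge0// lee_fin divr_ge0 ?(ltW (fine_vball_gt0 mm x)).
have S0 xi : 0 <= S xi by apply: esum_ge0 => x _; exact: t0.
have mS : measurable_fun [set: caratheodory_type m] S.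
  apply: measurable_overlap => //; first exact: (lev_countable W Hm).
  by move=> x _; exact: measurable_ball_c.
have a0 : 0 <= (4 * L * rad k)%:E by rewrite lee_fin !mulr_ge0 ?rad_ge0.
apply: (@le_trans _ _ (\int[cmeasure m]_(xi in ball o r) (((4 * L * rad k)%:E + S xi) + (nc (f xi - phi xi)%R)%:E))).
  apply: ge0_le_integral => //.
  - by move=> *; rewrite lee_fin normc_ge0.
  - apply: measurable_funTS; apply: measurable_nc.
    case: mf (measurable_Tn Hm k (Pavg W m f)) => [a1 a2] [b1 b2]; split.
      by under eq_fun do rewrite raddfB; exact: measurable_funB.
    by under eq_fun do rewrite raddfB; exact: measurable_funB.
  - by apply: measurable_funTS; do 2! (apply: emeasurable_funD => //).
  - move=> xi _; apply: (@le_trans _ _ ((nc (Tn k (Pavg W m f) xi - phi xi)%R)%:E + (nc (f xi - phi xi)%R)%:E)).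
      by rewrite -EFinD lee_fin (normcBC (f xi)); exact: normc_tri.
    by rewrite leeD2r//; exact: Tn_Pavg_lip.
rewrite ge0_integralD//; last 3 first.
- by move=> xi _; rewrite adde_ge0.
- by apply: measurable_funTS; apply: emeasurable_funD.
- exact: measurable_funTS.
rewrite ge0_integralD//; last exact: measurable_funTS.
rewrite int_cst_set//.
have h1 := int_sum_vball o r h0 mh N0 (HN k).
have h2 : \int[cmeasure m]_(xi in ball o r) (nc (f xi - phi xi)%R)%:E <=
    \int[cmeasure m]_(xi in ball o (r + 2)) (nc (f xi - phi xi)%R)%:E.
  apply: ge0_subset_integral => //; first exact: measurable_funTS.
  by move=> xi; rewrite !ballEmdist/=; lra.
apply: (le_trans (leeD (leeD (lexx _) h1) h2)).
have h3 : (2 * N)%:E * \int[cmeasure m]_(xi in ball o (r + 2)) (nc (f xi - phi xi)%R)%:E <=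
    (2 * N)%:E * (e / 2 / (1 + 2 * N))%:E.
  by rewrite lee_wpmul2l// lee_fin mulr_ge0// ltW.
apply: (le_trans (leeD (leeD (lexx _) h3) Hp)).
rewrite ME -!EFinM -!EFinD lee_fin -addrA -[X in (_ + (_ + X))%R]mul1r -mulrDl (addrC (2 * N)%R).
rewrite [X in (_ + X)%R]mulrC divfK ?gt_eqF ?addr_gt0 ?mulr_gt0//.
rewrite [leRHS](splitr e) lerD2r.
have := @rad_le R _ _ Kk; have := @rad_gt0 R k => k0 kK.
have : (rad k * (4 * L * M + 1) <= e / 2)%R by rewrite -ler_pdivlMr//; lra.
rewrite mulrDr mulr1 => h; have : (rad k * (4 * L * M) = 4 * L * rad k * M)%R by ring.
lra.
Qed.

(** Along levels where the L^1 errors are at most 2^(- i) the sum of the errors is integrable, hence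
    finite almost everywhere. Approximation at arbitrarily fine levels is all that [trace_of_close]
    takes from here, as it knows convergence from the trace series. *)
Lemma Tn_Pavg_liminf (f : T -> R[i]) : L1loc m f -> {ae cmeasure m, forall xi,
  forall e : R, (0 < e)%R -> forall N, exists2 n, (N <= n)%N &
    (nc (Tn n (Pavg W m f) xi - f xi) <= e)%R}.
Proof.
move=> Lf; have [mf _] := Lf; pose o : T := point.
have mE k : measurable_fun [set: caratheodory_type m] (fun xi => (nc (Tn k (Pavg W m f) xi - f xi)%R)%:E).
  apply: measurable_nc; case: mf (measurable_Tn Hm k (Pavg W m f)) => [a1 a2] [b1 b2]; split.
    by under eq_fun do rewrite raddfB; exact: measurable_funB.
  by under eq_fun do rewrite raddfB; exact: measurable_funB.
have H j : {ae cmeasure m, forall xi, ball o j.+1%:R xi ->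
    forall e : R, (0 < e)%R -> forall N, exists2 n, (N <= n)%N &
    (nc (Tn n (Pavg W m f) xi - f xi) <= e)%R}.
  have mB := measurable_ball_c mm o j.+1%:R.
  have ex i : exists k, (i <= k)%N /\
      \int[cmeasure m]_(xi in ball o j.+1%:R) (nc (Tn k (Pavg W m f) xi - f xi)%R)%:E <= (2^-1 ^+ i)%:E.
    have [|K HK] := int_Tn_Pavg o Lf (ltr0Sn R j) (e := 2^-1 ^+ i); first by rewrite exprn_gt0.
    by exists (maxn i K); rewrite leq_maxl; split => //; apply: HK; rewrite leq_maxr.
  have [k Hk] := choice ex.
  pose b xi := \esum_(i in [set: nat]) (nc (Tn (k i) (Pavg W m f) xi - f xi)%R)%:E.
  have e0 i xi : 0 <= (nc (Tn (k i) (Pavg W m f) xi - f xi)%R)%:E by rewrite lee_fin normc_ge0.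
  have mb : measurable_fun [set: caratheodory_type m] b.
    by apply: measurable_esum => //; exact: countableP.
  have : {ae cmeasure m, forall xi, ball o j.+1%:R xi -> b xi < +oo}.
    apply: integral_ae_lty => //; first exact: measurable_funTS.
      by move=> xi; apply: esum_ge0 => i _.
    rewrite integral_esum//; last 2 first.
      exact: countableP.
      by move=> i _; apply: measurable_funTS.
    apply: (@le_lt_trans _ _ (\esum_(i in [set: nat]) (2^-1 ^+ i)%:E)).
      by apply: le_esum => i _; exact: (Hk i).2.
    apply: le_lt_trans (@esum_geo R 2^-1 _) (ltry _).
    by rewrite invr_ge0 ler0n/= invf_lt1// ltr1n.
  apply: (ae_imp (mu := cmeasure m)) => xi h /h bfin e epos N.
  have [M HM] := esum_tail_small (b := fun i => (nc (Tn (k i) (Pavg W m f) xi - f xi)%R)%:E)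
    (fun i => e0 i xi) bfin epos.
  exists (k (maxn N M.+1)); first by apply: leq_trans (Hk _).1; rewrite leq_maxl.
  rewrite -lee_fin; apply: le_trans HM.
  apply: (esum_ge_term (a := fun i => (nc (Tn (k i) (Pavg W m f) xi - f xi)%R)%:E)) => //=.
  by rewrite leq_maxr.
have /(ae_imp (mu := cmeasure m)) := ae_foralln (mu := cmeasure m) H; apply => xi h.
pose j := Num.truncn (mdist o xi); apply: (h j); rewrite ballEmdist/=.
exact: truncnS_gt.
Qed.

End differentiation.

(** * Extended sequences tending to zero *)

Section vanishing.
Context {R : realType}.
Local Open Scope ereal_scope.

Definition to0 (a : nat -> \bar R) : Prop :=
  forall e : R, (0 < e)%R -> exists N, forall n, (N <= n)%N -> a n <= e%:E.

Lemma esum_to0 (b : nat -> \bar R) : (forall n, 0 <= b n) ->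
  \esum_(n in [set: nat]) b n < +oo -> to0 b.
Proof.
move=> b0 bf e e0; have [N HN] := esum_tail_small b0 bf e0.
exists N.+1 => n Nn; apply: le_trans HN.
exact: (esum_ge_term (a := b)).
Qed.

Lemma to0_le (a b : nat -> \bar R) (C : R) : (0 <= C)%R ->
  (forall n, a n <= C%:E * b n) -> to0 b -> to0 a.
Proof.
move=> C0 ab b0 e e0; have C1 : (0 < C + 1)%R by lra.
have [N HN] := b0 _ (divr_gt0 e0 C1); exists N => n /HN h.
apply: (le_trans (ab n)); apply: (le_trans (lee_wpmul2l _ h)); first by rewrite lee_fin.
by rewrite -EFinM lee_fin mulrCA ler_piMr ?(ltW e0)// ler_pdivrMr// mul1r; lra.
Qed.

Lemma to0D (a b : nat -> \bar R) : to0 a -> to0 b -> to0 (fun n => a n + b n).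
Proof.
move=> ha hb e e0; have e2 : (0 < e / 2)%R by rewrite divr_gt0.
have [N1 H1] := ha _ e2; have [N2 H2] := hb _ e2.
exists (maxn N1 N2) => n; rewrite geq_max => /andP[/H1 h1 /H2 h2].
by rewrite (splitr e) EFinD leeD.
Qed.

End vanishing.

(** * The trace of the extension *)

Section trace_after_extension.
Context {R : realType} {Z : pmetricType R} (mu : {outer_measure set Z -> \bar R}).
Context (Q : R) (X : filling Z) (F : set Z) (F0 : F !=set0).
Context (nu : {outer_measure set (subsp F0) -> \bar R}) (lambda : R).
Context (Y : filling (subsp F0)).
Hypothesis HX : regular_space Q mu.
Hypothesis HY : regular_space lambda nu.
Local Notation V := (vertex X).
Local Notation val := (@subsp_val R Z F F0).
Implicit Types (v : vertex Y -> R[i]) (u : V -> R[i]) (t : V -> \bar R) (n k : nat)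
  (xi eta : subsp F0) (z : Z) (p s : R).
Local Open Scope ereal_scope.

(** Moves coefficients from the vertices of Z to nearby vertices of F of the same level, so that the
    estimates of the synthesis on F apply to sums over vertices of Z near a point of F. *)
Definition transfer (K : R) t (y : vertex Y) : \bar R :=
  \esum_(x in [set x : V | level x = level y /\
    (mdist (center x) (val (center y)) < K * 2 ^ (- level y))%R]) t x.

Lemma transferE K t n y : lev n y ->
  transfer K t y = \esum_(x in [set x : V | lev n x /\ (mdist (center x) (val (center y)) < K * rad n)%R]) t x.
Proof. by move=> yn; rewrite /transfer (lev_rad yn) /lev /= yn. Qed.

Lemma transfer_ge0 K t y : (forall x, 0 <= t x) -> 0 <= transfer K t y.
Proof. by move=> t0; apply: esum_ge0. Qed.

Lemma near_transfer K t n xi : (forall x, 0 <= t x) ->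
  \esum_(x in nearv K n (val xi)) t x <= bsum (transfer (K + 1) t) n xi.
Proof.
move=> t0; have [y yn yB] := lev_cover_vball Y n xi.
apply: (@le_trans _ _ (transfer (K + 1) t y)).
  rewrite (transferE _ _ yn); apply: esum_le_subset => // x [xn xB]; split => //.
  have h2 : (mdist (val (center y)) (val xi) < rad n)%R := (vballE _ yn).1 yB.
  have h := metric_triangle (center x) (val xi) (val (center y)).
  rewrite (metric_sym (val xi)) in h.
  by apply: le_lt_trans h _; rewrite mulrDl mul1r ltrD.
by apply: (esum_ge_term (a := transfer (K + 1) t)) => // *; exact: transfer_ge0.
Qed.

Lemma transfer_pow K p : (0 < p)%R -> (1 <= K)%R -> exists2 C : R, (0 <= C)%R &
  forall t n, (forall x, 0 <= t x) -> psum_lev (transfer K t) p n <= C%:E * psum_lev t p n.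
Proof.
move=> p0 K1; have [N1 N11 HN1] := nearv_count X HX K1; have [N2 N21 HN2] := subsp_count Y HY K1.
pose N := (N1 + N2)%R; have N0 : (0 < N)%R by rewrite /N; lra.
exists (N `^ p * N)%R; first by rewrite mulr_ge0 ?powR_ge0// ltW.
move=> t n t0.
apply: (@le_trans _ _ (\esum_(y in @lev _ _ Y n) (\esum_(x in [set x : V | lev n x /\ (mdist (center x) (val (center y)) < K * rad n)%R]) t x) `^ p)).
  by apply: le_esum => y yn; rewrite (transferE _ _ yn).
apply: (le_trans (esum_pow_incidence (N := N) p0 N0 t0 _ _)).
- move=> y yn; apply: le_trans (HN1 n (val (center y))) _.
  by rewrite lee_fin /N; lra.
- move=> x xn.
  apply: (@le_trans _ _ (\esum_(y in [set y : vertex Y | lev n y /\ (mdist (val (center y)) (center x) < K * rad n)%R]) 1)).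
    by apply: esum_le_subset => // y [y0]; rewrite metric_sym.
  by apply: le_trans (HN2 n (center x)) _; rewrite lee_fin /N; lra.
rewrite lee_wpmul2l ?lee_fin ?mulr_ge0 ?powR_ge0 ?(ltW N0)//.
by apply: esum_le_subset => [x []//|*]; exact: poweR_ge0.
Qed.

(** As F may be null for [mu], finiteness almost everywhere on Z says nothing about F. After the
    transfer the coefficients live on F with the same level weights, and [total_bsum_ae] holds for
    [nu]. *)
Lemma transfer_ae K s p q t : (1 <= K)%R -> (0 < p)%R -> 0 < q ->
  (0 < tail_exp lambda p (s - (Q - lambda) / p))%R ->
  (forall x, 0 <= t x) -> lq_norm q setT (level_norm Q p s t) < +oo ->
  {ae cmeasure nu, forall xi, \esum_(n in [set: nat]) \esum_(x in nearv K n (val xi)) t x < +oo}.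
Proof.
move=> K1 p0 q0 te t0 fin; set s' := (s - _)%R in te.
have pn : p != 0%R by rewrite gt_eqF.
have Es : (s' * p - lambda = s * p - Q)%R by rewrite /s' mulrBl divfK//; ring.
have K2 : (1 <= K + 1)%R by lra.
have [C C0 HC] := transfer_pow p0 K2.
have c0 y : 0 <= transfer (K + 1) t y by exact: transfer_ge0.
have lf : lq_norm q setT (level_norm lambda p s' (transfer (K + 1) t)) < +oo.
  apply: (@le_lt_trans _ _ ((C `^ p^-1)%:E * lq_norm q setT (level_norm Q p s t))); last first.
    move: fin (lq_norm_ge0 q setT (level_norm Q p s t)).
    by case: (lq_norm _ _ _) => [r||]//= _ _; rewrite -EFinM ltry.
  apply: lq_norm_scale => // [|n _|n _|n _]; rewrite ?powR_ge0 ?level_norm_ge0//.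
  rewrite /level_norm Es -(poweR_EFin C) -poweRM ?mule_ge0 ?psum_lev_ge0 ?lee_fin ?e2_ge0//.
  apply: poweR_le; rewrite ?invr_ge0 ?(ltW p0)//.
    by rewrite mule_ge0 ?psum_lev_ge0// lee_fin e2_ge0.
  by rewrite muleCA lee_wpmul2l ?lee_fin ?e2_ge0//; exact: HC.
have ft := fine_tails_lq HY p0 q0 te c0 lf.
apply: (ae_imp (mu := cmeasure nu) _ (total_bsum_ae HY c0 ft)) => xi.
by apply: le_lt_trans; apply: le_esum => n _; exact: near_transfer.
Qed.

(** Bundles the tails, whose level is a parameter, into one vertex function to which [transfer_ae]
    applies. *)
Definition tails (c : V -> \bar R) x := tail_sum Q c (absz (level x)) x.

Lemma tails_lev (c : V -> \bar R) k x : lev k x -> tails c x = tail_sum Q c k x.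
Proof. by rewrite /tails => ->. Qed.

Lemma psum_tails (c : V -> \bar R) p k : psum_lev (tails c) p k = psum_lev (tail_sum Q c k) p k.
Proof.
rewrite /psum_lev; apply: (eq_esum (a := fun x => tails c x `^ p)) => x xk.
by rewrite (tails_lev c xk).
Qed.

Lemma near_tails (c : V -> \bar R) n z : \esum_(x in nearv 8 n z) tails c x = near_tail Q c n z.
Proof.
rewrite /near_tail; apply: (eq_esum (a := fun x => tails c x)) => x [xn _].
exact: tails_lev.
Qed.

(** The tails inherit the level norm of the coefficients, so their sums near almost every point of F
    are summable over the levels; the kernel is summable as well, and the terms of convergent series
    vanish. *)
Lemma level_sum_to0 s p q (c : V -> \bar R) : (0 < p)%R -> 0 < q -> (0 < tail_exp Q p s)%R ->
  (0 < tail_exp lambda p (s - (Q - lambda) / p))%R ->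
  (forall x, 0 <= c x) -> lq_norm q setT (level_norm Q p s c) < +oo ->
  {ae cmeasure nu, forall xi, to0 (fun n => near_tail Q c n (val xi)) /\
    to0 (fun n => level_sum Q c n (val xi))}.
Proof.
move=> p0 q0 te te' c0 fin; have [C C0 HC] := level_norm_tail X HX p0 q0 te.
have t0 x : 0 <= tails c x by exact: tail_sum_ge0.
have lt : lq_norm q setT (level_norm Q p s (tails c)) < +oo.
  apply: (@le_lt_trans _ _ (C%:E * lq_norm q setT (level_norm Q p s c))); last first.
    move: fin (lq_norm_ge0 q setT (level_norm Q p s c)).
    by case: (lq_norm _ _ _) => [r||]//= _ _; rewrite -EFinM ltry.
  apply: le_trans (HC c c0).
  have E : level_norm Q p s (tails c) = fun k => level_norm Q p s (tail_sum Q c k) k.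
    by apply/funext => k; rewrite /level_norm psum_tails.
  by rewrite E.
have K8 : (1 <= 8 :> R)%R by lra.
apply: (ae_imp (mu := cmeasure nu) _ (transfer_ae K8 p0 q0 te' t0 lt)) => xi h.
have A0 n : 0 <= near_tail Q c n (val xi) by exact: near_tail_ge0.
have {}h : \esum_(n in [set: nat]) near_tail Q c n (val xi) < +oo.
  have E : (fun n => \esum_(x in nearv 8 n (val xi)) tails c x) = (fun n => near_tail Q c n (val xi)).
    by apply/funext => n; exact: near_tails.
  by rewrite E in h.
split; first exact: esum_to0.
have [K K0 HK] := @geo_kernel_sum R 1 ltr01.
apply: esum_to0 => [n|]; first exact: level_sum_ge0.
rewrite /level_sum esum_exchangeT; last first.
  by move=> *; rewrite mule_ge0// lee_fin ltW// geo_kernel_gt0.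
apply: (@le_lt_trans _ _ (K%:E * \esum_(n in [set: nat]) near_tail Q c n (val xi))).
  rewrite -esumZl ?(ltW K0)//; apply: le_esum => n _.
  under eq_esum do rewrite muleC.
  move: (A0 n); case: (near_tail _ _ _ _) => [r||//] r0; last by rewrite gt0_muley ?leey// lte_fin.
  rewrite esumZl//; last by move=> *; rewrite lee_fin ltW// geo_kernel_gt0.
  rewrite muleC lee_wpmul2r//; apply: le_trans (HK n).
  by apply: le_esum => k _; rewrite geo_kernelC.
move: h (esum_ge0 (fun n (_ : [set: nat] n) => A0 n)).
by case: (\esum_(n in _) _) => [r||]//= _ _; rewrite -EFinM ltry.
Qed.

Definition close_seq u v xi : Prop :=
  to0 (fun n => (nc (Tn n u (val xi) - Tn (n + 5) (ext_vertex (X := X) v) (val xi))%R)%:E).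

(** A chain at a common point of F: the trace, the smoothing of u, that of [ext_vertex], that of v,
    and finally h. The last link is available at arbitrarily fine levels only, which is enough since
    the others hold from some level on. *)
Lemma trace_of_close u v (h : subsp F0 -> R[i]) : L1loc nu h -> v = Pavg Y nu h ->
  {ae cmeasure nu, forall xi, trace_cvg u xi} ->
  {ae cmeasure nu, forall xi, close_seq u v xi} ->
  {ae cmeasure nu, forall xi, to0 (fun n => edge_sum n v xi)} ->
  {ae cmeasure nu, forall xi, trace u xi = h xi}.
Proof.
move=> Lh -> cu cl ce; have lim := Tn_Pavg_liminf Y HY Lh.
have both : {ae cmeasure nu, forall xi, close_seq u (Pavg Y nu h) xi /\
    to0 (fun n => edge_sum n (Pavg Y nu h) xi)}.
  by apply: (ae_imp2 (mu := cmeasure nu) _ cl ce).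
have both2 : {ae cmeasure nu, forall xi, trace_cvg u xi /\ (forall e : R, (0 < e)%R -> forall N, exists2 n, (N <= n)%N &
    (nc (Tn n (Pavg Y nu h) xi - h xi) <= e)%R)}.
  by apply: (ae_imp2 (mu := cmeasure nu) _ cu lim).
apply: (ae_imp2 (mu := cmeasure nu) _ both both2) => xi {cu cl ce lim both both2} [cl ce] [cu lim].
set w := Pavg Y nu h in cl ce lim.
apply/eqP; rewrite -subr_eq0; apply/eqP; apply: Normc.eq0_normc; apply/eqP.
rewrite eq_le normc_ge0 andbT.
have H : forall e : R, (0 < e)%R -> (nc (trace u (xi : subsp F0) - h xi) <= e)%R; last first.
  by rewrite leNgt; apply/negP => g; have := H _ (divr_gt0 g (ltr0Sn R 1)); lra.
move=> e e0.
(* Five eighths are used: one for the trace, one for the closeness, two for comparing the smoothings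
   of [ext_vertex] and of v, one for the means of h. *)
have e8 : (0 < e / 8)%R by rewrite divr_gt0.
have [N1 H1] := cu _ e8; have [N2 H2] := cl _ e8; have [N3 H3] := ce _ e8.
have [n Nn Hn] := lim _ e8 (maxn N1 (maxn N2 N3)).
move: Nn; rewrite !geq_max => /and3P[n1 n2 n3].
have h1 := H1 n.+1 (leq_trans n1 (leqnSn n)); have h2 := H2 n.+1 (leq_trans n2 (leqnSn n)).
have h3 := H3 n n3; rewrite lee_fin in h2.
have h4 : (nc (Tn (n.+1 + 5) (ext_vertex (X := X) w) (val xi) - Tn n w xi) <= 2 * (e / 8))%R.
  have [y yn yB] := lev_cover_vball Y n xi.
  have -> : (2 * (e / 8) = e / 8 + e / 8)%R by lra.
  apply: (le_trans (normc_tri _ (w y) _)); apply: lerD.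
    apply: (Tn_osc HX) => x xn xz; rewrite -lee_fin; apply: le_trans h3.
    apply: (ext_vertex_osc w (or_intror xn) xz _ yn yB).
    by rewrite mdistxx mulr_gt0 ?rad_gt0.
  rewrite normcBC; apply: (Tn_osc HY) => y' yn' yB'; rewrite -lee_fin; apply: le_trans h3.
  by apply: edge_sum_osc => //; left.
have t1 := normc_tri (trace u (xi : subsp F0)) (Tn n.+1 u (val xi)) (h xi); rewrite (normcBC _ (Tn n.+1 u (val xi))) in t1.
have t2 := normc_tri (Tn n.+1 u (val xi)) (Tn (n.+1 + 5) (ext_vertex (X := X) w) (val xi)) (h xi).
have t3 := normc_tri (Tn (n.+1 + 5) (ext_vertex (X := X) w) (val xi)) (Tn n w xi) (h xi).
lra.
Qed.

(** [Pavg_near] compares means of the extension with the partial sums of its series, which on F are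
    smoothings of [ext_vertex]. The edge sums of v at level n are dominated by the coefficients of
    level n.+1. *)
Lemma ext_close s p q : (0 < p)%R -> 0 < q -> (0 < tail_exp Q p s)%R ->
  (0 < tail_exp lambda p (s - (Q - lambda) / p))%R ->
  forall v, ext_norm lambda (s - (Q - lambda) / p) p q v < +oo ->
  {ae cmeasure nu, forall xi, close_seq (Pavg X mu (ext X v)) v xi} /\
  {ae cmeasure nu, forall xi, to0 (fun n => edge_sum n v xi)}.
Proof.
move=> p0 q0 te te' v fin; have [K K1 HK] := ext_synth X Y HX HY; have K0 := ltW K1.
have [C3 C30 HC3] := ext_level_norm X Y HX HY s K0 p0 q0.
have [c0 _ _ _] := HK v.
have lqf : lq_norm q setT (level_norm Q p s (ext_coef (X := X) K v)) < +oo.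
  apply: le_lt_trans (HC3 v) _.
  have : 0 <= ext_norm lambda (s - (Q - lambda) / p) p q v by rewrite adde_ge0 ?poweR_ge0 ?lq_norm_ge0.
  by case: (ext_norm _ _ _ _ _) fin => [r||]// _ _; rewrite -EFinM ltry.
have ft := fine_tails_lq HX p0 q0 te c0 lqf.
have ls := level_sum_to0 p0 q0 te te' c0 lqf.
have [C C0 HC] := Pavg_near X HX.
split.
- apply: (ae_imp (mu := cmeasure nu) _ ls) => xi [_ h].
  apply: (to0_le C0 _ h) => n.
  have L0 : 0 <= C%:E * level_sum Q (ext_coef (X := X) K v) n (val xi).
    by rewrite mule_ge0// level_sum_ge0.
  have H x : lev n x -> vball x (val xi) ->
      (nc (Pavg X mu (ext X v) x - Tn (n + 5) (ext_vertex (X := X) v) (val xi))%R)%:E <=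
      C%:E * level_sum Q (ext_coef (X := X) K v) n (val xi).
    move=> xn xB; rewrite -(csum_ext X HX).
    apply: (HC _ _ n n x (val xi) (HK v) ft) => //; first by left.
      by have := (vballE _ xn).1 xB; have := @rad_gt0 R n; lra.
    move=> z zB; have := metric_triangle z (center x) (val xi).
    rewrite (metric_sym z (center x)).
    have := (vballE _ xn).1 xB; have := (vballE _ xn).1 zB; have := @rad_gt0 R n; lra.
  move: L0 H; case: (C%:E * _) => [r r0 H|_ _|//]; last by rewrite leey.
  rewrite lee_fin; apply: (Tn_osc HX) => x xn xB.
  by have := H x xn xB; rewrite lee_fin.
- apply: (ae_imp (mu := cmeasure nu) _ ls) => xi [h _] e e0.
  have [N HN] := h _ (mulr_gt0 K1 e0).
  exists N => n Nn; have Nn1 : (N <= n.+1)%N by exact: leqW.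
  rewrite -(@lee_pmul2l _ K%:E) ?lte_fin// -EFinM.
  apply: le_trans (HN _ Nn1).
  have d : (mdist (val xi) (val xi) < 4 * rad (n.+1 + 5))%R by rewrite mdistxx mulr_gt0 ?rad_gt0.
  apply: le_trans (bsum_extS X v K0 d) _.
  apply: bsum_le_near_tail => //.
  by rewrite mdistxx mulr_ge0 ?rad_ge0.
Qed.

Lemma Tn_Pavg_cont (f : Z -> R[i]) z : L1loc mu f -> continuous (f : Z -> R[i]^o) ->
  forall e : R, (0 < e)%R -> exists N, forall n, (N <= n)%N ->
  (nc (Tn n (Pavg X mu f) z - f z) <= e)%R.
Proof.
case: HX => _ mm _ [mf lf] cf e e0; have e2 : (0 < e / 2)%R by rewrite divr_gt0.
have e2c : (0 < (e / 2)%:C%C :> R[i])%R by rewrite ltcR.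
have := cf z => /cvgrPdist_le /(_ _ e2c) /nbhs_ballP[d /= d0 hd].
have [N HN] := rad_small (divr_gt0 d0 (ltr0Sn _ 1)).
exists N => n Nn; apply: (Tn_osc HX) => x xn xB.
have ci : cintegrable mu (vball x) f by apply: lf; rewrite exprz_gt0.
have mB : measurable (vball x : set (caratheodory_type mu)) by exact: measurable_ball_c.
have B0 := fine_vball_gt0 mm x.
rewrite -lee_fin -(@lee_pmul2r _ (mu (vball x))); last 2 first.
- by rewrite (vball_measE mm).
- by rewrite (vball_measE mm) lte_fin.
apply: (le_trans (Pavg_sub_le (x := x) mm (f z) mf ci)).
apply: (@le_trans _ _ (2%:E * ((e / 2)%:E * mu (vball x)))); last first.
  by rewrite muleA -EFinM mulrC divfK.
rewrite lee_wpmul2l// -(int_cst_set (B := vball x) mB); apply: ge0_le_integral => //.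
- by move=> *; rewrite lee_fin normc_ge0.
- by apply: measurable_funTS; apply: measurable_nc; exact: measurable_subC.
- move=> t tB; rewrite lee_fin normcBC -lecR; apply: hd.
  rewrite ballEmdist/=; have := metric_triangle z (center x) t.
  rewrite (metric_sym z (center x)).
  have := (vballE _ xn).1 xB; have := (vballE _ xn).1 tB; have := @rad_le R _ _ Nn; lra.
Qed.

End trace_after_extension.

Lemma lq_norm_le (R : realType) (I : choiceType) (q : \bar R) (A : set I) (a b : I -> \bar R) :
  (0 < q)%E -> (forall i, 0 <= a i)%E -> (forall i, a i <= b i)%E -> (lq_norm q A a <= lq_norm q A b)%E.
Proof.
move=> q0 a0 ab; rewrite -[leRHS]mul1e; apply: lq_norm_scale => // i _; last by rewrite mul1e.
exact: le_trans (a0 i) (ab i).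
Qed.

(** * Linearity of the means *)

Section linearity_of_averages.
Context {R : realType} {T : pmetricType R} (m : {outer_measure set T -> \bar R}).
Context (W : filling T).
Hypothesis mm : metric_measure_space m.

Lemma cintegralZD (x : vertex W) (a : R[i]) (f g : T -> R[i]) :
  cintegrable m (vball x) f -> cintegrable m (vball x) g ->
  cintegral m (vball x) (fun y => a * f y + g y) =
  a * cintegral m (vball x) f + cintegral m (vball x) g.
Proof.
move=> [f1 f2] [g1 g2].
have mB : measurable (vball x : set (caratheodory_type m)) by exact: measurable_ball_c.
have iZ (c : R) (h : T -> R) : (cmeasure m).-integrable (vball x) (fun y => (h y)%:E) ->
    (cmeasure m).-integrable (vball x) (fun y => (c * h y)%:E).
  by move=> ih; under eq_fun do rewrite EFinM; exact: integrableZl.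
have iB (h k : T -> R) : (cmeasure m).-integrable (vball x) (fun y => (h y)%:E) ->
    (cmeasure m).-integrable (vball x) (fun y => (k y)%:E) ->
    (cmeasure m).-integrable (vball x) (fun y => (h y - k y)%:E).
  by move=> ih ik; under eq_fun do rewrite EFinB; exact: integrableB.
have iD (h k : T -> R) : (cmeasure m).-integrable (vball x) (fun y => (h y)%:E) ->
    (cmeasure m).-integrable (vball x) (fun y => (k y)%:E) ->
    (cmeasure m).-integrable (vball x) (fun y => (h y + k y)%:E).
  by move=> ih ik; under eq_fun do rewrite EFinD; exact: integrableD.
case: a => a b.
have E1 : \int[cmeasure m]_(y in vball x) complex.Re ((a +i* b)%C * f y + g y) =
    \int[cmeasure m]_(y in vball x) (a * complex.Re (f y) - b * complex.Im (f y) + complex.Re (g y)).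
  by apply: eq_Rintegral => y _; case: (f y) => ? ?; case: (g y).
have E2 : \int[cmeasure m]_(y in vball x) complex.Im ((a +i* b)%C * f y + g y) =
    \int[cmeasure m]_(y in vball x) (a * complex.Im (f y) + b * complex.Re (f y) + complex.Im (g y)).
  by apply: eq_Rintegral => y _; case: (f y) => ? ?; case: (g y).
rewrite /cintegral E1 E2 RintegralD//; last first.
  by apply: iB; apply: iZ.
rewrite RintegralB//; [|exact: iZ|exact: iZ].
rewrite !RintegralZl// RintegralD//; last first.
  by apply: iD; apply: iZ.
rewrite RintegralD//; [|exact: iZ|exact: iZ].
by rewrite !RintegralZl.
Qed.

Lemma PavgZD (x : vertex W) (a : R[i]) (f g : T -> R[i]) : L1loc m f -> L1loc m g ->
  Pavg W m (fun y => a * f y + g y) x = a * Pavg W m f x + Pavg W m g x.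
Proof.
have r0 : 0 < 2 ^ (- level x) :> R by rewrite exprz_gt0.
move=> [_ lf] [_ lg]; rewrite /Pavg cintegralZD ?mulrDr ?mulrA 1?(mulrC a)//.
- exact: lf.
- exact: lg.
Qed.

End linearity_of_averages.

(** * Trace and extension as operators between function spaces *)

Section operators_between_spaces.
Context {R : realType} {Z : pmetricType R} (mu : {outer_measure set Z -> \bar R}).
Context (Q : R) (X : filling Z) (F : set Z) (F0 : F !=set0).
Context (nu : {outer_measure set (subsp F0) -> \bar R}) (lambda : R).
Context (Y : filling (subsp F0)).
Hypothesis HX : regular_space Q mu.
Hypothesis HY : regular_space lambda nu.
Local Notation val := (@subsp_val R Z F F0).
Implicit Types (p s : R) (q : \bar R).
Local Open Scope ereal_scope.

Definition Tr (f : Z -> R[i]) : subsp F0 -> R[i] := trace (F0 := F0) (Pavg X mu f).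
Definition Ext (h : subsp F0 -> R[i]) : Z -> R[i] := ext X (Pavg Y nu h).

Variables (s p : R) (q : \bar R).
Let s' := (s - (Q - lambda) / p)%R.
Hypothesis p0 : (0 < p)%R.
Hypothesis q0 : 0 < q.
Hypothesis s'01 : (0 < s' < 1)%R.
Hypothesis teF : (0 < tail_exp lambda p s')%R.
Hypothesis teZ : (0 < tail_exp Q p s)%R.

Let mmX : metric_measure_space mu. Proof. by case: HX. Qed.
Let mmY : metric_measure_space nu. Proof. by case: HY. Qed.

(** The space A is left abstract so that Besov and Triebel-Lizorkin spaces share the argument; each
    has only to bound the trace norm of the means. *)
Lemma trace_operator (A : fspace Z) :
  (forall f, fmem A f -> L1loc mu f) ->
  (exists2 C : R, (0 <= C)%R & forall f, fmem A f ->
     trace_norm Q F0 s p q (Pavg X mu f) <= C%:E * fnorm A f /\ fnorm A f < +oo) ->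
  [/\ bounded_linear_op mu nu A (besov nu Y s' p%:E q) Tr,
      (forall f, fmem A f -> {ae cmeasure nu, forall xi, trace_cvg (F0 := F0) (Pavg X mu f) xi}) &
      (forall f, fmem A f -> continuous (f : Z -> R[i]^o) -> cae_eq nu (Tr f) (f \o val))].
Proof.
move=> AL [C C0 HC]; have [C1 C10 HC1] := trace_besov X Y HX HY p0 q0 s'01 teF.
have fin f : fmem A f -> trace_norm Q F0 s p q (Pavg X mu f) < +oo.
  move=> Af; have [h1 h2] := HC f Af; apply: le_lt_trans h1 _.
  have : 0 <= trace_norm Q F0 s p q (Pavg X mu f) by rewrite adde_ge0 ?poweR_ge0 ?lq_norm_ge0.
  (* For an abstract space the value -oo is not excluded; C times it is still at most 0. *)
  case: (fnorm A f) h2 (HC f Af).1 => [r|//|] _ h h0; first by rewrite -EFinM ltry.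
  by rewrite (le_lt_trans (y := 0))//; case: ltgtP C0 h => // [C0|<-] _; rewrite ?mul0e// gt0_muleNy// lte_fin.
have cv f : fmem A f -> {ae cmeasure nu, forall xi, trace_cvg (F0 := F0) (Pavg X mu f) xi}.
  by move=> /fin /HC1[].
split => //.
- split.
  + move=> f Af; have [h1 h2 _] := HC1 _ (fin f Af); split => //.
    apply: le_lt_trans h2 _; have := fin f Af.
    have : 0 <= trace_norm Q F0 s p q (Pavg X mu f) by rewrite adde_ge0 ?poweR_ge0 ?lq_norm_ge0.
    by case: (trace_norm _ _ _ _ _) => [r||]// _ _; rewrite -EFinM ltry.
  + move=> f g Af Ag fg; have [mf _] := AL f Af; have [mg _] := AL g Ag.
    rewrite /Tr (_ : Pavg X mu f = Pavg X mu g); last first.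
      by apply/funext => x; exact: (Pavg_ae_eq mmX).
    exact: aeW.
  + move=> a f g Af Ag.
    apply: (ae_imp2 (mu := cmeasure nu) _ (cv f Af) (cv g Ag)) => xi cf cg.
    rewrite /Tr (_ : Pavg X mu _ = fun x => a * Pavg X mu f x + Pavg X mu g x)%R; last first.
      by apply/funext => x; apply: (PavgZD mmX); exact: AL.
    exact: (trace_linear HX).
  + exists (C1 * C)%R => f Af; have [_ h2 _] := HC1 _ (fin f Af).
    by apply: (le_trans h2); rewrite EFinM -muleA lee_wpmul2l//; exact: (HC f Af).1.
- move=> f Af cf; apply: aeW => xi; apply: trace_unique.
  by move=> e e0; have [N HN] := Tn_Pavg_cont X HX (val xi) (AL f Af) cf e0; exists N.
Qed.

Lemma ext_norm_besov : exists2 C : R, (0 <= C)%R & forall h, fmem (besov nu Y s' p%:E q) h ->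
  ext_norm lambda s' p q (Pavg Y nu h) <= C%:E * fnorm (besov nu Y s' p%:E q) h /\
  ext_norm lambda s' p q (Pavg Y nu h) < +oo.
Proof.
have [C C0 HC] := seq_norm_le_besov Y HY s' p0 q0.
exists C => // h [_ hfin]; split; first exact: HC.
apply: le_lt_trans (HC h) _.
have : 0 <= besov_norm nu Y s' p%:E q h by rewrite adde_ge0 ?Lnorm_ge0 ?lq_norm_ge0.
by move: hfin; case: (besov_norm _ _ _ _ _ _) => [r||]// _ _; rewrite -EFinM ltry.
Qed.

Lemma extension_operator (A : fspace Z) :
  (exists2 C : R, (0 <= C)%R & forall v : vertex Y -> R[i], ext_norm lambda s' p q v < +oo ->
    fmem A (ext X v) /\ fnorm A (ext X v) <= C%:E * ext_norm lambda s' p q v) ->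
  bounded_linear_op nu mu (besov nu Y s' p%:E q) A Ext.
Proof.
move=> [C1 C10 HC1]; have [C C0 HC] := ext_norm_besov.
have cv h : fmem (besov nu Y s' p%:E q) h ->
    {ae cmeasure mu, forall z, ext_cvg X (Pavg Y nu h) z}.
  by move=> /HC[_ fin]; have [] := ext_L1loc X HX HY p0 q0 teZ fin.
split.
- by move=> h /HC[_ /HC1[]].
- move=> f g [[mf _] _] [[mg _] _] fg.
  rewrite /Ext (_ : Pavg Y nu f = Pavg Y nu g); last first.
    by apply/funext => y; exact: (Pavg_ae_eq mmY).
  exact: aeW.
- move=> a f g Bf Bg.
  apply: (ae_imp2 (mu := cmeasure mu) _ (cv f Bf) (cv g Bg)) => z cf cg.
  rewrite /Ext (_ : Pavg Y nu _ = fun y => a * Pavg Y nu f y + Pavg Y nu g y)%R; last first.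
    by case: Bf Bg => Lf _ [Lg _]; apply/funext => y; exact: (PavgZD mmY).
  exact: (ext_linear HX).
- exists (C1 * C)%R => h Bh; have [h1 fin] := HC h Bh; have [_ h2] := HC1 _ fin.
  by apply: (le_trans h2); rewrite EFinM -muleA lee_wpmul2l.
Qed.

Lemma trace_extension_id (A : fspace Z) :
  (forall v : vertex Y -> R[i], ext_norm lambda s' p q v < +oo -> fmem A (ext X v)) ->
  (forall f, fmem A f -> {ae cmeasure nu, forall xi, trace_cvg (F0 := F0) (Pavg X mu f) xi}) ->
  forall h, fmem (besov nu Y s' p%:E q) h -> cae_eq nu (Tr (Ext h)) h.
Proof.
move=> AE cv h Bh; have [C C0 HC] := ext_norm_besov; have [_ fin] := HC h Bh.
have [cl es] := ext_close X HX HY p0 q0 teZ teF fin.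
by apply: (trace_of_close HX HY Bh.1 (erefl _) (cv _ (AE _ fin)) cl es).
Qed.

End operators_between_spaces.

(** * Admissible exponents and the case of Besov spaces *)

Section besov_spaces.
Context {R : realType} {Z : pmetricType R} (mu : {outer_measure set Z -> \bar R}).
Context (Q : R) (X : filling Z) (F : set Z) (F0 : F !=set0).
Context (nu : {outer_measure set (subsp F0) -> \bar R}) (lambda : R).
Context (Y : filling (subsp F0)).
Hypothesis HX : regular_space Q mu.
Hypothesis HY : regular_space lambda nu.
Hypothesis lQ : 0 < lambda <= Q.
Implicit Types (p s : R) (q : \bar R).

(** The bound (Q - lambda) / s makes the smoothness on F positive, which is also the tail condition
    on F for p >= 1; for p < 1 that condition is Q / (lambda + s) < p, and lambda <= Q carries it
    over to Z. When s = 1, smoothness below 1 on F comes from lambda < Q. *)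
Lemma exponents s p : 0 < s -> (s < 1 \/ (s <= 1 /\ lambda < Q)) ->
  Num.max (Q / (lambda + s)) ((Q - lambda) / s) < p ->
  [/\ 0 < p, 0 < s - (Q - lambda) / p < 1,
      0 < tail_exp lambda p (s - (Q - lambda) / p) & 0 < tail_exp Q p s].
Proof.
move=> s0 s1; rewrite gt_max => /andP[h1 h2].
have [l0 lq] := andP lQ; have Q0 : 0 < Q by exact: lt_le_trans lq.
have ls0 : 0 < lambda + s by rewrite addr_gt0.
have p0 : 0 < p by apply: lt_trans h1; rewrite divr_gt0.
have k1 : Q < p * (lambda + s) by rewrite -ltr_pdivrMr.
have k2 : Q - lambda < p * s by rewrite -ltr_pdivrMr.
have E : (s - (Q - lambda) / p) * p = s * p - Q + lambda.
  by rewrite mulrBl divfK ?gt_eqF//; ring.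
have s'0 : 0 < s - (Q - lambda) / p by rewrite subr_gt0 ltr_pdivrMr// mulrC.
split => //.
- rewrite s'0/=; case: s1 => [s1|[s1 ltQ]].
    apply: le_lt_trans s1; rewrite gerBl divr_ge0 ?(ltW p0)//; lra.
  apply: lt_le_trans s1; rewrite gtrBl divr_gt0//; lra.
- rewrite /tail_exp E; case: (leP (1 - p) 0) => hp; first by lra.
  have -> : s * p - Q + lambda - lambda * (1 - p) = p * (lambda + s) - Q by ring.
  by rewrite subr_gt0.
- apply: tail_exp_gt0 => //; apply: le_lt_trans h1.
  by rewrite ler_pM2l// lef_pV2 ?posrE ?addr_gt0// lerD2r.
Qed.

Lemma besov_trace_extension s p q : 0 < s < 1 ->
  Num.max (Q / (lambda + s)) ((Q - lambda) / s) < p -> (0 < q)%E ->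
  trace_and_extension mu nu (besov mu X s p%:E q)
    (besov nu Y (s - (Q - lambda) / p) p%:E q).
Proof.
move=> s01 hp q0; have [s0 s1] := andP s01.
have [p0 s'01 teF teZ] := exponents s0 (or_introl s1) hp.
have [C1 C10 H1] := ext_besov X Y HX HY p0 q0 s01 teZ.
have ext_mem (v : vertex Y -> R[i]) : (ext_norm lambda (s - (Q - lambda) / p) p q v < +oo)%E ->
    fmem (besov mu X s p%:E q) (ext X v).
  move=> fin; have [L _] := ext_L1loc X HX HY p0 q0 teZ fin; split => //.
  apply: le_lt_trans (H1 v fin) _.
  have : (0 <= ext_norm lambda (s - (Q - lambda) / p) p q v)%E by rewrite adde_ge0 ?poweR_ge0 ?lq_norm_ge0.
  by case: (ext_norm _ _ _ _ _) fin => [r||]// _ _; rewrite -EFinM ltry.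
have [T1 T2 T3] : [/\ bounded_linear_op mu nu (besov mu X s p%:E q) (besov nu Y (s - (Q - lambda) / p) p%:E q) (Tr mu X (F0 := F0)),
      (forall f, fmem (besov mu X s p%:E q) f -> {ae cmeasure nu, forall xi, trace_cvg (F0 := F0) (Pavg X mu f) xi}) &
      (forall f, fmem (besov mu X s p%:E q) f -> continuous (f : Z -> R[i]^o) -> cae_eq nu (Tr mu X f) (f \o @subsp_val R Z F F0))].
  apply: (@trace_operator _ _ mu Q X F F0 nu lambda Y HX HY s p q p0 q0 s'01 teF); first by move=> f [].
  have [C C0 HC] := seq_norm_le_besov X HX s p0 q0; exists C => // f [_ fin]; split => //.
  apply: le_trans (HC f); rewrite leeD2l//.
  apply: lq_norm_le => // k.
    by rewrite mule_ge0 ?poweR_ge0// lee_fin e2_ge0.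
  rewrite lee_wpmul2l ?lee_fin ?e2_ge0//; apply: poweR_le.
  - by rewrite invr_ge0 ltW.
  - by rewrite mule_ge0 ?near_edge_pow_ge0// lee_fin e2_ge0.
  - by rewrite lee_wpmul2l ?lee_fin ?e2_ge0//; exact: near_edge_pow_le.
exists (Tr mu X (F0 := F0)), (Ext X nu Y); split => //.
- apply: (extension_operator HX HY p0 q0 teZ); exists C1 => // v fin; split; first exact: ext_mem.
  exact: H1.
- exact: (trace_extension_id HX HY p0 q0 teF teZ ext_mem T2).
Qed.

End besov_spaces.

(** * Monotone integrals and families of bounded overlap *)

Section monotone_integral.
Context d (T : measurableType d) (R : realType) (mu : {measure set T -> \bar R}).
Local Open Scope ereal_scope.

(* No measurability is needed: the integral is a supremum over simple functions. *)
Lemma le_integral_nomeas (D : set T) (f g : T -> \bar R) :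
  (forall x, D x -> 0 <= f x) -> (forall x, D x -> f x <= g x) ->
  \int[mu]_(x in D) f x <= \int[mu]_(x in D) g x.
Proof.
move=> f0 fg; have g0 x : D x -> 0 <= g x by move=> Dx; exact: le_trans (f0 x Dx) (fg x Dx).
rewrite [leLHS]integral_mkcond [leRHS]integral_mkcond.
have fp x : 0 <= (f \_ D) x by rewrite patchE; case: ifPn => //; rewrite inE => /f0.
have gp x : 0 <= (g \_ D) x by rewrite patchE; case: ifPn => //; rewrite inE => /g0.
rewrite !ge0_integralTE//; apply: le_ereal_sup => _ [h hf <-]; exists h => // x.
apply: le_trans (hf x) _; rewrite !patchE; case: ifPn => //.
by rewrite inE => /fg.
Qed.

Lemma integral_overlap_le (I : choiceType) (A : set I) (B : I -> set T) (h : T -> \bar R)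
    (D : set T) (N : R) : (0 < N)%R -> countable A -> (forall i, A i -> measurable (B i)) ->
  measurable D -> (forall i, A i -> B i `<=` D) ->
  (forall x, 0 <= h x) -> measurable_fun setT h ->
  (forall x, \esum_(i in [set i | A i /\ B i x]) 1 <= N%:E) ->
  \esum_(i in A) \int[mu]_(x in B i) h x <= N%:E * \int[mu]_(x in D) h x.
Proof.
move=> N0 cA mB mD BD h0 mh HN.
have mhB i : A i -> measurable_fun setT (h \_ (B i)).
  by move=> Ai; apply/(measurable_restrictT _ (mB i Ai)); exact: measurable_funTS.
under eq_esum do rewrite integral_mkcond.
rewrite -integral_esum//; last by move=> i x; rewrite patchE; case: ifP.
rewrite -ge0_integralZl ?lee_fin ?(ltW N0)//; last exact: measurable_funTS.
rewrite [leRHS]integral_mkcond; apply: le_integral_nomeas.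
  by move=> x _; apply: esum_ge0 => i _; rewrite patchE; case: ifP.
move=> x _; rewrite [leRHS]patchE; case: ifPn => [_|/negP nD].
  rewrite [leLHS](_ : _ = \esum_(i in [set i | A i /\ B i x]) h x); first exact: esum_le_count.
  rewrite [RHS](esum_mkcondr A (fun i => B i x)); apply: eq_esum => i _.
  by rewrite patchE.
rewrite esum1// => i Ai; rewrite patchE; case: ifPn => //.
by rewrite inE => Bx; exfalso; apply: nD; rewrite inE; exact: (BD i Ai).
Qed.

End monotone_integral.

Lemma countable_levels (I : choiceType) (A : nat -> set I) : (forall n, countable (A n)) ->
  countable [set i : nat * I | A i.1 i.2].
Proof.
move=> cA; have -> : [set i : nat * I | A i.1 i.2] = [set: nat] `*`` A.
  by apply/seteqP; split => [[n i]|[n i] []].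
by apply: countableXR.
Qed.

(** * Holes of a porous set *)

Section porosity.
Context {R : realType} {Z : pmetricType R} (mu : {outer_measure set Z -> \bar R}).
Context (Q : R) (X : filling Z) (F : set Z) (F0 : F !=set0).
Context (nu : {outer_measure set (subsp F0) -> \bar R}) (lambda : R).
Context (Y : filling (subsp F0)).
Hypothesis HX : regular_space Q mu.
Hypothesis HY : regular_space lambda nu.
Hypothesis pF : porous F.
Hypothesis Z2 : exists x y : Z, x <> y.
Local Notation V := (vertex X).
Local Notation val := (@subsp_val R Z F F0).
Implicit Types (n k : nat) (xi eta : subsp F0) (z : Z) (p s : R) (q : \bar R) (x : V).
Local Open Scope ereal_scope.

Let mmX : metric_measure_space mu. Proof. by case: HX. Qed.
Let mmY : metric_measure_space nu. Proof. by case: HY. Qed.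

Lemma subsp_in xi : F (val xi).
Proof. exact: (set_mem (valP (xi : set_type F))). Qed.

(** If a ball of small multiple radius around the center of x misses F, the center of x serves;
    otherwise porosity provides a ball off F. Halving its radius keeps the points of the hole at a
    definite distance from F. *)
Lemma hole_ex : exists kappa : R, [/\ (0 < kappa)%R, (kappa <= 1)%R & forall n x, lev n x ->
  exists y, ball y (kappa * rad n) `<=` vball x /\
    forall z xi, ball y (kappa * rad n) z -> (kappa * rad n <= mdist z (val xi))%R].
Proof.
have [c [/andP[c0 c1] Hc]] := pF; have [a [b ab]] := Z2.
have d0 : (0 < mdist a b)%R.
  by rewrite lt_def mdist_ge0 andbT; apply/eqP => /mdist_positivity.
(* Porosity is only available at radii below the diameter; with this factor [dl * rad n] stays below
   the distance of two given points at every level. *)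
pose dl := (Num.min (1 / 2) (mdist a b / 2))%R.
have dl0 : (0 < dl)%R by rewrite lt_min !divr_gt0.
have dl1 : (dl <= 1 / 2)%R by rewrite ge_min lexx.
have dl2 : (dl <= mdist a b / 2)%R by rewrite ge_min lexx orbT.
have cd : (c * dl <= dl)%R by rewrite ler_piMl ?(ltW dl0)// ltW.
have cd0 : (0 < c * dl)%R by rewrite mulr_gt0.
exists (c * dl / 2)%R; split; [by rewrite divr_gt0|by lra|].
move=> n x xn; have r0 := @rad_gt0 R n; have r1 := @rad_le1 R n.
have dr0 : (0 < dl * rad n)%R by rewrite mulr_gt0.
have drd : ((dl * rad n)%:E < diam [set: Z]).
  apply: (@lt_le_trans _ _ (mdist a b)%:E).
    have : (dl * rad n <= dl)%R by rewrite ler_piMr ?(ltW dl0).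
    rewrite lte_fin; lra.
  by apply: ereal_sup_ubound; exists (a, b).
have [Fi|nF] := pselect (ball (center x) (dl * rad n) `&` F !=set0).
  have [y hy] := Hc (center x) (dl * rad n)%R dr0 drd Fi.
  exists y; have sub : ball y (c * dl / 2 * rad n) `<=` ball y (c * (dl * rad n)).
    move=> z; rewrite !ballEmdist/=; have := mulr_gt0 cd0 r0; rewrite mulrA; lra.
  split=> [z /sub /hy[+ _]|z xi zB].
    rewrite ballEmdist/= => h; apply/(vballE _ xn); apply: lt_le_trans h _.
    by rewrite ler_piMl ?(ltW r0)//; lra.
  rewrite leNgt; apply/negP => dz.
  have : ball y (c * (dl * rad n)) (val xi).
    move: zB; rewrite !ballEmdist/= => zB.
    have := metric_triangle y z (val xi); rewrite (mulrA c); lra.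
  by move=> /hy[_]; apply; exact: subsp_in.
exists (center x); split=> [z|z xi].
  rewrite ballEmdist/= => h; apply/(vballE _ xn); apply: lt_le_trans h _.
  rewrite ler_piMl ?(ltW r0)//; lra.
rewrite ballEmdist/= => zB; rewrite leNgt; apply/negP => dz; apply: nF.
exists (val xi); split; last exact: subsp_in.
rewrite ballEmdist/=; have := metric_triangle (center x) z (val xi).
have : (c * dl * rad n <= dl * rad n)%R by rewrite ler_wpM2r// ltW.
lra.
Qed.

Definition kappa : R := projT1 (cid hole_ex).

Lemma kappa_gt0 : (0 < kappa)%R.
Proof. by rewrite /kappa; case: cid => k []. Qed.

Lemma kappa_le1 : (kappa <= 1)%R.
Proof. by rewrite /kappa; case: cid => k []. Qed.

Lemma hole_centerP : exists y : V -> Z, forall n x, lev n x ->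
  ball (y x) (kappa * rad n) `<=` vball x /\
  forall z xi, ball (y x) (kappa * rad n) z -> (kappa * rad n <= mdist z (val xi))%R.
Proof.
have H x : exists y, forall n, lev n x -> ball y (kappa * rad n) `<=` vball x /\
    forall z xi, ball y (kappa * rad n) z -> (kappa * rad n <= mdist z (val xi))%R.
  have [[n xn]|nx] := pselect (exists n, lev n x); last first.
    by exists point => n xn; exfalso; apply: nx; exists n.
  rewrite /kappa; case: cid => k [k0 k1 hk]/=; have [y hy] := hk n x xn.
  by exists y => j xj; rewrite -(lev_inj xn xj).
have [y hy] := choice H; exists y => n x; exact: hy.
Qed.

Definition hole x : set Z :=
  ball (projT1 (cid hole_centerP) x) (kappa * 2 ^ (- level x)).

Lemma holeP n x : lev n x -> hole x `<=` vball x /\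
  forall z xi, hole x z -> (kappa * rad n <= mdist z (val xi))%R.
Proof. by move=> xn; rewrite /hole (lev_rad xn); case: cid => y hy/=; exact: hy. Qed.

Lemma measurable_hole x : measurable (hole x : set (caratheodory_type mu)).
Proof. exact: measurable_ball_c. Qed.

Lemma hole_measure : exists2 c : R, (0 < c)%R & forall n x, lev n x ->
  (2 `^ (- (n%:R * Q)))%:E <= c%:E * mu (hole x) /\ mu (hole x) < +oo.
Proof.
have [Q0 _ [C C0 [_ HC]]] := HX; have k0 := kappa_gt0; have k1 := kappa_le1.
exists (kappa `^ (- Q) * C)%R; first by rewrite mulr_gt0 ?powR_gt0.
move=> n x xn; rewrite /hole (lev_rad xn); have r0 := @rad_gt0 R n.
have kr0 : (0 < kappa * rad n)%R by rewrite mulr_gt0.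
split; last by case/andP: (mmX.2 (projT1 (cid hole_centerP) x) _ kr0).
have := HC (projT1 (cid hole_centerP) x) (kappa * rad n)%R.
rewrite kr0 mulr_ile1 ?(ltW k0) ?(ltW r0) ?rad_le1// => /(_ isT) h.
rewrite EFinM -muleA; apply: le_trans (lee_wpmul2l _ h); last by rewrite lee_fin powR_ge0.
rewrite -EFinM lee_fin powRM ?(ltW k0) ?(ltW r0)// mulrA -powRDpos// addNr powRr0 mul1r.
by rewrite rad_pow.
Qed.

(* A point sees the holes of finitely many consecutive levels only: the level of
   a hole near [F] is determined by the distance to [F] up to a bounded error. *)
Lemma level_window (K : R) : (0 < K)%R -> exists2 N : R, (0 < N)%R & forall (S : set nat) z,
  (forall n, S n -> (forall xi, (kappa * rad n.+1 <= mdist z (val xi))%R) /\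
    exists xi, (mdist z (val xi) < K * rad n)%R) ->
  \esum_(n in S) 1 <= N%:E.
Proof.
move=> K0; have k0 := kappa_gt0.
(* If n0 is the least level seen from z, a level i >= n0 + J.+1 is impossible: [K * rad i] would be
   less than [kappa * rad n0.+1], while the distance of z to some point of F lies between them. *)
have [J HJ] := rad_small (divr_gt0 k0 (mulr_gt0 K0 (ltr0Sn _ 1))).
exists J.+1%:R => // S z HS; have [->|/set0P[n Sn]] := eqVneq S set0.
  by rewrite esum_set0 lee_fin.
have ex : exists n, `[< S n >] by exists n; exact/asboolP.
have [n0 /asboolP S0 min0] := ex_minnP ex.
have sub : S `<=` [set i | (i \in iota n0 J.+1)].
  move=> i Si; suff : (i \in iota n0 J.+1) by [].
  rewrite mem_iota min0 ?asboolT//=.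
  rewrite ltnNge; apply/negP => h.
  have [h1 _] := HS _ S0; have [_ [xi h2]] := HS _ Si; have {}h1 := h1 xi.
  have ri : (rad i <= rad n0.+1 * rad J :> R)%R by rewrite -radD; apply: rad_le; rewrite addSnnS.
  have r0 := @rad_gt0 R n0.+1.
  have : (K * rad i < kappa * rad n0.+1)%R.
    apply: (@le_lt_trans _ _ (K * (rad n0.+1 * rad J))%R); first by rewrite ler_wpM2l// ltW.
    rewrite mulrCA (mulrC kappa) ltr_pM2l// mulrC -ltr_pdivlMr//.
    apply: lt_le_trans HJ _; rewrite ler_pM2l// lef_pV2 ?posrE ?mulr_gt0//; lra.
  lra.
apply: (@le_trans _ _ (\esum_(i in [set i | (i \in iota n0 J.+1)]) 1)).
  exact: esum_le_subset.
rewrite esum_fset//; last exact: finite_seq.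
by rewrite -fsbig_seq ?iota_uniq// sumEFin big_const_seq count_predT size_iota iter_addr_0.
Qed.

Definition near_set (K : R) n : set Z := [set z | exists xi, (mdist z (val xi) < K * rad n)%R].

Lemma near_set_open K n : open (near_set K n).
Proof.
have -> : near_set K n = \bigcup_(xi in [set: subsp F0]) ball (val xi) (K * rad n).
  apply/seteqP; split=> [z [xi h]|z [xi _ h]]; exists xi => //.
    by rewrite ballEmdist/= metric_sym.
  by move: h; rewrite ballEmdist/= metric_sym.
by apply: bigcup_open => xi _; exact: ball_open_metric.
Qed.

(** Overlap over all levels together is at most the number of levels visible from a point, by
    [level_window], times the overlap at a single level. *)
Lemma near_hole_overlap (I : choiceType) (A : nat -> set I) (w : I -> V) (K N2 : R) :
  (0 < K)%R -> (0 < N2)%R ->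
  (forall n i z, A n i -> hole (w i) z ->
     (forall xi, (kappa * rad n.+1 <= mdist z (val xi))%R) /\ near_set K n z) ->
  (forall n z, \esum_(i in [set i | A n i /\ hole (w i) z]) 1 <= N2%:E) ->
  exists2 N : R, (0 < N)%R & forall z,
  \esum_(i in [set i : nat * I | A i.1 i.2 /\ hole (w i.2) z]) 1 <= N%:E.
Proof.
move=> K0 N20 hA H2; have [N1 N10 H1] := level_window K0.
exists (N1 * N2)%R; first by rewrite mulr_gt0.
move=> z; pose S := [set n | exists i, A n i /\ hole (w i) z].
have HS : \esum_(n in S) 1 <= N1%:E.
  by apply: (H1 S z) => n [i [Ai hz]]; exact: hA hz.
apply: (@le_trans _ _ (\esum_(n in S) \esum_(i in [set i | A n i /\ hole (w i) z]) 1)).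
  rewrite esum_esum//; apply: esum_le_subset => // -[n i] [Ai hz] /=; split => //.
  by exists i.
apply: (@le_trans _ _ (\esum_(n in S) N2%:E)); first by apply: le_esum => n _; exact: H2.
rewrite mulrC EFinM -[X in \esum_(_ in _) X]mule1 esumZl ?(ltW N20)//.
by rewrite lee_wpmul2l// lee_fin ltW.
Qed.

Lemma hole_far n x z xi : lev n x \/ lev n.+1 x -> hole x z -> (kappa * rad n.+1 <= mdist z (val xi))%R.
Proof.
move=> [xn|xn] hz; have [_ /(_ z xi hz) h] := holeP xn; last exact: h.
by apply: le_trans h; rewrite ler_pM2l ?kappa_gt0//; exact: rad_le.
Qed.

(** If the dimensions were equal, the holes along a fixed piece of F would have total measure
    bounded below at every level, since balls of equal radius have comparable measures on F and on
    Z. By bounded overlap, however, the total over all levels is finite. *)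
Lemma dim_lt : (lambda <= Q)%R -> (lambda < Q)%R.
Proof.
move=> lQ; rewrite lt_neqAle lQ andbT; apply/eqP => El.
pose xi0 : subsp F0 := point.
pose A n : set V := [set x | lev n x /\ exists xi, (mdist (center x) (val xi) < rad n)%R /\ (mdist xi xi0 < 1)%R].
have [N2 N21 H2] := vball_count X HX; have N20 : (0 < N2)%R by exact: lt_le_trans N21.
have hA n x z : A n x -> hole x z -> (forall xi, (kappa * rad n.+1 <= mdist z (val xi))%R) /\ near_set 2 n z.
  move=> [xn [xi [d _]]] hz; split; first by move=> eta; apply: hole_far hz; left.
  have /(vballE _ xn) h := (holeP xn).1 _ hz; exists xi.
  have := metric_triangle z (center x) (val xi); rewrite (metric_sym z (center x)); lra.
have cnt n z : \esum_(x in [set x | A n x /\ hole x z]) 1 <= N2%:E.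
  apply: le_trans (H2 n z); apply: esum_le_subset => // x [[xn _] hz]; split => //.
  exact: (holeP xn).1.
have [N N0 HN] := near_hole_overlap (w := id) (ltr0Sn R 1) N20 hA cnt.
have mB4 : measurable (ball (val xi0) 4 : set (caratheodory_type mu)) by exact: measurable_ball_c.
have cAn n : countable (A n) by apply: sub_countable (lev_countable X HX n); apply: subset_card_le => x [].
have cA : countable [set i : nat * V | A i.1 i.2] by exact: countable_levels.
have up : \esum_(i in [set i : nat * V | A i.1 i.2]) mu (hole i.2) < +oo.
  have -> : \esum_(i in [set i : nat * V | A i.1 i.2]) mu (hole i.2) =
      \esum_(i in [set i : nat * V | A i.1 i.2]) \int[cmeasure mu]_(z in hole i.2) 1%:E.
    apply: eq_esum => i _; rewrite (_ : (fun _ => _) = cst 1%:E)// integral_cst ?mul1e//.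
    exact: measurable_hole.
  apply: (@le_lt_trans _ _ (N%:E * \int[cmeasure mu]_(z in ball (val xi0) 4) 1%:E)).
    apply: integral_overlap_le => //.
    - by move=> i _; exact: measurable_hole.
    - move=> [n x] /= [xn [xi [d d0]]] z /(holeP xn).1 /(vballE _ xn) h.
      have d1 : (mdist (val xi) (val xi0) < 1)%R := d0.
      rewrite ballEmdist/=; have := metric_triangle (val xi0) (val xi) z.
      have := metric_triangle (val xi) (center x) z.
      rewrite (metric_sym (val xi) (center x)) (metric_sym (val xi0) (val xi)).
      have := @rad_le1 R n; lra.
  rewrite (_ : (fun _ => _) = cst 1%:E)// integral_cst ?mul1e//.
  have /andP[h0 hy] := mmX.2 (val xi0) 4%R (ltr0Sn _ 3).
  have E : cmeasure mu (ball (val xi0) 4) = (fine (mu (ball (val xi0) 4)))%:E.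
    by rewrite fineK// ge0_fin_numE// ltW.
  by rewrite E -EFinM ltry.
have [c c0 Hc] := hole_measure; have [l0 _ [C C0 [HC _]]] := HY.
have nu0 : 0 < nu (ball xi0 1) by case/andP: (mmY.2 xi0 1%R ltr01).
pose c' := (C * 2 `^ lambda * c)%R.
have c'0 : (0 < c')%R by rewrite /c' !mulr_gt0 ?powR_gt0.
have low n : nu (ball xi0 1) <= c'%:E * \esum_(x in A n) mu (hole x).
  have : forall x, exists xi, A n x -> (mdist (center x) (val xi) < rad n)%R.
    move=> x; have [[xn [xi [d _]]]|nA] := pselect (A n x); first by exists xi.
    by exists xi0 => /nA.
  move=> /choice[xi hxi].
  apply: (@le_trans _ _ (\esum_(x in A n) nu (ball (xi x) (2 * rad n)))).
    have mb x : measurable (ball (xi x) (2 * rad n) : set (caratheodory_type nu)) by exact: measurable_ball_c.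
    rewrite (_ : \esum_(x in A n) _ = \esum_(x in A n) (1 * cmeasure nu (ball (xi x) (2 * rad n)))); last first.
      by apply: eq_esum => x _; rewrite mul1e.
    rewrite -(integral_overlap (cmeasure nu) (A := A n) (B := fun x => ball (xi x) (2 * rad n)) (t := fun=> 1)) //.
    have -> : nu (ball xi0 1) = \int[cmeasure nu]_(eta in ball xi0 1) 1%:E.
      by rewrite (_ : (fun _ => _) = cst 1%:E)// integral_cst ?mul1e//; exact: measurable_ball_c.
    rewrite [leLHS]integral_mkcond; apply: le_integral_nomeas => eta _; first by rewrite patchE; case: ifP.
    rewrite patchE; case: ifPn => [|_]; last exact: esum_ge0.
    rewrite inE ballEmdist/= => d1; have [x xn xB] := lev_cover_vball X n (val eta).
    have /(vballE _ xn) d2 := xB.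
    have Ax : A n x by split => //; exists eta; split => //; rewrite metric_sym.
    apply: (@esum_ge_term _ _ _ (fun=> 1%E) x) => //; split => //.
    rewrite ballEmdist/=; have h1 := hxi x Ax.
    have := metric_triangle (val (xi x)) (center x) (val eta); rewrite (metric_sym (val (xi x)) (center x)) => h2.
    have : (mdist (val (xi x)) (val eta) < 2 * rad n)%R by lra.
    by [].
  rewrite -esumZl ?(ltW c'0)//; apply: le_esum => x [xn _].
  apply: le_trans (HC (xi x) (2 * rad n)%R _) _; first by rewrite mulr_gt0 ?rad_gt0.
  rewrite powRM ?rad_ge0// rad_pow El mulrA EFinM /c' -El (EFinM (C * 2 `^ lambda)) -muleA.
  rewrite lee_wpmul2l ?lee_fin ?mulr_ge0 ?powR_ge0 ?(ltW C0)// El.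
  exact: (Hc n x xn).1.
have : \esum_(n in [set: nat]) \esum_(x in A n) mu (hole x) < +oo.
  apply: le_lt_trans up; rewrite esum_esum//.
  by apply: esum_le_subset => // -[n x] [_ /=].
move=> /(esum_to0 (b := fun n => \esum_(x in A n) mu (hole x)) (fun n => esum_ge0 (fun _ _ => outer_measure_ge0 mu _))) small.
pose d := fine (nu (ball xi0 1)).
have nuE : nu (ball xi0 1) = d%:E.
  by rewrite fineK// ge0_fin_numE//; case/andP: (mmY.2 xi0 1%R ltr01).
have d0 : (0 < d)%R by rewrite -lte_fin -nuE.
have [M /(_ M (leqnn M)) HM] := small _ (divr_gt0 (divr_gt0 d0 (ltr0Sn _ 1)) c'0).
have := low M; rewrite nuE; apply/negP; rewrite -ltNge.
apply: le_lt_trans (lee_wpmul2l _ HM) _; first by rewrite lee_fin ltW.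
rewrite -EFinM lte_fin mulrC divfK ?gt_eqF//; lra.
Qed.

End porosity.

(** The factor may be infinite, as the distance weight can be on F. *)
Lemma esum_mull_le (R : realType) (I : choiceType) (A : set I) (a : I -> \bar R) (c : \bar R) :
  (0 <= c)%E -> (forall i, 0 <= a i)%E ->
  (c * (\esum_(i in A) a i) <= \esum_(i in A) (c * a i))%E.
Proof.
case: c => [c||//] c0 a0; first by rewrite -esumZl// -lee_fin.
have [[i Ai ai]|h] := pselect (exists2 i, A i & (0 < a i)%E).
  apply: le_trans (_ : (+oo * a i <= _)%E); first by rewrite (gt0_mulye ai) leey.
  by apply: (@esum_ge_term _ _ A (fun i => (+oo * a i)%E) i Ai) => j _; rewrite mule_ge0.
rewrite esum1 ?mule0//; first by apply: esum_ge0 => j _; rewrite mule_ge0.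
move=> i Ai; apply/eqP; rewrite eq_le a0 andbT leNgt; apply/negP => ai; apply: h.
by exists i.
Qed.

(** * Weights given by the distance to F *)

Section distance_weights.
Context {R : realType} {Z : pmetricType R} (mu : {outer_measure set Z -> \bar R}).
Context (Q : R) (X : filling Z) (F : set Z) (F0 : F !=set0).
Context (nu : {outer_measure set (subsp F0) -> \bar R}) (lambda : R).
Context (Y : filling (subsp F0)).
Hypothesis HX : regular_space Q mu.
Hypothesis HY : regular_space lambda nu.
Hypothesis lQ : lambda < Q.
Local Notation V := (vertex X).
Local Notation val := (@subsp_val R Z F F0).
Local Notation near_set := (near_set F0).
Implicit Types (n k j : nat) (xi eta : subsp F0) (z : Z) (p s : R) (q : \bar R) (x : V) (c : V -> \bar R).
Local Open Scope ereal_scope.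

Let mmX : metric_measure_space mu. Proof. by case: HX. Qed.

(** The neighbourhood of F of width [20 * rad (n + j)], inside a ball of radius [8 * rad n], is
    covered by about 2^(j lambda) balls of measure about 2^(- (n + j) Q). *)
Lemma near_set_measure : exists2 C : R, (0 <= C)%R & forall n j z,
  mu (near_set 20 (n + j) `&` ball z (8 * rad n)) <=
  (C * 2 `^ (- (n%:R * Q)) * 2 `^ (- (j%:R * (Q - lambda))))%:E.
Proof.
have [C1 C10 HC1] := lev_count Y HY; have [_ _ [C2 C20 [HC2 _]]] := HX.
exists (C1 * 58 `^ lambda * (C2 * 21 `^ Q))%R; first by rewrite !mulr_ge0 ?powR_ge0// ltW.
move=> n j z; set S := _ `&` _; have rj := @rad_gt0 R (n + j).
have rnj : (rad (n + j) <= rad n :> R)%R by apply: rad_le; rewrite leq_addr.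
(* The 29 is 20 + 8 + 1, and the 21 in the radius of the covering balls is 20 + 1. Counting around a
   center of F instead of z doubles 29 to 58. *)
pose A := [set y : vertex Y | lev (n + j) y /\ (mdist (val (center y)) z < 29 * rad n)%R].
pose B (y : vertex Y) : set Z := ball (val (center y)) (21 * rad (n + j)).
have cA : countable A by apply: sub_countable (lev_countable Y HY (n + j)); apply: subset_card_le => y [].
have mB y : measurable (B y : set (caratheodory_type mu)) by exact: measurable_ball_c.
have mS : measurable (S : set (caratheodory_type mu)).
  by apply: measurable_open_c => //; apply: openI; [exact: near_set_open|exact: ball_open_metric].
apply: (@le_trans _ _ (\esum_(y in A) mu (B y))).
  rewrite (_ : \esum_(y in A) _ = \esum_(y in A) (1 * cmeasure mu (B y))); last first.
    by apply: eq_esum => y _; rewrite mul1e.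
  rewrite -(integral_overlap (cmeasure mu) (A := A) (B := B) (t := fun=> 1))//.
  have -> : mu S = \int[cmeasure mu]_(w in S) 1%:E.
    by rewrite (_ : (fun _ => _) = cst 1%:E)// integral_cst ?mul1e.
  rewrite [leLHS]integral_mkcond; apply: le_integral_nomeas => w _; first by rewrite patchE; case: ifP.
  rewrite patchE; case: ifPn => [|_]; last exact: esum_ge0.
  rewrite inE => -[[xi d1]]; rewrite ballEmdist/= => d2.
  have [y yn yB] := lev_cover_vball Y (n + j) xi.
  have d3 : (mdist (val (center y)) (val xi) < rad (n + j))%R := (vballE _ yn).1 yB.
  have h1 := metric_triangle (val (center y)) (val xi) w.
  have h2 := metric_triangle (val (center y)) w z.
  rewrite (metric_sym (val xi) w) in h1; rewrite (metric_sym w z) in h2.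
  apply: (@esum_ge_term _ _ _ (fun=> 1%E) y) => //; split; last by rewrite /B ballEmdist/=; lra.
  by split => //; lra.
apply: (@le_trans _ _ (\esum_(y in A) (C2 * (21 * rad (n + j)) `^ Q)%:E)).
  by apply: le_esum => y _; apply: HC2; rewrite mulr_gt0.
have cnt : \esum_(y in A) 1 <= (C1 * 58 `^ lambda * 2 `^ (j%:R * lambda))%:E.
  have [->|/set0P[y0 [y0n y0z]]] := eqVneq A set0.
    by rewrite esum_set0 lee_fin !mulr_ge0 ?powR_ge0// ltW.
  have h58 : (rad (n + j) <= 58 * rad n :> R)%R by have := @rad_gt0 R n; lra.
  apply: le_trans (le_trans (HC1 (n + j)%N (center y0) (58 * rad n)%R h58) _).
    apply: esum_le_subset => // y [yn yz]; split => //.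
    have h := metric_triangle (val (center y)) z (val (center y0)).
    rewrite (metric_sym z) in h.
    have : (mdist (val (center y)) (val (center y0)) < 58 * rad n)%R by lra.
    by [].
  rewrite lee_fin -mulrA ler_wpM2l ?(ltW C10)// -mulrA powRM//; last first.
    by rewrite divr_ge0 ?rad_ge0.
  rewrite ler_wpM2l ?powR_ge0//.
  have -> : (rad n / rad (n + j) = 2 `^ j%:R :> R)%R.
    by rewrite !radE -e2B; congr (2 `^ _)%R; rewrite natrD; ring.
  by rewrite -powRrM.
have x0 : 0 <= (C2 * (21 * rad (n + j)) `^ Q)%:E by rewrite lee_fin mulr_ge0 ?powR_ge0// ltW.
rewrite -[X in \esum_(_ in _) X]mule1 esumZl//.
apply: (le_trans (lee_wpmul2l x0 cnt)); rewrite -EFinM lee_fin powRM ?rad_ge0// rad_pow.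
have E : (2 `^ (- ((n + j)%:R * Q)) * 2 `^ (j%:R * lambda) = 2 `^ (- (n%:R * Q)) * 2 `^ (- (j%:R * (Q - lambda))) :> R)%R.
  by rewrite -!e2D; congr (2 `^ _)%R; rewrite natrD; ring.
rewrite le_eqVlt; apply/orP; left; apply/eqP.
rewrite -[RHS]mulrA -E; ring.
Qed.

(* Plays the role of [(2 ^ n * d(z, F)) ^ (- eps)]. *)
Definition dist_weight (eps : R) n z : \bar R :=
  \esum_(j in [set j | [set: nat] j /\ near_set 20 (n + j) z]) (2 `^ (j%:R * eps))%:E.

Lemma dist_weight_ge0 (eps : R) n z : 0 <= dist_weight eps n z.
Proof. by apply: esum_ge0 => j _; rewrite lee_fin e2_ge0. Qed.

Lemma near_setS n k z : (n <= k)%N -> near_set 20 k z -> near_set 20 n z.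
Proof.
move=> nk [xi d]; exists xi; apply: lt_le_trans d _.
by rewrite ler_pM2l//; exact: rad_le.
Qed.

Lemma measurable_dist_weight (eps : R) n :
  measurable_fun [set: caratheodory_type mu] (dist_weight eps n).
Proof.
apply: measurable_overlap => [|j _|j]; first exact: countableP.
  by apply: measurable_open_c => //; exact: near_set_open.
by rewrite lee_fin e2_ge0.
Qed.

(** The weight grows like 2^(j eps) on sets whose relative measure decays like 2^(- j (Q - lambda));
    for eps < Q - lambda the products form a convergent geometric series. *)
Lemma dist_weight_mean (eps : R) : (0 < eps)%R -> (eps < Q - lambda)%R -> exists2 C : R, (0 <= C)%R & forall n z,
  \int[cmeasure mu]_(w in ball z (8 * rad n)) dist_weight eps n w <= (C * 2 `^ (- (n%:R * Q)))%:E.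
Proof.
move=> e0 e1; have [C C0 HC] := near_set_measure.
pose b := (2 `^ (eps - (Q - lambda)))%R.
have b01 : (0 <= b < 1)%R by rewrite e2_ge0/= e2_lt1//; lra.
have b1 : (0 <= (1 - b)^-1)%R by rewrite invr_ge0; case/andP: b01; lra.
exists (C * (1 - b)^-1)%R; first by rewrite mulr_ge0.
move=> n z; pose B j := near_set 20 (n + j) `&` ball z (8 * rad n).
apply: (@le_trans _ _ (\int[cmeasure mu]_w (\esum_(j in [set j | [set: nat] j /\ B j w]) (2 `^ (j%:R * eps))%:E))).
  rewrite [leLHS]integral_mkcond; apply: le_integral_nomeas => w _.
    by rewrite patchE; case: ifP => // _; exact: dist_weight_ge0.
  rewrite patchE; case: ifPn => [|_]; last by apply: esum_ge0 => j _; rewrite lee_fin e2_ge0.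
  rewrite inE => wB; apply: esum_le_subset => [j [_ nj]|j _]; first by split.
  by rewrite lee_fin e2_ge0.
rewrite integral_overlap; last 3 first.
- exact: countableP.
- move=> j _; apply: measurable_open_c => //.
  by apply: openI; [exact: near_set_open|exact: ball_open_metric].
- by move=> j; rewrite lee_fin e2_ge0.
apply: (@le_trans _ _ (\esum_(j in [set: nat]) ((C * 2 `^ (- (n%:R * Q)))%:E * (b ^+ j)%:E))).
  apply: le_esum => j _; apply: (le_trans (lee_wpmul2l _ (HC n j z))); first by rewrite lee_fin e2_ge0.
  rewrite -!EFinM lee_fin le_eqVlt; apply/orP; left; apply/eqP.
  rewrite mulrCA; congr (_ * _)%R; rewrite -e2D -powR_mulrn ?e2_ge0// -powRrM.
  by congr (2 `^ _)%R; ring.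
rewrite esumZl ?mulr_ge0 ?e2_ge0//; last by move=> j _; rewrite lee_fin exprn_ge0// e2_ge0.
rewrite [leRHS](_ : _ = (C * 2 `^ (- (n%:R * Q)))%:E * ((1 - b)^-1)%:E); last by rewrite -EFinM mulrAC.
rewrite lee_wpmul2l ?lee_fin ?mulr_ge0 ?e2_ge0//.
exact: esum_geo.
Qed.

(** This is where q is exchanged for p. A point off F sees only levels n up to some N, and the
    weight at level n is at least 2^((N - n) eps), which pays for geometric weights centred at N in
    [esum_pow_weight]. *)
Lemma weighted_lq q p (eps : R) : 0 < q -> (0 < p)%R -> (0 < eps)%R -> exists2 C : R, (0 <= C)%R &
  forall (b : nat -> \bar R) z, (forall n, 0 <= b n) -> (forall n, ~ near_set 20 n z -> b n = 0) ->
  (lq_norm q setT b) `^ p <= C%:E * \esum_(n in [set: nat]) (b n `^ p * dist_weight eps n z).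
Proof.
move=> q0 p0 e0.
have W1 n z : near_set 20 n z -> 1 <= dist_weight eps n z.
  move=> h; have -> : 1 = (2 `^ (0%:R * eps))%:E :> \bar R by rewrite mul0r powRr0.
  apply: (@esum_ge_term _ _ _ (fun j => (2 `^ (j%:R * eps))%:E) 0%N); first by split => //; rewrite addn0.
  by move=> j _; rewrite lee_fin e2_ge0.
have T0 (b : nat -> \bar R) z n : 0 <= b n `^ p * dist_weight eps n z.
  by rewrite mule_ge0 ?poweR_ge0 ?dist_weight_ge0.
have pn : p != 0%R by rewrite gt_eqF.
case: q q0 => [r||//] q0; last first.
  exists 1%R => // b z b0 bz; rewrite mul1e.
  have S0 : 0 <= \esum_(n in [set: nat]) (b n `^ p * dist_weight eps n z) by apply: esum_ge0.
  rewrite -[leRHS](poweRKV p0)//; apply: poweR_le; rewrite ?(ltW p0) ?lq_norm_ge0//.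
  apply: lq_normy; first exact: poweR_ge0.
  move=> n _; apply: (poweR_le_inv p0); rewrite ?poweR_ge0// poweRKV//.
  apply: (@le_trans _ _ (b n `^ p * dist_weight eps n z)); last first.
    by apply: (esum_ge_term (a := fun n => b n `^ p * dist_weight eps n z)).
  have [h|h] := pselect (near_set 20 n z); first by rewrite -[leLHS]mule1 lee_wpmul2l ?poweR_ge0 ?W1.
  by rewrite bz// poweR0r// mul0e.
have r0 : (0 < r)%R by rewrite -lte_fin.
have rn : r != 0%R by rewrite gt_eqF.
have pr0 : (0 < p / r)%R by rewrite divr_gt0.
have d0 : (0 < eps * r / p)%R by rewrite divr_gt0// mulr_gt0.
have [K K0 HK] := geo_kernel_sum d0.
exists (K `^ (p / r))%R; first exact: powR_ge0.
move=> b z b0 bz.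
have [[n0 /eqP bn0]|/forallNP ball0] := pselect (exists n, b n <> 0); last first.
  have E : lq_norm r%:E setT b = 0.
    rewrite /lq_norm esum1 ?poweR0r ?invr_neq0// => n _.
    have -> : b n = 0 by apply: contrapT => /ball0.
    by rewrite poweR0r.
  by rewrite E poweR0r// mule_ge0 ?lee_fin ?powR_ge0 ?esum_ge0.
have near0 : near_set 20 n0 z by apply: contrapT => /bz; apply/eqP.
(* If z lies in all neighbourhoods of F, the weight is a divergent sum of terms at least 1, and the
   nonzero [b n0] makes the right side infinite. *)
have [all|/existsNP[M HM]] := pselect (forall M, near_set 20 M z).
  have Winf : dist_weight eps n0 z = +oo.
    apply/eqP; rewrite -leye_eq leNgt; apply/negP => fin.
    have E : dist_weight eps n0 z = \esum_(j in [set: nat]) (2 `^ (j%:R * eps))%:E.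
      by congr esum; apply/seteqP; split => // j _; split.
    rewrite E in fin; have h0 : (0 < 1 / 2 :> R)%R by rewrite divr_gt0.
    have g0 j : 0 <= (2 `^ (j%:R * eps))%:E :> \bar R by rewrite lee_fin e2_ge0.
    have [J /(_ J (leqnn J))] := esum_to0 g0 fin h0.
    rewrite lee_fin; have : (1 <= 2 `^ (J%:R * eps) :> R)%R; last by lra.
    by rewrite -[leLHS](powRr0 2) e2_le// mulr_ge0// ltW.
  have -> : \esum_(n in [set: nat]) (b n `^ p * dist_weight eps n z) = +oo.
    apply/eqP; rewrite eq_le leey/=.
    apply: le_trans (esum_ge_term (a := fun n => b n `^ p * dist_weight eps n z) (i := n0) I _); last by move=> n _; exact: T0.
    rewrite Winf gt0_muley// poweR_gt0// lt_neqAle eq_sym bn0; exact: b0.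
  by rewrite gt0_muley ?leey// lte_fin powR_gt0.
have bnd n : `[< near_set 20 n z >] -> (n <= M)%N.
  by move=> /asboolP h; rewrite leqNgt; apply/negP => Mn; apply: HM; exact: near_setS (ltnW Mn) h.
have ex : exists n, `[< near_set 20 n z >] by exists n0; exact/asboolP.
(* N is the last level at which z is near F, and j = N - n is the term of the weight that is used
   below. *)
have [N /asboolP nearN maxN] := ex_maxnP ex bnd.
rewrite /lq_norm -poweRrM (mulrC r^-1)%R.
apply: (@le_trans _ _ ((\esum_(n in [set n | near_set 20 n z]) b n `^ r) `^ (p / r))).
  apply: poweR_le; rewrite ?(ltW pr0)//; first by apply: esum_ge0 => *; exact: poweR_ge0.
  rewrite [leRHS]esum_mkcond; apply: le_esum => n _; case: ifPn => // /negP h.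
  rewrite bz ?poweR0r// => nz; apply: h; rewrite inE; exact: nz.
apply: (le_trans (esum_pow_weight (w := geo_kernel (eps * r / p) N) pr0 (ltW K0) _ _ _)).
- by move=> *; exact: poweR_ge0.
- by move=> *; exact: geo_kernel_gt0.
- apply: le_trans (HK N); apply: esum_le_subset => // n _.
  by rewrite lee_fin ltW// geo_kernel_gt0.
rewrite lee_wpmul2l ?lee_fin ?powR_ge0//.
apply: (@le_trans _ _ (\esum_(n in [set n | near_set 20 n z]) (b n `^ p * dist_weight eps n z))); last first.
  by apply: esum_le_subset => // n _; exact: T0.
apply: le_esum => n nz; have nN : (n <= N)%N by apply: maxN; exact/asboolP.
rewrite -poweRrM (mulrC r) divfK// muleC lee_wpmul2l ?poweR_ge0//.
have -> : (geo_kernel (eps * r / p) N n `^ (- (p / r)) = 2 `^ ((N - n)%:R * eps))%R.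
  rewrite geo_kernel_pow geo_kernelC geo_kernel_le// natrB//; congr (2 `^ _)%R.
  by field; rewrite rn pn.
apply: (@esum_ge_term _ _ _ (fun j => (2 `^ (j%:R * eps))%:E) (N - n)%N).
  by split => //; rewrite subnKC.
by move=> j _; rewrite lee_fin e2_ge0.
Qed.

Definition near_support c : Prop := forall n x, lev n x -> c x != 0 -> near_set 10 n (center x).

(** The 20 is 8 from [near_tail], 2 from [near_pair] and 10 from the support of the coefficients. *)
Lemma near_tail_support c n z : near_support c -> (forall x, 0 <= c x) ->
  ~ near_set 20 n z -> near_tail Q c n z = 0.
Proof.
move=> sc c0 nz; apply: esum1 => x [xn xz]; apply: esum1 => m nm.
rewrite esum1 ?mule0// => y [ym yx]; apply: contrapT => /eqP cy.
have [xi d] := sc m y ym cy; apply: nz; exists xi.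
have rm : (rad m <= rad n :> R)%R by exact: rad_le.
have := metric_triangle z (center x) (val xi); have := metric_triangle (center x) (center y) (val xi).
rewrite (metric_sym z (center x)) (metric_sym (center x) (center y)); lra.
Qed.

Lemma weighted_tail_integral p (eps : R) : (0 < p)%R -> (0 < eps)%R -> (eps < Q - lambda)%R ->
  exists2 C : R, (0 <= C)%R & forall c n, (forall x, 0 <= c x) ->
  \int[cmeasure mu]_z (near_tail Q c n z `^ p * dist_weight eps n z) <=
  (C * 2 `^ (- (n%:R * Q)))%:E * psum_lev (tail_sum Q c n) p n.
Proof.
move=> p0 e0 e1; have [C C0 HC] := dist_weight_mean e0 e1.
have h8 : (1 <= 8 :> R)%R by lra.
have [N N1 HN] := nearv_count X HX h8; have N0 : (0 <= N)%R by lra.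
exists (N `^ p * C)%R; first by rewrite mulr_ge0 ?powR_ge0.
move=> c n c0; have t0 x : 0 <= tail_sum Q c n x by exact: tail_sum_ge0.
have W0 z := dist_weight_ge0 eps n z; have mW := measurable_dist_weight eps n.
pose B x : set Z := ball (center x) (8 * rad n).
have mB x : measurable (B x : set (caratheodory_type mu)) by exact: measurable_ball_c.
have mWB x : measurable_fun [set: caratheodory_type mu] (dist_weight eps n \_ (B x)).
  by apply/(measurable_restrictT _ (mB x)); exact: measurable_funTS.
have WB0 x z : 0 <= (dist_weight eps n \_ (B x)) z by rewrite patchE; case: ifP.
pose g x z := tail_sum Q c n x `^ p * (dist_weight eps n \_ (B x)) z.
have g0 x z : 0 <= g x z by rewrite mule_ge0 ?poweR_ge0.
have mg x : measurable_fun [set: caratheodory_type mu] (g x) by exact: measurable_funeM.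
apply: (@le_trans _ _ (\int[cmeasure mu]_z ((N `^ p)%:E * \esum_(x in @lev _ _ X n) g x z))).
  apply: le_integral_nomeas => z _; first by rewrite mule_ge0 ?poweR_ge0.
  apply: (@le_trans _ _ (((N `^ p)%:E * \esum_(x in nearv 8 n z) tail_sum Q c n x `^ p) * dist_weight eps n z)).
    by rewrite lee_wpmul2r//; apply: esum_pow_count => //; exact: HN.
  rewrite -muleA lee_wpmul2l ?lee_fin ?powR_ge0//.
  have P0 : 0 <= \esum_(x in nearv 8 n z) tail_sum Q c n x `^ p by apply: esum_ge0 => *; exact: poweR_ge0.
  rewrite [leLHS]muleC; apply: (le_trans (esum_mull_le _ _ _)) => //; first by move=> *; exact: poweR_ge0.
  rewrite [leRHS](_ : _ = \esum_(x in [set x | lev n x /\ B x z]) (tail_sum Q c n x `^ p * dist_weight eps n z)).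
    apply: le_trans (esum_le_subset (A := nearv 8 n z) _ _) => [|x [xn xz]|x _].
    - by apply: le_esum => x _; rewrite muleC.
    - by split => //; rewrite /B ballEmdist.
    - by rewrite mule_ge0 ?poweR_ge0.
  rewrite [RHS](esum_mkcondr (@lev _ _ X n) (fun x => B x z)); apply: eq_esum => x _.
  rewrite /g patchE; case: ifPn => h1; case: ifPn => h2 //; rewrite ?mule0//.
  - by exfalso; move/negP: h2; apply; move: h1; rewrite !inE.
  - by exfalso; move/negP: h1; apply; move: h2; rewrite !inE.
rewrite ge0_integralZl//; last 3 first.
- by apply: measurable_esum => //; exact: (lev_countable X HX).
- by move=> z _; apply: esum_ge0.
- by rewrite lee_fin powR_ge0.
rewrite -mulrA EFinM -muleA lee_wpmul2l ?lee_fin ?powR_ge0//.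
rewrite integral_esum//; last exact: (lev_countable X HX).
rewrite -esumZl ?mulr_ge0 ?e2_ge0//; last by move=> *; exact: poweR_ge0.
apply: le_esum => x _; rewrite ge0_integralZl ?poweR_ge0//.
rewrite muleC lee_wpmul2r ?poweR_ge0//; apply: le_trans (HC n (center x)).
by rewrite [leRHS]integral_mkcond.
Qed.

(** The right side is an l^p norm whatever q is. The functional G stays abstract: it is the
    Triebel-Lizorkin functional of the extension, or the gradient of the extension with q = s =
    1. *)
Lemma tail_lq_integral q p s : 0 < q -> (0 < p)%R -> (0 < tail_exp Q p s)%R ->
  exists2 C : R, (0 <= C)%R & forall c (B : R) (G : Z -> \bar R),
  (forall x, 0 <= c x) -> near_support c -> (0 <= B)%R -> (forall z, 0 <= G z) ->
  (forall z, G z <= B%:E * lq_norm q setT (fun n => (2 `^ (n%:R * s))%:E * near_tail Q c n z)) ->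
  \int[cmeasure mu]_z (G z `^ p) <= ((B * C)%:E * lq_norm p%:E setT (level_norm Q p s c)) `^ p.
Proof.
move=> q0 p0 te; pose eps := ((Q - lambda) / 2)%R.
have e0 : (0 < eps)%R by rewrite divr_gt0// subr_gt0.
have e1 : (eps < Q - lambda)%R by rewrite /eps; move: e0; rewrite /eps; lra.
have [C1 C10 HC1] := weighted_lq q0 p0 e0.
have [C2 C20 HC2] := weighted_tail_integral p0 e0 e1.
have pe0 : 0 < p%:E by rewrite lte_fin.
have [C3 C30 HC3] := level_norm_tail X HX p0 pe0 te.
have C12 : (0 <= C1 * C2)%R by rewrite mulr_ge0.
exists ((C1 * C2) `^ p^-1 * C3)%R; first by rewrite mulr_ge0 ?powR_ge0.
move=> c B G c0 sc B0 G0 GB; have A0 n z : 0 <= near_tail Q c n z by exact: near_tail_ge0.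
have mW n := measurable_dist_weight eps n; have W0 n z := dist_weight_ge0 eps n z.
have mA n := measurable_near_tail HX n c0.
pose b n z := (2 `^ (n%:R * s))%:E * near_tail Q c n z.
have b0 n z : 0 <= b n z by rewrite mule_ge0// lee_fin e2_ge0.
pose g n z := near_tail Q c n z `^ p * dist_weight eps n z.
have g0 n z : 0 <= g n z by rewrite mule_ge0 ?poweR_ge0.
have mg n : measurable_fun [set: caratheodory_type mu] (g n).
  by apply: emeasurable_funM => //; exact: (measurableT_comp (measurable_poweR p) (mA n)).
have bgE n z : b n z `^ p * dist_weight eps n z = (2 `^ (n%:R * (s * p)))%:E * g n z.
  by rewrite /b poweRM ?lee_fin ?e2_ge0// poweR_EFin -powRrM muleA mulrA.
apply: (@le_trans _ _ (\int[cmeasure mu]_z ((B `^ p * C1)%:E * \esum_(n in [set: nat]) ((2 `^ (n%:R * (s * p)))%:E * g n z)))).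
  apply: le_integral_nomeas => z _; first exact: poweR_ge0.
  apply: (le_trans (poweR_le (ltW p0) (G0 z) (GB z))).
  rewrite poweRM ?lq_norm_ge0// poweR_EFin EFinM -muleA lee_wpmul2l ?lee_fin ?powR_ge0//.
  apply: (le_trans (HC1 (fun n => b n z) z _ _)) => // [n nz|].
    by rewrite /b near_tail_support// mule0.
  by rewrite lee_wpmul2l//; apply: le_esum => n _; rewrite bgE.
have h0 n z : 0 <= (2 `^ (n%:R * (s * p)))%:E * g n z by rewrite mule_ge0// lee_fin e2_ge0.
have mh n : measurable_fun [set: caratheodory_type mu] (fun z => (2 `^ (n%:R * (s * p)))%:E * g n z).
  exact: measurable_funeM.
rewrite ge0_integralZl//; last 3 first.
- by apply: measurable_esum => //; exact: countableP.
- by move=> z _; apply: esum_ge0.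
- by rewrite lee_fin mulr_ge0 ?powR_ge0.
rewrite integral_esum//; last exact: countableP.
have -> : ((B * ((C1 * C2) `^ p^-1 * C3))%:E * lq_norm p%:E setT (level_norm Q p s c)) `^ p =
    (B `^ p)%:E * (((C1 * C2) `^ p^-1 * C3)%:E * lq_norm p%:E setT (level_norm Q p s c)) `^ p.
  rewrite (EFinM B) -muleA; set L := _%:E * lq_norm _ _ _.
  have L0 : 0 <= L by rewrite mule_ge0 ?lq_norm_ge0// lee_fin mulr_ge0 ?powR_ge0.
  by rewrite poweRM// poweR_EFin.
rewrite EFinM -muleA lee_wpmul2l ?lee_fin ?powR_ge0//.
have -> : (((C1 * C2) `^ p^-1 * C3)%:E * lq_norm p%:E setT (level_norm Q p s c)) `^ p =
    (C1 * C2)%:E * (C3%:E * lq_norm p%:E setT (level_norm Q p s c)) `^ p.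
  rewrite EFinM -muleA; set L := C3%:E * _.
  have L0 : 0 <= L by rewrite mule_ge0// lq_norm_ge0.
  rewrite poweRM// ?lee_fin ?powR_ge0//.
  by rewrite poweR_EFin -powRrM mulVf ?gt_eqF// powRr1.
rewrite EFinM -muleA lee_wpmul2l//.
apply: (@le_trans _ _ (C2%:E * lq_norm p%:E setT (fun k => level_norm Q p s (tail_sum Q c k) k) `^ p)); last first.
  rewrite lee_wpmul2l//; apply: poweR_le; rewrite ?(ltW p0) ?lq_norm_ge0//; exact: HC3.
rewrite /lq_norm poweRKV//; last by apply: esum_ge0 => *; exact: poweR_ge0.
rewrite -esumZl//; last by move=> *; exact: poweR_ge0.
apply: le_esum => n _; rewrite ge0_integralZl ?lee_fin ?e2_ge0//.
apply: (le_trans (lee_wpmul2l _ (HC2 c n c0))); first by rewrite lee_fin e2_ge0.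
rewrite level_normK// !muleA -!EFinM lee_wpmul2r ?psum_lev_ge0// lee_fin.
by rewrite mulrCA mulrBr e2D.
Qed.

Definition triebel_lq s q (u : V -> R[i]) z : \bar R :=
  lq_norm q [set e : V * V | edge e /\ (0 <= elevel e)%R]
    (fun e => (2 `^ ((elevel e)%:~R * s) * nc (du u e) * \1_(eball e) z)%:E).

(** Edges are regrouped by level; at a point at most N edges of a level count, each bounded by the
    edge sum of that level. *)
Lemma triebel_lq_le q s : 0 < q -> exists2 C : R, (0 <= C)%R & forall u z,
  triebel_lq s q u z <= C%:E * lq_norm q setT (fun k => (2 `^ (k%:R * s))%:E * edge_sum k u z).
Proof.
move=> q0; have [N N1 HN] := eball_count X HX; have N0 : (0 < N)%R by exact: lt_le_trans N1.
have b0 (u : V -> R[i]) z k : 0 <= (2 `^ (k%:R * s))%:E * edge_sum k u z.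
  by rewrite mule_ge0 ?edge_sum_ge0// lee_fin e2_ge0.
have term (u : V -> R[i]) z e k : elev k e -> (2 `^ ((elevel e)%:~R * s) * nc (du u e) * \1_(eball e) z)%:E <=
    (2 `^ (k%:R * s))%:E * edge_sum k u z.
  move=> [ee ek]; rewrite ek indicE; case: (boolP (z \in eball e)) => [|_]; last by rewrite mulr0.
  rewrite inE mulr1 EFinM => zB; rewrite lee_wpmul2l ?lee_fin ?e2_ge0//.
  exact: edge_sum_term.
have a0 (u : V -> R[i]) z e : 0 <= (2 `^ ((elevel e)%:~R * s) * nc (du u e) * \1_(eball e) z)%:E.
  by rewrite lee_fin !mulr_ge0 ?e2_ge0 ?normc_ge0.
have lv (e : V * V) : edge e -> (0 <= elevel e)%R -> exists k, elev k e.
  by move=> ee; case E : (elevel e) => [k|//] _; exists k.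
case: q q0 => [r||//] q0; last first.
  exists 1%R => // u z; rewrite mul1e; apply: lq_normy; first exact: lq_norm_ge0.
  move=> e [ee e0]; have [k ek] := lv e ee e0; apply: (le_trans (term u z e k ek)).
  exact: (lq_norm_term (a := fun k => (2 `^ (k%:R * s))%:E * edge_sum k u z)).
have r0 : (0 < r)%R by rewrite -lte_fin.
exists (N `^ r^-1)%R; first exact: powR_ge0.
move=> u z; rewrite /triebel_lq lq_norm_fin//; last by rewrite mule_ge0 ?lq_norm_ge0// lee_fin powR_ge0.
rewrite poweRM ?lq_norm_ge0 ?lee_fin ?powR_ge0// poweR_EFin -powRrM mulVf ?gt_eqF// powRr1 ?(ltW N0)//.
rewrite /lq_norm poweRKV//; last by apply: esum_ge0 => *; exact: poweR_ge0.
set E := [set e | _]; set a := fun e : V * V => _ `^ r.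
have E1 : \esum_(e in E) a e = \esum_(k in [set: nat]) \esum_(e in [set e | E e /\ elev k e]) a e.
  rewrite -(esum_exchange (Rl := fun e k => elev k e)) => [|*]; last exact: poweR_ge0.
  apply: eq_esum => e [ee e0]; have [k ek] := lv e ee e0.
  rewrite (_ : [set j | [set: nat] j /\ elev j e] = [set k]) ?esum_set1 ?poweR_ge0//.
  apply/seteqP; split => [j [_ [_ ej]]|j ->]; last by split.
  by case: ek => _ ek; move: ej; rewrite ek => -[].
rewrite E1 -esumZl ?(ltW N0)//; last by move=> *; exact: poweR_ge0.
apply: le_esum => k _.
apply: (@le_trans _ _ (\esum_(e in [set e : V * V | elev k e /\ eball e z]) ((2 `^ (k%:R * s))%:E * edge_sum k u z) `^ r)); last first.
  by apply: esum_le_count => //; exact: poweR_ge0.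
rewrite (_ : [set e | E e /\ elev k e] = @elev _ _ X k); last first.
  apply/seteqP; split => [e []//|e ek]; split => //; split; first by case: ek.
  by case: ek => _ ->.
rewrite [leRHS](esum_mkcondr (@elev _ _ X k) (fun e => eball e z)); apply: le_esum => e ek.
case: ifPn => [_|nB]; first by apply: poweR_le; rewrite ?(ltW r0)//; exact: term.
rewrite /a indicE (_ : z \in eball e = false) ?mulr0 ?poweR0r ?gt_eqF//.
by apply/negbTE; move: nB; rewrite !notin_setE.
Qed.

(** Schur's test at a fixed point, with p = 1: the weight 2^(k s) leaves the kernel the decay 1 -
    s. *)
Lemma level_lq_le q s : 0 < q -> (0 <= s)%R -> (s < 1)%R -> exists2 C : R, (0 <= C)%R & forall c z, (forall x, 0 <= c x) ->
  lq_norm q setT (fun k => (2 `^ (k%:R * s))%:E * level_sum Q c k z) <=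
  C%:E * lq_norm q setT (fun n => (2 `^ (n%:R * s))%:E * near_tail Q c n z).
Proof.
move=> q0 s0 s1.
have d0 : (0 < 1 - s)%R by rewrite subr_gt0.
have [K K0 HK] := lq_norm_geo q0 ltr01 d0 ler01; exists K => // c z c0.
have A0 n : 0 <= near_tail Q c n z by exact: near_tail_ge0.
apply: HK => [k|k|k].
- by rewrite mule_ge0 ?level_sum_ge0// lee_fin e2_ge0.
- by rewrite mule_ge0// lee_fin e2_ge0.
rewrite poweRe1; last by rewrite mule_ge0 ?level_sum_ge0// lee_fin e2_ge0.
rewrite mul1e /level_sum -esumZl ?e2_ge0//; last first.
  by move=> n _; rewrite mule_ge0// lee_fin ltW// geo_kernel_gt0.
apply: le_esum => n _; rewrite poweRe1; last by rewrite mule_ge0// lee_fin e2_ge0.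
rewrite !muleA lee_wpmul2r// -!EFinM lee_fin /geo_kernel -!e2D; apply: e2_le.
have := ler_wpM2l s0 (ler_norm (k%:R - n%:R : R)); lra.
Qed.

End distance_weights.

(** The scalar is moved onto the measurable function S; h, which will be a power of the
    Triebel-Lizorkin functional, enters through monotonicity alone. *)
Lemma integral_le_scale d (T : measurableType d) (R : realType) (mu : {measure set T -> \bar R})
    (S h : T -> \bar R) (N : R) : 0 < N -> measurable_fun setT S -> (forall x, 0 <= S x)%E ->
  (forall x, S x <= N%:E * h x)%E -> (\int[mu]_x S x <= N%:E * \int[mu]_x h x)%E.
Proof.
move=> N0 mS S0 Sh.
have -> : (\int[mu]_x S x = N%:E * \int[mu]_x ((N^-1)%:E * S x))%E.
  rewrite ge0_integralZl// ?lee_fin ?invr_ge0 ?(ltW N0)// muleA -EFinM mulfV ?gt_eqF//.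
  by rewrite mul1e.
rewrite lee_wpmul2l ?lee_fin ?(ltW N0)//; apply: le_integral_nomeas => x _.
  by rewrite mule_ge0// lee_fin invr_ge0 ltW.
rewrite -(@lee_pmul2l _ N%:E) ?lte_fin// muleA -EFinM mulfV ?gt_eqF// mul1e.
exact: Sh.
Qed.

(** * Triebel-Lizorkin spaces *)

Section triebel_spaces.
Context {R : realType} {Z : pmetricType R} (mu : {outer_measure set Z -> \bar R}).
Context (Q : R) (X : filling Z) (F : set Z) (F0 : F !=set0).
Context (nu : {outer_measure set (subsp F0) -> \bar R}) (lambda : R).
Context (Y : filling (subsp F0)).
Hypothesis HX : regular_space Q mu.
Hypothesis HY : regular_space lambda nu.
Hypothesis lQ : lambda < Q.
Hypothesis pF : porous F.
Hypothesis Z2 : exists x y : Z, x <> y.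
Local Notation V := (vertex X).
Local Notation val := (@subsp_val R Z F F0).
Implicit Types (n k : nat) (z : Z) (p s : R) (q : \bar R) (u : V -> R[i]) (v : vertex Y -> R[i]).
Local Open Scope ereal_scope.

Let mmX : metric_measure_space mu. Proof. by case: HX. Qed.

(** Coefficients of level n.+1 see edges within [5 * rad n = 10 * rad n.+1]: the origin of the 10 in
    [near_support]. *)
Lemma ext_coef_support (K : R) v : near_support F0 (ext_coef (X := X) K v).
Proof.
move=> n x xn; apply: contra_neqP => nx.
case: n xn nx => [|n] xn nx.
- rewrite ext_coef0// (_ : [set y | _] = set0) ?esum_set0 ?mule0//.
  apply/seteqP; split => // y [_ d]; apply: nx; exists (center y).
  rewrite metric_sym; apply: lt_le_trans d _; rewrite ler_pM2r ?rad_gt0//; lra.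
- rewrite (ext_coefS K v xn) (_ : [set e | _] = set0) ?esum_set0 ?mule0//.
  apply/seteqP; split => // e [_ d]; apply: nx; exists (center e.1).
  by rewrite metric_sym; apply: lt_le_trans d _; rewrite (@radS R n); lra.
Qed.

Lemma triebel_ext s p q : (0 < p)%R -> 0 < q -> (0 < s < 1)%R -> (0 < tail_exp Q p s)%R ->
  exists2 C : R, (0 <= C)%R & forall v, ext_norm lambda (s - (Q - lambda) / p) p p%:E v < +oo ->
  triebel_norm mu X s p q (ext X v) <= C%:E * ext_norm lambda (s - (Q - lambda) / p) p p%:E v.
Proof.
move=> p0 q0 s01 te; have [s0 s1] := andP s01.
have pe0 : 0 < p%:E by rewrite lte_fin.
have [K K1 HK] := ext_synth X Y HX HY; have K0 := ltW K1.
have [C0 C00 HC0] := ext_besov X Y HX HY p0 pe0 s01 te.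
have [C1 C10 HC1] := ext_level_norm X Y HX HY s K0 p0 pe0.
have [C2 C20 HC2] := tail_lq_integral X Y HX HY lQ (s := s) q0 p0 te.
have [C3 C30 HC3] := triebel_lq_le X HX s q0.
have [C4 C40 HC4] := level_lq_le Q X q0 (ltW s0) s1.
have [C5 C50 HC5] := edge_sum_synth X HX.
pose C6 := (C3 * C5 * C4)%R; have C60 : (0 <= C6)%R by rewrite !mulr_ge0.
exists (C0 + C6 * C2 * C1)%R; first by rewrite addr_ge0 ?mulr_ge0.
move=> v fin; set E := ext_norm _ _ _ _ _ in fin *.
have E0 : 0 <= E by rewrite adde_ge0 ?poweR_ge0 ?lq_norm_ge0.
rewrite EFinD ge0_muleDl ?lee_fin ?mulr_ge0//; apply: leeD.
  by apply: le_trans (HC0 v fin); rewrite leeDl// lq_norm_ge0.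
have [c0 _ _ _] := HK v.
have lqf : lq_norm p%:E setT (level_norm Q p s (ext_coef (X := X) K v)) < +oo.
  apply: le_lt_trans (HC1 v) _; rewrite -/E.
  by move: E0 fin; case: E => [r||]// _ _; rewrite -EFinM ltry.
have ft := fine_tails_lq HX p0 pe0 te c0 lqf.
set c := ext_coef (X := X) K v in c0 lqf ft.
have T0 z : 0 <= triebel_lq s q (Pavg X mu (ext X v)) z by exact: lq_norm_ge0.
apply: (poweR_le_inv p0); [exact: Lnorm_ge0|by rewrite mule_ge0// lee_fin !mulr_ge0|].
rewrite Lp_norm_pow//.
pose h z := lq_norm q setT (fun n => (2 `^ (n%:R * s))%:E * near_tail Q c n z).
have h0 z : 0 <= h z by exact: lq_norm_ge0.
have pt z : triebel_lq s q (Pavg X mu (ext X v)) z <= C6%:E * h z.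
  apply: (le_trans (HC3 _ z)); rewrite /C6 -mulrA EFinM -muleA lee_wpmul2l//.
  rewrite EFinM -muleA; apply: (@le_trans _ _ (C5%:E * lq_norm q setT (fun k => (2 `^ (k%:R * s))%:E * level_sum Q c k z))); last first.
    by rewrite lee_wpmul2l//; exact: HC4.
  apply: lq_norm_scale => // k _.
  - by rewrite mule_ge0 ?edge_sum_ge0// lee_fin e2_ge0.
  - by rewrite mule_ge0 ?level_sum_ge0// lee_fin e2_ge0.
  - rewrite muleCA lee_wpmul2l ?lee_fin ?e2_ge0//.
    exact: (HC5 _ _ k z (HK v) ft).
apply: (le_trans (HC2 c C6 _ c0 (@ext_coef_support K v) C60 T0 pt)).
apply: poweR_le; rewrite ?(ltW p0)//.
  by rewrite mule_ge0 ?lq_norm_ge0// lee_fin mulr_ge0.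
by rewrite [in leRHS]EFinM -muleA lee_wpmul2l ?lee_fin ?mulr_ge0//; exact: HC1.
Qed.

Let hl := hole (X := X) F0 pF Z2.

(** The function w picks an endpoint of each edge. One choice suffices for Triebel-Lizorkin spaces;
    for gradients the holes of both endpoints are needed. *)
Lemma near_edge_holes (w : V * V -> V) : (forall n e, elev n e -> w e = e.1 \/ w e = e.2) ->
  exists2 N : R, (0 < N)%R & forall z,
  \esum_(i in [set i : nat * (V * V) | near_elev F0 i.1 i.2 /\ hl (w i.2) z]) 1 <= N%:E.
Proof.
move=> hw; have [N2 N21 H2] := eball_count X HX; have N20 : (0 < N2)%R by exact: lt_le_trans N21.
have hB n e z : elev n e -> hl (w e) z -> eball e z /\ forall xi, (kappa X F0 pF Z2 * rad n.+1 <= mdist z (val xi))%R.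
  move=> en hz; have [e1 e2] := elev_levels en.
  case: (hw n e en) => we; rewrite we in hz; split.
  - by left; exact: (holeP F0 pF Z2 e1).1.
  - by move=> xi; apply: (hole_far xi _ hz); left.
  - by right; case: e2 => e2; exact: (holeP F0 pF Z2 e2).1.
  - by move=> xi; apply: (hole_far xi _ hz).
(* The 9 is 4, from a point of an edge ball to [e.1], plus 5, from [e.1] to F. *)
apply: (near_hole_overlap (A := @near_elev _ _ X _ F0) (K := 9) _ N20) => //.
- move=> n e z [en [xi d]] hz; have [eB far] := hB n e z en hz; split => //.
  exists xi; have [d1 _] := elev_near en eB; have := metric_triangle z (center e.1) (val xi).
  rewrite (metric_sym z (center e.1)); lra.
- move=> n z; apply: le_trans (H2 n z); apply: esum_le_subset => // e [[en _] hz]; split => //.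
  exact: (hB n e z en hz).1.
Qed.

(** On the hole of [e.1] the functional G is at least the weighted difference along e, a single term
    of its l^q norm, so q disappears. The measure of the hole replaces 2^(- n Q), and bounded
    overlap sums the integrals. *)
Lemma triebel_trace s p q : (0 < p)%R -> 0 < q -> exists2 C : R, (0 <= C)%R & forall f : Z -> R[i],
  trace_norm Q F0 s p p%:E (Pavg X mu f) <= C%:E * triebel_norm mu X s p q f.
Proof.
move=> p0 q0; have [C1 C10 HC1] := base_pow_le X HX p0.
have [N1 N10 HN1] := near_edge_holes (w := fun e => e.1) (fun n e _ => or_introl erefl).
have [N2 N21 HN2] := eball_count X HX; have N20 : (0 < N2)%R by exact: lt_le_trans N21.
have [c c0 Hc] := hole_measure X F0 HX pF Z2.
have ip : (0 <= p^-1)%R by rewrite invr_ge0 ltW.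
pose C2 := (C1 * (1 + N2 `^ p))%R; have C20 : (0 <= C2)%R by rewrite mulr_ge0 ?addr_ge0 ?powR_ge0.
exists ((C2 * 2) `^ p^-1 + (c * N1) `^ p^-1)%R; first by rewrite addr_ge0 ?powR_ge0.
move=> f; set u := Pavg X mu f; set M := triebel_norm mu X s p q f.
pose G := triebel_lq s q u; have G0 z : 0 <= G z by exact: lq_norm_ge0.
have a0 e z : 0 <= (2 `^ ((elevel e)%:~R * s) * nc (du u e) * \1_(eball e) z)%:E.
  by rewrite lee_fin !mulr_ge0 ?e2_ge0 ?normc_ge0.
have Gterm n e z : elev n e -> eball e z -> (2 `^ (n%:R * s) * nc (du u e))%:E <= G z.
  move=> en eB; case: (en) => ee el.
  have := lq_norm_term (a := fun e => (2 `^ ((elevel e)%:~R * s) * nc (du u e) * \1_(eball e) z)%:E)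
    (A := [set e : V * V | edge e /\ (0 <= elevel e)%R]) (i := e) q0 (fun e _ => a0 e z) _.
  by rewrite indicE mem_set// mulr1 el; apply; split => //; rewrite el.
have M10 : 0 <= Lp_norm mu p%:E (cabs (T0 u)) by exact: Lnorm_ge0.
have M20 : 0 <= Lp_norm mu p%:E G by exact: Lnorm_ge0.
have ME : M = Lp_norm mu p%:E (cabs (T0 u)) + Lp_norm mu p%:E G by [].
have M0 : 0 <= M by rewrite ME adde_ge0.
have I1 : \int[cmeasure mu]_z (cabs (Tn 0 u) z `^ p) <= M `^ p.
  rewrite -Lp_norm_pow//; last by move=> z; rewrite lee_fin normc_ge0.
  by apply: poweR_le; rewrite ?(ltW p0)// ME leeDl.
have I2 : \int[cmeasure mu]_z (G z `^ p) <= M `^ p.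
  by rewrite -Lp_norm_pow//; apply: poweR_le; rewrite ?(ltW p0)// ME leeDr.
have I3 : \int[cmeasure mu]_z (edge_sum 0 u z `^ p) <= (N2 `^ p)%:E * \int[cmeasure mu]_z (G z `^ p).
  apply: integral_le_scale; first by rewrite powR_gt0.
  - by apply: (measurableT_comp (measurable_poweR p)); exact: (measurable_edge_sum HX).
  - by move=> *; exact: poweR_ge0.
  - move=> z; rewrite -poweR_EFin -poweRM ?(ltW N20)// ?lee_fin ?(ltW N20)//.
    apply: poweR_le; rewrite ?(ltW p0) ?edge_sum_ge0//.
    apply: esum_le_count => // e [e0 eB]; have := Gterm 0%N e z e0 eB.
    by rewrite mul0r powRr0 mul1r.
have Mp0 : 0 <= M `^ p by exact: poweR_ge0.
rewrite EFinD ge0_muleDl ?lee_fin ?powR_ge0//; apply: leeD.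
  have C22 : 0 <= (C2 * 2)%:E by rewrite lee_fin mulr_ge0.
  rewrite -[X in _ * X](poweRVK p0 M0) -poweR_EFin -poweRM//.
  apply: poweR_le => //; first exact: base_pow_ge0.
  apply: (le_trans (HC1 u)); rewrite /C2 -mulrA EFinM -muleA lee_wpmul2l//.
  apply: (le_trans (leeD I1 (le_trans I3 (lee_wpmul2l _ I2)))); first by rewrite lee_fin powR_ge0.
  rewrite -[X in X + _]mul1e -ge0_muleDl ?lee_fin ?powR_ge0// -EFinD lee_wpmul2r// lee_fin.
  by rewrite ler_peMr ?addr_ge0 ?powR_ge0// ler1n.
rewrite lq_norm_fin//; last by rewrite mule_ge0// lee_fin powR_ge0.
rewrite poweRM ?lee_fin ?powR_ge0// poweR_EFin -powRrM mulVf ?gt_eqF// powRr1 ?mulr_ge0 ?(ltW c0) ?(ltW N10)//.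
pose t (i : nat * (V * V)) : \bar R := (2 `^ (i.1%:R * s) * nc (du u i.2))%:E `^ p.
have t0 i : 0 <= t i by exact: poweR_ge0.
have cA : countable [set i : nat * (V * V) | near_elev F0 i.1 i.2].
  apply: (countable_levels (A := @near_elev _ _ X _ F0)) => n.
  by apply: sub_countable (elev_countable X HX n); apply: subset_card_le => e [].
apply: (@le_trans _ _ (c%:E * \esum_(i in [set i : nat * (V * V) | near_elev F0 i.1 i.2]) (t i * mu (hl i.2.1)))).
  rewrite -esumZl ?(ltW c0)//; last by move=> i _; rewrite mule_ge0.
  apply: (@le_trans _ _ (\esum_(n in [set: nat]) \esum_(e in near_elev F0 n) (c%:E * (t (n, e) * mu (hl e.1))))); last first.
    rewrite esum_esum; last by move=> n e; rewrite mule_ge0 ?mule_ge0// lee_fin ltW.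
    by apply: esum_le_subset => -[n e] => [[_ ?]//|_]; rewrite mule_ge0 ?mule_ge0// lee_fin ltW.
  apply: le_esum => n _.
  rewrite poweRM ?poweR_ge0 ?lee_fin ?e2_ge0// poweR_EFin -powRrM poweRKV//; last first.
    by rewrite mule_ge0 ?near_edge_pow_ge0// lee_fin e2_ge0.
  rewrite muleA -EFinM /near_edge_pow -esumZl ?mulr_ge0 ?e2_ge0//; last by move=> *; exact: poweR_ge0.
  apply: le_esum => e [en _]; have [e1 _] := elev_levels en.
  have h1 := (Hc n e.1 e1).1.
  have -> : t (n, e) = (2 `^ (n%:R * s * p) * nc (du u e) `^ p)%:E.
    rewrite /t poweR_EFin /=. congr EFin. rewrite powRM ?e2_ge0 ?normc_ge0// -powRrM//.
  rewrite poweR_EFin muleCA !EFinM -!muleA lee_wpmul2l ?lee_fin ?e2_ge0//.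
  rewrite muleC lee_wpmul2l ?lee_fin ?powR_ge0//.
rewrite EFinM -muleA lee_wpmul2l ?lee_fin ?(ltW c0)//.
rewrite -(integral_overlap (cmeasure mu) (B := fun i : nat * (V * V) => hl i.2.1))//; last first.
  by move=> i _; exact: (measurable_hole F0 HX pF Z2).
apply: le_trans (lee_wpmul2l _ I2); last by rewrite lee_fin ltW.
apply: integral_le_scale => //.
- by apply: measurable_overlap => // i _; exact: (measurable_hole F0 HX pF Z2).
- by move=> z; apply: esum_ge0.
move=> z; apply: esum_le_count => //; first exact: poweR_ge0.
move=> [n e] [/= [en _] hz]; have [e1 _] := elev_levels en.
apply: poweR_le; rewrite ?(ltW p0)//; first by rewrite lee_fin mulr_ge0 ?e2_ge0 ?normc_ge0.
by apply: Gterm => //; left; exact: (holeP F0 pF Z2 e1).1.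
Qed.

Lemma triebel_trace_extension s p q : (0 < lambda)%R -> (0 < s < 1)%R ->
  (Num.max (Q / (lambda + s)) ((Q - lambda) / s) < p)%R -> 0 < q ->
  trace_and_extension mu nu (triebel mu X s p q)
    (besov nu Y (s - (Q - lambda) / p) p%:E p%:E).
Proof.
move=> l0 s01 hp q0; have [s0 s1] := andP s01.
have lQ' : (0 < lambda <= Q)%R by rewrite l0 ltW.
have [p0 s'01 teF teZ] := exponents lQ' s0 (or_introl s1) hp.
have pe0 : 0 < p%:E by rewrite lte_fin.
have [C1 C10 H1] := triebel_ext p0 q0 s01 teZ.
have ext_mem v : ext_norm lambda (s - (Q - lambda) / p) p p%:E v < +oo ->
    fmem (triebel mu X s p q) (ext X v).
  move=> fin; have [L _] := ext_L1loc X HX HY p0 pe0 teZ fin; split => //.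
  apply: le_lt_trans (H1 v fin) _.
  have : 0 <= ext_norm lambda (s - (Q - lambda) / p) p p%:E v by rewrite adde_ge0 ?poweR_ge0 ?lq_norm_ge0.
  by case: (ext_norm _ _ _ _ _) fin => [r||]// _ _; rewrite -EFinM ltry.
have [T1 T2 T3] : [/\ bounded_linear_op mu nu (triebel mu X s p q) (besov nu Y (s - (Q - lambda) / p) p%:E p%:E) (Tr mu X (F0 := F0)),
      (forall f, fmem (triebel mu X s p q) f -> {ae cmeasure nu, forall xi, trace_cvg (F0 := F0) (Pavg X mu f) xi}) &
      (forall f, fmem (triebel mu X s p q) f -> continuous (f : Z -> R[i]^o) -> cae_eq nu (Tr mu X f) (f \o val))].
  apply: (@trace_operator _ _ mu Q X F F0 nu lambda Y HX HY s p p%:E p0 pe0 s'01 teF); first by move=> f [].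
  by have [C C0 HC] := triebel_trace s p0 q0; exists C => // f [_ fin].
exists (Tr mu X (F0 := F0)), (Ext X nu Y); split => //.
- apply: (extension_operator HX HY p0 pe0 teZ); exists C1 => // v fin; split; first exact: ext_mem.
  exact: H1.
- exact: (trace_extension_id HX HY p0 pe0 teF teZ ext_mem T2).
Qed.

End triebel_spaces.

(** * Hajlasz functions sampled at points of the holes *)

Section hajlasz_traces.
Context {R : realType} {Z : pmetricType R} (mu : {outer_measure set Z -> \bar R}).
Context (Q : R) (X : filling Z) (F : set Z) (F0 : F !=set0).
Context (nu : {outer_measure set (subsp F0) -> \bar R}) (lambda : R).
Context (Y : filling (subsp F0)).
Hypothesis HX : regular_space Q mu.
Hypothesis HY : regular_space lambda nu.
Hypothesis pF : porous F.
Hypothesis Z2 : exists x y : Z, x <> y.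
Variable p : R.
Hypothesis p0 : 0 < p.
Local Notation V := (vertex X).
Local Notation val := (@subsp_val R Z F F0).
Local Notation hl := (hole (X := X) F0 pF Z2).
Implicit Types (f : Z -> R[i]) (G Gt : Z -> \bar R) (a b : V -> Z) (n k : nat) (z t : Z) (x : V).
Local Open Scope ereal_scope.

Let mmX : metric_measure_space mu. Proof. by case: HX. Qed.

Definition power_integrable G : Prop :=
  [/\ measurable_fun [set: caratheodory_type mu] G, (forall z, 0 <= G z) &
      \int[cmeasure mu]_z (G z `^ p) < +oo].

(** One function majorises both the modulus and a gradient, so that a single sampled value of G
    controls base values and differences alike. *)
Definition hajlasz_bound f G : Prop :=
  (forall z, (nc (f z))%:E <= G z) /\
  (forall z t, (nc (f z - f t)%R)%:E <= (mdist z t)%:E * (G z + G t)).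

(** The sampled function G and the function Gt whose mean bounds it are kept apart: selections made
    for different majorants can then be compared under one larger Gt. *)
Definition selection G Gt a : Prop := forall n x, lev n x -> hl x (a x) /\
  G (a x) `^ p * mu (hl x) <= 2%:E * \int[cmeasure mu]_(z in hl x) (Gt z `^ p).

Lemma measurable_power G : measurable_fun [set: caratheodory_type mu] G ->
  measurable_fun [set: caratheodory_type mu] (fun z => G z `^ p).
Proof. by move=> mG; apply: (measurableT_comp (measurable_poweR p)). Qed.

Lemma power_integral_le G G' : power_integrable G -> power_integrable G' ->
  \int[cmeasure mu]_z ((G z + G' z) `^ p) <=
  (2 `^ p)%:E * (\int[cmeasure mu]_z (G z `^ p) + \int[cmeasure mu]_z (G' z `^ p)).
Proof.
move=> [mG G0 _] [mG' G0' _].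
apply: (@le_trans _ _ (\int[cmeasure mu]_z ((2 `^ p)%:E * (G z `^ p + G' z `^ p)))).
  apply: le_integral_nomeas => z _; first exact: poweR_ge0.
  exact: poweRD_le.
rewrite ge0_integralZl ?lee_fin ?powR_ge0//; last 2 first.
- by apply: emeasurable_funD; exact: measurable_power.
- by move=> z _; rewrite adde_ge0 ?poweR_ge0.
rewrite ge0_integralD//.
- by move=> z _; exact: poweR_ge0.
- exact: measurable_power.
- by move=> z _; exact: poweR_ge0.
- exact: measurable_power.
Qed.

Lemma power_integrableD G G' : power_integrable G -> power_integrable G' ->
  power_integrable (fun z => G z + G' z).
Proof.
move=> hG hG'; have [mG G0 iG] := hG; have [mG' G0' iG'] := hG'; split.
- exact: emeasurable_funD.
- by move=> z; rewrite adde_ge0.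
- apply: le_lt_trans (power_integral_le hG hG') _.
  by apply: lte_mul_pinfty; [rewrite lee_fin powR_ge0|by []|exact: lte_add_pinfty].
Qed.

Lemma hajlasz_bound_le f G G' : (forall z, 0 <= G z) -> (forall z, G z <= G' z) ->
  hajlasz_bound f G -> hajlasz_bound f G'.
Proof.
move=> G0 GG [h1 h2]; split => [z|z t]; first exact: le_trans (GG z).
apply: le_trans (h2 z t) _; rewrite lee_wpmul2l ?lee_fin ?mdist_ge0//.
exact: leeD.
Qed.

Lemma selection_le G0 G1 Gt Gt' a : (forall z, 0 <= G0 z) -> (forall z, G0 z <= G1 z) ->
  (forall z, 0 <= Gt z) -> (forall z, Gt z <= Gt' z) ->
  selection G1 Gt a -> selection G0 Gt' a.
Proof.
move=> g0 g1 t0 t1 H n x xn; have [h1 h2] := H n x xn; split => //.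
apply: (@le_trans _ _ (G1 (a x) `^ p * mu (hl x))).
  by rewrite lee_wpmul2r//; apply: poweR_le; rewrite ?(ltW p0).
apply: le_trans h2 _; rewrite lee_wpmul2l//; apply: le_integral_nomeas => z _.
  exact: poweR_ge0.
by apply: poweR_le; rewrite ?(ltW p0).
Qed.

Lemma hole_mass n x : lev n x -> 0 < mu (hl x) < +oo.
Proof.
move=> xn; have [c c0 Hc] := hole_measure X F0 HX pF Z2; have [h1 h2] := Hc n x xn.
rewrite h2 andbT lt_neqAle measure_ge0 andbT eq_sym; apply/eqP => E.
by move: h1; rewrite E mule0 lee_fin leNgt e2_gt0.
Qed.

(** Chebyshev's argument: a function cannot exceed twice its mean everywhere on a hole, which has
    positive measure. *)
Lemma selection_ex G : power_integrable G -> exists a, selection G G a.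
Proof.
move=> [mG G0 iG].
have mp := measurable_power mG.
suff H x : exists z, forall n, lev n x -> hl x z /\
    G z `^ p * mu (hl x) <= 2%:E * \int[cmeasure mu]_(w in hl x) (G w `^ p).
  by have [a Ha] := choice H; exists a => n x; exact: Ha.
have [[n xn]|nx] := pselect (exists n, lev n x); last by exists point => n xn; case: nx; exists n.
have [m0 moo] := andP (hole_mass xn).
have mh : measurable (hl x : set (caratheodory_type mu)) by exact: (measurable_hole F0 HX pF Z2).
suff [z [hz Hz]] : exists z, hl x z /\
    G z `^ p * mu (hl x) <= 2%:E * \int[cmeasure mu]_(w in hl x) (G w `^ p).
  by exists z.
apply: contrapT => /forallNP nz.
set I := \int[cmeasure mu]_(w in hl x) (G w `^ p).
have I0 : 0 <= I by apply: integral_ge0 => *; exact: poweR_ge0.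
have Ioo : I < +oo.
  apply: le_lt_trans iG; apply: ge0_subset_integral => //.
  by move=> *; exact: poweR_ge0.
have hlt z : hl x z -> 2%:E * I < G z `^ p * mu (hl x).
  by move=> hz; rewrite ltNge; apply/negP => ?; apply: (nz z).
have [r r0 Er] : exists2 r : R, (0 < r)%R & mu (hl x) = r%:E.
  by move: m0 moo; case: (mu (hl x)) => // r r0 _; exists r.
(* With mean 0 the assumption only says that G is positive on the whole hole. But its power then
   vanishes almost everywhere there, which makes the hole a null set. *)
have [I00|I0'] := eqVneq I 0.
- have mpB := @measurable_funTS _ _ _ _ (hl x : set (caratheodory_type mu)) _ mp.
  have h0 : \int[cmeasure mu]_(w in hl x) `|G w `^ p| = 0.
    by rewrite -I00; apply: eq_integral => w _; rewrite gee0_abs ?poweR_ge0.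
  have [N [mN N0 sN]] := (ae_eq_integral_abs (cmeasure mu) mh mpB).1 h0.
  have : mu (hl x) <= mu N.
    apply: le_outer_measure => z hz; apply: sN => /(_ hz) E.
    by have := hlt z hz; rewrite I00 mule0 E mul0e ltxx.
  by rewrite (_ : mu N = 0)// leNgt m0.
- have : (2 / r)%:E * I * mu (hl x) <= I.
    rewrite -(fineK (x := (2 / r)%:E * I)); last first.
      by rewrite fin_numM// ge0_fin_numE.
    rewrite -(int_cst_set mh (fine _)); apply: le_integral_nomeas => z hz.
      by rewrite lee_fin fine_ge0// mule_ge0// lee_fin divr_ge0 ?(ltW r0).
    rewrite fineK; last by rewrite fin_numM// ge0_fin_numE.
    rewrite -(@lee_pmul2r _ r%:E) ?lte_fin//.
    have := hlt z hz; rewrite Er => /ltW; apply: le_trans.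
    by rewrite muleAC -EFinM divfK ?gt_eqF.
  rewrite Er muleAC -EFinM divfK ?gt_eqF//.
  move: I0 Ioo I0'; case: (I) => // i i0 _ in0; rewrite -EFinM lee_fin => h.
  move: i0; rewrite lee_fin le_eqVlt => /orP[/eqP E|i0]; first by rewrite -E eqxx in in0.
  by move: h; rewrite mulr_natl mulr2n gerDl leNgt i0.
Qed.

Lemma selection_mass : exists2 C : R, (0 <= C)%R & forall G Gt a n x,
  (forall z, 0 <= G z) -> selection G Gt a -> lev n x \/ lev n.+1 x ->
  (2 `^ (- (n%:R * Q)))%:E * G (a x) `^ p <= C%:E * \int[cmeasure mu]_(z in hl x) (Gt z `^ p).
Proof.
have [Q0 _ _] := HX; have [c c0 Hc] := hole_measure X F0 HX pF Z2.
exists (2 `^ Q * (c * 2))%R; first by rewrite !mulr_ge0 ?e2_ge0 ?(ltW c0).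
move=> G Gt a n x G0 sa xn; have [k xk kn] : exists2 k, lev k x & (k%:R <= n%:R + 1 :> R)%R.
  by case: xn => xn; [exists n|exists n.+1] => //; rewrite -?natr1 ?lerDl.
have [h1 _] := Hc k x xk; have [_ h2] := sa k x xk.
apply: (@le_trans _ _ ((2 `^ Q * 2 `^ (- (k%:R * Q)))%:E * G (a x) `^ p)).
  rewrite lee_wpmul2r ?poweR_ge0// lee_fin -e2D e2_le//.
  have := ler_wpM2r (ltW Q0) kn; rewrite mulrDl mul1r; lra.
rewrite EFinM -muleA [in leRHS]EFinM -[in leRHS]muleA lee_wpmul2l ?lee_fin ?e2_ge0//.
apply: (@le_trans _ _ (c%:E * mu (hl x) * G (a x) `^ p)).
  by rewrite lee_wpmul2r ?poweR_ge0.
by rewrite EFinM -!muleA lee_wpmul2l ?lee_fin ?(ltW c0)// muleC.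
Qed.

Lemma selection_vball G Gt a n x : selection G Gt a -> lev n x -> vball x (a x).
Proof. by move=> sa xn; apply: (holeP F0 pF Z2 xn).1; exact: (sa n x xn).1. Qed.

Lemma selection_edge G Gt a n (e : V * V) f : selection G Gt a -> (forall z, 0 <= G z) ->
  hajlasz_bound f G -> elev n e ->
  (2 ^+ n * nc (du (f \o a) e))%:E <= 4%:E * (G (a e.1) + G (a e.2)).
Proof.
move=> sa G0 [_ fG] en; have [e1 e2] := elev_levels en.
have B1 := selection_vball sa e1.
have B2 : vball e.2 (a e.2) by case: e2 => e2; exact: (selection_vball sa e2).
have d : (mdist (a e.2) (a e.1) <= 4 * rad n)%R.
  case: (en) => /edge_adjacent[_ _ ne] _.
  by rewrite ltW//; apply: (vball_diam e1 e2 ne); [right|left].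
rewrite EFinM; apply: (@le_trans _ _ ((2 ^+ n)%:E * ((4 * rad n)%:E * (G (a e.1) + G (a e.2))))).
  rewrite lee_wpmul2l ?lee_fin ?exprn_ge0//; apply: le_trans (fG _ _) _.
  by rewrite (addeC (G (a e.2))) lee_wpmul2r ?adde_ge0.
rewrite muleA -EFinM (_ : (2 ^+ n * (4 * rad n) = 4)%R)// /rad.
by rewrite mulrC -mulrA mulVf ?mulr1// expf_neq0.
Qed.

(** The difference along an edge of level n is at most 4 * 2^(- n) times the sum of G at two sampled
    points, and each value is bounded through an integral over its hole. The holes of starting
    points and those of endpoints form two families of bounded overlap. *)
Lemma selection_trace : exists2 C : R, (0 <= C)%R & forall f G Gt a,
  (forall z, 0 <= G z) -> hajlasz_bound f G -> power_integrable Gt -> selection G Gt a ->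
  trace_norm Q F0 1 p p%:E (f \o a) <= C%:E * (\int[cmeasure mu]_z (Gt z `^ p)) `^ p^-1.
Proof.
have [C1 C10 HC1] := selection_mass.
have [N1 N10 HN1] := near_edge_holes F0 HX pF Z2 (w := fun e : V * V => e.1) (fun n e _ => or_introl erefl).
have [N2 N20 HN2] := near_edge_holes F0 HX pF Z2 (w := fun e : V * V => e.2) (fun n e _ => or_intror erefl).
have [N3 N31 HN3] := vball_count X HX; have N30 : (0 < N3)%R by exact: lt_le_trans N31.
pose C2 := ((2 `^ p * 4 `^ p) * C1)%R; have C20 : (0 <= C2)%R by rewrite !mulr_ge0 ?powR_ge0.
exists ((C1 * N3) `^ p^-1 + (C2 * (N1 + N2)) `^ p^-1)%R; first by rewrite addr_ge0 ?powR_ge0.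
move=> f G Gt a G0 fG [mGt Gt0 iGt] sa; set J := \int[cmeasure mu]_z _; set u := f \o a.
have ip : (0 <= p^-1)%R by rewrite invr_ge0 ltW.
have mp := measurable_power mGt.
have J0 : 0 <= J by apply: integral_ge0 => *; exact: poweR_ge0.
pose W x := \int[cmeasure mu]_(z in hl x) (Gt z `^ p).
have W0 x : 0 <= W x by apply: integral_ge0 => *; exact: poweR_ge0.
have mh x : measurable (hl x : set (caratheodory_type mu)) by exact: (measurable_hole F0 HX pF Z2).
rewrite EFinD ge0_muleDl ?lee_fin ?powR_ge0//; apply: leeD.
  rewrite -poweR_EFin -poweRM ?lee_fin ?mulr_ge0 ?(ltW N30)//.
  apply: poweR_le => //; first exact: base_pow_ge0.
  apply: (@le_trans _ _ (\esum_(x in @lev _ _ X 0) (C1%:E * W x))).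
    apply: le_esum => x x0; apply: le_trans (HC1 G Gt a 0%N x G0 sa (or_introl x0)).
    rewrite mul0r oppr0 powRr0 mul1e; apply: poweR_le; rewrite ?(ltW p0)//; first by rewrite lee_fin normc_ge0.
    exact: fG.1.
  rewrite esumZl// EFinM -muleA lee_wpmul2l//.
  apply: (integral_overlap_le (cmeasure mu) (B := hl)) => //; first exact: (lev_countable X HX).
  - by move=> z; exact: poweR_ge0.
  - move=> z; apply: le_trans (HN3 0%N z); apply: esum_le_subset => // x [x0 hz]; split => //.
    exact: (holeP F0 pF Z2 x0).1.
rewrite lq_norm_fin//; last by rewrite mule_ge0 ?poweR_ge0// lee_fin powR_ge0.
rewrite poweRM ?lee_fin ?powR_ge0 ?poweR_ge0// poweR_EFin -powRrM mulVf ?gt_eqF// powRr1 ?mulr_ge0 ?addr_ge0 ?(ltW N10) ?(ltW N20)//.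
rewrite poweRKV//.
pose A := [set i : nat * (V * V) | near_elev F0 i.1 i.2].
have cA : countable A.
  apply: (countable_levels (A := @near_elev _ _ X _ F0)) => n.
  by apply: sub_countable (elev_countable X HX n); apply: subset_card_le => e [].
have C2W (e : V * V) : 0 <= C2%:E * (W e.1 + W e.2).
  by apply: mule_ge0; [rewrite lee_fin|exact: adde_ge0].
apply: (@le_trans _ _ (\esum_(i in A) (C2%:E * (W i.2.1 + W i.2.2)))).
  apply: (@le_trans _ _ (\esum_(n in [set: nat]) \esum_(e in near_elev F0 n) (C2%:E * (W e.1 + W e.2)))); last first.
    rewrite esum_esum; last by move=> n e _ _; exact: C2W.
    by apply: esum_le_subset => -[n e] => [[_ ?]//|_]; exact: C2W.
  apply: le_esum => n _.
  rewrite poweRM ?poweR_ge0 ?lee_fin ?e2_ge0// poweR_EFin -powRrM poweRKV//; last first.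
    by rewrite mule_ge0 ?near_edge_pow_ge0// lee_fin e2_ge0.
  rewrite muleA -EFinM /near_edge_pow -esumZl ?mulr_ge0 ?e2_ge0//; last by move=> *; exact: poweR_ge0.
  apply: le_esum => e [en _]; have [e1 e2] := elev_levels en.
  have h1 := HC1 G Gt a n e.1 G0 sa (or_introl e1).
  have h2 := HC1 G Gt a n e.2 G0 sa e2.
  have h3 : (2 ^+ n * nc (du u e))%:E `^ p <= (2 `^ p * 4 `^ p)%:E * (G (a e.1) `^ p + G (a e.2) `^ p).
    apply: (@le_trans _ _ ((4%:E * (G (a e.1) + G (a e.2))) `^ p)).
      apply: poweR_le; rewrite ?(ltW p0)//; first by rewrite lee_fin mulr_ge0 ?exprn_ge0 ?normc_ge0.
      exact: (selection_edge sa).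
    rewrite poweRM ?adde_ge0// poweR_EFin mulrC EFinM -muleA lee_wpmul2l ?lee_fin ?powR_ge0//.
    exact: poweRD_le.
  have -> : (2 `^ (n%:R * 1 * p) * 2 `^ (- (n%:R * Q)))%:E * (nc (du u e))%:E `^ p =
     (2 `^ (- (n%:R * Q)))%:E * (2 ^+ n * nc (du u e))%:E `^ p.
    rewrite !poweR_EFin powRM ?exprn_ge0 ?normc_ge0// -e2_nat -powRrM mulr1 -!EFinM.
    by congr EFin; ring.
  apply: (le_trans (lee_wpmul2l _ h3)); first by rewrite lee_fin e2_ge0.
  rewrite muleCA /C2 [in leRHS]EFinM -[in leRHS]muleA lee_wpmul2l ?lee_fin ?mulr_ge0 ?powR_ge0//.
  by rewrite (ge0_muleDr _ (poweR_ge0 _ _) (poweR_ge0 _ _)) (ge0_muleDr _ (W0 _) (W0 _)) leeD.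
rewrite esumZl//; last by move=> *; rewrite adde_ge0.
rewrite (EFinM C2) -muleA lee_wpmul2l// EFinD ge0_muleDl ?lee_fin ?(ltW N10) ?(ltW N20)//.
rewrite esumD//; apply: leeD.
- apply: (integral_overlap_le (cmeasure mu) (B := fun i : nat * (V * V) => hl i.2.1)) => //.
  by move=> z; exact: poweR_ge0.
- apply: (integral_overlap_le (cmeasure mu) (B := fun i : nat * (V * V) => hl i.2.2)) => //.
  by move=> z; exact: poweR_ge0.
Qed.

Lemma selection_cont f G Gt a z : selection G Gt a -> continuous (f : Z -> R[i]^o) ->
  forall e : R, (0 < e)%R -> exists N, forall n, (N <= n)%N -> (nc (Tn n (f \o a) z - f z) <= e)%R.
Proof.
move=> sa cf e e0.
have e0c : (0 < e%:C%C :> R[i])%R by rewrite ltcR.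
have := cf z => /cvgrPdist_le /(_ _ e0c) /nbhs_ballP[d /= d0 hd].
have [N HN] := rad_small (divr_gt0 d0 (ltr0Sn _ 1)).
exists N => n Nn; apply: (Tn_osc HX) => x xn xB; rewrite /= normcBC -lecR; apply: hd.
have aB := selection_vball sa xn; rewrite ballEmdist/=; have := metric_triangle z (center x) (a x).
rewrite (metric_sym z (center x)).
have := (vballE _ xn).1 xB; have := (vballE _ xn).1 aB; have := @rad_le R _ _ Nn; lra.
Qed.

Lemma Tn_eq n (u u' : V -> R[i]) z : (forall x, lev n x -> u x = u' x) -> Tn n u z = Tn n u' z.
Proof. by move=> E; apply: eq_fsbigr => x; rewrite inE => /E ->. Qed.

Lemma trace_eq (u u' : V -> R[i]) (xi : subsp F0) : (forall n x, lev n x -> u x = u' x) ->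
  trace u xi = trace u' xi.
Proof.
move=> E; rewrite /trace; congr (clim _ xi); apply/funext => n; apply/funext => eta.
by rewrite !csum_trace; apply: Tn_eq => x; exact: E.
Qed.

Definition mix a b x : Z := if odd (absz (level x)) then a x else b x.

Lemma mix_trace (u u' u'' : V -> R[i]) (xi : subsp F0) :
  (forall n x, lev n x -> u'' x = if odd n then u x else u' x) ->
  trace_cvg u xi -> trace_cvg u' xi -> trace_cvg u'' xi -> trace u xi = trace u' xi.
Proof.
move=> E c1 c2 c3.
have close (w : R[i]) (t : R[i]) : (forall e : R, (0 < e)%R -> (nc (w - t) <= e)%R) -> w = t.
  move=> h; apply/eqP; rewrite -subr_eq0; apply/eqP/Normc.eq0_normc; apply/eqP.
  rewrite eq_le normc_ge0 andbT; apply/ler_addgt0Pr => e e0; rewrite add0r; exact: h.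
have E1 n : odd n -> Tn n u'' (val xi) = Tn n u (val xi).
  by move=> on; apply: Tn_eq => x xn; rewrite (E n)// on.
have E2 n : ~~ odd n -> Tn n u'' (val xi) = Tn n u' (val xi).
  by move=> on; apply: Tn_eq => x xn; rewrite (E n)// (negbTE on).
have h (w : V -> R[i]) (j : nat -> nat) : trace_cvg w xi -> (forall n, (n <= j n)%N) ->
    (forall n, Tn (j n) u'' (val xi) = Tn (j n) w (val xi)) -> trace u'' xi = trace w xi.
  move=> cw jn Ej; apply: close => e e0; have e20 : (0 < e / 2)%R by rewrite divr_gt0.
  have [N1 H1] := c3 _ e20; have [N2 H2] := cw _ e20; pose n := maxn N1 N2.
  have := H1 (j n) (leq_trans (leq_maxl _ _) (jn n)).
  have := H2 (j n) (leq_trans (leq_maxr _ _) (jn n)).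
  rewrite Ej => k1 k2.
  apply: le_trans (normc_tri _ (Tn (j n) w (val xi)) _) _.
  by rewrite (splitr e) lerD// normcBC.
rewrite -(h u (fun n => n.*2.+1) c1) ?(h u' (fun n => n.*2) c2)//.
- by move=> n; rewrite -addnn leq_addr.
- by move=> n; apply: E2; rewrite odd_double.
- by move=> n; rewrite -addnn; apply: leqW; rewrite leq_addr.
- by move=> n; apply: E1; rewrite /= odd_double.
Qed.

End hajlasz_traces.

(** * A gradient for synthesised functions *)

Section synthesis_gradient.
Context {R : realType} {Z : pmetricType R} (mu : {outer_measure set Z -> \bar R}).
Context (Q : R) (X : filling Z).
Hypothesis HX : regular_space Q mu.
Local Notation V := (vertex X).
Implicit Types (n k : nat) (z t : Z) (p s : R) (c : V -> \bar R).
Local Open Scope ereal_scope.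

Definition synth_grad c z : \bar R := \esum_(n in [set: nat]) ((2 ^+ n)%:E * bsum c n z).

Lemma synth_grad_term_ge0 c n z : (forall x, 0 <= c x) -> 0 <= (2 ^+ n)%:E * bsum c n z.
Proof. by move=> c0; rewrite mule_ge0 ?bsum_ge0// lee_fin exprn_ge0. Qed.

Lemma synth_grad_ge0 c z : (forall x, 0 <= c x) -> 0 <= synth_grad c z.
Proof. by move=> c0; apply: esum_ge0 => n _; exact: synth_grad_term_ge0. Qed.

Lemma measurable_synth_grad c : (forall x, 0 <= c x) ->
  measurable_fun [set: caratheodory_type mu] (synth_grad c).
Proof.
move=> c0; apply: measurable_esum => [|n z|n _]; first exact: countableP.
  exact: synth_grad_term_ge0.
by apply: measurable_funeM; exact: (measurable_bsum HX).
Qed.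

Lemma total_le_grad c z : (forall x, 0 <= c x) -> total_bsum c z <= synth_grad c z.
Proof.
move=> c0; apply: le_esum => n _; rewrite -[leLHS]mul1e lee_wpmul2r ?bsum_ge0//.
by rewrite lee_fin exprn_ege1// ler1n.
Qed.

Lemma synth_grad_tail c z k : (forall x, 0 <= c x) ->
  \esum_(n in [set n | (k < n)%N]) bsum c n z <= (rad k)%:E * synth_grad c z.
Proof.
move=> c0; rewrite -esumZl ?rad_ge0//; last by move=> n _; exact: synth_grad_term_ge0.
apply: (@le_trans _ _ (\esum_(n in [set n | (k < n)%N]) ((rad k)%:E * ((2 ^+ n)%:E * bsum c n z)))).
  apply: le_esum => n /= kn; rewrite muleA -EFinM -[leLHS]mul1e lee_wpmul2r ?bsum_ge0// lee_fin.
  by rewrite /rad mulrC ler_pdivlMr ?exprn_gt0// mul1r ler_weXn2l ?ler1n// ltnW.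
by apply: esum_le_subset => // n _; rewrite mule_ge0 ?synth_grad_term_ge0// lee_fin rad_ge0.
Qed.

Lemma csum_grad c f n z t : synth_data mu c f ->
  (nc (csum f n z - csum f n t)%R)%:E <= (mdist z t)%:E * (synth_grad c z + synth_grad c t).
Proof.
move=> [c0 _ _ h].
have t0 i y := @synth_grad_term_ge0 c i y c0.
rewrite -esumD; [|by move=> i _; exact: t0|by move=> i _; exact: t0].
rewrite -esumZl ?mdist_ge0//; last by move=> *; rewrite adde_ge0.
rewrite -nneseries_esumT; last by move=> i; rewrite mule_ge0 ?adde_ge0// lee_fin mdist_ge0.
apply: le_trans (nneseries_lim_ge n.+1 _); last by move=> i _ _; rewrite mule_ge0 ?adde_ge0// lee_fin mdist_ge0.
rewrite big_mkord /csum -sumrB.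
apply: (@le_trans _ _ (\sum_(i < n.+1) (nc (f i z - f i t)%R)%:E)).
  by rewrite sumEFin lee_fin normc_sum.
apply: lee_sum => i _; apply: le_trans (h i z t) _.
rewrite mulrC EFinM -muleA lee_wpmul2l ?lee_fin ?mdist_ge0//.
by rewrite ge0_muleDr ?bsum_ge0.
Qed.

Lemma csum_tail_grad c f n z : synth_data mu c f -> synth_grad c z < +oo ->
  (nc (clim (csum f) z - csum f n z)%R)%:E <= (rad n)%:E * synth_grad c z.
Proof.
move=> sd fin; have [c0 _ _ _] := sd.
apply: le_trans (synth_grad_tail z n c0).
by apply: (synth_cvg sd); exact: le_lt_trans (total_le_grad z c0) fin.
Qed.

(** The inequality must hold for every pair of points. Where the gradient is infinite it is trivial;
    elsewhere the partial sums obey it and approach the limit with error at most [rad n] times the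
    gradient. *)
Lemma synth_hajlasz c f : synth_data mu c f -> hajlasz_bound (clim (csum f)) (synth_grad c).
Proof.
move=> sd; have [c0 _ _ _] := sd; split => [z|z t].
  have [fin|] := ltP (synth_grad c z) +oo; last by rewrite leye_eq => /eqP ->; rewrite leey.
  apply: le_trans (total_le_grad z c0); apply: (synth_le_total sd).
  exact: le_lt_trans (total_le_grad z c0) fin.
have [->|zt] := eqVneq z t; first by rewrite subrr normc0 mule_ge0 ?adde_ge0 ?synth_grad_ge0// lee_fin mdist_ge0.
have d0 : (0 < mdist z t)%R.
  by rewrite lt_neqAle mdist_ge0 andbT eq_sym; apply: contra_neqN zt => /eqP/mdist_positivity.
have gz := synth_grad_ge0 z c0; have gt := synth_grad_ge0 t c0.
have [fz|] := ltP (synth_grad c z) +oo; last first.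
  by rewrite leye_eq => /eqP ->; rewrite addye ?gt0_muley ?lte_fin ?leey// gt_eqF// (lt_le_trans _ gt).
have [ft|] := ltP (synth_grad c t) +oo; last first.
  by rewrite leye_eq => /eqP ->; rewrite addey ?gt0_muley ?lte_fin ?leey// gt_eqF// (lt_le_trans _ gz).
have H n : (nc (clim (csum f) z - clim (csum f) t)%R)%:E <=
    (mdist z t + rad n)%:E * (synth_grad c z + synth_grad c t).
  apply: (@le_trans _ _ ((nc (clim (csum f) z - csum f n z)%R)%:E + (nc (csum f n z - csum f n t)%R)%:E
     + (nc (clim (csum f) t - csum f n t)%R)%:E)).
    rewrite -!EFinD lee_fin; have := normc_tri (clim (csum f) z) (csum f n z) (clim (csum f) t).
    have := normc_tri (csum f n z) (csum f n t) (clim (csum f) t).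
    rewrite (normcBC (csum f n t)); lra.
  rewrite EFinD ge0_muleDl ?lee_fin ?mdist_ge0 ?rad_ge0// addeAC addeC.
  apply: leeD; first exact: csum_grad.
  rewrite ge0_muleDr//; apply: leeD; exact: csum_tail_grad.
have [r Er] : exists r : R, synth_grad c z + synth_grad c t = r%:E.
  by move: gz gt fz ft; case: (synth_grad c z) => [a||]//; case: (synth_grad c t) => [b||]// *; exists (a + b)%R.
have r0 : (0 <= r)%R by rewrite -lee_fin -Er adde_ge0.
rewrite Er in H *; rewrite -EFinM lee_fin; apply/ler_addgt0Pr => e e0.
have [N HN] := rad_small (divr_gt0 e0 (ltr_pwDr ltr01 r0)).
have := H N; rewrite -EFinM lee_fin => /le_trans; apply.
rewrite mulrDl lerD2l; apply: (@le_trans _ _ (e / (r + 1) * r)%R).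
  by rewrite ler_wpM2r// ltW.
by rewrite mulrAC ler_pdivrMr ?ltr_pwDr// ler_wpM2l ?(ltW e0)// lerDl.
Qed.

(** Puts the gradient in the form required by [tail_lq_integral] with q = 1 and s = 1, bypassing
    [level_sum] and its condition s < 1. *)
Lemma synth_grad_lq c z : (forall x, 0 <= c x) ->
  synth_grad c z <= 1%:E * lq_norm 1%:E setT (fun n => (2 `^ (n%:R * 1))%:E * near_tail Q c n z).
Proof.
move=> c0; rewrite mul1e /lq_norm invr1.
have E n : ((2 `^ (n%:R * 1))%:E * near_tail Q c n z) `^ 1 = (2 ^+ n)%:E * near_tail Q c n z.
  by rewrite mulr1 e2_nat poweRe1// mule_ge0 ?near_tail_ge0// lee_fin exprn_ge0.
rewrite poweRe1; last by apply: esum_ge0 => n _; exact: poweR_ge0.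
apply: le_esum => n _; rewrite E lee_wpmul2l ?lee_fin ?exprn_ge0//.
by apply: (bsum_le_near_tail Q c0); rewrite mdistxx mulr_ge0 ?rad_ge0.
Qed.

End synthesis_gradient.

(** * The trace of Hajlasz functions, independent of the samples *)

Section hajlasz_spaces.
Context {R : realType} {Z : pmetricType R} (mu : {outer_measure set Z -> \bar R}).
Context (Q : R) (X : filling Z) (F : set Z) (F0 : F !=set0).
Context (nu : {outer_measure set (subsp F0) -> \bar R}) (lambda : R).
Context (Y : filling (subsp F0)).
Hypothesis HX : regular_space Q mu.
Hypothesis HY : regular_space lambda nu.
Hypothesis lQ : lambda < Q.
Hypothesis pF : porous F.
Hypothesis Z2 : exists x y : Z, x <> y.
Variable p : R.
Hypothesis p0 : 0 < p.
Let s' := 1 - (Q - lambda) / p.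
Hypothesis s'01 : 0 < s' < 1.
Hypothesis teF : 0 < tail_exp lambda p s'.
Hypothesis teZ : 0 < tail_exp Q p 1.
Local Notation V := (vertex X).
Local Notation val := (@subsp_val R Z F F0).
Local Notation hl := (hole (X := X) F0 pF Z2).
Implicit Types (f : Z -> R[i]) (g G Gt : Z -> \bar R) (a b : V -> Z) (n k : nat) (z t : Z) (x : V)
  (v : vertex Y -> R[i]) (xi : subsp F0).
Local Open Scope ereal_scope.

Let mmX : metric_measure_space mu. Proof. by case: HX. Qed.
Let mmY : metric_measure_space nu. Proof. by case: HY. Qed.
Let pe0 : 0 < p%:E. Proof. by rewrite lte_fin. Qed.

Local Notation pnorm G := ((\int[cmeasure mu]_z (G z `^ p)) `^ p^-1).
Local Notation sel G Gt a := (selection (X := X) mu F0 pF Z2 p G Gt a).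

Lemma Lp_normE G : (forall z, 0 <= G z) -> Lp_norm mu p%:E G = pnorm G.
Proof. by move=> G0; rewrite -(Lp_norm_pow mu p0 G0) poweRVK// Lnorm_ge0. Qed.

Lemma pnorm_lty G : power_integrable mu p G -> pnorm G < +oo.
Proof. by move=> [_ _ fin]; rewrite poweR_lty. Qed.

Lemma hajlasz_ext : exists2 C : R, (0 <= C)%R & forall v, ext_norm lambda s' p p%:E v < +oo ->
  exists c : V -> \bar R, [/\ synth_data mu c (ext_seq X v), power_integrable mu p (synth_grad c),
    lq_norm p%:E setT (level_norm Q p 1 c) < +oo &
    pnorm (synth_grad c) <= C%:E * ext_norm lambda s' p p%:E v].
Proof.
have [K K1 HK] := ext_synth X Y HX HY; have K0 := ltW K1.
have [C1 C10 HC1] := ext_level_norm X Y HX HY 1%R K0 p0 pe0.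
have [C2 C20 HC2] := tail_lq_integral X Y HX HY lQ (s := 1%R) (q := 1%:E) lte01 p0 teZ.
exists (C2 * C1)%R; first by rewrite mulr_ge0.
move=> v fin; set E := ext_norm _ _ _ _ _ in fin *.
have E0 : 0 <= E by rewrite adde_ge0 ?poweR_ge0 ?lq_norm_ge0.
have sd := HK v; have [c0 _ _ _] := sd; set c := ext_coef K v in sd c0.
have g0 z := @synth_grad_ge0 _ _ X c z c0.
have H := HC2 c 1%R _ c0 (@ext_coef_support _ _ X F F0 Y K v) ler01 g0 (fun z => synth_grad_lq Q z c0).
rewrite mul1r in H.
have H' : \int[cmeasure mu]_z (synth_grad c z `^ p) <= ((C2 * C1)%:E * E) `^ p.
  apply: (le_trans H); apply: poweR_le; rewrite ?(ltW p0)//.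
    by rewrite mule_ge0 ?lq_norm_ge0.
  by rewrite EFinM -muleA lee_wpmul2l//; exact: HC1.
have CE : 0 <= (C2 * C1)%:E * E by rewrite mule_ge0// lee_fin mulr_ge0.
exists c; split => //.
- split => //; first exact: (measurable_synth_grad HX).
  apply: le_lt_trans H' _; rewrite poweR_lty//.
  by move: E0 fin; case: (E) => [r||]// _ _; rewrite -EFinM ltry.
- apply: le_lt_trans (HC1 v) _.
  by rewrite -/E; move: E0 fin; case: (E) => [r||]// _ _; rewrite -EFinM ltry.
- rewrite -[leRHS](poweRVK p0 CE); apply: poweR_le => //; first by rewrite invr_ge0 ltW.
  by apply: integral_ge0 => *; exact: poweR_ge0.
Qed.

Lemma hajlasz_member f G : cmeasurable mu f -> hajlasz_bound f G -> power_integrable mu p G ->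
  fmem (hajlasz mu p) f /\ fnorm (hajlasz mu p) f <= 2%:E * pnorm G.
Proof.
move=> mf [h1 h2] iG; have [mG G0 _] := iG; have fin := pnorm_lty iG.
have hg : hajlasz_gradient mu p f G by split; rewrite ?Lp_normE.
have hf : Lp_norm mu p%:E (cabs f) <= pnorm G.
  rewrite Lp_normE; last by move=> z; rewrite lee_fin normc_ge0.
  apply: poweR_le; first by rewrite invr_ge0 ltW.
    by apply: integral_ge0 => *; exact: poweR_ge0.
  apply: le_integral_nomeas => z _; first exact: poweR_ge0.
  by apply: poweR_le; [exact: ltW|rewrite lee_fin normc_ge0|exact: h1].
split; first by split => //; [exact: le_lt_trans hf fin|exists G].
rewrite (_ : 2%:E = 1 + 1)// ge0_muleDl// mul1e; apply: leeD => //.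
by apply: ereal_inf_lbound; exists G => //; rewrite Lp_normE.
Qed.

Lemma hajlasz_majorant f g : cmeasurable mu f -> Lp_norm mu p%:E (cabs f) < +oo ->
  hajlasz_gradient mu p f g ->
  let G := fun z => cabs f z + g z in [/\ hajlasz_bound f G, power_integrable mu p G &
    pnorm G <= (2 * 2 `^ p^-1)%:E * (Lp_norm mu p%:E (cabs f) + Lp_norm mu p%:E g)].
Proof.
move=> mf finf [g0 mg fing hg] G.
have f0 z : 0 <= cabs f z by rewrite lee_fin normc_ge0.
have pow H : (forall z, 0 <= H z) -> Lp_norm mu p%:E H < +oo ->
    measurable_fun [set: caratheodory_type mu] H -> power_integrable mu p H.
  by move=> H0 Hf mH; split => //; rewrite -Lp_norm_pow// poweR_lty.
have pf : power_integrable mu p (cabs f) by apply: pow => //; exact: measurable_cabs.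
have pg : power_integrable mu p g by exact: pow.
have pG := power_integrableD p0 pf pg; split => //.
  split => [z|z t]; first by rewrite leeDl.
  by apply: le_trans (hg z t) _; rewrite lee_wpmul2l ?lee_fin ?mdist_ge0// leeD// leeDr.
set A := Lp_norm _ _ _; set B := Lp_norm _ _ g.
have A0 : 0 <= A by exact: Lnorm_ge0.
have B0 : 0 <= B by exact: Lnorm_ge0.
have AB0 : 0 <= (2 * 2 `^ p^-1)%:E * (A + B).
  by rewrite mule_ge0 ?adde_ge0// lee_fin mulr_ge0 ?powR_ge0.
rewrite -[leRHS](poweRVK p0 AB0); apply: poweR_le; first by rewrite invr_ge0 ltW.
  by apply: integral_ge0 => *; exact: poweR_ge0.
apply: (le_trans (power_integral_le p0 pf pg)).
rewrite poweRM ?adde_ge0 ?lee_fin ?mulr_ge0 ?powR_ge0// poweR_EFin powRM ?powR_ge0//.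
rewrite -powRrM mulVf ?gt_eqF// powRr1// [in leRHS]EFinM -muleA lee_wpmul2l ?lee_fin ?powR_ge0//.
rewrite -!Lp_norm_pow// (_ : 2%:E = 1 + 1)// ge0_muleDl// mul1e.
by apply: leeD; apply: poweR_le; rewrite ?(ltW p0) ?leeDl ?leeDr.
Qed.

Lemma selection_besov : exists2 C : R, (0 <= C)%R & forall f G Gt a,
  (forall z, 0 <= G z) -> hajlasz_bound f G -> power_integrable mu p Gt -> sel G Gt a ->
  [/\ L1loc nu (trace (F0 := F0) (f \o a)),
    besov_norm nu Y s' p%:E p%:E (trace (f \o a)) <= C%:E * pnorm Gt &
    {ae cmeasure nu, forall xi, trace_cvg (f \o a) xi}].
Proof.
have [C1 C10 HC1] := selection_trace X F0 HX pF Z2 p0.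
have [C2 C20 HC2] := trace_besov X Y HX HY (s := 1%R) p0 pe0 s'01 teF.
exists (C2 * C1)%R; first by rewrite mulr_ge0.
move=> f G Gt a G0 fG iGt sa; have h1 := HC1 f G Gt a G0 fG iGt sa.
have fin : trace_norm Q F0 1 p p%:E (f \o a) < +oo.
  apply: le_lt_trans h1 _; have := pnorm_lty iGt.
  have : 0 <= pnorm Gt by exact: poweR_ge0.
  by case: (pnorm Gt) => [r||]// _ _; rewrite -EFinM ltry.
have [k1 k2 k3] := HC2 _ fin; split => //.
by apply: (le_trans k2); rewrite EFinM -muleA lee_wpmul2l.
Qed.

(** A majorant and a selection are chosen for each f separately, so linearity holds only almost
    everywhere and needs a comparison of selections. Functions without a majorant get the default
    0. *)
Definition Htrace f : subsp F0 -> R[i] :=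
  if pselect (exists Ga : (Z -> \bar R) * (V -> Z),
    [/\ hajlasz_bound f Ga.1, power_integrable mu p Ga.1 & sel Ga.1 Ga.1 Ga.2]) is left h
  then trace (f \o (projT1 (cid h)).2) else fun=> 0%R.

Lemma HtraceE f G : hajlasz_bound f G -> power_integrable mu p G -> exists G1 a,
  [/\ hajlasz_bound f G1, power_integrable mu p G1, sel G1 G1 a & Htrace f = trace (f \o a)].
Proof.
move=> fG iG; rewrite /Htrace; case: pselect => [h|[]].
  by case: (cid h) => -[G1 a] /= [h1 h2 h3]; exists G1, a.
by have [a sa] := selection_ex X F0 HX pF Z2 iG; exists (G, a).
Qed.

Lemma selection_indep f G Gt a b : hajlasz_bound f G -> (forall z, 0 <= G z) ->
  power_integrable mu p Gt -> sel G Gt a -> sel G Gt b ->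
  {ae cmeasure nu, forall xi, trace (F0 := F0) (f \o a) xi = trace (f \o b) xi}.
Proof.
move=> fG G0 iGt sa sb; have [C C0 HC] := selection_besov.
have sm : sel G Gt (mix a b) by move=> n x xn; rewrite /mix; case: ifP => _; [exact: (sa n x)|exact: (sb n x)].
have [_ _ ca] := HC f G Gt a G0 fG iGt sa.
have [_ _ cb] := HC f G Gt b G0 fG iGt sb.
have [_ _ cm] := HC f G Gt _ G0 fG iGt sm.
have cbm : {ae cmeasure nu, forall xi, trace_cvg (F0 := F0) (f \o b) xi /\
    trace_cvg (F0 := F0) (f \o mix a b) xi}.
  exact: (ae_imp2 (mu := cmeasure nu) _ cb cm).
apply: (ae_imp2 (mu := cmeasure nu) _ ca cbm) => xi k1 [k2 k3].
apply: (mix_trace (u'' := f \o mix a b)) => // n x xn.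
by rewrite /= /mix xn /=; case: ifP.
Qed.

(** The selection b and the one inside [Htrace f] belong to different majorants G and G1. A
    selection c for their sum samples both G and G1 well, and [selection_indep], applied once to
    each with the sum as common bound, links the two through c. *)
Lemma Htrace_selection f G b : hajlasz_bound f G -> power_integrable mu p G -> sel G G b ->
  {ae cmeasure nu, forall xi, trace_cvg (F0 := F0) (f \o b) xi /\ Htrace f xi = trace (f \o b) xi}.
Proof.
move=> fG iG sb; have [C C0 HC] := selection_besov.
have [G1 [a [fG1 iG1 sa ->]]] := HtraceE fG iG.
have [_ G0 _] := iG; have [_ G10 _] := iG1.
pose Gs z := G1 z + G z; have iGs : power_integrable mu p Gs by exact: power_integrableD.
have Gs1 z : G1 z <= Gs z by rewrite leeDl.
have Gs2 z : G z <= Gs z by rewrite leeDr.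
have Gs0 z : 0 <= Gs z by rewrite adde_ge0.
have [c sc] := selection_ex X F0 HX pF Z2 iGs.
have lift H a' : (forall z, 0 <= H z) -> (forall z, H z <= Gs z) -> sel H H a' -> sel H Gs a'.
  by move=> H0 HG; apply: (selection_le p0).
have lift' H : (forall z, 0 <= H z) -> (forall z, H z <= Gs z) -> sel H Gs c.
  by move=> H0 HG; apply: (selection_le p0) sc.
have e1 := selection_indep fG1 G10 iGs (lift _ _ G10 Gs1 sa) (lift' _ G10 Gs1).
have e2 := selection_indep fG G0 iGs (lift _ _ G0 Gs2 sb) (lift' _ G0 Gs2).
have [_ _ cb] := HC f G G b G0 fG iG sb.
have e3 : {ae cmeasure nu, forall xi, trace (F0 := F0) (f \o a) xi = trace (f \o b) xi}.
  by apply: (ae_imp2 (mu := cmeasure nu) _ e1 e2) => xi k1 k2; rewrite k1 k2.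
by apply: (ae_imp2 (mu := cmeasure nu) _ cb e3).
Qed.

End hajlasz_spaces.

(** * The operators for Hajlasz spaces *)

Section hajlasz_operators.
Context {R : realType} {Z : pmetricType R} (mu : {outer_measure set Z -> \bar R}).
Context (Q : R) (X : filling Z) (F : set Z) (F0 : F !=set0).
Context (nu : {outer_measure set (subsp F0) -> \bar R}) (lambda : R).
Context (Y : filling (subsp F0)).
Hypothesis HX : regular_space Q mu.
Hypothesis HY : regular_space lambda nu.
Hypothesis lQ : lambda < Q.
Hypothesis pF : porous F.
Hypothesis Z2 : exists x y : Z, x <> y.
Variable p : R.
Hypothesis p0 : 0 < p.
Let s' := 1 - (Q - lambda) / p.
Hypothesis s'01 : 0 < s' < 1.
Hypothesis teF : 0 < tail_exp lambda p s'.
Hypothesis teZ : 0 < tail_exp Q p 1.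
Local Notation V := (vertex X).
Local Notation val := (@subsp_val R Z F F0).
Local Notation hl := (hole (X := X) F0 pF Z2).
Implicit Types (f : Z -> R[i]) (g G Gt : Z -> \bar R) (b : V -> Z) (n k : nat) (z t : Z) (x : V)
  (v : vertex Y -> R[i]) (xi : subsp F0).
Local Open Scope ereal_scope.

Let mmX : metric_measure_space mu. Proof. by case: HX. Qed.
Let mmY : metric_measure_space nu. Proof. by case: HY. Qed.
Let pe0 : 0 < p%:E. Proof. by rewrite lte_fin. Qed.

Local Notation pnorm G := ((\int[cmeasure mu]_z (G z `^ p)) `^ p^-1).
Local Notation sel G Gt a := (selection (X := X) mu F0 pF Z2 p G Gt a).
Local Notation A := (hajlasz mu p).
Local Notation B := (besov nu Y s' p%:E p%:E).
Local Notation S := (Htrace mu X (F0 := F0) pF Z2 p).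

Lemma hajlasz_majorant_ex f : fmem A f -> exists G, hajlasz_bound f G /\ power_integrable mu p G.
Proof.
move=> [mf ff [g hg]]; have [h1 h2 _] := hajlasz_majorant p0 mf ff hg.
by exists (fun z => cabs f z + g z).
Qed.

Lemma power_integrableZ G (c : R) : (0 <= c)%R -> power_integrable mu p G ->
  power_integrable mu p (fun z => c%:E * G z).
Proof.
move=> c0 [mG G0 iG]; have cp : (0 <= c `^ p)%R by exact: powR_ge0.
split; first exact: measurable_funeM.
  by move=> z; rewrite mule_ge0.
under eq_integral do rewrite poweRM ?lee_fin// poweR_EFin.
rewrite ge0_integralZl ?lee_fin//.
- by apply: lte_mul_pinfty; rewrite ?lee_fin.
- exact: measurable_power.
- by move=> z _; exact: poweR_ge0.
Qed.

(** Adding infinity on a null set changes no integral; as the majorant is finite at sampled points,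
    a selection for the new majorant avoids that set. *)
Lemma power_integrable_null G (N : set Z) : power_integrable mu p G ->
  measurable (N : set (caratheodory_type mu)) -> mu N = 0 ->
  power_integrable mu p (fun z => G z + if z \in N then +oo else 0).
Proof.
move=> [mG G0 iG] mN N0.
have mN' : measurable_fun [set: caratheodory_type mu] (fun z => if z \in N then +oo else 0 : \bar R).
  apply: measurable_fun_ifT; [|exact: measurable_cst|exact: measurable_cst].
  apply: (measurable_fun_bool true); rewrite setTI (_ : _ @^-1` _ = N)//.
  by apply/seteqP; split => [z /=|z Nz /=]; [exact: set_mem|exact: mem_set].
have m' : measurable_fun [set: caratheodory_type mu] (fun z => G z + if z \in N then +oo else 0).
  exact: emeasurable_funD.
have p' z : 0 <= G z + (if z \in N then +oo else 0) by rewrite adde_ge0//; case: ifP.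
split => //.
suff -> : \int[cmeasure mu]_z ((G z + if z \in N then +oo else 0) `^ p) =
  \int[cmeasure mu]_z (G z `^ p) by [].
apply: ge0_ae_eq_integral => //.
- exact: measurable_power.
- exact: measurable_power.
- by move=> z _; exact: poweR_ge0.
- by move=> z _; exact: poweR_ge0.
- exists N; split => // z /= h; apply: contrapT => nz; apply: h => _.
  by rewrite memNset// adde0.
Qed.

(** Both functions are sampled at the same points, off the set where they differ, and so define the
    same vertex function. *)
Lemma Htrace_ae f f' : fmem A f -> fmem A f' -> cae_eq mu f f' -> cae_eq nu (S f) (S f').
Proof.
move=> /hajlasz_majorant_ex[G [fG iG]] /hajlasz_majorant_ex[G' [fG' iG']] [N [mN N0 sN]].
have [_ G0 _] := iG; have [_ G0' _] := iG'.
have iT := power_integrable_null (power_integrableD p0 iG iG') mN N0.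
set Gt := fun z => _ in iT; have [_ Gt0 fin] := iT.
have GG z : G z <= Gt z.
  by rewrite /Gt -addeA leeDl// adde_ge0//; case: ifP.
have GG' z : G' z <= Gt z.
  by rewrite /Gt (addeC (G z)) -addeA leeDl// adde_ge0//; case: ifP.
have [b sb] := selection_ex X F0 HX pF Z2 iT.
have e1 := Htrace_selection Y HX HY p0 s'01 teF (hajlasz_bound_le G0 GG fG) iT sb.
have e2 := Htrace_selection Y HX HY p0 s'01 teF (hajlasz_bound_le G0' GG' fG') iT sb.
apply: (ae_imp2 (mu := cmeasure nu) _ e1 e2) => xi [_ ->] [_ ->].
apply: trace_eq => n x xn /=; have [_ h2] := sb n x xn.
have bN : ~ N (b x).
  move=> bN; have [m0 moo] := andP (hole_mass F0 HX pF Z2 xn).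
  have E : Gt (b x) = +oo.
    by rewrite /Gt mem_set// addey// gt_eqF// (lt_le_trans _ (adde_ge0 (G0 _) (G0' _))).
  move: h2; rewrite E poweRyr ?gt_eqF// gt0_mulye// leye_eq => /eqP h.
  have : 2%:E * \int[cmeasure mu]_(z in hl x) (Gt z `^ p) < +oo.
    apply: lte_mul_pinfty => //; apply: le_lt_trans fin; apply: ge0_subset_integral => //.
    - exact: (measurable_hole F0 HX pF Z2).
    - by apply: measurable_power; case: iT.
    - by move=> *; exact: poweR_ge0.
  by rewrite h ltxx.
by apply: contrapT => h; apply: bN; exact: sN.
Qed.

Lemma Htrace_linear (a : R[i]) f f' : fmem A f -> fmem A f' ->
  cae_eq nu (S (fun z : Z => a * f z + f' z)%R) (fun y => a * S f y + S f' y)%R.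
Proof.
move=> /hajlasz_majorant_ex[G [fG iG]] /hajlasz_majorant_ex[G' [fG' iG']].
have [_ G0 _] := iG; have [_ G0' _] := iG'; have a0 := normc_ge0 a.
have a1 : (0 <= 1 + nc a)%R by rewrite addr_ge0.
have iT := power_integrableD p0 (power_integrableZ a1 iG) iG'.
set Gt := fun z => _ in iT.
have aG z : 0 <= (nc a)%:E * G z by rewrite mule_ge0.
have GtE z : Gt z = G z + ((nc a)%:E * G z + G' z).
  by rewrite /Gt EFinD ge0_muleDl// mul1e addeA.
have GG z : G z <= Gt z by rewrite GtE leeDl// adde_ge0.
have GG' z : G' z <= Gt z by rewrite GtE addeA leeDr// adde_ge0.
have Ga z : (nc a)%:E * G z + G' z <= Gt z by rewrite GtE leeDr.
have h3 : hajlasz_bound (fun z : Z => a * f z + f' z)%R Gt.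
  have [k1 k2] := fG; have [k1' k2'] := fG'; split => [z|z t].
    apply: le_trans (Ga z); apply: (@le_trans _ _ ((nc a)%:E * (nc (f z))%:E + (nc (f' z))%:E)).
      by rewrite -EFinM -EFinD lee_fin -Normc.normcM normcD.
    by rewrite leeD// lee_wpmul2l.
  apply: (@le_trans _ _ ((nc a)%:E * (nc (f z - f t)%R)%:E + (nc (f' z - f' t)%R)%:E)).
    rewrite -EFinM -EFinD lee_fin -Normc.normcM (_ : _ - _ = a * (f z - f t) + (f' z - f' t))%R ?normcD//.
    by ring.
  apply: (@le_trans _ _ ((mdist z t)%:E * (((nc a)%:E * G z + G' z) + ((nc a)%:E * G t + G' t)))).
    rewrite addeACA ge0_muleDr ?adde_ge0// -(ge0_muleDr _ (G0 z) (G0 t)).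
    by rewrite muleCA leeD// lee_wpmul2l.
  by rewrite lee_wpmul2l ?lee_fin ?mdist_ge0// leeD.
have [b sb] := selection_ex X F0 HX pF Z2 iT.
have e1 := Htrace_selection Y HX HY p0 s'01 teF (hajlasz_bound_le G0 GG fG) iT sb.
have e2 := Htrace_selection Y HX HY p0 s'01 teF (hajlasz_bound_le G0' GG' fG') iT sb.
have e3 := Htrace_selection Y HX HY p0 s'01 teF h3 iT sb.
have e12 : {ae cmeasure nu, forall xi, S (fun z : Z => a * f z + f' z)%R xi =
    trace ((fun z : Z => a * f z + f' z)%R \o b) xi}.
  by apply: (ae_imp (mu := cmeasure nu) _ e3) => xi [].
have e4 : {ae cmeasure nu, forall xi, (a * S f xi + S f' xi)%R =
    trace (F0 := F0) ((fun z : Z => a * f z + f' z)%R \o b) xi}.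
  apply: (ae_imp2 (mu := cmeasure nu) _ e1 e2) => xi [c1 ->] [c2 ->].
  by rewrite -(trace_linear HX)//.
by apply: (ae_imp2 (mu := cmeasure nu) _ e12 e4) => xi -> ->.
Qed.

Lemma besov_norm_ae (h h' : subsp F0 -> R[i]) : cmeasurable nu h -> cmeasurable nu h' ->
  cae_eq nu h h' -> besov_norm nu Y s' p%:E p%:E h = besov_norm nu Y s' p%:E p%:E h'.
Proof.
move=> mh mh' hh; rewrite /besov_norm (_ : Pavg Y nu h = Pavg Y nu h')//.
by apply/funext => y; exact: (Pavg_ae_eq mmY).
Qed.

Lemma Htrace_operator : bounded_linear_op mu nu A B S.
Proof.
have [C C0 HC] := selection_besov X Y HX HY pF Z2 p0 s'01 teF.
split; [|exact: Htrace_ae|exact: Htrace_linear|].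
- move=> f /hajlasz_majorant_ex[G [fG iG]].
  have [G1 [b [fG1 iG1 sb ->]]] := HtraceE X F0 HX pF Z2 fG iG; have [_ G10 _] := iG1.
  have [h1 h2 _] := HC f G1 G1 b G10 fG1 iG1 sb; split => //.
  apply: le_lt_trans h2 _; have := pnorm_lty iG1.
  have : 0 <= pnorm G1 by exact: poweR_ge0.
  by case: (pnorm G1) => [r||]// _ _; rewrite -EFinM ltry.
- pose D := (C * (2 * 2 `^ p^-1) + 1)%R.
  have D0 : (0 < D)%R by rewrite ltr_wpDl ?mulr_ge0 ?powR_ge0.
  exists D => f Af; have [mf ff _] := Af.
  (* Each gradient g has its own selection. The resulting trace differs from [S f] on a null set
     only, which the Besov quasi-norm does not see, so that the infimum over g can be taken
     afterwards. *)
  have key g : hajlasz_gradient mu p f g ->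
      besov_norm nu Y s' p%:E p%:E (S f) <= D%:E * (Lp_norm mu p%:E (cabs f) + Lp_norm mu p%:E g).
    move=> hg; have := hajlasz_majorant p0 mf ff hg; set G := fun z => _ => -[fG iG bG].
    have [_ G0 _] := iG.
    have [b sb] := selection_ex X F0 HX pF Z2 iG.
    have [L bb _] := HC f G G b G0 fG iG sb.
    have [G1 [b1 [fG1 iG1 sb1 E1]]] := HtraceE X F0 HX pF Z2 fG iG; have [_ G10 _] := iG1.
    have [L1 _ _] := HC f G1 G1 b1 G10 fG1 iG1 sb1.
    rewrite (@besov_norm_ae _ (trace (f \o b))) ?E1; [|exact: L1.1|exact: L.1|]; last first.
      have e := Htrace_selection Y HX HY p0 s'01 teF fG iG sb.
      by apply: (ae_imp (mu := cmeasure nu) _ e) => xi [_]; rewrite E1.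
    apply: (le_trans bb).
    have N0 : 0 <= Lp_norm mu p%:E (cabs f) + Lp_norm mu p%:E g by rewrite adde_ge0 ?Lnorm_ge0.
    apply: (@le_trans _ _ ((C * (2 * 2 `^ p^-1))%:E * (Lp_norm mu p%:E (cabs f) + Lp_norm mu p%:E g))).
      by rewrite EFinM -muleA lee_wpmul2l.
    by rewrite lee_wpmul2r// lee_fin lerDl.
  rewrite /= -lee_pdivrMl// -leeBlDl; last by rewrite ge0_fin_numE ?Lnorm_ge0.
  apply: le_ereal_inf_tmp => _ [g hg <-].
  by rewrite leeBlDl ?lee_pdivrMl//; [exact: key|rewrite ge0_fin_numE ?Lnorm_ge0].
Qed.

Lemma Htrace_cont f : fmem A f -> continuous (f : Z -> R[i]^o) -> cae_eq nu (S f) (f \o val).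
Proof.
move=> /hajlasz_majorant_ex[G [fG iG]] cf.
have [b sb] := selection_ex X F0 HX pF Z2 iG.
have e := Htrace_selection Y HX HY p0 s'01 teF fG iG sb.
apply: (ae_imp (mu := cmeasure nu) _ e) => xi [_ ->]; apply: trace_unique => r r0.
exact: (selection_cont HX (val xi) sb cf r0).
Qed.

Lemma ext_hajlasz_member : exists2 C : R, (0 <= C)%R & forall v, ext_norm lambda s' p p%:E v < +oo ->
  fmem A (ext X v) /\ fnorm A (ext X v) <= C%:E * ext_norm lambda s' p p%:E v.
Proof.
have [C C0 HC] := hajlasz_ext X Y HX HY lQ p0 teZ; exists (2 * C)%R; first by rewrite mulr_ge0.
move=> v fin; have [c [sd iG _ nG]] := HC v fin; have [_ mf _ _] := sd.
have [h1 h2] := hajlasz_member p0 (measurable_clim (fun n => measurable_csum n mf)) (synth_hajlasz sd) iG.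
split=> //; apply: (le_trans h2); rewrite EFinM -muleA lee_wpmul2l//.
Qed.

(* The values of an extension at the points of a selection are close to the
   partial sums: the errors, radius times gradient, are summable at almost every
   point of [F], by the bounded overlap of the holes. *)
Lemma selection_close v (c : V -> \bar R) b : synth_data mu c (ext_seq X v) ->
  power_integrable mu p (synth_grad c) -> lq_norm p%:E setT (level_norm Q p 1 c) < +oo ->
  sel (synth_grad c) (synth_grad c) b ->
  {ae cmeasure nu, forall xi, close_seq (ext X v \o b) v xi}.
Proof.
move=> sd iG lqf sb; have [c0 _ _ _] := sd; have [mG G0 fG] := iG.
set G := synth_grad c in iG sb mG G0 fG.
(* [rad n * G (b x)] bounds the tail of the series at the sampled point. The coefficient is cut off
   away from F because only holes near F overlap boundedly. *)
pose t (x : V) : \bar R := if `[< exists xi, (mdist (center x) (val xi) < 2 ^ (- level x))%R >]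
  then (2 ^ (- level x) : R)%:E * G (b x) else 0.
have t0 x : 0 <= t x.
  by rewrite /t; case: ifP => // _; rewrite mule_ge0// lee_fin exprz_ge0.
have tE n x xi : lev n x -> vball x (val xi) -> t x = (rad n)%:E * G (b x).
  move=> xn xB; rewrite /t (lev_rad xn) asboolT//; exists xi; exact: (vballE _ xn).1.
have [N N1 HN] := vball_count X HX; have N0 : (0 < N)%R by exact: lt_le_trans N1.
pose An n : set V := [set x | lev n x /\ exists xi, vball x (val xi)].
have [N' N'0 HN'] : exists2 N : R, (0 < N)%R & forall z,
    \esum_(i in [set i : nat * V | An i.1 i.2 /\ hl i.2 z]) 1 <= N%:E.
  apply: (near_hole_overlap (A := An) (w := id) (K := 2) _ N0) => //.
  - move=> n x z [xn [xi xB]] hz; split; first by move=> eta; apply: (hole_far eta _ hz); left.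
    exists xi; have := (vballE _ xn).1 xB; have := (vballE _ xn).1 ((holeP F0 pF Z2 xn).1 _ hz).
    have := metric_triangle z (center x) (val xi); rewrite (metric_sym z (center x)); lra.
  - move=> n z; apply: le_trans (HN n z); apply: esum_le_subset => // x [[xn _] hz]; split => //.
    exact: (holeP F0 pF Z2 xn).1.
have [C C0 HC] := selection_mass X F0 HX pF Z2 p.
(* The factor [rad n] cancels the smoothness weight of s = 1 and leaves 2^(- n Q) G(b x)^p, which
   [selection_mass] bounds by an integral over the hole. *)
have finT : lq_norm p%:E setT (level_norm Q p 1 t) < +oo.
  have mh x : measurable (hl x : set (caratheodory_type mu)) by exact: (measurable_hole F0 HX pF Z2).
  have cA : countable [set i : nat * V | An i.1 i.2].
    apply: (countable_levels (A := An)) => n.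
    by apply: sub_countable (lev_countable X HX n); apply: subset_card_le => x [].
  have W0 x : 0 <= C%:E * \int[cmeasure mu]_(z in hl x) (G z `^ p).
    by rewrite mule_ge0//; apply: integral_ge0 => *; exact: poweR_ge0.
  rewrite /lq_norm poweR_lty//.
  apply: (@le_lt_trans _ _ (\esum_(n in [set: nat]) \esum_(x in An n)
      (C%:E * \int[cmeasure mu]_(z in hl x) (G z `^ p)))).
    apply: le_esum => n _; rewrite level_normK// /psum_lev.
    rewrite -esumZl ?e2_ge0//; last by move=> *; exact: poweR_ge0.
    rewrite (esumID (An n)); last by move=> *; rewrite mule_ge0 ?poweR_ge0// lee_fin e2_ge0.
    rewrite [X in _ + X](_ : _ = 0) ?adde0; last first.
      apply: esum1 => x [xn nA]; rewrite /t asboolF ?poweR0r ?mule0 ?gt_eqF// => -[xi].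
      by rewrite (lev_rad xn) => d; apply: nA; split => //; exists xi; exact/(vballE _ xn).
    apply: (@le_trans _ _ (\esum_(x in An n) ((2 `^ (n%:R * (1 * p - Q)))%:E * t x `^ p))).
      by apply: esum_le_subset => [x []//|x _]; rewrite mule_ge0 ?poweR_ge0// lee_fin e2_ge0.
    apply: le_esum => x [xn [xi xB]]; rewrite (tE n x xi)//.
    apply: le_trans (HC G G b n x G0 sb (or_introl xn)).
    rewrite poweRM ?lee_fin ?rad_ge0// poweR_EFin rad_pow muleA -EFinM -e2D.
    by rewrite (_ : n%:R * (1 * p - Q) + - (n%:R * p) = - (n%:R * Q))%R//; ring.
  rewrite esum_esum; last by move=> n x _ _; exact: W0.
  apply: (@le_lt_trans _ _ (\esum_(i in [set i : nat * V | An i.1 i.2])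
      (C%:E * \int[cmeasure mu]_(z in hl i.2) (G z `^ p)))).
    by apply: esum_le_subset => [[n x] [_ ?]//|i _]; exact: W0.
  rewrite esumZl//; last by move=> i _; apply: integral_ge0 => *; exact: poweR_ge0.
  apply: (@le_lt_trans _ _ (C%:E * (N'%:E * \int[cmeasure mu]_z (G z `^ p)))).
    rewrite lee_wpmul2l//.
    apply: (integral_overlap_le (cmeasure mu) (B := fun i : nat * V => hl i.2)) => //.
    - by move=> z; exact: poweR_ge0.
    - exact: measurable_power.
  by do 2 (apply: lte_mul_pinfty; rewrite ?lee_fin ?(ltW N'0)//).
have e1 := transfer_ae Y HX HY (lexx 1%R) p0 pe0 teF t0 finT.
have e2 := level_sum_to0 Y HX HY p0 pe0 teZ teF c0 lqf.
apply: (ae_imp2 (mu := cmeasure nu) _ e1 e2) => xi k1 [_ k2].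
have s0 n : 0 <= \esum_(x in nearv 1 n (val (xi : subsp F0))) t x by exact: esum_ge0.
have T1 := esum_to0 s0 k1.
have T2 : to0 (fun n => 8%:E * level_sum Q c n (val (xi : subsp F0))).
  by apply: (to0_le (C := 8%R)) k2.
have T := to0D T1 T2.
apply: (to0_le (C := 1%R) _ _ T) => // n; rewrite mul1e -(csum_ext X HX).
set L := \esum_(x in _) _ + _.
have L0 : 0 <= L by rewrite adde_ge0// mule_ge0// level_sum_ge0.
case E : L L0 => [r||]// L0; last by rewrite leey.
rewrite lee_fin; apply: (Tn_osc HX) => x xn xB; rewrite /= -lee_fin -E.
have tL : t x <= \esum_(y in nearv 1 n (val (xi : subsp F0))) t y.
  by apply: esum_ge_term => //; split => //; rewrite mul1r; exact: (vballE _ xn).1.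
have tx := tE n x xi xn xB.
have Gf : G (b x) < +oo.
  rewrite ltNge leye_eq; apply/negP => /eqP Gy.
  have : t x < +oo.
    apply: le_lt_trans tL _; apply: (@le_lt_trans _ _ L); last by rewrite E ltry.
    by rewrite leeDl// mule_ge0// level_sum_ge0.
  by rewrite tx Gy gt0_muley ?lte_fin ?rad_gt0// ltxx.
apply: (@le_trans _ _ ((nc (ext X v (b x) - csum (ext_seq X v) n (b x))%R)%:E +
    (nc (csum (ext_seq X v) n (b x) - csum (ext_seq X v) n (val (xi : subsp F0)))%R)%:E)).
  by rewrite -EFinD lee_fin normc_tri.
apply: leeD.
  have ct : (nc (ext X v (b x) - csum (ext_seq X v) n (b x))%R)%:E <= (rad n)%:E * G (b x).
    exact: (csum_tail_grad n sd Gf).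
  by apply: (le_trans ct); rewrite -tx; exact: tL.
apply: (csum_near Q sd).
have bB := selection_vball sb xn.
have := (vballE _ xn).1 xB; have := (vballE _ xn).1 bB.
have := metric_triangle (b x) (center x) (val (xi : subsp F0)); rewrite (metric_sym (b x) (center x)).
have := @rad_gt0 R n; lra.
Qed.

Lemma Htrace_ext h : fmem B h -> cae_eq nu (S (Ext X nu Y h)) h.
Proof.
move=> Bh; have [C C0 HC] := ext_norm_besov Q Y HY 1%R p0 pe0.
have [_ fin] := HC h Bh; set v := Pavg Y nu h in fin.
have [C1 C10 HC1] := hajlasz_ext X Y HX HY lQ p0 teZ.
have [c [sd iG lqf _]] := HC1 v fin.
have [b sb] := selection_ex X F0 HX pF Z2 iG.
have e := Htrace_selection Y HX HY p0 s'01 teF (synth_hajlasz sd) iG sb.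
have [_ es] := ext_close X HX HY p0 pe0 teZ teF fin.
have cl := selection_close sd iG lqf sb.
have cv : {ae cmeasure nu, forall xi, trace_cvg (ext X v \o b) xi}.
  by apply: (ae_imp (mu := cmeasure nu) _ e) => xi [].
have e' := trace_of_close HX HY Bh.1 (erefl _) cv cl es.
by apply: (ae_imp2 (mu := cmeasure nu) _ e e') => xi [_ ->].
Qed.

Lemma hajlasz_trace_extension_p : trace_and_extension mu nu A B.
Proof.
exists S, (Ext X nu Y); split.
- exact: Htrace_operator.
- apply: (extension_operator HX HY p0 pe0 teZ); exact: ext_hajlasz_member.
- exact: Htrace_cont.
- exact: Htrace_ext.
Qed.

End hajlasz_operators.

(** The whole space has diameter 0 and covers itself at every scale, and 0 to a positive power is
    0. *)
Lemma hausdorff_measure_point (R : realType) (T : pmetricType R) (lambda : R) :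
  0 < lambda -> (forall x y : T, x = y) -> hausdorff_measure lambda [set: T] = 0%E.
Proof.
move=> l0 T1; apply/eqP; rewrite eq_le; apply/andP; split; last first.
  exact: (outer_measure_ge0 (hausdorff_measure lambda)).
have d0 : diam [set: T] = 0%E.
  apply/eqP; rewrite eq_le; apply/andP; split.
    by apply: ge_ereal_sup => _ [[x y] _ <-] /=; rewrite (T1 x y) mdistxx.
  by apply: ereal_sup_ubound; exists (point, point) => //=; rewrite mdistxx.
apply: ge_ereal_sup => _ [delta delta0 <-]; apply: ereal_inf_lbound.
exists (fun=> setT).
  split => [_|]; first by rewrite d0 lee_fin ltW.
  by move=> x _; exists 0%N.
apply: eseries0 => k _ _; rewrite /hausdorff_gauge; case: ifP => // _.
by rewrite d0 poweR0r ?gt_eqF.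
Qed.

Theorem theorem1p7 (R : realType) (Z : pmetricType R)
  (mu : {outer_measure set Z -> \bar R}) (Q lambda : R)
  (F : set Z) (F0 : F !=set0)
  (X : filling Z) (Y : filling (subsp F0)) :
  let nu : {outer_measure set (subsp F0) -> \bar R} :=
    hausdorff_measure lambda in
  0 < Q -> metric_measure_space mu -> ahlfors_regular Q mu ->
  0 < lambda <= Q ->
  closed F -> metric_measure_space nu -> ahlfors_regular lambda nu ->
  [/\ (forall (s p : R) (q : \bar R), 0 < s < 1 ->
         Num.max (Q / (lambda + s)) ((Q - lambda) / s) < p -> (0 < q)%E ->
         trace_and_extension mu nu (besov mu X s p%:E q)
           (besov nu Y (s - (Q - lambda) / p) p%:E q)),
      (porous F -> forall (s p : R) (q : \bar R), 0 < s < 1 ->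
         Num.max (Q / (lambda + s)) ((Q - lambda) / s) < p ->
         ((Q / (Q + s))%:E < q)%E ->
         trace_and_extension mu nu (triebel mu X s p q)
           (besov nu Y (s - (Q - lambda) / p) p%:E p%:E)) &
      (porous F -> forall p : R,
         Num.max (Q / (lambda + 1)) (Q - lambda) < p ->
         trace_and_extension mu nu (hajlasz mu p)
           (besov nu Y (1 - (Q - lambda) / p) p%:E p%:E))].
Proof.
move=> nu Q0 mm aQ lQ _ mmF aF; have [l0 lQ'] := andP lQ.
(* A one point F would be null for [nu], while its balls have positive measure. Ahlfors regularity
   alone does not exclude it, being vacuous at diameter 0. *)
have F2 : exists x y : subsp F0, x <> y.
  apply: contrapT => h; have T1 (x y : subsp F0) : x = y.
    by apply: contrapT => xy; apply: h; exists x, y.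
  have /andP[+ _] := mmF.2 point 1 ltr01.
  apply/negP; rewrite -leNgt; apply: (@le_trans _ _ (nu setT)); first exact: le_outer_measure.
  by rewrite /nu /= (hausdorff_measure_point l0 T1).
have Z2 : exists x y : Z, x <> y.
  by have [x [y xy]] := F2; exists (subsp_val x), (subsp_val y) => /val_inj.
have HX := ahlfors_regular_space Q0 mm aQ Z2.
have HY := ahlfors_regular_space l0 mmF aF F2.
split.
- by move=> s p q; exact: (besov_trace_extension X Y HX HY lQ).
- move=> pF s p q s01 hp hq; have lt := dim_lt X HX HY pF Z2 lQ'.
  apply: (triebel_trace_extension X Y HX HY lt pF Z2) => //.
  apply: le_lt_trans hq; have [s0 _] := andP s01.
  by rewrite lee_fin divr_ge0 ?addr_ge0 ?(ltW Q0) ?(ltW s0).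
- move=> pF p hp; have lt := dim_lt X HX HY pF Z2 lQ'.
  have hp' : Num.max (Q / (lambda + 1)) ((Q - lambda) / 1) < p by rewrite divr1.
  (* For s = 1 the smoothness on F is below 1 because porosity forces lambda < Q. *)
  have [p0 s'01 teF teZ] := exponents lQ ltr01 (or_intror (conj (lexx 1) lt)) hp'.
  exact: (hajlasz_trace_extension_p X Y HX HY lt pF Z2 p0 s'01 teF teZ).
Qed.
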